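(* Let $(M,\omega,J)$ be a compact almost Hermitian manifold of real dimension $2n$ with nonempty smooth boundary, with associated Riemannian metric $g$ and Levi-Civita connection $\nabla$. Let $T$ be a tensor field on $M$ with components $T_{i\overline j}^{p},T_{i\overline j}^{\overline p}$ satisfying $$\overline{T_{i\overline j}^{p}}=T_{j\overline i}^{\overline p},\qquad \overline{T_{i\overline j}^{\overline p}}=T_{j\overline i}^{p},$$ and let $f$ be a positive smooth function on $M$. Let $\varphi$ be a smooth real solution of $$\det\big(g_{i\overline j}+\varphi_{i\overline j}+T_{i\overline j}^{p}\varphi_{p}+T_{i\overline j}^{\overline p}\varphi_{\overline p}\big)=f\det(g_{i\overline j}),\qquad g_{i\overline j}+\varphi_{i\overline j}+T_{i\overline j}^{p}\varphi_{p}+T_{i\overline j}^{\overline p}\varphi_{\overline p}>0 .$$ Then there exists a constant $C$ depending only on $\sup_{M}|\varphi|$, $\sup_{M}|\partial\varphi|_{g}$, $\sup_{\partial M}|\nabla^{2}\varphi|_{g}$, $(M,\omega,J)$, $\sup_{M}f$, $\sup_{M}|\partial(f^{1/n})|_{g}$ and a lower bound of $\nabla^{2}(f^{1/n})$ such that $$\sup_{M}|\nabla^{2}\varphi|_{g}\leq C .$$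
   Context: An almost Hermitian manifold is a manifold with an almost complex structure $J$ ($J^2=-\mathrm{Id}$, not necessarily integrable) and a Riemannian metric $g$ with $g(JV_1,JV_2)=g(V_1,V_2)$; $\omega(V_1,V_2)=g(JV_1,V_2)$. $\{e_i\}_{i=1}^n$ denotes a local frame of the $\sqrt{-1}$-eigenbundle $T^{(1,0)}_{\mathbb C}M$ of $J$; $g_{i\overline j}=g(e_i,\overline e_j)$, $\varphi_p=e_p(\varphi)$, $\varphi_{\overline p}=\overline e_p(\varphi)$, and $\varphi_{i\overline j}=(\nabla^2\varphi)(e_i,\overline e_j)$ with $\nabla$ the Levi-Civita connection. Repeated indices are summed. $T$ is a smooth tensor field assigning to $(e_i,\overline e_j)$ the complex vector $T_{i\overline j}^pe_p+T_{i\overline j}^{\overline p}\overline e_p$, complex-linear in each argument; the equation is independent of the choice of frame. Positivity means that the Hermitian matrix is positive definite. $\nabla^2\varphi$ is the real Hessian.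
   Formalization: The constant C is also allowed to depend on the tensor field T, which the list of dependencies omits; without this the claim fails already for n = 1 on the flat cylinder [0,1]×S^1 with f = 1 and an oscillating φ. *)

(* Defs.v *)
From HB Require Import structures.
From mathcomp Require Import all_boot all_order all_algebra.
From mathcomp Require Import complex.
From mathcomp Require Import ring.
From mathcomp Require Import all_classical all_reals all_analysis.
Set Implicit Arguments.
Unset Strict Implicit.
Unset Printing Implicit Defensive.
Import Order.TTheory GRing.Theory Num.Theory.
Import numFieldNormedType.Exports.
Local Open Scope classical_set_scope.
Local Open Scope complex_scope.
Local Open Scope ring_scope.

Section EuclideanCalculus.
Variables (R : realType) (m : nat).
Notation V := 'rV[R]_m.

Definition basis_vec (i : 'I_m) : V := delta_mx 0 i.

Fixpoint is_Ck (k : nat) (U : set V) (F : V -> R) : Prop :=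
  (forall x, U x -> {for x, continuous F}) /\
  match k with
  | 0%N => True
  | k'.+1 => forall i, (forall x, U x -> derivable F x (basis_vec i)) /\
                       is_Ck k' U ('D_(basis_vec i) F)
  end.

(* Smoothness on a set that need not be open (here: a relatively open subset
   of the half-space): local extendability to a smooth function. *)
Definition smooth_on (A : set V) (F : V -> R) : Prop :=
  forall x, A x -> exists U : set V, exists G : V -> R,
    [/\ open U, U x, (forall k, is_Ck k U G) &
        forall y, A y -> U y -> G y = F y].

(* The condition bears on the coordinate of index 0 only. *)
Definition half_space : set V := [set x | forall i : 'I_m, val i = 0%N -> 0 <= x 0 i].

(* Partial derivative relative to the half-space: the usual one at interior
   points, and one-sided in the direction of index 0 at boundary points. *)
Definition rel_pderiv (i : 'I_m) (F : V -> R) (x : V) : R :=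
  lim ((fun h : R => h^-1 * (F (x + h *: basis_vec i) - F x)) @
       within [set h | half_space (x + h *: basis_vec i)] 0^').

End EuclideanCalculus.

Record chart (R : realType) (X : topologicalType) (m : nat) := Chart {
  cdom : set X;
  cmap : X -> 'rV[R]_m;
  cinv : 'rV[R]_m -> X }.

Definition is_chart (R : realType) (X : topologicalType) (m : nat)
    (c : chart R X m) : Prop :=
  [/\ open (cdom c),
      exists2 O, open O & cmap c @` cdom c = O `&` @half_space R m,
      {in cdom c, cancel (cmap c) (cinv c)},
      {within cdom c, continuous (cmap c)} &
      {within cmap c @` cdom c, continuous (cinv c)}].

(* Smooth manifolds with (possibly empty) boundary, given by an atlas. The
   field [chart_at] selects a chart around each point; tensors at p are
   evaluated in the coordinates of that chart. *)
Record manifold (R : realType) (m : nat) := Manifold {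
  mspace :> topologicalType;
  mindex : Type;
  mchart : mindex -> chart R mspace m;
  chart_at : mspace -> mindex;
  manifold_hausdorff : hausdorff_space mspace;
  manifold_second_countable : @second_countable mspace;
  manifold_chartP : forall a, is_chart (mchart a);
  chart_atP : forall p, cdom (mchart (chart_at p)) p;
  manifold_compat : forall a b (j : 'I_m),
    smooth_on (cmap (mchart a) @` (cdom (mchart a) `&` cdom (mchart b)))
      (fun x => cmap (mchart b) (cinv (mchart a) x) 0 j) }.

Section Manifold.
Variables (R : realType) (m : nat) (M : manifold R m).

Definition dom (a : mindex M) : set M := cdom (mchart a).
Definition crd (a : mindex M) : M -> 'rV[R]_m := cmap (mchart a).
Definition par (a : mindex M) : 'rV[R]_m -> M := cinv (mchart a).

Definition mboundary : set M :=
  [set p | exists2 a, dom a p & exists2 i : 'I_m, val i = 0%N & crd a p 0 i = 0].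

Definition smooth_in (a : mindex M) (u : M -> R) : Prop :=
  smooth_on (crd a @` dom a) (u \o par a).

Definition smooth (u : M -> R) : Prop := forall a, smooth_in a u.

(* The coordinate vector field d/dx^i of the chart a, applied to u. *)
Definition pderiv (a : mindex M) (i : 'I_m) (u : M -> R) (p : M) : R :=
  rel_pderiv i (u \o par a) (crd a p).

Definition differential (a : mindex M) (u : M -> R) (p : M) : 'cV[R]_m :=
  \col_i pderiv a i u p.

(* A tangent vector with components v (a row) in the chart a has components
   v *m jacobian a b p in the chart b. *)
Definition jacobian (a b : mindex M) (p : M) : 'M[R]_m :=
  \matrix_(i, j) pderiv a i (fun q => crd b q 0 j) p.

End Manifold.

Arguments mboundary {R m} M _.

(* In a chart a, J v is v *m acs a p and g(v, w) is v *m metric a p *m w^T,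
   for rows v, w of components of tangent vectors. *)
Record almost_hermitian (R : realType) (n : nat) := AlmostHermitian {
  ah_manifold :> manifold R (n + n);
  acs : mindex ah_manifold -> ah_manifold -> 'M[R]_(n + n);
  metric : mindex ah_manifold -> ah_manifold -> 'M[R]_(n + n);
  acs_smooth : forall a i j, smooth_in a (fun p => acs a p i j);
  acs_tensor : forall a b p, dom a p -> dom b p ->
    acs a p *m jacobian a b p = jacobian a b p *m acs b p;
  acs_sqr : forall a p, dom a p -> acs a p *m acs a p = - 1%:M;
  metric_smooth : forall a i j, smooth_in a (fun p => metric a p i j);
  metric_tensor : forall a b p, dom a p -> dom b p ->
    metric a p = jacobian a b p *m metric b p *m (jacobian a b p)^T;
  metric_sym : forall a p, dom a p -> (metric a p)^T = metric a p;
  metric_pos : forall a p, dom a p -> forall v : 'rV[R]_(n + n), v != 0 ->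
    0 < (v *m metric a p *m v^T) 0 0;
  metric_acs : forall a p, dom a p ->
    acs a p *m metric a p *m (acs a p)^T = metric a p }.

Section AlmostHermitian.
Variables (R : realType) (n : nat) (M : almost_hermitian R n).
Notation C := (R[i]).
Notation m := (n + n)%N.

(* Christoffel symbols Gamma^k_{ij} of the Levi-Civita connection; see
   [christoffelP] below. *)
Definition christoffel (a : mindex M) (p : M) (k i j : 'I_m) : R :=
  2^-1 * \sum_(l < m) invmx (metric a p) k l *
    (pderiv a i (fun q => metric a q j l) p +
     pderiv a j (fun q => metric a q i l) p -
     pderiv a l (fun q => metric a q i j) p).

(* (nabla^2 u)(X, Y) = X (Y u) - (nabla_X Y) u *)
Definition hess (a : mindex M) (u : M -> R) (p : M) : 'M[R]_m :=
  \matrix_(i, j) (pderiv a i (pderiv a j u) p -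
                  \sum_(k < m) christoffel a p k i j * pderiv a k u p).

Definition hess_norm (u : M -> R) (p : M) : R :=
  let a := chart_at p in
  let ginv := invmx (metric a p) in
  Num.sqrt (\tr (ginv *m hess a u p *m ginv *m (hess a u p)^T)).

Definition hess_ge (k : R) (u : M -> R) : Prop :=
  forall a p, dom a p -> forall v : 'rV[R]_m,
    k * (v *m metric a p *m v^T) 0 0 <= (v *m hess a u p *m v^T) 0 0.

Definition toC {r s} (A : 'M[R]_(r, s)) : 'M[C]_(r, s) :=
  map_mx (real_complex R) A.

Definition conjM {r s} (A : 'M[C]_(r, s)) : 'M[C]_(r, s) := map_mx Num.conj A.

(* The (1,0)-part (du - i du o J) / 2 of du. *)
Definition del (a : mindex M) (u : M -> R) (p : M) : 'cV[C]_m :=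
  2^-1 *: (toC (differential a u p) -
           'i%C *: toC (acs a p *m differential a u p)).

(* The Hermitian norm of the covector del u; in a (1,0)-frame its square is
   g^{i jbar} u_i u_jbar. *)
Definition del_norm (u : M -> R) (p : M) : R :=
  let a := chart_at p in
  let d := del a u p in
  Num.sqrt (complex.Re (((conjM d)^T *m toC (invmx (metric a p)) *m d) 0 0)).

Definition sup_on (A : set M) (u : M -> R) : \bar R :=
  ereal_sup [set (u p)%:E | p in A].

(* The rows of E are the vectors e_1, ..., e_n of a basis of the
   i-eigenspace of J on the complexified tangent space at p. *)
Definition is_frame (a : mindex M) (p : M) (E : 'M[C]_(n, m)) : Prop :=
  row_free E /\ E *m toC (acs a p) = 'i%C *: E.

(* The matrix h(e_i, conj e_j) of a real bilinear form h. *)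
Definition frame_form (E : 'M[C]_(n, m)) (h : 'M[R]_m) : 'M[C]_n :=
  E *m toC h *m (conjM E)^T.

(* T a p k l is the complexified tangent vector T(d/dx^k, d/dx^l). Only the
   restriction to T^{1,0} x T^{0,1} is ever used; every smooth section defined
   on that subbundle is such a restriction. *)
Definition mixed_field := mindex M -> M -> 'I_m -> 'I_m -> 'rV[C]_m.

Definition is_smooth_tensor (T : mixed_field) : Prop :=
  (forall a k l s, smooth_in a (fun p => complex.Re (T a p k l 0 s)) /\
                   smooth_in a (fun p => complex.Im (T a p k l 0 s))) /\
  (forall a b p, dom a p -> dom b p -> forall k l,
     T a p k l *m toC (jacobian a b p) =
     \sum_(k' < m) \sum_(l' < m)
       (jacobian a b p k k' * jacobian a b p l l')%:C *: T b p k' l').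

Definition T_frame (T : mixed_field) a p (E : 'M[C]_(n, m)) (i j : 'I_n) : 'rV[C]_m :=
  \sum_(k < m) \sum_(l < m) (E i k * (E j l)^*) *: T a p k l.

(* Components of a complex tangent vector in the basis e_p, conj e_p. *)
Definition comp10 (E : 'M[C]_(n, m)) (v : 'rV[C]_m) (q : 'I_n) : C :=
  lsubmx (v *m invmx (col_mx E (conjM E))) 0 q.
Definition comp01 (E : 'M[C]_(n, m)) (v : 'rV[C]_m) (q : 'I_n) : C :=
  rsubmx (v *m invmx (col_mx E (conjM E))) 0 q.

Definition T10 T a p E i j q : C := comp10 E (T_frame T a p E i j) q.
Definition T01 T a p E i j q : C := comp01 E (T_frame T a p E i j) q.

Definition T_conj (T : mixed_field) : Prop :=
  forall a p E, dom a p -> is_frame a p E -> forall i j q,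
    (T10 T a p E i j q)^* = T01 T a p E j i q /\
    (T01 T a p E i j q)^* = T10 T a p E j i q.

Definition e_der a p (E : 'M[C]_(n, m)) (u : M -> R) (q : 'I_n) : C :=
  (E *m toC (differential a u p)) q 0.
Definition ebar_der a p (E : 'M[C]_(n, m)) (u : M -> R) (q : 'I_n) : C :=
  (conjM E *m toC (differential a u p)) q 0.

Definition ma_matrix T a p (E : 'M[C]_(n, m)) (u : M -> R) : 'M[C]_n :=
  frame_form E (metric a p) + frame_form E (hess a u p) +
  \matrix_(i, j) (\sum_q T10 T a p E i j q * e_der a p E u q +
                  \sum_q T01 T a p E i j q * ebar_der a p E u q).

Definition herm_posdef (W : 'M[C]_n) : Prop :=
  W \is hermsymmx /\
  forall v : 'rV[C]_n, v != 0 -> 0 < (v *m W *m (conjM v)^T) 0 0.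

Definition ma_solution T (f u : M -> R) : Prop :=
  forall a p E, dom a p -> is_frame a p E ->
    \det (ma_matrix T a p E u) = (f p)%:C * \det (frame_form E (metric a p)) /\
    herm_posdef (ma_matrix T a p E u).

Lemma metric_unitmx a p : dom a p -> metric (a : mindex M) p \in unitmx.
Proof.
move=> ap; rewrite -row_free_unit -kermx_eq0; apply/eqP/row_matrixP => i.
rewrite row0; apply/eqP/negP => /negP v0.
have := metric_pos ap v0.
by rewrite -row_mul mulmx_ker row0 mul0mx mxE ltxx.
Qed.

Lemma pderiv_eq_dom a i (u v : M -> R) p : dom (a : mindex M) p ->
  {in dom a, u =1 v} -> pderiv a i u p = pderiv a i v p.
Proof.
move=> ap uv; rewrite /pderiv /rel_pderiv.
have [_ [D Oo OE] crdK _ _] := manifold_chartP a.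
have par_dom x : D x -> @half_space R m x -> dom a (par a x).
  move=> Ox Hx; have : (D `&` @half_space R m) x by [].
  by rewrite -OE => -[q aq <-]; rewrite /par crdK ?inE.
have uvp x : D x -> @half_space R m x -> (u \o par a) x = (v \o par a) x.
  by move=> Ox Hx /=; rewrite uv// inE; exact: par_dom.
have [Ox Hx] : (D `&` @half_space R m) (crd a p) by rewrite -OE; exists p.
have nearO : \forall h \near (0 : R)^', D (crd a p + h *: basis_vec R i).
  apply: nbhs_dnbhs; apply: open_nbhs_nbhs; split => //=; last first.
    by rewrite scale0r addr0.
  apply: open_comp Oo => h _; apply: cvgD; first exact: cvg_cst.
  by apply: cvgZr_tmp.
congr (lim _); apply/seteqP; split; apply: near_eq_cvg;
  rewrite near_withinE; apply: filterS nearO => h Oh hh;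
  by rewrite (uvp _ Oh hh) (uvp _ Ox Hx).
Qed.

(* In a chart, [christoffel] is the only family of coefficients that is
   torsion-free and compatible with the metric. *)
Lemma christoffelP a p (G : 'I_m -> 'I_m -> 'I_m -> R) : dom (a : mindex M) p ->
  ((forall k i j, G k i j = G k j i) /\
   (forall k i j, pderiv a k (fun q => metric a q i j) p =
      \sum_l G l k i * metric a p l j + \sum_l G l k j * metric a p i l))
  <-> (forall k i j, G k i j = christoffel a p k i j).
Proof.
move=> ap; have gU := metric_unitmx ap.
have gsym q i j : dom a q -> metric a q i j = metric a q j i.
  by move=> aq; rewrite -{1}(metric_sym aq) mxE.
pose d k i j := pderiv a k (fun q => metric a q i j) p.
have dsym k i j : d k i j = d k j i.
  by apply: pderiv_eq_dom => // q; rewrite inE => aq; rewrite gsym.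
pose L l i j := \sum_s G s i j * metric a p s l.
have invE i j s (X : 'I_m -> R) : (forall l, L l i j = X l) <->
    (forall k, G k i j = \sum_l invmx (metric a p) k l * X l).
  pose Gc := \col_k G k i j; pose Xc := \col_l X l.
  have LE l : L l i j = (metric a p *m Gc) l 0.
    by rewrite mxE; apply: eq_bigr => k _; rewrite !mxE gsym// mulrC.
  have XE k : \sum_l invmx (metric a p) k l * X l = (invmx (metric a p) *m Xc) k 0.
    by rewrite mxE; apply: eq_bigr => l _; rewrite !mxE.
  split=> H.
    have gX : metric a p *m Gc = Xc by apply/colP => l; rewrite -LE H mxE.
    by move=> k; rewrite XE -gX mulmxA mulVmx// mul1mx mxE.
  have gX : Gc = invmx (metric a p) *m Xc by apply/colP => k; rewrite mxE H XE.
  by move=> l; rewrite LE gX mulmxA mulmxV// mul1mx mxE.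
have cE k i j : christoffel a p k i j =
    \sum_l invmx (metric a p) k l * (2^-1 * (d i j l + d j i l - d l i j)).
  by rewrite /christoffel mulr_sumr; apply: eq_bigr => l _; rewrite mulrCA.
have compatE k i j : \sum_l G l k i * metric a p l j +
    \sum_l G l k j * metric a p i l = L j k i + L i k j.
  by congr (_ + _); apply: eq_bigr => l _; rewrite ?[metric a p i l]gsym.
split=> [[Gsym Gd]|GE].
  have Lsym l i j : L l i j = L l j i by apply: eq_bigr => s _; rewrite Gsym.
  have dE k i j : d k i j = L j k i + L i k j by rewrite -compatE -Gd.
  move=> k i j; rewrite cE; apply/invE: k => // l.
  rewrite !dE (Lsym l j i) (Lsym j l i) (Lsym i l j) (Lsym j i l) (Lsym i j l).
  by field.
have LE l i j : L l i j = 2^-1 * (d i j l + d j i l - d l i j).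
  by apply/invE: l => // k; rewrite GE cE.
split=> [k i j|k i j].
  rewrite !GE !cE; apply: eq_bigr => l _; congr (_ * (_ * _)).
  by rewrite (dsym l i j) [d i j l + _]addrC.
rewrite compatE !LE -/(d k i j) (dsym i k j) (dsym j k i) (dsym k j i) (dsym j i k) (dsym i j k).
by field.
Qed.

End AlmostHermitian.

(* Main.v *)
(* A maximum principle for exp(eta) H(v, v) / g(v, v) over all tangent vectors v, where H
   is the Hessian of phi and eta = eps |d phi|^2 + exp(- A (phi - K0)). The equation is
   used only through the arithmetic-geometric mean inequality: for every frame E of the
   (1,0)-bundle, f det g(E, E) <= (n^-1 sum_i W(E_i, E_i))^n for the Hermitian matrix W of
   the equation, with equality for a g-orthogonal frame at the maximum point. Two
   derivatives of this inequality, along curves of frames which start there, replace the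
   differentiation of the eigenvalues of W. If X_i is the real part of that frame, the
   maximum is tested along pairs of curves (t X_i, V + t Z_i), (t J X_i, V + t Z'_i), for which
   the third and fourth derivatives of phi cancel against those of the equation. The Z_i
   are chosen so that the part of the bad term |d eta|^2 coming from the exponential
   cancels; the part coming from eps |d phi|^2 is absorbed by the good term
   eps sum_i |D^2 phi(X_i, .)|^2. This bounds H from above, and then from below because W is
   positive. *)
Require Import Defs.
From mathcomp Require Import all_boot all_order all_algebra.
From mathcomp Require Import complex ring lra.
From mathcomp Require Import all_classical all_reals all_analysis.
Set Implicit Arguments.
Unset Strict Implicit.
Unset Printing Implicit Defensive.
Import Order.TTheory GRing.Theory Num.Theory.
Import numFieldNormedType.Exports.
Local Open Scope classical_set_scope.
Local Open Scope ring_scope.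

(** * Two-jets of functions of one variable *)

(** The obstacle is the size of the bad term. At the maximum, with y = exp(- A (phi - K0)) >= 1, the
    second order condition along X_i carries, up to the common factor lam = H(V, V), the good term
    A^2 y dphi(X_i)^2 and the bad term (A y dphi(X_i))^2, which is at least as large whatever A is.
    Moving V together with the point repairs this. For Z_i = (ra V + rb J V) / 2, where ra and - rb
    are the derivatives of y along X_i and J X_i, the exponential parts contribute (ra^2 - rb^2) / 2
    along X_i and the opposite along J X_i. The matching motion of the frame in the equation has
    rank one over C, because V is expanded in the frame itself; so its determinant is an explicit
    factor |1 + t kappa|^2. The constants are chosen in one direction: B bounds the geometry and
    dphi, C is a multiple of a power of B, eps is of order C^-2 and A of order C^3. No single
    eigenvalue sg_i^2 of g relative to W is bounded a priori, so each error is measured by sg_i and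
    by the size of D^2 phi(X_i, .) and D^2 phi(J X_i, .). *)

Section Jets.
Variable R : realType.
Implicit Types (F G : R -> R) (a b c t e : R) (Fl : set_system R).

(** A Peano expansion: only the values of [F] along [Fl] enter, and [c] is half a second derivative.
    [Fl] is [nbhs 0] at interior points and [0^'+] where only one half of a ray stays in the
    half-space. *)
Definition jet2 Fl F a b c : Prop := forall e, 0 < e ->
  \forall t \near Fl, `|F t - (a + b * t + c * t ^+ 2)| <= e * t ^+ 2.

Lemma nbhs0_lt (d : R) : 0 < d -> \forall t \near (0 : R), `|t| < d.
Proof.
move=> d0; near=> t; rewrite -[t]subr0 distrC.
by near: t; apply: nbhsx_ballx.
Unshelve. all: by end_near. Qed.

Lemma nbhs0P (P : R -> Prop) : (\forall t \near (0 : R), P t) <->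
  exists2 d, 0 < d & forall t, `|t| < d -> P t.
Proof.
split=> [/nbhs_ballP[d /= d0 dP]|[d d0 dP]].
  by exists d => // t td; apply: dP; rewrite /ball /= sub0r normrN.
by apply: filterS (nbhs0_lt d0) => t; exact: dP.
Qed.

Lemma near0_right (P : R -> Prop) :
  (\forall t \near (0 : R), P t) -> \forall t \near (0 : R)^'+, P t.
Proof. by rewrite near_withinE; apply: filterS. Qed.

Lemma le0_near_right b (K : R) :
  (\forall t \near (0 : R)^'+, b <= K * t) -> b <= 0.
Proof.
move=> bK; rewrite leNgt; apply/negP => b0.
have K1 : 0 < `|K| + 1 by rewrite ltr_pwDr.
have H : \forall t \near (0 : R)^'+, False.
  near=> t.
  have t0 : 0 < t by near: t; exact: nbhs_right_gt.
  have tb : t < b / (`|K| + 1).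
    by near: t; apply: nbhs_right_lt; rewrite divr_gt0.
  have : b <= K * t by near: t.
  rewrite ltr_pdivlMr // in tb.
  have := ler_norm K => KK ?.
  nra.
have := @filter_ex _ _ (at_right_proper_filter (0:R)) _ H.
by case.
Unshelve. all: by end_near. Qed.

Section Filter.
Variable Fl : set_system R.
Context {FF : Filter Fl}.
Hypothesis Fl0 : forall P : R -> Prop,
  (\forall t \near (0 : R), P t) -> \forall t \near Fl, P t.

Lemma jet2_eq F a b c a' b' c' : jet2 Fl F a b c ->
  a = a' -> b = b' -> c = c' -> jet2 Fl F a' b' c'.
Proof. by move=> + <- <- <-. Qed.

Lemma jet2_near F G a b c : (\forall t \near Fl, F t = G t) ->
  jet2 Fl F a b c -> jet2 Fl G a b c.
Proof.
move=> FG jF e e0; have := jF e e0.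
by apply: filterS2 FG => t ->.
Qed.

Lemma jet2_ext F G a b c : F =1 G -> jet2 Fl F a b c -> jet2 Fl G a b c.
Proof. by move=> FG; apply: jet2_near; apply: nearW. Qed.

Lemma jet2_poly a b c : jet2 Fl (fun t => a + b * t + c * t ^+ 2) a b c.
Proof.
move=> e e0; apply: nearW => t; rewrite subrr normr0.
by apply: mulr_ge0; [exact: ltW | exact: sqr_ge0].
Qed.

Lemma jet2_cst a : jet2 Fl (fun=> a) a 0 0.
Proof.
apply: jet2_ext (jet2_poly a 0 0) => t.
by rewrite !mul0r !addr0.
Qed.

Lemma jet2D F G a b c a' b' c' : jet2 Fl F a b c -> jet2 Fl G a' b' c' ->
  jet2 Fl (fun t => F t + G t) (a + a') (b + b') (c + c').
Proof.
move=> jF jG e e0; have e2 : 0 < e / 2 by rewrite divr_gt0.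
apply: filterS2 (jF _ e2) (jG _ e2) => t; rewrite !ler_norml; nra.
Qed.

Lemma jet2N F a b c : jet2 Fl F a b c -> jet2 Fl (fun t => - F t) (- a) (- b) (- c).
Proof.
move=> jF e e0; apply: filterS (jF _ e0) => t.
rewrite -normrN => h; apply: le_trans h; rewrite le_eqVlt; apply/orP; left.
by apply/eqP; congr `|_|; ring.
Qed.

Lemma jet2B F G a b c a' b' c' : jet2 Fl F a b c -> jet2 Fl G a' b' c' ->
  jet2 Fl (fun t => F t - G t) (a - a') (b - b') (c - c').
Proof. by move=> jF jG; apply: jet2D => //; exact: jet2N. Qed.

Lemma jet2_sum (I : Type) (r : seq I) (P : pred I) (F : I -> R -> R) (a b c : I -> R) :
  (forall i, P i -> jet2 Fl (F i) (a i) (b i) (c i)) ->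
  jet2 Fl (fun t => \sum_(i <- r | P i) F i t)
    (\sum_(i <- r | P i) a i) (\sum_(i <- r | P i) b i) (\sum_(i <- r | P i) c i).
Proof.
move=> jF; elim: r => [|i r IH].
  rewrite !big_nil; apply: jet2_ext (jet2_cst 0) => t.
  by rewrite big_nil.
rewrite !big_cons; case: ifP => Pi; last first.
  by apply: jet2_ext IH => t; rewrite big_cons Pi.
apply: jet2_ext (jet2D (jF _ Pi) IH) => t.
by rewrite big_cons Pi.
Qed.

(** Chain rule for expansions: the one of [F] is substituted into the one of [h]. The auxiliary [e2]
    and [D] split the tolerance [e] among the three remainders. *)
Lemma jet2_comp (h : R -> R) F a b c h1 h2 :
  jet2 (nbhs (0 : R)) (fun z => h (a + z)) (h a) h1 h2 -> jet2 Fl F a b c ->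
  jet2 Fl (fun t => h (F t)) (h a) (h1 * b) (h1 * c + h2 * b ^+ 2).
Proof.
move=> jh jF e e0.
pose K := `|b| + `|c| + 1.
have b0 := normr_ge0 b; have c0 := normr_ge0 c.
have n1 := normr_ge0 h1; have n2 := normr_ge0 h2.
have K1 : 1 <= K by rewrite /K; lra.
have K0 : 0 < K by lra.
have KK : 0 < K ^+ 2 by rewrite exprn_gt0.
have e10 : 0 < e / (2 * K ^+ 2) by rewrite divr_gt0// mulr_gt0.
pose e2 := Num.min 1 (e / (4 * (`|h1| + 1))).
have e20 : 0 < e2 by rewrite lt_min ltr01 divr_gt0// mulr_gt0// ltr_pwDr.
have [e21 e2h] : e2 <= 1 /\ e2 * (`|h1| + 1) <= e / 4.
  split; first by rewrite ge_min lexx.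
  apply: le_trans (_ : e / (4 * (`|h1| + 1)) * (`|h1| + 1) <= _).
    by rewrite ler_wpM2r ?addr_ge0// ge_min lexx orbT.
  have h0 : `|h1| + 1 != 0 by rewrite gt_eqF// ltr_pwDr.
  by rewrite le_eqVlt; apply/orP; left; apply/eqP; field.
pose D := Num.min 1 (e / (8 * (`|h2| + 1) * K ^+ 2)).
have D0 : 0 < D by rewrite lt_min ltr01 divr_gt0// !mulr_gt0// ltr_pwDr.
have [D1 Dh] : D <= 1 /\ D * ((`|h2| + 1) * K ^+ 2) <= e / 8.
  split; first by rewrite ge_min lexx.
  have hK : 0 < (`|h2| + 1) * K ^+ 2 by rewrite mulr_gt0// ltr_pwDr.
  apply: le_trans (_ : e / (8 * (`|h2| + 1) * K ^+ 2) * ((`|h2| + 1) * K ^+ 2) <= _).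
    by rewrite ler_wpM2r ?(ltW hK)// ge_min lexx orbT.
  have h0 : `|h2| + 1 != 0 by rewrite gt_eqF// ltr_pwDr.
  have Kn : K != 0 by rewrite gt_eqF.
  by rewrite le_eqVlt; apply/orP; left; apply/eqP; field; rewrite Kn.
have /nbhs0P[d d0 dP] := jh _ e10.
have small : \forall t \near Fl, `|t| < Num.min D (d / K).
  by apply: Fl0; apply: nbhs0_lt; rewrite lt_min D0 divr_gt0.
apply: filterS2 (jF _ e20) small => t Ft; rewrite lt_min => /andP[tD td].
have t0 := normr_ge0 t; have tt := real_normK (num_real t).
have t20 := sqr_ge0 t.
set z := F t - a; set r := z - (b * t + c * t ^+ 2).
have rE : `|r| <= e2 * t ^+ 2 by move: Ft; rewrite /r /z; congr (`| _ | <= _); ring.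
have zE : z = b * t + c * t ^+ 2 + r by rewrite /r; ring.
have t2 : t ^+ 2 <= `|t| by rewrite -tt; nra.
have cr : `|c * t ^+ 2 + r| <= (`|c| + 1) * t ^+ 2.
  apply: le_trans (ler_normD _ _) _; rewrite normrM (ger0_norm t20); nra.
have zK : `|z| <= K * `|t|.
  rewrite zE -addrA; apply: le_trans (ler_normD _ _) _; rewrite normrM /K; nra.
have zd : `|z| < d.
  by apply: le_lt_trans zK _; rewrite ltr_pdivlMr// in td; rewrite mulrC.
have zbt : `|z + b * t| <= 2 * K * `|t|.
  apply: le_trans (ler_normD _ _) _; rewrite normrM.
  have bK : `|b| <= K by rewrite /K; clear -c0; lra.
  by clear -bK zK t0; nra.
have hz : a + z = F t by rewrite /z addrC subrK.
have H := dP _ zd; rewrite hz in H.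
(* The remainders are that of [h] at z, the term [h1 * r] from the remainder of [F], and z^2 - (b
   t)^2 = (z + b t) (c t^2 + r), which is of third order in t. *)
have -> : h (F t) - (h a + h1 * b * t + (h1 * c + h2 * b ^+ 2) * t ^+ 2) =
   (h (F t) - (h a + h1 * z + h2 * z ^+ 2)) +
   (h1 * r + h2 * ((z + b * t) * (c * t ^+ 2 + r))).
  by rewrite /r; ring.
have A1 : e / (2 * K ^+ 2) * z ^+ 2 <= e / 2 * t ^+ 2.
  have -> : e / 2 * t ^+ 2 = e / (2 * K ^+ 2) * (K * `|t|) ^+ 2.
    by rewrite exprMn tt; field; rewrite gt_eqF.
  by rewrite ler_wpM2l ?(ltW e10)// -(real_normK (num_real z)) lerXn2r// nnegrE ?mulr_ge0// ltW.
have A2 : `|h1 * r| <= e / 4 * t ^+ 2.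
  rewrite normrM; apply: le_trans (_ : `|h1| * (e2 * t ^+ 2) <= _).
    by rewrite ler_wpM2l.
  by rewrite mulrA ler_wpM2r//; clear -e2h e20 n1; lra.
have A3 : `|h2 * ((z + b * t) * (c * t ^+ 2 + r))| <= e / 4 * t ^+ 2.
  rewrite !normrM; apply: le_trans (_ : `|h2| * (2 * K * `|t| * (K * t ^+ 2)) <= _).
    rewrite ler_wpM2l// ler_pM//; apply: le_trans cr _.
    by rewrite ler_wpM2r// /K; clear -b0; lra.
  have -> : `|h2| * (2 * K * `|t| * (K * t ^+ 2)) = (2 * (`|t| * (`|h2| * K ^+ 2))) * t ^+ 2 by ring.
  rewrite ler_wpM2r//.
  apply: le_trans (_ : 2 * (D * ((`|h2| + 1) * K ^+ 2)) <= _); last by clear -Dh; lra.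
  rewrite ler_pM2l//; have hK0 : 0 <= `|h2| * K ^+ 2 by rewrite mulr_ge0// ltW.
  by apply: ler_pM => //; [exact: ltW | rewrite ler_pM2r// lerDl].
apply: le_trans (ler_normD _ _) _; apply: le_trans (lerD H (ler_normD _ _)) _.
by clear -A1 A2 A3; lra.
Qed.

Lemma jet2X2 F a b c : jet2 Fl F a b c ->
  jet2 Fl (fun t => F t ^+ 2) (a ^+ 2) (2 * a * b) (2 * a * c + b ^+ 2).
Proof.
move=> jF; rewrite -[b ^+ 2]mul1r.
apply: (@jet2_comp (fun x => x ^+ 2)) => // e e0; apply: nearW => t.
have -> : (a + t) ^+ 2 - (a ^+ 2 + 2 * a * t + 1 * t ^+ 2) = 0 by ring.
by rewrite normr0 mulr_ge0 ?sqr_ge0 ?ltW.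
Qed.

Lemma jet2Z k F a b c : jet2 Fl F a b c ->
  jet2 Fl (fun t => k * F t) (k * a) (k * b) (k * c).
Proof.
move=> jF; apply: (@jet2_eq _ (k * a) (k * b) (k * c + 0 * b ^+ 2)) => //; last by ring.
apply: (@jet2_comp (fun x => k * x)) => // e e0; apply: nearW => t.
have -> : k * (a + t) - (k * a + k * t + 0 * t ^+ 2) = 0 by ring.
by rewrite normr0 mulr_ge0 ?sqr_ge0 ?ltW.
Qed.

(** Polarisation reduces the product to squares, which are an instance of the chain rule. *)
Lemma jet2M F G a b c a' b' c' : jet2 Fl F a b c -> jet2 Fl G a' b' c' ->
  jet2 Fl (fun t => F t * G t) (a * a') (b * a' + a * b') (c * a' + b * b' + a * c').
Proof.
move=> jF jG.
have j := jet2Z 4^-1 (jet2B (jet2X2 (jet2D jF jG)) (jet2X2 (jet2B jF jG))).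
by apply: jet2_ext (jet2_eq j _ _ _) => [t|||] /=; field.
Qed.

End Filter.

(** The necessary conditions of first and second order at a maximum of value 0, in the form in which
    the maximum principle and the arithmetic-geometric mean inequality are exploited. *)
Lemma jet2_le0 F b c : jet2 (nbhs (0 : R)) F 0 b c ->
  (\forall t \near (0 : R), F t <= 0) -> b = 0 /\ c <= 0.
Proof.
move=> jF F0.
have [d d0 dP] := (nbhs0P _).1 (filterI (jF 1 ltr01) F0).
have bb : b = 0.
  apply/eqP; rewrite eq_le; apply/andP; split.
    apply: (@le0_near_right _ (1 + `|c|)); near=> t.
    have t0 : 0 < t by near: t; exact: nbhs_right_gt.
    have td : `|t| < d by rewrite gtr0_norm//; near: t; apply: nbhs_right_lt.
    have [] := dP _ td; rewrite ler_norml => /andP[+ _] Ft.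
    have := ler_norm (- c); rewrite normrN => cc.
    by rewrite expr2; nra.
  rewrite -oppr_le0; apply: (@le0_near_right _ (1 + `|c|)); near=> t.
  have t0 : 0 < t by near: t; exact: nbhs_right_gt.
  have td : `|- t| < d by rewrite normrN gtr0_norm//; near: t; apply: nbhs_right_lt.
  have [] := dP _ td; rewrite ler_norml => /andP[+ _] Ft.
  have := ler_norm (- c); rewrite normrN => cc.
  by rewrite expr2; nra.
split=> //; apply/ler_addgt0Pl => e e0; rewrite addr0.
have [r r0 rP] := (nbhs0P _).1 (filterI (jF e e0) F0).
have r2 : `|r / 2| < r by rewrite gtr0_norm ?divr_gt0//; lra.
have [] := rP _ r2; rewrite bb ler_norml => /andP[+ _] Ft.
have r20 : 0 < (r / 2) ^+ 2 by rewrite exprn_gt0// divr_gt0.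
move=> h; rewrite -(ler_pM2r r20); lra.
Unshelve. all: by end_near. Qed.

Lemma jet2_0 F a b c : jet2 (nbhs (0 : R)) F a b c -> F 0 = a.
Proof.
move=> /(_ 1 ltr01)/nbhs_singleton.
by rewrite !(mulr0, expr0n, addr0) normr_le0 subr_eq0 => /eqP.
Qed.

Lemma jet2_zero a b c : jet2 (0 : R)^'+ (fun=> 0) a b c -> [/\ a = 0, b = 0 & c = 0].
Proof.
move=> j; have j1 := j 1 ltr01.
have a0 : a = 0.
  apply/eqP; rewrite -normr_le0; apply: (@le0_near_right _ (`|b| + `|c| + 1)); near=> t.
  have t0 : 0 < t by near: t; exact: nbhs_right_gt.
  have t1 : t < 1 by near: t; exact: nbhs_right_lt.
  have : `|0 - (a + b * t + c * t ^+ 2)| <= 1 * t ^+ 2 by near: t.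
  move=> h; have -> : `|a| = `|- (0 - (a + b * t + c * t ^+ 2)) - (b * t + c * t ^+ 2)|.
    by congr (`|_|); ring.
  apply: le_trans (ler_normB _ _) _; rewrite normrN; apply: le_trans (lerD h (ler_normD _ _)) _.
  rewrite !normrM (gtr0_norm t0) ?(ger0_norm (sqr_ge0 t)) ?normrX ?(gtr0_norm t0).
  have := normr_ge0 c; have t2 : t ^+ 2 <= t by rewrite expr2; nra.
  nra.
have b0 : b = 0.
  apply/eqP; rewrite -normr_le0; apply: (@le0_near_right _ (`|c| + 1)); near=> t.
  have t0 : 0 < t by near: t; exact: nbhs_right_gt.
  have : `|0 - (a + b * t + c * t ^+ 2)| <= 1 * t ^+ 2 by near: t.
  rewrite a0 sub0r normrN add0r => h.
  rewrite -(ler_pM2r t0) -{1}(gtr0_norm t0) -normrM.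
  have -> : `|b * t| = `|(b * t + c * t ^+ 2) - c * t ^+ 2| by congr (`|_|); ring.
  apply: le_trans (ler_normB _ _) _; apply: le_trans (lerD h (lexx _)) _.
  by rewrite normrM normrX (gtr0_norm t0) le_eqVlt; apply/orP; left; apply/eqP; ring.
split=> //; apply/eqP; rewrite -normr_le0; apply/ler_addgt0Pl => e e0; rewrite addr0.
have [t [t0 h]] : exists t, 0 < t /\ `|0 - (a + b * t + c * t ^+ 2)| <= e * t ^+ 2.
  apply: (@filter_ex _ _ (at_right_proper_filter (0:R))); near=> t; split.
    by near: t; exact: nbhs_right_gt.
  by near: t; exact: j.
have t2 : 0 < t ^+ 2 by rewrite exprn_gt0.
by move: h; rewrite a0 b0 mul0r !add0r normrN normrM (gtr0_norm t2) ler_pM2r.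
Unshelve. all: by end_near. Qed.

(** One side of 0 suffices for uniqueness. Two coordinate computations of one function can therefore
    be compared at boundary points as well. *)
Lemma jet2_unique F a b c a' b' c' :
  jet2 (0 : R)^'+ F a b c -> jet2 (0 : R)^'+ F a' b' c' ->
  [/\ a = a', b = b' & c = c'].
Proof.
move=> jF jG; have := jet2_zero (jet2_ext (fun t => subrr (F t)) (jet2B jF jG)).
by case=> /eqP + /eqP + /eqP; rewrite !subr_eq0 => /eqP -> /eqP -> /eqP ->.
Qed.

(** The derivative of [F] minus its candidate expansion is at most e |s| between 0 and t, and the
    mean value theorem costs one more factor |t|. *)
Lemma jet2_derive F (F' : R -> R) b c :
  (\forall t \near (0 : R), is_derive t (1 : R) F (F' t)) ->
  (forall e, 0 < e -> \forall t \near (0 : R), `|F' t - (b + 2 * c * t)| <= e * `|t|) ->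
  jet2 (nbhs (0 : R)) F (F 0) b c.
Proof.
move=> dF jF' e e0; have [d d0 dP] := (nbhs0P _).1 (filterI dF (jF' e e0)).
apply/nbhs0P; exists d => // t td.
pose p : {poly R} := (F 0)%:P + b *: 'X + c *: 'X^2.
pose G : R -> R := F - horner p.
have GE s : G s = F s - (F 0 + b * s + c * s ^+ 2).
  by rewrite /G /p -[(F - _) s]/(F s - _) !hornerE.
have dG s : `|s| < d -> is_derive s (1 : R) G (F' s - (b + 2 * c * s)).
  move=> /dP[ds _]; apply: is_derive_eq (is_deriveB ds (is_derive_poly p s)) _.
  by rewrite /p !derivD derivC !derivZ derivX derivXn !hornerE /=; ring.
have cG s : `|s| < d -> {for s, continuous G}.
  move=> /dG ds; apply: differentiable_continuous; apply/derivable1_diffP.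
  exact: ex_derive.
have key (a1 b1 : R) : a1 <= b1 -> `|a1| < d -> `|b1| < d ->
    exists2 s, (a1 <= s <= b1) & G b1 - G a1 = (F' s - (b + 2 * c * s)) * (b1 - a1).
  move=> ab ad bd; have sd s : a1 <= s <= b1 -> `|s| < d.
    by move: ad bd; rewrite !ltr_norml; lra.
  have dG' s : s \in `]a1, b1[ -> is_derive s 1 G (F' s - (b + 2 * c * s)).
    by rewrite in_itv /= => /andP[? ?]; apply: dG; apply: sd; lra.
  have cG' : {within `[a1, b1], continuous G}.
    by apply: continuous_in_subspaceT => s; rewrite inE /= in_itv /= => h; apply/cG/sd.
  have [s] := MVT_segment ab dG' cG'.
  by rewrite in_itv /= => sab E; exists s.
have G0 : G 0 = 0 by rewrite GE; ring.
have bd s : `|s| <= `|t| -> `|F' s - (b + 2 * c * s)| <= e * `|t|.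
  move=> st; have [_ h] := dP s (le_lt_trans st td).
  by apply: le_trans h _; rewrite ler_pM2l.
rewrite -GE; have d00 : `|0 : R| < d by rewrite normr0.
have [t0|t0] := leP 0 t.
  have [s sab] := key 0 t t0 d00 td; rewrite G0 !subr0 => ->.
  rewrite normrM -real_normK ?num_real// expr2 mulrA ler_wpM2r//; apply: bd.
  by rewrite !ger0_norm; lra.
have [s sab] := key t 0 (ltW t0) td d00; rewrite G0 sub0r => E.
rewrite -normrN E normrM sub0r normrN -[t ^+ 2]real_normK ?num_real// expr2 mulrA ler_wpM2r//.
by apply: bd; rewrite !ler0_norm; lra.
Qed.

Lemma jet2_expR Fl F a b c : Filter Fl ->
  (forall P : R -> Prop, (\forall t \near (0 : R), P t) -> \forall t \near Fl, P t) ->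
  jet2 Fl F a b c ->
  jet2 Fl (fun t => expR (F t)) (expR a) (expR a * b) (expR a * (c + b ^+ 2 / 2)).
Proof.
move=> FF Fl0 jF.
suff j1 : jet2 (nbhs (0 : R)) (fun z => expR z) 1 1 (1 / 2).
  apply: jet2_eq (jet2_comp Fl0 _ jF) _ _ _; [|by []|by []|].
    apply: (@jet2_ext (nbhs (0 : R)) _ (fun z => expR a * expR z)) => [t|]; first by rewrite expRD.
    apply: jet2_eq (@jet2Z (nbhs (0 : R)) (nbhs_filter 0) (fun _ h => h) (expR a) _ _ _ _ j1) (mulr1 _) (mulr1 _) (erefl _).
  by field.
rewrite -expR0; apply: (@jet2_derive _ expR).
  by apply/nbhs0P; exists 1 => // t _; exact: is_derive_expR.
move=> e e0.
have [d d0 dP] := (nbhs0P _).1 (iffLR (cvgrPdist_le _ _) (@continuous_expR R 0) e e0).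
apply/nbhs0P; exists d => // t td; rewrite expR0.
have key (u v : R) : u <= v -> `|u| < d -> `|v| < d -> 
    `|(expR v - expR u) - (v - u)| <= e * (v - u).
  move=> uv ud vd.
  have cE : {within `[u, v], continuous (@expR R)}.
    by apply: continuous_subspaceT; exact: continuous_expR.
  have [s] := MVT_segment uv (fun s _ => is_derive_expR s) cE.
  rewrite in_itv /= => /andP[us sv] ->.
  rewrite -[X in _ - X]mul1r -mulrBl normrM (ger0_norm (_ : 0 <= v - u)) ?subr_ge0//.
  rewrite ler_wpM2r ?subr_ge0// distrC -expR0; apply: dP.
  by move: ud vd; rewrite !ltr_norml; lra.
have d00 : `|0 : R| < d by rewrite normr0.
have [t0|t0] := leP 0 t.
  by have := key 0 t t0 d00 td; rewrite expR0 (ger0_norm t0) subr0; congr (`|_| <= _); field.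
have := key t 0 (ltW t0) td d00; rewrite expR0 (ltr0_norm t0) sub0r -normrN.
by congr (`|_| <= _); field.
Qed.

Lemma jet2_ln Fl F a b c : Filter Fl ->
  (forall P : R -> Prop, (\forall t \near (0 : R), P t) -> \forall t \near Fl, P t) ->
  0 < a -> jet2 Fl F a b c ->
  jet2 Fl (fun t => ln (F t)) (ln a) (b / a) (c / a - (b / a) ^+ 2 / 2).
Proof.
move=> FF Fl0 a0 jF.
suff j1 : jet2 (nbhs (0 : R)) (fun z => ln (1 + z)) 0 1 (- (1 / 2)).
  have j2 : jet2 Fl (fun t => F t / a - 1) 0 (b / a) (c / a).
    apply: jet2_eq (jet2_ext _ (jet2B (jet2Z Fl0 a^-1 jF) (jet2_cst 1))) _ _ _.
    - by move=> t; rewrite mulrC.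
    - by rewrite mulVf ?subrr// gt_eqF.
    - by rewrite subr0 mulrC.
    - by rewrite subr0 mulrC.
  have pos : \forall t \near Fl, 0 < F t.
    pose D := `|b| + `|c| + 1; have D0 : 0 < D by rewrite ltr_pwDr ?addr_ge0.
    have sm := Fl0 _ (nbhs0_lt (_ : 0 < Num.min 1 (a / D))).
    have {}sm := sm (ltac:(by rewrite lt_min ltr01 divr_gt0)).
    apply: filterS2 (jF _ ltr01) sm => t; rewrite lt_min => h /andP[t1 tD].
    rewrite ltr_pdivlMr// in tD.
    have t2 : t ^+ 2 <= `|t| by rewrite -real_normK ?num_real// expr2 ler_piMl// ltW.
    have bt : - (b * t) <= `|b| * `|t| by rewrite -normrM -normrN ler_norm.
    have ct : - (c * t ^+ 2) <= `|c| * `|t|.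
      apply: le_trans (_ : `|c| * t ^+ 2 <= _); last by rewrite ler_wpM2l.
      by rewrite -mulNr ler_wpM2r ?sqr_ge0// -normrN ler_norm.
    move: h tD; rewrite ler_norml /D => /andP[h _] tD; nra.
  have h1 : jet2 (nbhs (0 : R)) (fun z => (fun z => ln (1 + z)) (0 + z))
      ((fun z => ln (1 + z)) 0) 1 (- (1 / 2)).
    by apply: jet2_eq (jet2_ext _ j1) _ _ _ => [z|||]; rewrite ?add0r ?addr0 ?ln1.
  have j3 := jet2_comp (h := fun z => ln (1 + z)) Fl0 h1 j2.
  have j4 := @jet2D Fl FF _ _ _ _ _ _ _ _ (j3 FF) (@jet2_cst Fl FF (ln a)).
  apply: jet2_eq (jet2_near _ j4) _ _ _.
  - apply: filterS pos => t Ft; rewrite [1 + _]addrC subrK ln_div ?subrK//.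
  - by rewrite addr0 ln1 add0r.
  - by rewrite mul1r addr0.
  - by field; rewrite gt_eqF.
have jd : jet2 (nbhs (0 : R)) (fun z => ln (1 + z)) (ln (1 + 0)) 1 (- (1 / 2)).
  apply: (@jet2_derive _ (fun z => (1 + z)^-1)).
    apply/nbhs0P; exists 1 => // t; rewrite ltr_norml => /andP[t1 _].
    have t0 : 0 < 1 + t by lra.
    have hd := is_derive1_ln t0.
    have -> : (fun z : R => ln (1 + z)) = @ln R \o (fun z => 1 + z) by [].
    apply: is_derive_eq (is_derive1_comp hd (_ : is_derive t 1 (cst 1 + @idfun R) _)) _.
    by rewrite add0r /GRing.scale /= mulr1.
  move=> e e0; apply/nbhs0P; exists (Num.min (1/2) (e / 2)).
    by rewrite lt_min !divr_gt0.
  move=> t; rewrite lt_min => /andP[t1 te].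
  have t0 : 1 / 2 < 1 + t by move: t1; rewrite ltr_norml; lra.
  have -> : (1 + t)^-1 - (1 + 2 * (- (1 / 2)) * t) = (1 + t)^-1 * t ^+ 2.
    by field; lra.
  have i2 : (1 + t)^-1 <= 2.
    by rewrite -[leRHS]invrK lef_pV2 ?posrE ?invr_gt0//; lra.
  rewrite normrM normrX expr2 ger0_norm ?invr_ge0; last by lra.
  rewrite mulrA ler_wpM2r//; apply: le_trans (_ : 2 * `|t| <= _); last by lra.
  by rewrite ler_wpM2r.
by rewrite addr0 ln1 in jd.
Qed.

End Jets.

(** * Calculus on R^m *)

Section RowCalculus.
Variables (R : realType) (m : nat).
Notation V := 'rV[R]_m.
Implicit Types (u v w x y z : V) (U : set V) (F G : V -> R) (e : R).
Notation pd i G := ('D_(basis_vec R i) G).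

(** The l^1 norm: increments are taken one coordinate at a time, and their errors add up to it. *)
Definition n1 u : R := \sum_j `|u 0 j|.

Lemma n1_ge0 u : 0 <= n1 u. Proof. exact: sumr_ge0. Qed.

Lemma n1_coord u j : `|u 0 j| <= n1 u.
Proof. by rewrite /n1 (bigD1 j)//= lerDl sumr_ge0. Qed.

Lemma n1D u v : n1 (u + v) <= n1 u + n1 v.
Proof. by rewrite /n1 -big_split ler_sum// => j _; rewrite mxE ler_normD. Qed.

Lemma n1Z (a : R) u : n1 (a *: u) = `|a| * n1 u.
Proof. by rewrite /n1 mulr_sumr; apply: eq_bigr => j _; rewrite mxE normrM. Qed.

Lemma n1_0 : n1 0 = 0.
Proof. by rewrite /n1 big1// => j _; rewrite mxE normr0. Qed.

Lemma nbhs_n1P x (A : set V) : nbhs x A <->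
  exists2 d : R, 0 < d & forall y, n1 (y - x) < d -> A y.
Proof.
split=> [/nbhs_ballP[d /= d0 dA]|[d d0 dA]].
  exists d => // y yd; apply: dA; split=> // i j.
  rewrite /ball /= ord1 distrC; apply: le_lt_trans yd.
  by have := n1_coord (y - x) j; rewrite !mxE.
apply/nbhs_ballP; exists (d / (m%:R + 1)) => /=.
  by rewrite divr_gt0// ltr_wpDl.
move=> y [_ yd]; apply: dA.
have M0 : 0 < (m%:R + 1 : R) by rewrite ltr_wpDl.
apply: le_lt_trans (_ : m%:R * (d / (m%:R + 1)) < _).
  have -> : m%:R * (d / (m%:R + 1)) = \sum_(j < m) (d / (m%:R + 1)).
    by rewrite sumr_const card_ord mulr_natl.
  apply: ler_sum => j _; rewrite !mxE distrC; apply: ltW; exact: (yd 0 j).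
by rewrite mulrA ltr_pdivrMr// mulrC ltr_pM2l// ltrDl.
Qed.

Lemma open_n1P U x : open U -> U x -> exists2 d : R, 0 < d & forall y, n1 (y - x) < d -> U y.
Proof. by move=> oU Ux; apply/nbhs_n1P/open_nbhs_nbhs. Qed.

Lemma n1_near_all (I : finType) (P : I -> V -> Prop) x :
  (forall i, exists2 d : R, 0 < d & forall y, n1 (y - x) < d -> P i y) ->
  exists2 d : R, 0 < d & forall y, n1 (y - x) < d -> forall i, P i y.
Proof.
move=> H; apply/nbhs_n1P; apply: (@filter_forall _ _ _ _ (nbhs_filter x)) => i.
exact/nbhs_n1P.
Qed.

Lemma n1_nearI (P Q : V -> Prop) x :
  (exists2 d : R, 0 < d & forall y, n1 (y - x) < d -> P y) ->
  (exists2 d : R, 0 < d & forall y, n1 (y - x) < d -> Q y) ->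
  exists2 d : R, 0 < d & forall y, n1 (y - x) < d -> P y /\ Q y.
Proof.
move=> [d d0 dP] [d' d'0 d'P]; exists (Num.min d d'); first by rewrite lt_min d0.
by move=> y; rewrite lt_min => /andP[/dP ? /d'P].
Qed.

Lemma cont_n1P F x : {for x, continuous F} <-> forall e : R, 0 < e ->
  exists2 d : R, 0 < d & forall y, n1 (y - x) < d -> `|F y - F x| <= e.
Proof.
split=> [cF e e0|H].
  have [d d0 dF] := iffLR (nbhs_n1P _ _) (iffLR (cvgrPdist_le _ _) cF e e0).
  by exists d => // y /dF; rewrite distrC.
have FF : Filter (nbhs x) := nbhs_filter x.
apply/cvgrPdist_le => e e0; apply/nbhs_n1P; have [d d0 dF] := H e e0.
by exists d => // y /dF; rewrite distrC.
Qed.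

Lemma is_derive_eps (f : R -> R) (s l : R) :
  (forall e : R, 0 < e -> exists2 d : R, 0 < d &
     forall h, `|h| < d -> `|f (s + h) - f s - h * l| <= e * `|h|) ->
  is_derive s 1 f l.
Proof.
move=> H.
have cv : (fun h => h^-1 *: (f (h *: (1 : R) + s) - f s)) @ (0 : R)^' --> l.
  apply/cvgrPdist_le => e e0; have [d d0 dH] := H e e0.
  rewrite near_withinE; apply/nbhs_ballP; exists d => //= h.
  rewrite /ball /= sub0r normrN => hd h0.
  have := dH h hd; rewrite distrC => hE.
  rewrite [h *: 1]mulr1 [h + s]addrC.
  have -> : l - h^-1 *: (f (s + h) - f s) = h^-1 * (h * l - (f (s + h) - f s)).
    by rewrite /GRing.scale /=; field.
  by rewrite normrM normfV mulrC ler_pdivrMr ?normr_gt0.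
apply: DeriveDef; first by apply: cvgP cv.
exact: cvg_lim cv.
Qed.

Lemma is_derive_line G w z s : derivable G (w + s *: z) z ->
  is_derive s (1 : R) (fun s => G (w + s *: z)) ('D_z G (w + s *: z)).
Proof.
move=> dG.
have E : (fun h => h^-1 *: (G (w + (h *: (1 : R) + s) *: z) - G (w + s *: z))) =
    (fun h => h^-1 *: (G (h *: z + (w + s *: z)) - G (w + s *: z))).
  by apply/funext => h; rewrite [h *: 1]mulr1 scalerDl addrCA.
by apply: DeriveDef; rewrite /derivable /derive E.
Qed.

Lemma MVT0 (f df : R -> R) (t : R) :
  (forall r : R, `|r| <= `|t| -> is_derive r (1 : R) f (df r)) ->
  exists2 r, `|r| <= `|t| & f t - f 0 = df r * t.
Proof.
move=> dP; have cont r : `|r| <= `|t| -> {for r, continuous f}.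
  move=> /dP dr; apply: differentiable_continuous; apply/derivable1_diffP.
  exact: ex_derive.
have key (a b : R) : a <= b -> `|a| <= `|t| -> `|b| <= `|t| ->
    exists2 r, `|r| <= `|t| & f b - f a = df r * (b - a).
  move=> ab ad bd.
  have sd r : a <= r <= b -> `|r| <= `|t|.
    by move: ad bd; rewrite !ler_norml; lra.
  have dG' r : r \in `]a, b[ -> is_derive r 1 f (df r).
    by rewrite in_itv /= => /andP[? ?]; apply/dP/sd; lra.
  have cG' : {within `[a, b], continuous f}.
    by apply: continuous_in_subspaceT => r; rewrite inE /= in_itv /= => h; apply/cont/sd.
  have [r] := MVT_segment ab dG' cG'.
  by rewrite in_itv /= => rab E; exists r => //; apply: sd.
have n0 : `|0 : R| <= `|t| by rewrite normr0.
have [t0|t0] := leP 0 t.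
  by have [r rt] := key 0 t t0 n0 (lexx _); rewrite subr0; exists r.
have [r rt E] := key t 0 (ltW t0) (lexx _) n0; exists r => //.
by rewrite -opprB E sub0r mulrN opprK.
Qed.

Lemma is_CkS k U G : is_Ck k.+1 U G -> is_Ck k U G.
Proof.
elim: k G => [|k IH] G [cG dG]; first by split.
by split=> // i; have [dGi /IH] := dG i; split.
Qed.

Lemma is_Ck_cont k U G : is_Ck k U G -> forall x, U x -> {for x, continuous G}.
Proof. by case: k => [|k] []. Qed.

Lemma is_Ck_sub k U U' G : U' `<=` U -> is_Ck k U G -> is_Ck k U' G.
Proof.
move=> UU; elim: k G => [|k IH] G [cG dG]; split=> //; first by move=> x /UU/cG.
  by move=> x /UU/cG.
by move=> i; have [dGi /IH c] := dG i; split=> // x /UU/dGi.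
Qed.

Lemma is_Ck_eq k U F G : open U -> (forall x, U x -> F x = G x) ->
  is_Ck k U F -> is_Ck k U G.
Proof.
move=> oU; have cE F' G' : (forall x, U x -> F' x = G' x) ->
    (forall x, U x -> {for x, continuous F'}) -> forall x, U x -> {for x, continuous G'}.
  move=> FG' cF' x Ux; apply/cont_n1P => e e0.
  have [d d0 dF] := (cont_n1P _ _).1 (cF' x Ux) e e0.
  have [d' d'0 d'U] := open_n1P oU Ux.
  exists (Num.min d d') => [|y]; first by rewrite lt_min d0.
  by rewrite lt_min => /andP[/dF yd /d'U Uy]; rewrite -!FG'.
elim: k F G => [|k IH] F G FG [cF dF]; first by split=> //; exact: cE cF.
split=> [|i]; first exact: cE cF.
have nFG x : U x -> \forall y \near x, F y = G y.
  by move=> Ux; have := open_nbhs_nbhs (conj oU Ux); apply: filterS => y /FG.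
have [dFi cFi] := dF i; split=> [x Ux|].
  by apply: near_eq_derivable (dFi x Ux); exact: nFG.
by apply: IH cFi => x Ux; apply: near_eq_derive; exact: nFG.
Qed.

Lemma is_Ck_cst k U (c : R) : is_Ck k U (cst c).
Proof.
elim: k c => [|k IH] c; first by split=> // x _; exact: cst_continuous.
split=> [x _|i]; first exact: cst_continuous.
split=> [x _|]; first exact: derivable_cst.
have -> : pd i (cst c : V -> R) = cst 0 by apply/funext => x; rewrite derive_cst.
exact: IH.
Qed.

Lemma is_CkD k U F G : open U -> is_Ck k U F -> is_Ck k U G ->
  is_Ck k U (fun x => F x + G x).
Proof.
move=> oU; elim: k F G => [|k IH] F G [cF dF] [cG dG].
  by split=> // x Ux; exact: (cvgD (cF x Ux) (cG x Ux)).
split=> [x Ux|i]; first by exact: (cvgD (cF x Ux) (cG x Ux)).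
have [dFi cFi] := dF i; have [dGi cGi] := dG i; split=> [x Ux|].
  by apply: derivableD; [exact: dFi | exact: dGi].
apply: is_Ck_eq oU _ (IH _ _ cFi cGi) => x Ux.
by rewrite -deriveD; [| exact: dFi | exact: dGi].
Qed.

Lemma is_CkM k U F G : open U -> is_Ck k U F -> is_Ck k U G ->
  is_Ck k U (fun x => F x * G x).
Proof.
move=> oU; elim: k F G => [|k IH] F G [cF dF] [cG dG].
  by split=> // x Ux; exact: (cvgM (cF x Ux) (cG x Ux)).
split=> [x Ux|i]; first by exact: (cvgM (cF x Ux) (cG x Ux)).
have [dFi cFi] := dF i; have [dGi cGi] := dG i; split=> [x Ux|].
  by apply: derivableM; [exact: dFi | exact: dGi].
have FS : is_Ck k U F by apply: is_CkS; split.
have GS : is_Ck k U G by apply: is_CkS; split.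
apply: is_Ck_eq oU _ (is_CkD oU (IH _ _ FS cGi) (IH _ _ GS cFi)) => x Ux.
by rewrite [RHS]deriveM; [| exact: dFi | exact: dGi].
Qed.

Lemma is_derive_comp_scalar (h : R -> R) G x v (dh dG : R) :
  is_derive (G x) 1 h dh -> is_derive x v G dG ->
  is_derive x v (h \o G) (dh * dG).
Proof.
move=> Hh HG; pose g (t : R) := G (t *: v + x).
have E (T : V -> R) : (fun t : R => t^-1 *: (T ((t *: (1 : R) + 0) *: v + x) - T ((0 : R) *: v + x)))
   = (fun t => t^-1 *: (T (t *: v + x) - T x)).
  by apply/funext => t; rewrite [t *: 1]mulr1 addr0 scale0r add0r.
have hg : is_derive (0 : R) 1 g dG.
  by case: HG => HG1 HG2; apply: DeriveDef; rewrite /derivable /derive /g E.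
have hh : is_derive (g 0) 1 h dh by rewrite /g scale0r add0r.
have [H1 H2] := is_derive1_comp hh hg.
have E2 := E (h \o G).
by apply: DeriveDef; [move: H1 | move: H2]; rewrite /derivable /derive /g /= E2.
Qed.

Lemma is_Ck_powR k U G (a : R) : open U -> (forall x, U x -> 0 < G x) ->
  is_Ck k U G -> is_Ck k U (fun x => G x `^ a).
Proof.
move=> oU Gp; elim: k a => [|k IH] a cG.
  split=> // x Ux; apply: (@continuous_comp _ _ _ G (fun r => r `^ a)).
    exact: is_Ck_cont cG x Ux.
  apply: differentiable_continuous; apply/derivable1_diffP.
  by apply: derivable_powR; rewrite in_itv /= andbT Gp.
have dP i x : U x -> is_derive x (basis_vec R i) (fun x => G x `^ a)
    (a * G x `^ (a - 1) * pd i G x).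
  move=> Ux; apply: (@is_derive_comp_scalar (fun r => r `^ a)).
    exact/is_derive1_powR/Gp.
  by have [/(_ x Ux)/derivableP] := (cG.2 i).
split=> [x Ux|i].
  exact: (is_Ck_cont (IH a (is_CkS cG))) x Ux.
split=> [x Ux|]; first by case: (dP i x Ux).
have c1 := is_CkM oU (IH (a - 1) (is_CkS cG)) (cG.2 i).2.
apply: is_Ck_eq oU _ (is_CkM oU (is_Ck_cst k U a) c1) => x Ux.
by have := dP i x Ux => /@derive_val ->; rewrite mulrA.
Qed.

Lemma n1_seg z (t : R) : `|t| <= 1 -> n1 (t *: z) <= n1 z.
Proof. by move=> t1; rewrite n1Z ler_piMl// n1_ge0. Qed.

(** Continuous partial derivatives imply differentiability: the increment is telescoped over the
    coordinates and each difference is treated by the mean value theorem. *)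
Lemma C1_diff U G y : open U -> is_Ck 1 U G -> U y -> forall e : R, 0 < e ->
  exists2 d : R, 0 < d & forall z, n1 z < d ->
    `|G (y + z) - G y - \sum_i z 0 i * pd i G y| <= e * n1 z.
Proof.
move=> oU [_ dG] Uy e e0.
have [d d0 dP] : exists2 d : R, 0 < d & forall w, n1 (w - y) < d ->
    U w /\ forall i, `|pd i G w - pd i G y| <= e.
  apply: n1_nearI; first exact: open_n1P.
  apply: n1_near_all => i; have [_ [/(_ y Uy)/cont_n1P ci _]] := dG i.
  exact: ci.
exists d => // z zd.
(* The point [w k] has received the first k coordinates of z, so consecutive points differ in one
   coordinate and remain in the l^1 ball. *)
pose w (k : nat) : V := y + \row_j (if (j < k)%N then z 0 j else 0).
have wS (k : 'I_m) : w k.+1 = w k + z 0 k *: basis_vec R k.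
  rewrite /w -addrA; congr (_ + _); apply/rowP => j; rewrite !mxE eqxx /= eq_sym.
  rewrite ltnS leq_eqVlt; have [->|jk] := eqVneq j k.
    by rewrite ltnn eqxx /= add0r mulr1.
  have -> : (j == k :> nat) = false by apply/negbTE.
  by rewrite /= mulr0 addr0.
have near_w (k : 'I_m) (r : R) : `|r| <= `|z 0 k| -> n1 (w k + r *: basis_vec R k - y) < d.
  move=> rz; apply: le_lt_trans zd; rewrite /w addrAC [y + _]addrC addrK.
  rewrite /n1 ler_sum// => j _; rewrite !mxE eqxx /= eq_sym.
  have [->|jk] := eqVneq j k; first by rewrite ltnn add0r mulr1.
  by rewrite mulr0 addr0; case: ifP => // _; rewrite normr0.
have step (k : 'I_m) : `|G (w k.+1) - G (w k) - z 0 k * pd k G y| <= e * `|z 0 k|.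
  have dk (r : R) : `|r| <= `|z 0 k| ->
      is_derive r 1 (fun r => G (w k + r *: basis_vec R k)) (pd k G (w k + r *: basis_vec R k)).
    move=> rz; have [Uw _] := dP _ (near_w k r rz).
    by apply: is_derive_line; exact: (dG k).1.
  have [r rz] := MVT0 dk; rewrite scale0r addr0 -wS => ->.
  have [_ /(_ k) h] := dP _ (near_w k r rz).
  by rewrite [z 0 k * _]mulrC -mulrBl normrM ler_wpM2r.
have tel : G (y + z) - G y = \sum_(k < m) (G (w k.+1) - G (w k)).
  rewrite -(big_mkord xpredT (fun k => G (w k.+1) - G (w k))) telescope_sumr//.
  congr (G _ - G _); rewrite /w; first by congr (_ + _); apply/rowP => j; rewrite mxE ltn_ord.
  by rewrite -[LHS]addr0; congr (_ + _); apply/rowP => j; rewrite !mxE.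
rewrite tel -sumrB; apply: le_trans (ler_norm_sum _ _ _) _.
by rewrite /n1 mulr_sumr ler_sum.
Qed.

Lemma C1_is_derive_line U G w z (s : R) : open U -> is_Ck 1 U G -> U (w + s *: z) ->
  is_derive s (1 : R) (fun s => G (w + s *: z)) (\sum_i z 0 i * pd i G (w + s *: z)).
Proof.
move=> oU cG Uw; apply: is_derive_eps => e e0.
have z1 : 0 < n1 z + 1 by rewrite ltr_wpDl// n1_ge0.
have [d d0 dP] := C1_diff oU cG Uw (divr_gt0 e0 z1).
exists (d / (n1 z + 1)) => [|h hd]; first by rewrite divr_gt0.
have hz : n1 (h *: z) < d.
  rewrite n1Z; apply: le_lt_trans (_ : `|h| * (n1 z + 1) < _).
    by rewrite ler_wpM2l// lerDl.
  by rewrite -ltr_pdivlMr.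
have := dP _ hz; have <- : w + (s + h) *: z = w + s *: z + h *: z by rewrite scalerDl addrA.
have -> : \sum_i (h *: z) 0 i * pd i G (w + s *: z) = h * \sum_i z 0 i * pd i G (w + s *: z).
  by rewrite mulr_sumr; apply: eq_bigr => i _; rewrite mxE mulrA.
move=> /le_trans; apply; rewrite n1Z mulrCA mulrC ler_wpM2r//.
rewrite mulrAC ler_pdivrMr// ler_pM2l// lerDl //.
Qed.

Definition quad (A : 'I_m -> 'I_m -> R) z : R := \sum_i \sum_j z 0 i * z 0 j * A i j.

Lemma eq_quad (A B : 'I_m -> 'I_m -> R) z : (forall i j, A i j = B i j) ->
  quad A z = quad B z.
Proof. by move=> AB; apply: eq_bigr => i _; apply: eq_bigr => j _; rewrite AB. Qed.

Lemma quad_le (A : 'I_m -> 'I_m -> R) z e : (forall i j, `|A i j| <= e) ->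
  `|quad A z| <= e * n1 z ^+ 2.
Proof.
move=> Ae; apply: le_trans (ler_norm_sum _ _ _) _.
rewrite expr2 {1}/n1 mulrC mulr_suml mulr_suml ler_sum// => i _.
apply: le_trans (ler_norm_sum _ _ _) _.
rewrite /n1 mulr_sumr mulr_suml ler_sum// => j _.
by rewrite !normrM ler_wpM2l// mulr_ge0.
Qed.

(** The mean value theorem is applied twice along the segment to the difference with the second
    order polynomial, so that only the continuity of the second derivatives at y is used. *)
Lemma taylor2 U G y : open U -> is_Ck 2 U G -> U y -> forall e : R, 0 < e ->
  exists2 d : R, 0 < d & forall z, n1 z < d ->
    `|G (y + z) - (G y + \sum_i z 0 i * pd i G y +
       2^-1 * quad (fun i j => pd j (pd i G) y) z)| <= e * n1 z ^+ 2.
Proof.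
move=> oU cG Uy e e0.
have [d d0 dP] : exists2 d : R, 0 < d & forall w, n1 (w - y) < d ->
    U w /\ forall i j, `|pd j (pd i G) w - pd j (pd i G) y| <= e.
  apply: n1_nearI; first exact: open_n1P.
  apply: n1_near_all => i; apply: n1_near_all => j.
  have [_ [_ /(_ j)[_ [/(_ y Uy)/cont_n1P ci _]]]] := cG.2 i.
  exact: ci.
exists d => // z zd.
have seg (s : R) : `|s| <= 1 -> n1 (y + s *: z - y) < d.
  by move=> s1; rewrite addrAC subrr add0r; apply: le_lt_trans (n1_seg z s1) zd.
pose L (s : R) := \sum_i z 0 i * pd i G (y + s *: z).
pose q := quad (fun i j => pd j (pd i G) y) z.
have dF (s : R) : `|s| <= `|1 : R| -> is_derive s 1 (fun s => G (y + s *: z)) (L s).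
  rewrite normr1 => s1; apply: C1_is_derive_line oU (is_CkS cG) _.
  by have [] := dP _ (seg s s1).
have dL (s : R) : `|s| <= 1 ->
    is_derive s 1 L (\sum_i z 0 i * \sum_j z 0 j * pd j (pd i G) (y + s *: z)).
  move=> s1; have -> : L = \sum_i (fun s => z 0 i * pd i G (y + s *: z)).
    by apply/funext => r; rewrite fct_sumE.
  apply: is_derive_sum => i.
  have Uw : U (y + s *: z) by have [] := dP _ (seg s s1).
  have h := is_deriveZ (z 0 i) (C1_is_derive_line oU (cG.2 i).2 Uw).
  exact: h.
(* The second order part of the expansion along the segment, without its constant term. *)
pose p : {poly R} := L 0 *: 'X + (q / 2) *: 'X^2.
have dH (s : R) : `|s| <= `|1 : R| ->
    is_derive s 1 ((fun s => G (y + s *: z)) - horner p) (L s - p^`().[s]).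
  by move=> s1; apply: is_deriveB (dF s s1) (is_derive_poly p s).
have [s s1 E] := MVT0 dH; rewrite normr1 in s1.
have pE' : p^`() = (L 0)%:P + q *: 'X.
  rewrite /p derivD !derivZ derivX derivXn alg_polyC; congr (_ + _).
  by rewrite /= expr1 mulr2n scalerDr -scalerDl; congr (_ *: _); field.
have pE (r : R) : p^`().[r] = L 0 + q * r by rewrite pE' !hornerE.
have dR (r : R) : `|r| <= `|s| -> is_derive r 1 (L - horner (p^`()))
    (\sum_i z 0 i * \sum_j z 0 j * pd j (pd i G) (y + r *: z) - q).
  move=> rs; have r1 := le_trans rs s1.
  apply: is_derive_eq (is_deriveB (dL r r1) (is_derive_poly _ r)) _.
  by congr (_ - _); rewrite pE' derivD derivC derivZ derivX add0r alg_polyC hornerC.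
have [r rs] := MVT0 dR.
rewrite -[(L - _) s]/(L s - p^`().[s]) -[(L - _) 0]/(L 0 - p^`().[0]) !pE mulr0 addr0 subrr subr0.
have r1 := le_trans rs s1.
have -> : \sum_i z 0 i * \sum_j z 0 j * pd j (pd i G) (y + r *: z) - q =
   quad (fun i j => pd j (pd i G) (y + r *: z) - pd j (pd i G) y) z.
  rewrite /q /quad -sumrB; apply: eq_bigr => i _; rewrite mulr_sumr -sumrB.
  by apply: eq_bigr => j _; rewrite mulrBr mulrA.
move=> E2.
have -> : G (y + z) - (G y + \sum_i z 0 i * pd i G y + 2^-1 * q) =
    ((fun s => G (y + s *: z)) - horner p) 1 - ((fun s => G (y + s *: z)) - horner p) 0.
  rewrite -[(_ - _) 1]/(G (y + 1 *: z) - p.[1]) -[(_ - _) 0]/(G (y + 0 *: z) - p.[0]).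
  have <- : L 0 = \sum_i z 0 i * pd i G y by apply: eq_bigr => i _; rewrite scale0r addr0.
  by rewrite scale1r scale0r addr0 /p !hornerE /=; field.
rewrite E mulr1 pE E2 normrM -[leRHS]mulr1.
apply: ler_pM => //.
by apply: quad_le => i j; have [_ /(_ i j)] := dP _ (seg r r1).
Qed.

(** The mixed second difference is symmetric in the two directions, while [key] expands it as h^2
    times the mixed derivative in either order. *)
Lemma schwarz U G y i j : open U -> is_Ck 2 U G -> U y ->
  pd i (pd j G) y = pd j (pd i G) y.
Proof.
move=> oU cG Uy.
have n1e k : n1 (basis_vec R k) = 1.
  rewrite /n1 (bigD1 k)//= big1 ?addr0 => [|l lk]; rewrite !mxE eqxx /=; last first.
    by rewrite (negbTE lk) normr0.
  by rewrite eqxx normr1.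
have key (a b : 'I_m) e : 0 < e -> exists2 d : R, 0 < d & forall h, 0 < h < d ->
    `|G (y + h *: basis_vec R a + h *: basis_vec R b) - G (y + h *: basis_vec R a)
      - G (y + h *: basis_vec R b) + G y - h ^+ 2 * pd b (pd a G) y| <= e * h ^+ 2.
  move=> e0; pose ea := basis_vec R a; pose eb := basis_vec R b.
  have e3 : 0 < e / 3 by rewrite divr_gt0.
  have [d d0 dP] := C1_diff oU (cG.2 a).2 Uy e3.
  have [d' d'0 d'P] := open_n1P oU Uy.
  exists (Num.min (d / 2) (d' / 2)) => [|h]; first by rewrite lt_min !divr_gt0.
  rewrite lt_min => /and3P[h0 hd hd'].
  have hn : `|h| = h by rewrite gtr0_norm.
  have small (r s : R) : `|r| <= h -> `|s| <= h -> n1 (r *: ea + s *: eb) <= 2 * h.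
    by move=> rh sh; apply: le_trans (n1D _ _) _; rewrite !n1Z !n1e; lra.
  have n00 : `|0 : R| <= h by rewrite normr0 ltW.
  have UU (r s : R) : `|r| <= h -> `|s| <= h -> U (y + s *: eb + r *: ea).
    move=> rh sh; apply: d'P; rewrite addrAC [y + _]addrC addrK addrC.
    by apply: le_lt_trans (small _ _ rh sh) _; lra.
  have dk (r : R) : `|r| <= `|h| -> is_derive r 1
     ((fun r => G (y + h *: eb + r *: ea)) - (fun r => G (y + r *: ea)))
     (pd a G (y + h *: eb + r *: ea) - pd a G (y + r *: ea)).
    rewrite hn => rh; apply: is_deriveB; apply: is_derive_line; apply: (cG.2 a).1.
      by apply: UU => //; rewrite hn.
    by have := UU r 0 rh n00; rewrite scale0r addr0.
  have [r] := MVT0 dk; rewrite hn => rh.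
  set f1 := (_ - _ : R -> R).
  rewrite -[f1 h]/(G (y + h *: eb + h *: ea) - G (y + h *: ea)).
  rewrite -[f1 0]/(G (y + h *: eb + 0 *: ea) - G (y + 0 *: ea)) !scale0r !addr0 => E.
  have -> : G (y + h *: ea + h *: eb) - G (y + h *: ea) - G (y + h *: eb) + G y
     - h ^+ 2 * pd b (pd a G) y = h * ((pd a G (y + h *: eb + r *: ea) - pd a G (y + r *: ea))
      - h * pd b (pd a G) y).
    rewrite mulrBr [h * (_ - _)]mulrC -E expr2 mulrA addrAC.
    by rewrite [y + h *: ea + _]addrAC; ring.
  have nn (z : V) : z = r *: ea + h *: eb \/ z = r *: ea + (0 : R) *: eb -> n1 z < d.
    by case=> ->; apply: le_lt_trans (small _ _ _ _) _; rewrite ?hn//; lra.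
  have h1 := dP _ (nn _ (or_introl erefl)).
  have h2 := dP _ (nn _ (or_intror erefl)).
  rewrite normrM hn expr2 mulrA [e * h]mulrC -mulrA ler_pM2l//.
  have sumE (s : R) : \sum_k (r *: ea + s *: eb) 0 k * pd k (pd a G) y =
      r * pd a (pd a G) y + s * pd b (pd a G) y.
    under eq_bigr do rewrite !mxE eqxx /= mulrDl; rewrite big_split /=; congr (_ + _).
      rewrite (bigD1 a)//= big1 ?addr0 => [|l /negbTE la]; last by rewrite la mulr0 mul0r.
      by rewrite eqxx mulr1.
    rewrite (bigD1 b)//= big1 ?addr0 => [|l /negbTE la]; last by rewrite la mulr0 mul0r.
    by rewrite eqxx mulr1.
  rewrite sumE in h1; rewrite sumE mul0r addr0 scale0r addr0 in h2.
  have s1 := small r h rh (_ : `|h| <= h); have s2 := small r 0 rh n00.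
  have {}s1 := s1 ltac:(by rewrite hn).
  rewrite scale0r addr0 in s2.
  have b1 : e / 3 * n1 (r *: ea + h *: eb) <= e / 3 * (2 * h) by rewrite ler_pM2l.
  have b2 : e / 3 * n1 (r *: ea) <= e / 3 * h.
    by rewrite ler_pM2l// n1Z n1e mulr1.
  have := le_trans h1 b1; have := le_trans h2 b2; rewrite addrA [y + r *: ea + _]addrAC.
  move: (pd a G _ : R) (pd a G _ : R) (pd a G _ : R) (pd a (pd a G) y : R) (pd b (pd a G) y : R) => A B C D1 D2 k2 k1.
  have -> : A - C - h * D2 = (A - B - (r * D1 + h * D2)) - (C - B - r * D1) by ring.
  by apply: le_trans (ler_normB _ _) _; apply: le_trans (lerD k1 k2) _; clear -h0; lra.
apply/eqP; rewrite -subr_eq0 -normr_le0; apply/ler_addgt0Pl => e e0; rewrite addr0.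
have e2 : 0 < e / 2 by rewrite divr_gt0.
have [d1 d10 h1] := key j i _ e2; have [d2 d20 h2] := key i j _ e2.
pose h := Num.min d1 d2 / 2.
have hm : 0 < Num.min d1 d2 by rewrite lt_min d10.
have h0 : 0 < h by rewrite divr_gt0.
have hh : h < Num.min d1 d2 by rewrite /h; lra.
have [hd1 hd2] : h < d1 /\ h < d2 by move: hh; rewrite lt_min => /andP[].
have := h1 h; rewrite h0 hd1 => /(_ isT); have := h2 h; rewrite h0 hd2 => /(_ isT).
rewrite [y + h *: basis_vec R j + _]addrAC.
have := exprn_gt0 2 h0; move: (h ^+ 2) => H H0.
move: (G _) (G _) (G _) (G _) (pd i (pd j G) y : R) (pd j (pd i G) y : R) => A B C D D1 D2 k2 k1.
rewrite -(ler_pM2r H0); apply: le_trans (_ : `|(D1 - D2) * H| <= _).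
  by rewrite normrM (gtr0_norm H0).
have -> : (D1 - D2) * H = (D - C - B + A - H * D2) - (D - B - C + A - H * D1) by ring.
apply: le_trans (ler_normB _ _) _.
by apply: le_trans (lerD k2 k1) _; clear; lra.
Qed.

Section Curves.
Variable Fl : set_system R.
Context {FF : Filter Fl}.
Hypothesis Fl0 : forall P : R -> Prop,
  (\forall t \near (0 : R), P t) -> \forall t \near Fl, P t.

Lemma jet2_lip (f : R -> R) (a b c : R) : jet2 Fl f a b c ->
  \forall t \near Fl, `|f t - a| <= (`|b| + `|c| + 1) * `|t|.
Proof.
move=> jf; apply: filterS2 (jf 1 ltr01) (Fl0 (nbhs0_lt ltr01)) => t h t1.
have t2 : t ^+ 2 <= `|t| by rewrite -real_normK ?num_real// expr2 ler_piMl// ltW.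
have -> : f t - a = (f t - (a + b * t + c * t ^+ 2)) + (b * t + c * t ^+ 2) by ring.
apply: le_trans (ler_normD _ _) _; apply: le_trans (lerD h (ler_normD _ _)) _.
rewrite [`|b * t|]normrM [`|c * _|]normrM (ger0_norm (sqr_ge0 t)) !mulrDl.
have := ler_wpM2l (normr_ge0 c) t2; move: (`|c| * _) (`|c| * _) (`|b| * _) => x1 x2 x3.
lra.
Qed.

Lemma jet2_curve U G (y : R -> V) y0 y1 y2 : open U -> is_Ck 2 U G -> U y0 ->
  (forall j, jet2 Fl (fun t => y t 0 j) (y0 0 j) (y1 0 j) (y2 0 j)) ->
  jet2 Fl (fun t => G (y t)) (G y0) (\sum_i y1 0 i * pd i G y0)
    (\sum_i y2 0 i * pd i G y0 + 2^-1 * quad (fun i j => pd j (pd i G) y0) y1).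
Proof.
move=> oU cG Uy jy; pose z t := y t - y0.
have jz j : jet2 Fl (fun t => z t 0 j) 0 (y1 0 j) (y2 0 j).
  apply: jet2_eq (jet2_ext _ (jet2B (jy j) (jet2_cst (y0 0 j)))) _ _ _.
  - by move=> t; rewrite !mxE.
  - by rewrite subrr.
  - by rewrite subr0.
  - by rewrite subr0.
pose A i j := pd j (pd i G) y0.
have jL : jet2 Fl (fun t => \sum_i z t 0 i * pd i G y0) 0
    (\sum_i y1 0 i * pd i G y0) (\sum_i y2 0 i * pd i G y0).
  have j1 : jet2 Fl (fun t => \sum_i pd i G y0 * z t 0 i) (\sum_i pd i G y0 * 0)
      (\sum_i pd i G y0 * y1 0 i) (\sum_i pd i G y0 * y2 0 i).
    by apply: jet2_sum => i _; apply: jet2Z.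
  apply: jet2_eq (jet2_ext _ j1) _ _ _.
  - by move=> t; apply: eq_bigr => i _; rewrite mulrC.
  - by rewrite big1// => i _; rewrite mulr0.
  - by apply: eq_bigr => i _; rewrite mulrC.
  - by apply: eq_bigr => i _; rewrite mulrC.
have jQ : jet2 Fl (fun t => 2^-1 * quad A (z t)) 0 0 (2^-1 * quad A y1).
  have j1 : jet2 Fl (fun t => \sum_i \sum_j A i j * (z t 0 i * z t 0 j))
      (\sum_i \sum_j A i j * (0 * 0))
      (\sum_i \sum_j A i j * (y1 0 i * 0 + 0 * y1 0 j))
      (\sum_i \sum_j A i j * (y2 0 i * 0 + y1 0 i * y1 0 j + 0 * y2 0 j)).
    by apply: jet2_sum => i _; apply: jet2_sum => j _; apply: jet2Z => //; apply: jet2M.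
  apply: jet2_eq (jet2Z _ 2^-1 (jet2_ext _ j1)) _ _ _ => //.
  - by move=> t; apply: eq_bigr => i _; apply: eq_bigr => j _; rewrite mulrC.
  - by rewrite big1 ?mulr0// => i _; rewrite big1// => j _; rewrite !mulr0.
  - by rewrite big1 ?mulr0// => i _; rewrite big1// => j _; rewrite !(mul0r, mulr0, addr0).
  - congr (_ * _); apply: eq_bigr => i _; apply: eq_bigr => j _.
    by rewrite mulr0 mul0r add0r addr0 mulrC.
have jE : jet2 Fl (fun t => G (y t) - (G y0 + \sum_i z t 0 i * pd i G y0 + 2^-1 * quad A (z t))) 0 0 0.
  pose K := \sum_j (`|y1 0 j| + `|y2 0 j| + 1).
  have K0 : 0 <= K by apply: sumr_ge0 => j _; rewrite !addr_ge0.
  have zK : \forall t \near Fl, n1 (z t) <= K * `|t|.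
    have h : \forall t \near Fl, forall j, `|z t 0 j - 0| <= (`|y1 0 j| + `|y2 0 j| + 1) * `|t|.
      by apply: filter_forall => j; exact: jet2_lip (jz j).
    apply: filterS h => t h; rewrite /n1 /K mulr_suml ler_sum// => j _.
    by have := h j; rewrite subr0.
  have K1 : 0 < K + 1 by rewrite ltr_wpDl.
  move=> e e0; pose e' := e / (K + 1) ^+ 2.
  have e'0 : 0 < e' by rewrite divr_gt0// exprn_gt0.
  have [d d0 dP] := taylor2 oU cG Uy e'0.
  have sm : \forall t \near Fl, `|t| < d / (K + 1).
    by apply: Fl0; apply: nbhs0_lt; rewrite divr_gt0.
  apply: filterS2 zK sm => t zt td.
  have zt1 : n1 (z t) <= (K + 1) * `|t|.
    by apply: le_trans zt _; rewrite ler_wpM2r// lerDl.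
  have ztd : n1 (z t) < d.
    by apply: le_lt_trans zt1 _; rewrite mulrC -ltr_pdivlMr.
  have := dP _ ztd; rewrite [y0 + _]addrC subrK mul0r !addr0 mul0r addr0 subr0 => /le_trans; apply.
  have -> : e * t ^+ 2 = e' * ((K + 1) * `|t|) ^+ 2.
    by rewrite exprMn real_normK ?num_real// /e'; field; rewrite gt_eqF.
  by rewrite ler_pM2l// lerXn2r// nnegrE ?n1_ge0// mulr_ge0// ltW.
apply: jet2_eq (jet2_ext _ (jet2D (jet2D (jet2D (jet2_cst (G y0)) jL) jQ) jE)) _ _ _.
- by move=> t /=; rewrite addrC subrK.
- by rewrite !addr0.
- by rewrite add0r !addr0.
- by rewrite add0r addr0.
Qed.

Lemma jet2_line U G y0 (v : V) : open U -> is_Ck 2 U G -> U y0 ->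
  jet2 Fl (fun t => G (y0 + t *: v)) (G y0) (\sum_i v 0 i * pd i G y0)
    (2^-1 * quad (fun i j => pd j (pd i G) y0) v).
Proof.
move=> oU cG Uy.
have jv j : jet2 Fl (fun t => (y0 + t *: v) 0 j) (y0 0 j) (v 0 j) ((0 : V) 0 j).
  apply: jet2_eq (jet2_ext _ (jet2_poly (y0 0 j) (v 0 j) 0)) _ _ _ => //.
    by move=> t; rewrite !mxE mul0r addr0 mulrC.
  by rewrite mxE.
apply: jet2_eq (jet2_curve oU cG Uy jv) _ _ _ => //.
by rewrite big1 ?add0r// => i _; rewrite mxE mul0r.
Qed.

End Curves.

End RowCalculus.

(** * Jets of matrices; smooth functions on a manifold with boundary *)

Section MatrixJets.
Variable R : realType.
Variable Fl : set_system R.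
Context {FF : Filter Fl}.
Hypothesis Fl0 : forall P : R -> Prop,
  (\forall t \near (0 : R), P t) -> \forall t \near Fl, P t.

Definition mjet {p q} (A : R -> 'M[R]_(p, q)) (A0 A1 A2 : 'M[R]_(p, q)) : Prop :=
  forall i j, jet2 Fl (fun t => A t i j) (A0 i j) (A1 i j) (A2 i j).

Lemma mjet_eq p q (A : R -> 'M[R]_(p, q)) A0 A1 A2 B0 B1 B2 : mjet A A0 A1 A2 ->
  A0 = B0 -> A1 = B1 -> A2 = B2 -> mjet A B0 B1 B2.
Proof. by move=> + <- <- <-. Qed.

Lemma mjet_cst p q (A : 'M[R]_(p, q)) : mjet (fun=> A) A 0 0.
Proof. by move=> i j; apply: jet2_eq (jet2_cst (A i j)) _ _ _; rewrite ?mxE. Qed.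

Lemma mjet_lin p q (A B : 'M[R]_(p, q)) : mjet (fun t => A + t *: B) A B 0.
Proof.
move=> i j; apply: jet2_eq (jet2_ext _ (jet2_poly (A i j) (B i j) 0)) _ _ _ => //.
  by move=> t; rewrite !mxE mul0r addr0 mulrC.
by rewrite mxE.
Qed.

Lemma mjetD p q (A B : R -> 'M[R]_(p, q)) A0 A1 A2 B0 B1 B2 :
  mjet A A0 A1 A2 -> mjet B B0 B1 B2 ->
  mjet (fun t => A t + B t) (A0 + B0) (A1 + B1) (A2 + B2).
Proof.
move=> jA jB i j; apply: jet2_eq (jet2_ext _ (jet2D (jA i j) (jB i j))) _ _ _ => [t|||];
  by rewrite mxE.
Qed.

Lemma mjetZ p q (f : R -> R) (A : R -> 'M[R]_(p, q)) f0 f1 f2 A0 A1 A2 :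
  jet2 Fl f f0 f1 f2 -> mjet A A0 A1 A2 ->
  mjet (fun t => f t *: A t) (f0 *: A0) (f1 *: A0 + f0 *: A1)
    (f2 *: A0 + f1 *: A1 + f0 *: A2).
Proof.
move=> jf jA i j; apply: jet2_eq (jet2_ext _ (jet2M Fl0 jf (jA i j))) _ _ _ => [t|||];
  by rewrite !mxE.
Qed.

Lemma mjetT p q (A : R -> 'M[R]_(p, q)) A0 A1 A2 : mjet A A0 A1 A2 ->
  mjet (fun t => (A t)^T) A0^T A1^T A2^T.
Proof.
by move=> jA i j; apply: jet2_eq (jet2_ext _ (jA j i)) _ _ _ => [t|||]; rewrite mxE.
Qed.

Lemma mjetM p q r (A : R -> 'M[R]_(p, q)) (B : R -> 'M[R]_(q, r)) A0 A1 A2 B0 B1 B2 :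
  mjet A A0 A1 A2 -> mjet B B0 B1 B2 ->
  mjet (fun t => A t *m B t) (A0 *m B0) (A1 *m B0 + A0 *m B1)
    (A2 *m B0 + A1 *m B1 + A0 *m B2).
Proof.
move=> jA jB i j.
have h : jet2 Fl (fun t => \sum_k A t i k * B t k j) _ _ _ :=
  @jet2_sum _ _ FF _ (index_enum _) xpredT _ _ _ _ (fun k _ => jet2M (FF := FF) Fl0 (jA i k) (jB k j)).
apply: jet2_eq (jet2_ext _ h) _ _ _ => [t|||]; first by rewrite mxE.
- by rewrite mxE.
- by rewrite !mxE big_split.
- by rewrite !mxE !big_split.
Qed.

Lemma mjet_near p q (A B : R -> 'M[R]_(p, q)) A0 A1 A2 : (\forall t \near Fl, A t = B t) ->
  mjet A A0 A1 A2 -> mjet B A0 A1 A2.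
Proof.
by move=> AB jA i j; apply: jet2_near (jA i j); apply: filterS AB => t ->.
Qed.

End MatrixJets.

Lemma mjet_unique (R : realType) p q (A : R -> 'M[R]_(p, q)) A0 A1 A2 B0 B1 B2 :
  mjet (0 : R)^'+ A A0 A1 A2 -> mjet (0 : R)^'+ A B0 B1 B2 ->
  [/\ A0 = B0, A1 = B1 & A2 = B2].
Proof.
move=> jA jB; have h i j := jet2_unique (jA i j) (jB i j).
by split; apply/matrixP => i j; case: (h i j).
Qed.

Section Manifold.
Variables (R : realType) (m : nat) (M : manifold R m).
Implicit Types (a b : mindex M) (p q : M) (c d u : M -> R) (v x y : 'rV[R]_m).
Notation pd i G := ('D_(basis_vec R i) G).

Lemma chart_near a p : dom a p -> exists2 d : R, 0 < d &
  forall y, n1 (y - crd a p) < d -> half_space y -> dom a (par a y) /\ crd a (par a y) = y.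
Proof.
move=> ap; have [_ [D oD DE] crdK _ _] := manifold_chartP a.
have [Dx _] : (D `&` @half_space R m) (crd a p) by rewrite -DE; exists p.
have [d d0 dD] := open_n1P oD Dx; exists d => // y /dD Dy Hy.
have : (D `&` @half_space R m) y by [].
by rewrite -DE => -[q aq <-]; rewrite /par /crd crdK ?inE.
Qed.

Lemma parK a p : dom a p -> par a (crd a p) = p.
Proof. by move=> ap; have [_ _ crdK _ _] := manifold_chartP a; apply: crdK; rewrite inE. Qed.

Lemma half_space_crd a p : dom a p -> half_space (crd a p).
Proof.
move=> ap; have [_ [D _ DE] _ _ _] := manifold_chartP a.
by have [] : (D `&` @half_space R m) (crd a p) by rewrite -DE; exists p.
Qed.

Lemma dom_open a : open (dom a).
Proof. by have [] := manifold_chartP a. Qed.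

Lemma dom_near a b p : dom a p -> dom b p -> exists2 d : R, 0 < d &
  forall y, n1 (y - crd a p) < d -> half_space y ->
    [/\ dom a (par a y), crd a (par a y) = y & dom b (par a y)].
Proof.
move=> ap bp; have [d1 d10 H1] := chart_near ap.
have [_ _ _ _ /subspace_continuousP cP] := manifold_chartP a.
have xA : (crd a @` dom a) (crd a p) by exists p.
have h := cP _ xA (dom b).
have : nbhs (par a (crd a p)) (dom b).
  by apply: open_nbhs_nbhs; split; [exact: dom_open | rewrite parK].
move=> {}/h; rewrite /within /= => /nbhs_n1P[d2 d20 H2].
exists (Num.min d1 d2) => [|y]; first by rewrite lt_min d10.
rewrite lt_min => /andP[/H1 h1 /H2 h2] hy; have [ay yE] := h1 hy.
by split=> //; apply: h2; exists (par a y).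
Qed.

Lemma crd_cont a p : dom a p -> forall e : R, 0 < e ->
  \forall q \near p, dom a q /\ n1 (crd a q - crd a p) < e.
Proof.
move=> ap e e0; have FF : Filter (nbhs p) := nbhs_filter p.
have na : nbhs p (dom a) by apply: open_nbhs_nbhs; split => //; exact: dom_open.
apply: filterI => //.
have [_ _ _ /subspace_continuousP/(_ p ap) cc _] := manifold_chartP a.
have /cc : nbhs (crd a p) [set y | n1 (y - crd a p) < e].
  by apply/nbhs_n1P; exists e.
rewrite /within /= => h; apply: filterS2 na h => q aq; exact.
Qed.

(** The condition bears on a neighbourhood of [p] only. It thus applies to functions such as the
    coordinates of another chart, which are meaningful near [p] but not on the whole chart [a]. *)
Definition smooth_at a p c : Prop := exists U, exists G,
  [/\ open U, U (crd a p), forall k, is_Ck k U G &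
      forall y, (crd a @` dom a) y -> U y -> G y = c (par a y)].

Lemma smooth_in_at a c p : smooth_in a c -> dom a p -> smooth_at a p c.
Proof.
move=> sc ap; have [|U [G [oU Ux cG GE]]] := sc (crd a p); first by exists p.
by exists U, G.
Qed.

(** The limit in [rel_pderiv] runs over admissible increments. Positive increments are always
    admissible, hence the restricted filter is proper and its limit is the derivative of the smooth
    extension. *)
Lemma pderiv_ext a p c U G i : dom a p -> open U -> U (crd a p) -> is_Ck 1 U G ->
  (forall y, (crd a @` dom a) y -> U y -> G y = c (par a y)) ->
  pderiv a i c p = pd i G (crd a p).
Proof.
move=> ap oU Ux cG GE; rewrite /pderiv /rel_pderiv.
set x := crd a p in Ux *; set A := [set h : R | _].
have posA (h : R) : 0 < h -> A h.
  move=> h0 j j0; rewrite !mxE; apply: addr_ge0; first exact: (half_space_crd ap j0).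
  by rewrite mulr_ge0 ?ler0n// ltW.
have PF : ProperFilter (within A (0 : R)^').
  split; last exact: within_filter.
  rewrite /within /= => /nbhs_ballP[e /= e0 h].
  have e20 : 0 < e / 2 by rewrite divr_gt0.
  apply: (h (e / 2)); [|by rewrite gt_eqF|exact: posA].
  by rewrite /ball /= sub0r normrN gtr0_norm// ltr_pdivrMr// mulr_natr mulr2n ltrDl.
have [d d0 dP] := chart_near ap; have [d' d'0 dU] := open_n1P oU Ux.
have n1e : n1 (basis_vec R i) = 1.
  rewrite /n1 (bigD1 i)//= big1 ?addr0 => [|l li]; rewrite !mxE eqxx /=; last first.
    by rewrite (negbTE li) normr0.
  by rewrite eqxx normr1.
have dG := (cG.2 i).1 x Ux.
have cv : (fun h : R => h^-1 *: (G (h *: basis_vec R i + x) - G x)) @ (0 : R)^' --> pd i G x.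
  exact: dG.
apply: cvg_lim; first exact: norm_hausdorff.
have cv2 : (fun h : R => h^-1 *: (G (h *: basis_vec R i + x) - G x)) @ within A (0 : R)^' --> pd i G x.
  apply: cvg_trans cv; apply: cvg_app; exact: cvg_within.
apply: cvg_trans cv2; apply: near_eq_cvg.
have dd : 0 < Num.min d d' by rewrite lt_min d0.
rewrite near_withinE near_withinE; apply/nbhs_ballP; exists (Num.min d d') => //= h.
rewrite /ball /= sub0r normrN => hd h0 Ah.
rewrite [h *: _ + x]addrC.
move: hd; rewrite lt_min => /andP[hd hd'].
have E (z : 'rV[R]_m) : n1 (z - x) < d -> n1 (z - x) < d' -> half_space z -> G z = c (par a z).
  move=> zd zd' hz; have [az zE] := dP _ zd hz.
  by apply: GE (dU _ zd'); exists (par a z).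
have nE : n1 (x + h *: basis_vec R i - x) = `|h|.
  by rewrite addrAC subrr add0r n1Z n1e mulr1.
rewrite /= (E (x + h *: _)) ?nE// (E x)//; try by rewrite subrr n1_0.
exact: half_space_crd.
Qed.

Lemma pderiv_smooth a p c i : dom a p -> smooth_at a p c -> smooth_at a p (pderiv a i c).
Proof.
move=> ap [U [G [oU Ux cG GE]]]; exists U, (pd i G); split=> //.
  by move=> k; have := cG k.+1 => -[_ /(_ i)[]].
move=> y [q aq <-] Uq; rewrite parK//; apply/esym.
exact: pderiv_ext aq oU Uq (cG 1%N) GE.
Qed.

Lemma smooth_at_near a b p c d : dom a p -> dom b p ->
  (forall q, dom a q -> dom b q -> c q = d q) -> smooth_at a p c -> smooth_at a p d.
Proof.
move=> ap bp cd [U [G [oU Ux cG GE]]]; have [e e0 H] := dom_near ap bp.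
have [U' oU' [U'x U'H]] : exists2 U', open U' & U' (crd a p) /\ forall y, U' y -> n1 (y - crd a p) < e.
  exists (interior [set y | n1 (y - crd a p) < e]); first exact: open_interior.
  split; last by move=> y /interior_subset.
  by apply/nbhs_n1P; exists e.
exists (U `&` U'), G; split=> //; first exact: openI.
  by move=> k; apply: is_Ck_sub (cG k) => y [].
move=> y yA [Uy U'y]; rewrite GE//; case: yA => q aq qy.
have hy : half_space y by rewrite -qy; exact: half_space_crd.
have [ay _ by_] := H y (U'H _ U'y) hy; exact: cd.
Qed.

Lemma smooth_at_eq a p c d : dom a p -> (forall q, dom a q -> c q = d q) ->
  smooth_at a p c -> smooth_at a p d.
Proof. by move=> ap cd; apply: (smooth_at_near ap ap) => q aq _; exact: cd. Qed.

Lemma smooth_at_cst a p (r : R) : smooth_at a p (fun=> r).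
Proof. by exists setT, (cst r); split=> // [|k]; [exact: openT | exact: is_Ck_cst]. Qed.

Lemma smooth_atD a p c d : smooth_at a p c -> smooth_at a p d ->
  smooth_at a p (fun q => c q + d q).
Proof.
move=> [U [G [oU Ux cG GE]]] [U' [G' [oU' Ux' cG' GE']]].
exists (U `&` U'), (fun y => G y + G' y); split=> //; first exact: openI.
  move=> k; apply: is_CkD; first exact: openI.
    by apply: is_Ck_sub (cG k) => y [].
  by apply: is_Ck_sub (cG' k) => y [].
by move=> y yA [Uy U'y]; rewrite GE// GE'.
Qed.

Lemma smooth_atM a p c d : smooth_at a p c -> smooth_at a p d ->
  smooth_at a p (fun q => c q * d q).
Proof.
move=> [U [G [oU Ux cG GE]]] [U' [G' [oU' Ux' cG' GE']]].
exists (U `&` U'), (fun y => G y * G' y); split=> //; first exact: openI.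
  move=> k; apply: is_CkM; first exact: openI.
    by apply: is_Ck_sub (cG k) => y [].
  by apply: is_Ck_sub (cG' k) => y [].
by move=> y yA [Uy U'y]; rewrite GE// GE'.
Qed.

Lemma smooth_atN a p c : smooth_at a p c -> smooth_at a p (fun q => - c q).
Proof.
move=> /(smooth_atM (smooth_at_cst a p (-1))) [U [G [oU Ux cG GE]]].
by exists U, G; split=> // y yA Uy; rewrite GE// mulN1r.
Qed.

Lemma smooth_at_sum a p (I : Type) (r : seq I) (F : I -> M -> R) :
  (forall i, smooth_at a p (F i)) -> smooth_at a p (fun q => \sum_(i <- r) F i q).
Proof.
move=> sF; elim: r => [|i r IH].
  have -> : (fun q => \sum_(i <- [::]) F i q) = (fun=> 0) by apply/funext => q; rewrite big_nil.
  exact: smooth_at_cst.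
have -> : (fun q => \sum_(j <- i :: r) F j q) = (fun q => F i q + \sum_(j <- r) F j q).
  by apply/funext => q; rewrite big_cons.
exact: smooth_atD.
Qed.

Lemma smooth_at_prod a p (I : Type) (r : seq I) (F : I -> M -> R) :
  (forall i, smooth_at a p (F i)) -> smooth_at a p (fun q => \prod_(i <- r) F i q).
Proof.
move=> sF; elim: r => [|i r IH].
  have -> : (fun q => \prod_(i <- [::]) F i q) = (fun=> 1) by apply/funext => q; rewrite big_nil.
  exact: smooth_at_cst.
have -> : (fun q => \prod_(j <- i :: r) F j q) = (fun q => F i q * \prod_(j <- r) F j q).
  by apply/funext => q; rewrite big_cons.
exact: smooth_atM.
Qed.

Lemma smooth_at_det a p k (A : M -> 'M[R]_k) :
  (forall i j, smooth_at a p (fun q => A q i j)) -> smooth_at a p (fun q => \det (A q)).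
Proof.
move=> sA; apply: smooth_at_sum => s; apply: smooth_atM; first exact: smooth_at_cst.
by apply: smooth_at_prod => i.
Qed.

Lemma smooth_at_powR a p c (r : R) : dom a p -> 0 < c p ->
  smooth_at a p c -> smooth_at a p (fun q => c q `^ r).
Proof.
move=> ap c0 [U [G [oU Ux cG GE]]].
have Gx : 0 < G (crd a p) by rewrite GE ?parK ?c0//; exists p.
have G2 : 0 < G (crd a p) / 2 by rewrite divr_gt0.
have [d d0 dP] := (cont_n1P _ _).1 (is_Ck_cont (cG 0%N) Ux) _ G2.
pose U' := interior [set y | n1 (y - crd a p) < d].
exists (U `&` U'), (fun y => G y `^ r); split.
- by apply: openI => //; exact: open_interior.
- by split=> //; apply/nbhs_n1P; exists d.
- move=> k; apply: is_Ck_powR.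
  + by apply: openI => //; exact: open_interior.
  + by move=> y [_ /interior_subset/dP]; rewrite ler_norml; lra.
  + by apply: is_Ck_sub (cG k) => y [].
- by move=> y yA [Uy _]; rewrite GE.
Qed.

(** [c] may be negative, whereas real powers are smooth on positive functions: the inverse is
    written as c (c^2)^-1. *)
Lemma smooth_atV a p c : dom a p -> c p != 0 ->
  smooth_at a p c -> smooth_at a p (fun q => (c q)^-1).
Proof.
move=> ap c0 sc.
have c2 : 0 < c p ^+ 2 by rewrite exprn_even_gt0.
have s2 := smooth_atM sc (smooth_at_powR (-1) ap c2 (smooth_atM sc sc)).
apply: smooth_at_eq ap _ s2 => q _.
rewrite powR_inv1; last by rewrite -expr2 sqr_ge0.
have [->|cq] := eqVneq (c q) 0; first by rewrite mul0r invr0.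
by rewrite invfM mulrA mulfV// mul1r.
Qed.

Lemma smooth_at_cont a p c : dom a p -> smooth_at a p c -> forall e : R, 0 < e ->
  \forall q \near p, `|c q - c p| <= e.
Proof.
move=> ap [U [G [oU Ux cG GE]]] e e0.
have [d d0 dP] := (cont_n1P _ _).1 (is_Ck_cont (cG 0%N) Ux) _ e0.
have [d' d'0 dU] := open_n1P oU Ux.
have dd : 0 < Num.min d d' by rewrite lt_min d0.
apply: filterS (crd_cont ap dd) => q [aq]; rewrite lt_min => /andP[/dP qd /dU Uq].
have E r : dom a r -> U (crd a r) -> G (crd a r) = c r.
  by move=> ar Ur; rewrite GE ?parK//; exists r.
by rewrite -!E.
Qed.

Section Rays.
Variable Fl : set_system R.
Context {FF : Filter Fl}.
Hypothesis Fl0 : forall P : R -> Prop,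
  (\forall t \near (0 : R), P t) -> \forall t \near Fl, P t.

Definition ray a p v (t : R) : M := par a (crd a p + t *: v).

Lemma ray_near a b p v : dom a p -> dom b p ->
  (\forall t \near Fl, half_space (crd a p + t *: v)) ->
  forall d : R, 0 < d -> \forall t \near Fl,
    [/\ dom a (ray a p v t), crd a (ray a p v t) = crd a p + t *: v,
        dom b (ray a p v t) & n1 (t *: v) < d].
Proof.
move=> ap bp hv d d0; have [e e0 H] := dom_near ap bp.
have v1 : 0 < n1 v + 1 by rewrite ltr_wpDl// n1_ge0.
have sm : \forall t \near Fl, `|t| < Num.min d e / (n1 v + 1).
  by apply: Fl0; apply: nbhs0_lt; rewrite divr_gt0// lt_min d0.
apply: filterS2 hv sm => t ht td.
have : n1 (t *: v) < Num.min d e.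
  rewrite n1Z; apply: le_lt_trans (_ : `|t| * (n1 v + 1) < _).
    by rewrite ler_wpM2l// lerDl.
  by rewrite -ltr_pdivlMr.
rewrite lt_min => /andP[td1 te].
by have [|? ? ?] := H (crd a p + t *: v) _ ht; first by rewrite addrAC subrr add0r.
Qed.

Lemma ray_jet a p c v : dom a p -> smooth_at a p c ->
  (\forall t \near Fl, half_space (crd a p + t *: v)) ->
  jet2 Fl (fun t => c (ray a p v t)) (c p) (\sum_i v 0 i * pderiv a i c p)
    (2^-1 * quad (fun i j => pderiv a j (pderiv a i c) p) v).
Proof.
move=> ap sc hv; have [U [G [oU Ux cG GE]]] := sc.
have Gx : G (crd a p) = c p by rewrite GE ?parK//; exists p.
have [d d0 dU] := open_n1P oU Ux.
have j1 := jet2_line (FF := FF) Fl0 v oU (cG 2%N) Ux.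
have nE : \forall t \near Fl, G (crd a p + t *: v) = c (ray a p v t).
  apply: filterS (ray_near ap ap hv d0) => t [ar rE _ td].
  rewrite -rE GE; first by rewrite rE.
    by exists (ray a p v t).
  by rewrite rE; apply: dU; rewrite addrAC subrr add0r.
apply: (jet2_eq (jet2_near nE j1) Gx).
- by apply: eq_bigr => i _; rewrite (pderiv_ext i ap oU Ux (cG 1%N) GE).
- apply: congr1; apply: eq_quad => i j.
  have cGi : is_Ck 1 U (pd i G) by have [_ /(_ i)[]] := cG 2%N.
  apply/esym; apply: (pderiv_ext _ ap oU Ux cGi) => y [q aq <-] Uq.
  by rewrite parK//; apply/esym; exact: pderiv_ext aq oU Uq (cG 1%N) GE.
Qed.

End Rays.

Lemma pderivC a p c i j : dom a p -> smooth_at a p c ->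
  pderiv a i (pderiv a j c) p = pderiv a j (pderiv a i c) p.
Proof.
move=> ap [U [G [oU Ux cG GE]]].
have cGk k : is_Ck 1 U (pd k G) by have [_ /(_ k)[]] := cG 2%N.
have E k l : pderiv a k (pderiv a l c) p = pd k (pd l G) (crd a p).
  apply: (pderiv_ext _ ap oU Ux (cGk l)) => y [q aq <-] Uq.
  by rewrite parK//; apply/esym; exact: pderiv_ext aq oU Uq (cG 1%N) GE.
by rewrite !E; apply: schwarz oU (cG 2%N) Ux.
Qed.

Definition hmat a c p : 'M[R]_m := \matrix_(i, j) pderiv a i (pderiv a j c) p.

Lemma hmat_sym a p c : dom a p -> smooth_at a p c -> (hmat a c p)^T = hmat a c p.
Proof. by move=> ap sc; apply/matrixP => i j; rewrite !mxE pderivC. Qed.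

(** The half-space constrains a single coordinate, and the sign of v in that coordinate decides. *)
Lemma inward_or a p v : dom a p ->
  (\forall t \near (0 : R)^'+, half_space (crd a p + t *: v)) \/
  (\forall t \near (0 : R)^'+, half_space (crd a p + t *: - v)).
Proof.
move=> ap; have pos (w : 'rV[R]_m) : (forall i : 'I_m, val i = 0%N -> 0 <= w 0 i) ->
    \forall t \near (0 : R)^'+, half_space (crd a p + t *: w).
  move=> w0; near=> t => i i0; rewrite !mxE; apply: addr_ge0.
    exact: (half_space_crd ap i0).
  by apply: mulr_ge0 (w0 i i0); apply: ltW; near: t; exact: nbhs_right_gt.
have [[i /eqP i0]|no] := pselect (exists i : 'I_m, val i == 0%N).
  have [v0|v0] := leP 0 (v 0 i); [left|right]; apply: pos => j j0.
    by have -> : j = i by apply: val_inj; rewrite i0.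
  have -> : j = i by apply: val_inj; rewrite i0.
  by rewrite mxE oppr_ge0 ltW.
by left; apply: pos => j /eqP j0; exfalso; apply: no; exists j.
Unshelve. all: by end_near. Qed.

End Manifold.

(** * Change of chart *)

Section Bilinear.
Variable R : comNzRingType.

Definition bil {p q} (A : 'M[R]_(p, q)) (u : 'rV[R]_p) (w : 'rV[R]_q) : R :=
  (u *m A *m w^T) 0 0.

Variables p q : nat.
Implicit Types (A B : 'M[R]_(p, q)) (u v : 'rV[R]_p) (w z : 'rV[R]_q).

Lemma bilE A u w : bil A u w = \sum_i \sum_j u 0 i * w 0 j * A i j.
Proof.
rewrite /bil mxE exchange_big; apply: eq_bigr => j _; rewrite mxE mulr_suml.
by apply: eq_bigr => i _; rewrite mxE mulrAC.
Qed.

Lemma bilDl A u v w : bil A (u + v) w = bil A u w + bil A v w.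
Proof. by rewrite /bil !mulmxDl mxE. Qed.
Lemma bilDr A u w z : bil A u (w + z) = bil A u w + bil A u z.
Proof. by rewrite /bil linearD mulmxDr mxE. Qed.
Lemma bilZl A (k : R) u w : bil A (k *: u) w = k * bil A u w.
Proof. by rewrite /bil -!scalemxAl mxE. Qed.
Lemma bilZr A (k : R) u w : bil A u (k *: w) = k * bil A u w.
Proof. by rewrite /bil linearZ -!scalemxAr mxE. Qed.
Lemma bilNl A u w : bil A (- u) w = - bil A u w.
Proof. by rewrite /bil !mulNmx mxE. Qed.
Lemma bilNr A u w : bil A u (- w) = - bil A u w.
Proof. by rewrite /bil linearN mulmxN mxE. Qed.
Lemma bil0l A w : bil A 0 w = 0.
Proof. by rewrite /bil !mul0mx mxE. Qed.
Lemma bil0r A u : bil A u 0 = 0.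
Proof. by rewrite /bil trmx0 mulmx0 mxE. Qed.
Lemma bilD A B u w : bil (A + B) u w = bil A u w + bil B u w.
Proof. by rewrite /bil mulmxDr mulmxDl mxE. Qed.
Lemma bilZ (k : R) A u w : bil (k *: A) u w = k * bil A u w.
Proof. by rewrite /bil -scalemxAr -scalemxAl mxE. Qed.
Lemma bilN A u w : bil (- A) u w = - bil A u w.
Proof. by rewrite /bil mulmxN mulNmx mxE. Qed.
Lemma bilB A B u w : bil (A - B) u w = bil A u w - bil B u w.
Proof. by rewrite bilD bilN. Qed.
Lemma bil_0 u w : bil 0 u w = 0.
Proof. by rewrite /bil mulmx0 mul0mx mxE. Qed.
Lemma bil_sum (I : Type) (r : seq I) (A : I -> 'M[R]_(p, q)) u w :
  bil (\sum_(i <- r) A i) u w = \sum_(i <- r) bil (A i) u w.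
Proof.
elim: r => [|i r IH]; first by rewrite !big_nil bil_0.
by rewrite !big_cons bilD IH.
Qed.
Lemma bilT A u w : bil A^T w u = bil A u w.
Proof.
transitivity ((u *m A *m w^T)^T 0 0); last by rewrite mxE.
by rewrite !trmx_mul trmxK mulmxA.
Qed.
Lemma bil_mull r (P : 'M[R]_(r, p)) A (u' : 'rV_r) w : bil A (u' *m P) w = bil (P *m A) u' w.
Proof. by rewrite /bil mulmxA. Qed.
Lemma bil_mulr r (P : 'M[R]_(r, q)) A u (w' : 'rV_r) : bil A u (w' *m P) = bil (A *m P^T) u w'.
Proof. by rewrite /bil trmx_mul !mulmxA. Qed.
End Bilinear.

Lemma bil_sym (R : comNzRingType) p (A : 'M[R]_p) u w : A^T = A -> bil A u w = bil A w u.
Proof. by move=> AT; rewrite -[in RHS]AT bilT. Qed.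

Lemma bil_delta (R : comNzRingType) p q (A : 'M[R]_(p, q)) i j :
  bil A (delta_mx 0 i) (delta_mx 0 j) = A i j.
Proof. by rewrite /bil -rowE trmx_delta -colE !mxE. Qed.

Lemma quad_inj (R : numFieldType) p (A B : 'M[R]_p) : A^T = A -> B^T = B ->
  (forall v, bil A v v = bil B v v) -> A = B.
Proof.
move=> AT BT AB; apply/matrixP => i j; rewrite -!bil_delta.
have := AB (delta_mx 0 i + delta_mx 0 j).
rewrite !bilDl !bilDr !AB -!addrA (bil_sym (delta_mx 0 j) _ AT) (bil_sym (delta_mx 0 j) _ BT).
move=> /addrI; rewrite !addrA => /addIr h.
have : 2 * bil A (delta_mx 0 i) (delta_mx 0 j) = 2 * bil B (delta_mx 0 i) (delta_mx 0 j).
  by rewrite !mulr_natl !mulr2n.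
by apply: mulfI; rewrite pnatr_eq0.
Qed.

Notation jac := Defs.jacobian.

Section ChartChange.
Variables (R : realType) (m : nat) (M : manifold R m).
Implicit Types (a b : mindex M) (p q : M) (c d u : M -> R) (v x y : 'rV[R]_m).

Lemma quadE (A : 'I_m -> 'I_m -> R) v : quad A v = bil (\matrix_(i, j) A i j) v v.
Proof. by rewrite bilE; apply: eq_bigr => i _; apply: eq_bigr => j _; rewrite mxE. Qed.

Lemma quad_hmat a c p v :
  quad (fun i j => pderiv a j (pderiv a i c) p) v = bil (hmat a c p) v v.
Proof.
rewrite quadE -[RHS]bilT; congr bil.
by apply/matrixP => i j; rewrite !mxE.
Qed.

Lemma sum_differential a c p v :
  \sum_i v 0 i * pderiv a i c p = (v *m differential a c p) 0 0.
Proof. by rewrite mxE; apply: eq_bigr => i _; rewrite mxE. Qed.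

Lemma smooth_at_crd a b p s : dom a p -> dom b p ->
  smooth_at a p (fun q => crd b q 0 s).
Proof.
move=> ap bp; have [|U [G [oU Ux cG GE]]] := @manifold_compat R m M a b s (crd a p).
  by exists p.
have [e e0 H] := dom_near ap bp.
pose U' := interior [set y | n1 (y - crd a p) < e].
exists (U `&` U'), G; split=> //.
- by apply: openI => //; exact: open_interior.
- by split=> //; apply/nbhs_n1P; exists e.
- by move=> k; apply: is_Ck_sub (cG k) => y [].
move=> y [q aq <-] [Uy /interior_subset U'y].
rewrite parK//; have [|_ _] := H _ U'y; first exact: half_space_crd.
rewrite parK// => bq; rewrite GE//; last by exists q.
by rewrite -/(par a _) -/(crd b _) parK.
Qed.

Lemma smooth_at_jac a b p i s : dom a p -> dom b p ->
  smooth_at a p (fun q => jac a b q i s).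
Proof.
move=> ap bp; apply: smooth_at_eq ap _ (pderiv_smooth i ap (smooth_at_crd s ap bp)) => q _.
by rewrite mxE.
Qed.

(** The coefficient of t^2 of the coordinate ray of [a] in direction v, read in the chart [b]. *)
Definition jac2 a b p v : 'rV[R]_m :=
  \row_s (2^-1 * bil (hmat a (fun q => crd b q 0 s) p) v v).

Section Rays.
Variable Fl : set_system R.
Context {FF : Filter Fl}.
Hypothesis Fl0 : forall P : R -> Prop,
  (\forall t \near (0 : R), P t) -> \forall t \near Fl, P t.

Lemma ray_jet' a p c v : dom a p -> smooth_at a p c ->
  (\forall t \near Fl, half_space (crd a p + t *: v)) ->
  jet2 Fl (fun t => c (ray a p v t)) (c p) ((v *m differential a c p) 0 0)
    (2^-1 * bil (hmat a c p) v v).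
Proof.
move=> ap sc hv; rewrite -sum_differential -quad_hmat; exact: ray_jet.
Qed.

Lemma ray_jet_chart a b p c v : dom a p -> dom b p -> smooth_at b p c ->
  (\forall t \near Fl, half_space (crd a p + t *: v)) ->
  jet2 Fl (fun t => c (ray a p v t)) (c p)
    ((v *m jac a b p *m differential b c p) 0 0)
    ((jac2 a b p v *m differential b c p) 0 0 +
     2^-1 * bil (hmat b c p) (v *m jac a b p) (v *m jac a b p)).
Proof.
move=> ap bp [U [G [oU Ux cG GE]]] hv.
have Gx : G (crd b p) = c p by rewrite GE ?parK//; exists p.
have [d d0 dU] := open_n1P oU Ux.
pose y t := crd b (ray a p v t).
have jy s : jet2 Fl (fun t => y t 0 s) (crd b p 0 s) ((v *m jac a b p) 0 s) (jac2 a b p v 0 s).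
  have := ray_jet' ap (smooth_at_crd s ap bp) hv.
  rewrite [jac2 _ _ _ _ _ _]mxE; move=> j; apply: (jet2_eq j) => //.
  by rewrite !mxE; apply: eq_bigr => i _; rewrite !mxE.
have j1 := jet2_curve (FF := FF) Fl0 oU (cG 2%N) Ux jy.
have nE : \forall t \near Fl, G (y t) = c (ray a p v t).
  have n1y : \forall t \near Fl, n1 (y t - crd b p) < d.
    pose K := \sum_j (`|(v *m jac a b p) 0 j| + `|jac2 a b p v 0 j| + 1).
    have K0 : 0 <= K by apply: sumr_ge0 => j _; rewrite !addr_ge0.
    have K1 : 0 < K + 1 by rewrite ltr_wpDl.
    have h : \forall t \near Fl, forall j, `|y t 0 j - crd b p 0 j| <=
        (`|(v *m jac a b p) 0 j| + `|jac2 a b p v 0 j| + 1) * `|t|.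
      by apply: filter_forall => j; exact: jet2_lip (jy j).
    have sm := Fl0 (nbhs0_lt (divr_gt0 d0 K1)).
    apply: filterS2 h sm => t h td.
    apply: le_lt_trans (_ : (K + 1) * `|t| < _); last by rewrite mulrC -ltr_pdivlMr.
    apply: le_trans (_ : K * `|t| <= _); last by rewrite ler_wpM2r// lerDl.
    by rewrite /n1 /K mulr_suml ler_sum// => j _; have := h j; rewrite !mxE.
  apply: filterS2 (ray_near (FF := FF) Fl0 ap bp hv ltr01) n1y => t [_ _ br _] /dU Uy.
  rewrite GE ?parK//; by exists (ray a p v t).
have E1 i : pderiv b i c p = 'D_(basis_vec R i) G (crd b p).
  exact: pderiv_ext bp oU Ux (cG 1%N) GE.
have E2 i j : pderiv b j (pderiv b i c) p = 'D_(basis_vec R j) ('D_(basis_vec R i) G) (crd b p).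
  have cGi : is_Ck 1 U ('D_(basis_vec R i) G) by have [_ /(_ i)[]] := cG 2%N.
  apply: (pderiv_ext _ bp oU Ux cGi) => z [q bq <-] Uq.
  by rewrite parK//; apply/esym; exact: pderiv_ext bq oU Uq (cG 1%N) GE.
apply: (jet2_eq (jet2_near nE j1) Gx).
  by rewrite -sum_differential; apply: eq_bigr => i _; rewrite E1.
congr (_ + _).
  transitivity (\sum_i (jac2 a b p v) 0 i * pderiv b i c p); last exact: sum_differential.
  by apply: eq_bigr => i _; rewrite E1.
apply: congr1; transitivity (quad (fun i j => pderiv b j (pderiv b i c) p) (v *m jac a b p)); last exact: quad_hmat.
by apply: eq_quad => i j; rewrite E2.
Qed.

End Rays.

(** The transformation laws below are even or odd in v, so it suffices to verify them along rays
    that stay in M. This covers boundary points. *)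
Lemma from_inward a p (P : 'rV[R]_m -> Prop) : dom a p ->
  (forall v, (\forall t \near (0 : R)^'+, half_space (crd a p + t *: v)) -> P v) ->
  (forall v, P (- v) -> P v) -> forall v, P v.
Proof. by move=> ap H PN v; have [/H|/H/PN] := inward_or v ap. Qed.

Lemma right_filter : forall P : R -> Prop, (\forall t \near (0 : R), P t) -> \forall t \near (0 : R)^'+, P t.
Proof. exact: near0_right. Qed.

Lemma differential_jac a b p c : dom a p -> dom b p -> smooth_at a p c -> smooth_at b p c ->
  differential a c p = jac a b p *m differential b c p.
Proof.
move=> ap bp sa sb.
have H : forall v, (v *m differential a c p) 0 0 = (v *m jac a b p *m differential b c p) 0 0.
  apply: (from_inward ap) => [v hv|v]; last by rewrite !mulNmx mxE [in RHS]mxE => /oppr_inj.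
  by have [] := jet2_unique (ray_jet' right_filter ap sa hv) (ray_jet_chart right_filter ap bp sb hv).
apply/matrixP => i j; rewrite ord1; have := H (delta_mx 0 i).
by rewrite -!mulmxA -!rowE !mxE.
Qed.

(** The coefficients of t^2 of one function in two charts are compared. The [jac2] term is the
    defect of tensoriality of the coordinate Hessian, to be compensated by the Christoffel
    symbols. *)
Lemma hmat_jac a b p c v : dom a p -> dom b p -> smooth_at a p c -> smooth_at b p c ->
  bil (hmat a c p) v v = 2 * (jac2 a b p v *m differential b c p) 0 0 +
    bil (hmat b c p) (v *m jac a b p) (v *m jac a b p).
Proof.
move=> ap bp sa sb; move: v; apply: (from_inward ap) => [v hv|v].
  have [_ _] := jet2_unique (ray_jet' right_filter ap sa hv) (ray_jet_chart right_filter ap bp sb hv).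
  move=> h; have -> : bil (hmat a c p) v v = 2 * (2^-1 * bil (hmat a c p) v v) by field.
  by rewrite h; field.
have NN (A : 'M[R]_m) x y : bil A (- x) (- y) = bil A x y by rewrite bilNl bilNr opprK.
have e1 : jac2 a b p (- v) = jac2 a b p v.
  by apply/rowP => s; rewrite [LHS]mxE [RHS]mxE NN.
have e2 : - v *m jac a b p = - (v *m jac a b p) by exact: mulNmx.
by move=> h; rewrite -(NN (hmat a c p)) h e1 e2 NN.
Qed.

End ChartChange.

(** * The Hessian is a tensor *)

Section Tensoriality.
Variables (R : realType) (n : nat) (M : almost_hermitian R n).
Notation m := (n + n)%N.
Implicit Types (a b : mindex M) (p q : M) (c u : M -> R) (v w : 'rV[R]_m).

Lemma invmx_uniq k (A B : 'M[R]_k) : A *m B = 1%:M -> invmx A = B.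
Proof.
move=> AB; have [Au _] := mulmx1_unit AB.
by rewrite -[RHS]mul1mx -(mulVmx Au) -mulmxA AB mulmx1.
Qed.

Lemma smooth_at_metric a p i j : dom a p -> smooth_at a p (fun q => metric a q i j).
Proof. by move=> ap; exact: (@smooth_in_at _ _ _ a (fun q => metric a q i j) p (@metric_smooth _ _ M a i j) ap). Qed.

Lemma smooth_at_acs a p i j : dom a p -> smooth_at a p (fun q => acs a q i j).
Proof. by move=> ap; exact: (@smooth_in_at _ _ _ a (fun q => acs a q i j) p (@acs_smooth _ _ M a i j) ap). Qed.

Lemma smooth_at_ginv a p i j : dom a p -> smooth_at a p (fun q => invmx (metric a q) i j).
Proof.
move=> ap.
have sc : smooth_at a p (fun q => (\det (metric a q))^-1 * cofactor (metric a q) j i).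
  apply: smooth_atM.
    apply: (smooth_atV ap); first by rewrite -unitfE -unitmxE; exact: metric_unitmx.
    by apply: smooth_at_det => k l; exact: smooth_at_metric.
  apply: smooth_atM; first exact: smooth_at_cst.
  apply: smooth_at_det => k l.
  by apply: smooth_at_eq ap _ (smooth_at_metric (lift j k) (lift i l) ap) => q _; rewrite !mxE.
apply: smooth_at_eq ap _ sc => q aq.
by rewrite /invmx metric_unitmx// !mxE.
Qed.

Lemma ginv_sym a p : dom a p -> (invmx (metric a p))^T = invmx (metric a p).
Proof. by move=> ap; rewrite trmx_inv Defs.metric_sym. Qed.

Lemma jac_unitmx a b p : dom a p -> dom b p -> jac a b p \in unitmx.
Proof.
move=> ap bp; have := metric_unitmx ap.
by rewrite (metric_tensor ap bp) -mulmxA unitmx_mul => /andP[].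
Qed.

Definition Dg a v p : 'M[R]_m :=
  \matrix_(j, l) \sum_i v 0 i * pderiv a i (fun q => metric a q j l) p.

Definition Djac a b v p : 'M[R]_m :=
  \matrix_(i, s) \sum_k v 0 k * pderiv a k (fun q => jac a b q i s) p.

Lemma DgN a v p : Dg a (- v) p = - Dg a v p.
Proof.
apply/matrixP => j l; rewrite !mxE -sumrN; apply: eq_bigr => i _.
by rewrite mxE mulNr.
Qed.

Lemma DjacN a b v p : Djac a b (- v) p = - Djac a b v p.
Proof.
apply/matrixP => j l; rewrite !mxE -sumrN; apply: eq_bigr => i _.
by rewrite mxE mulNr.
Qed.

Lemma DjacE a b v w p s : dom a p -> dom b p ->
  (w *m Djac a b v p) 0 s = bil (hmat a (fun q => crd b q 0 s) p) v w.
Proof.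
move=> ap bp; rewrite bilE mxE exchange_big; apply: eq_bigr => i _.
rewrite mxE mulr_sumr; apply: eq_bigr => k _; rewrite !mxE mulrCA mulrA; congr (_ * _).
by apply: pderiv_eq_dom => // q _; rewrite mxE.
Qed.

Lemma Djac_sym a b v w p : dom a p -> dom b p -> w *m Djac a b v p = v *m Djac a b w p.
Proof.
move=> ap bp; apply/rowP => s; rewrite !DjacE// bil_sym//.
exact: hmat_sym ap (smooth_at_crd s ap bp).
Qed.

(** The product rule for the transformation law of the metric, obtained from the uniqueness of the
    jets of both sides along an inward ray. *)
Lemma Dg_jac a b p v : dom a p -> dom b p ->
  Dg a v p = Djac a b v p *m metric b p *m (jac a b p)^T +
    jac a b p *m Dg b (v *m jac a b p) p *m (jac a b p)^T +
    jac a b p *m metric b p *m (Djac a b v p)^T.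
Proof.
move=> ap bp; move: v; apply: (from_inward ap) => [v hv|v]; last first.
  have -> : - v *m jac a b p = - (v *m jac a b p) by rewrite mulNmx.
  rewrite !DgN !DjacN; have -> : (- Djac a b v p)^T = - (Djac a b v p)^T by rewrite linearN.
  by rewrite !(mulmxN, mulNmx) -!opprD => /oppr_inj.
pose rt := @right_filter R; have FF : Filter (0 : R)^'+ by exact: _.
have ja : mjet (0 : R)^'+ (fun t => metric a (ray a p v t)) (metric a p) (Dg a v p)
    (\matrix_(j, l) (2^-1 * bil (hmat a (fun q => metric a q j l) p) v v)).
  move=> j l; have jj := ray_jet' (FF := FF) (c := fun q => metric a q j l) rt ap (smooth_at_metric _ _ ap) hv.
  apply: (jet2_eq jj) => //; last by rewrite mxE.
  by rewrite -sum_differential !mxE.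
have jb : mjet (0 : R)^'+ (fun t => metric b (ray a p v t)) (metric b p) (Dg b (v *m jac a b p) p)
    (\matrix_(j, l) ((jac2 a b p v *m differential b (fun q => metric b q j l) p) 0 0 +
     2^-1 * bil (hmat b (fun q => metric b q j l) p) (v *m jac a b p) (v *m jac a b p))).
  move=> j l; have jj := ray_jet_chart (FF := FF) (c := fun q => metric b q j l) rt ap bp (smooth_at_metric _ _ bp) hv.
  apply: (jet2_eq jj) => //; last by rewrite [in RHS]mxE.
  by rewrite -sum_differential [in RHS]mxE.
have jJ : mjet (0 : R)^'+ (fun t => jac a b (ray a p v t)) (jac a b p) (Djac a b v p)
    (\matrix_(j, l) (2^-1 * bil (hmat a (fun q => jac a b q j l) p) v v)).
  move=> j l; have jj := ray_jet' (FF := FF) (c := fun q => jac a b q j l) rt ap (smooth_at_jac _ _ ap bp) hv.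
  apply: (jet2_eq jj) => //; last by rewrite mxE.
  by rewrite -sum_differential !mxE.
have jM := mjetM (FF := FF) rt (mjetM (FF := FF) rt jJ jb) (mjetT (FF := FF) jJ).
have nE : \forall t \near (0 : R)^'+, jac a b (ray a p v t) *m metric b (ray a p v t) *m
    (jac a b (ray a p v t))^T = metric a (ray a p v t).
  by apply: filterS (ray_near rt ap bp hv ltr01) => t [ar _ br _]; rewrite -metric_tensor.
have [_ -> _] := mjet_unique ja (mjet_near nE jM).
by rewrite mulmxDl -!addrA.
Qed.

Definition grad a c p : 'rV[R]_m := (invmx (metric a p) *m differential a c p)^T.

Lemma hessE a c p i j : dom a p -> hess a c p i j = hmat a c p i j -
  2^-1 * \sum_l grad a c p 0 l * (pderiv a i (fun q => metric a q j l) p +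
    pderiv a j (fun q => metric a q i l) p - pderiv a l (fun q => metric a q i j) p).
Proof.
move=> ap; have gs := ginv_sym ap.
rewrite !mxE; congr (_ - _).
under eq_bigr do rewrite /christoffel -mulrA mulr_suml.
rewrite -mulr_sumr; congr (_ * _); rewrite exchange_big; apply: eq_bigr => l _.
have -> : grad a c p 0 l = \sum_k invmx (metric a p) k l * pderiv a k c p.
  rewrite !mxE; apply: eq_bigr => k _; rewrite mxE; congr (_ * _).
  by rewrite -[in LHS]gs mxE.
by rewrite mulr_suml; apply: eq_bigr => k _; rewrite mulrAC.
Qed.

Lemma pderiv_metricC a p k i j : dom a p ->
  pderiv a k (fun q => metric a q i j) p = pderiv a k (fun q => metric a q j i) p.
Proof.
move=> ap; apply: pderiv_eq_dom => // q; rewrite inE => aq.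
by rewrite -[in LHS](Defs.metric_sym aq) mxE.
Qed.

Lemma hess_sym a c p : dom a p -> smooth_at a p c -> (hess a c p)^T = hess a c p.
Proof.
move=> ap sc; apply/matrixP => i j; rewrite mxE !hessE//.
rewrite -[in LHS](hmat_sym ap sc) [_^T _ _]mxE; congr (_ - _ * _).
apply: eq_bigr => l _; congr (_ * _); rewrite (pderiv_metricC l i j ap).
by congr (_ - _); rewrite addrC.
Qed.

(** Contracted with dc, the Christoffel symbols become derivatives of the metric in the directions v
    and grad c. In this form a change of chart can be followed term by term. *)
Lemma hess_bil a c p v : dom a p -> bil (hess a c p) v v =
  bil (hmat a c p) v v - bil (Dg a v p) v (grad a c p) + 2^-1 * bil (Dg a (grad a c p) p) v v.
Proof.
move=> ap; set w := grad a c p.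
pose d i j l := pderiv a i (fun q => metric a q j l) p.
have E1 : bil (Dg a v p) v w = \sum_i \sum_j v 0 i * v 0 j * \sum_l w 0 l * d i j l.
  rewrite bilE exchange_big.
  transitivity (\sum_l \sum_j \sum_i v 0 i * v 0 j * (w 0 l * d i j l)).
    apply: eq_bigr => l _; apply: eq_bigr => j _; rewrite [Dg _ _ _ _ _]mxE mulr_sumr.
    by apply: eq_bigr => i _; rewrite /d; ring.
  rewrite exchange_big [RHS]exchange_big; apply: eq_bigr => j _.
  by rewrite exchange_big; apply: eq_bigr => i _; rewrite mulr_sumr.
have E2 : bil (Dg a v p) v w = \sum_i \sum_j v 0 i * v 0 j * \sum_l w 0 l * d j i l.
  rewrite E1 exchange_big; apply: eq_bigr => i _; apply: eq_bigr => j _.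
  by rewrite [v 0 j * _]mulrC.
have E3 : bil (Dg a w p) v v = \sum_i \sum_j v 0 i * v 0 j * \sum_l w 0 l * d l i j.
  by rewrite bilE; apply: eq_bigr => i _; apply: eq_bigr => j _; rewrite [Dg _ _ _ _ _]mxE.
have -> : bil (hess a c p) v v = bil (hmat a c p) v v -
    2^-1 * (bil (Dg a v p) v w + bil (Dg a v p) v w - bil (Dg a w p) v v).
  rewrite {1}E1 E2 E3 !bilE -!big_split -sumrB mulr_sumr -sumrB; apply: eq_bigr => i _.
  rewrite -big_split -sumrB mulr_sumr -sumrB; apply: eq_bigr => j _ /=.
  rewrite hessE// -!mulrDr -mulrBr mulrCA -mulrBr; congr (_ * (_ - _ * _)).
  by rewrite -big_split -sumrB; apply: eq_bigr => l _; rewrite /= mulrBr mulrDr.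
by field.
Qed.

Lemma grad_metric a c p : dom a p -> grad a c p *m metric a p = (differential a c p)^T.
Proof.
move=> ap; rewrite /grad trmx_mul ginv_sym// -mulmxA mulVmx ?mulmx1//.
exact: metric_unitmx.
Qed.

Lemma grad_jac a b c p : dom a p -> dom b p -> smooth_at a p c -> smooth_at b p c ->
  grad a c p *m jac a b p = grad b c p.
Proof.
move=> ap bp sa sb; have bu := metric_unitmx bp; have ju := jac_unitmx ap bp.
have jtu : (jac a b p)^T \in unitmx by rewrite unitmx_tr.
have : grad a c p *m jac a b p *m metric b p *m (jac a b p)^T =
    grad b c p *m metric b p *m (jac a b p)^T.
  rewrite -!mulmxA !(mulmxA (jac a b p)) -metric_tensor// grad_metric//.
  rewrite (differential_jac ap bp sa sb) trmx_mul mulmxA grad_metric//.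
by move/(can_inj (mulmxK jtu))/(can_inj (mulmxK bu)).
Qed.

(** Both sides are symmetric, so their quadratic forms are compared. The second derivatives of the
    transition map enter through [hmat] and through the derivatives of the metric along v and along
    the gradient; [E3] matches the first with the second, and the mixed terms of the last two
    cancel. *)
Lemma hess_jac a b c p : dom a p -> dom b p -> smooth_at a p c -> smooth_at b p c ->
  hess a c p = jac a b p *m hess b c p *m (jac a b p)^T.
Proof.
move=> ap bp sa sb; apply: quad_inj; first exact: hess_sym.
  by rewrite !trmx_mul trmxK hess_sym// mulmxA.
move=> v; rewrite -bil_mulr -bil_mull hess_bil// hess_bil// (hmat_jac v ap bp sa sb).
set w := grad a c p; set J := jac a b p; set wb := grad b c p.
have wJ : w *m J = wb by exact: grad_jac.
have E1 : bil (Dg a v p) v w = bil (metric b p) (v *m Djac a b v p) wb +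
    bil (Dg b (v *m J) p) (v *m J) wb + bil (metric b p) (v *m J) (w *m Djac a b v p).
  rewrite (Dg_jac v ap bp) !bilD -!bil_mulr -!bil_mull.
  by rewrite wJ.
have E2 : bil (Dg a w p) v v = 2 * bil (metric b p) (v *m J) (w *m Djac a b v p) +
    bil (Dg b wb p) (v *m J) (v *m J).
  rewrite (Dg_jac w ap bp) !bilD -!bil_mulr -!bil_mull wJ (Djac_sym v w ap bp).
  by rewrite (bil_sym (v *m J) (v *m Djac a b w p) (Defs.metric_sym bp)); ring.
have E3 : bil (metric b p) (v *m Djac a b v p) wb =
    2 * (jac2 a b p v *m differential b c p) 0 0.
  have -> : jac2 a b p v = 2^-1 *: (v *m Djac a b v p).
    by apply/rowP => s; rewrite [LHS]mxE [RHS]mxE DjacE.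
  rewrite -scalemxAl mxE mulrA divff ?pnatr_eq0// mul1r /bil -mulmxA.
  by rewrite -[differential b c p]trmxK -grad_metric// trmx_mul Defs.metric_sym.
by rewrite E1 E2 E3; field.
Qed.

Definition gradsq a c p : R := bil (invmx (metric a p)) (differential a c p)^T (differential a c p)^T.

Lemma gradsqE a c p : dom a p -> gradsq a c p = bil (metric a p) (grad a c p) (grad a c p).
Proof.
move=> ap; rewrite /bil grad_metric// /grad trmxK mulmxA /gradsq /bil trmxK.
by rewrite -mulmxA.
Qed.

Lemma gradsq_jac a b c p : dom a p -> dom b p -> smooth_at a p c -> smooth_at b p c ->
  gradsq a c p = gradsq b c p.
Proof.
move=> ap bp sa sb; rewrite (gradsqE c ap) (gradsqE c bp) -(grad_jac ap bp sa sb) bil_mull bil_mulr.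
by rewrite (metric_tensor ap bp).
Qed.

Lemma hess_trace_jac a b c p : dom a p -> dom b p -> smooth_at a p c -> smooth_at b p c ->
  \tr (invmx (metric a p) *m hess a c p *m invmx (metric a p) *m (hess a c p)^T) =
  \tr (invmx (metric b p) *m hess b c p *m invmx (metric b p) *m (hess b c p)^T).
Proof.
move=> ap bp sa sb; rewrite (hess_sym ap sa) (hess_sym bp sb) (hess_jac ap bp sa sb) (metric_tensor ap bp).
have ju := jac_unitmx ap bp; have bu := metric_unitmx bp.
have jtu : (jac a b p)^T \in unitmx by rewrite unitmx_tr.
set J := jac a b p in ju jtu *; set g := metric b p in bu *; set H := hess b c p.
have iE : invmx (J *m g *m J^T) = invmx J^T *m invmx g *m invmx J.
  apply: invmx_uniq; rewrite -!mulmxA (mulmxA J^T) mulmxV// mul1mx.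
  by rewrite (mulmxA g) mulmxV// mul1mx mulmxV.
have E : invmx (J *m g *m J^T) *m (J *m H *m J^T) = invmx J^T *m (invmx g *m H) *m J^T.
  by rewrite iE -!mulmxA (mulKmx ju).
rewrite -mulmxA E -!mulmxA mxtrace_mulC !mulmxA.
by rewrite -!(mulmxA _ J^T) (mulmxV jtu) ?mulmx1 -?mulmxA.
Qed.

End Tensoriality.

(** * Hermitian linear algebra *)

Section ComplexFrames.
Variable R : realType.
Local Open Scope complex_scope.
Local Open Scope ring_scope.
Notation C := (R[i]).
Notation "A ^H" := ((conjM A)^T) (at level 8, format "A ^H").
Notation ii := ('i%C : C).

Lemma i2N1 : ii * ii = -1.
Proof. by rewrite -expr2 sqr_i. Qed.

Lemma toCM p q r (A : 'M[R]_(p, q)) (B : 'M[R]_(q, r)) : toC (A *m B) = toC A *m toC B.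
Proof. exact: map_mxM. Qed.
Lemma toCD p q (A B : 'M[R]_(p, q)) : toC (A + B) = toC A + toC B.
Proof. exact: map_mxD. Qed.
Lemma toCN p q (A : 'M[R]_(p, q)) : toC (- A) = - toC A.
Proof. exact: map_mxN. Qed.
Lemma toCT p q (A : 'M[R]_(p, q)) : toC A^T = (toC A)^T.
Proof. by rewrite /toC map_trmx. Qed.
Lemma conjMM p q r (A : 'M[C]_(p, q)) (B : 'M[C]_(q, r)) : conjM (A *m B) = conjM A *m conjM B.
Proof. exact: map_mxM. Qed.
Lemma conjMK p q (A : 'M[C]_(p, q)) : conjM (conjM A) = A.
Proof. by apply/matrixP => i j; rewrite !mxE conjCK. Qed.
Lemma conjM_toC p q (A : 'M[R]_(p, q)) : conjM (toC A) = toC A.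
Proof.
apply/matrixP => i j; rewrite !mxE.
by rewrite /real_complex_def /=; congr (_ +i* _)%C; rewrite oppr0.
Qed.
Lemma ctrM p q r (A : 'M[C]_(p, q)) (B : 'M[C]_(q, r)) : (A *m B)^H = B^H *m A^H.
Proof. by rewrite conjMM trmx_mul. Qed.
Lemma ctrK p q (A : 'M[C]_(p, q)) : A^H^H = A.
Proof. by apply/matrixP => i j; rewrite !mxE conjCK. Qed.

Definition reM p q (A : 'M[C]_(p, q)) : 'M[R]_(p, q) := map_mx (@complex.Re R) A.
Definition imM p q (A : 'M[C]_(p, q)) : 'M[R]_(p, q) := map_mx (@complex.Im R) A.

Lemma cmxE p q (A : 'M[C]_(p, q)) : A = toC (reM A) + ii *: toC (imM A).
Proof. by apply/matrixP => i j; rewrite !mxE -complexE. Qed.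

Lemma reM_E p q (A B : 'M[R]_(p, q)) : reM (toC A + ii *: toC B) = A.
Proof. by apply/matrixP => i j; rewrite !mxE; simpc. Qed.
Section Frames.
Variable n : nat.
Notation m := (n + n)%N.
Variable J : 'M[R]_m.
Hypothesis JJ : J *m J = - 1%:M.

(** The (1,0)-vectors x - i J x, without the usual factor 1/2. Hence g(e, conj e) = 2 g(x, x), which
    is the source of the factors 2 and 2^-1 attached to frames. *)
Definition cfr p (X : 'M[R]_(p, m)) : 'M[C]_(p, m) := toC X - ii *: toC (X *m J).

Lemma cfr_eig p (X : 'M[R]_(p, m)) : cfr X *m toC J = ii *: cfr X.
Proof.
rewrite /cfr mulmxBl -scalemxAl -!toCM -mulmxA JJ mulmxN mulmx1 toCN scalerN opprK.
by rewrite scalerBr scalerA i2N1 scaleN1r opprK addrC.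
Qed.

Lemma cfr_J p (X : 'M[R]_(p, m)) : cfr (X *m J) = ii *: cfr X.
Proof. by rewrite -cfr_eig /cfr mulmxBl -scalemxAl -!toCM. Qed.

Lemma cfrD p (X Y : 'M[R]_(p, m)) : cfr (X + Y) = cfr X + cfr Y.
Proof. by rewrite /cfr mulmxDl !toCD scalerDr opprD addrACA. Qed.

Lemma cfr_mul p q (A : 'M[R]_(p, q)) (X : 'M[R]_(q, m)) : cfr (A *m X) = toC A *m cfr X.
Proof. by rewrite /cfr -mulmxA !toCM mulmxBr -scalemxAr. Qed.

Lemma frame_cfr p (E : 'M[C]_(p, m)) : E *m toC J = ii *: E -> E = cfr (reM E).
Proof.
rewrite {1 2}(cmxE E) mulmxDl -scalemxAl -!toCM scalerDr scalerA i2N1 scaleN1r => h.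
have /(congr1 (@reM _ _)) := h; rewrite reM_E addrC -toCN reM_E => h1.
by rewrite /cfr h1 toCN scalerN opprK -cmxE.
Qed.

Lemma conj_cfr p (X : 'M[R]_(p, m)) : conjM (cfr X) = toC X + ii *: toC (X *m J).
Proof.
rewrite /cfr /conjM map_mxB map_mxZ -!/(conjM _) !conjM_toC.
set j := (X in _ - X *: _); have -> : j = - ii by rewrite /j /Num.conj /=; simpc.
by rewrite scaleNr opprK.
Qed.

(** The rows of E and of its conjugate lie in the eigenspaces of J for i and - i, which meet only in
    0. *)
Lemma col_frame_unit (E : 'M[C]_(n, m)) : row_free E -> E *m toC J = ii *: E ->
  col_mx E (conjM E) \in unitmx.
Proof.
move=> Ef EJ.
have EJ' : conjM E *m toC J = - ii *: conjM E.
  rewrite -[toC J]conjM_toC -conjMM EJ; apply/matrixP => i j; rewrite !mxE rmorphM; congr (_ * _).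
  by rewrite /Num.conj /=; simpc.
have Ef' : row_free (conjM E) by rewrite /conjM row_free_map.
rewrite -row_free_unit -kermx_eq0; apply/eqP/row_matrixP => k; rewrite row0.
set z := row k _; have : z *m col_mx E (conjM E) = 0 by rewrite -row_mul mulmx_ker row0.
rewrite -[z]hsubmxK mul_row_col => h.
have : (lsubmx z *m E + rsubmx z *m conjM E) *m toC J = 0 by rewrite h mul0mx.
rewrite mulmxDl -!mulmxA EJ EJ' -!scalemxAr scaleNr -scalerBr => /eqP.
rewrite scaler_eq0 => /orP[/eqP i0|/eqP h2].
  by have := i2N1; rewrite i0 mul0r => /eqP; rewrite eq_sym oppr_eq0 oner_eq0.
have h3 : lsubmx z *m E = 0.
  have : 2%:R *: (lsubmx z *m E) = 0 by rewrite scaler_nat mulr2n {2}(subr0_eq h2).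
  by move/eqP; rewrite scaler_eq0 pnatr_eq0 => /eqP.
have h4 : rsubmx z *m conjM E = 0 by move: h; rewrite h3 add0r.
have -> : lsubmx z = 0 by apply: (row_free_inj Ef); rewrite h3 mul0mx.
have -> : rsubmx z = 0 by apply: (row_free_inj Ef'); rewrite h4 mul0mx.
by rewrite row_mx0.
Qed.

(** For P = 1 - i J, the relation P + conj P = 2 gives rank P + rank (conj P) >= 2n and P (conj P) =
    0 gives the reverse inequality. The two ranks agree, so the image of P has dimension n. *)
Lemma frame_exists : exists X : 'M[R]_(n, m), row_free (cfr X).
Proof.
pose P : 'M[C]_m := cfr 1%:M.
have PP : P + conjM P = 2%:R *: 1%:M.
  rewrite conj_cfr /P /cfr addrACA addNr addr0 -mulr2n scaler_nat.
  by rewrite /toC map_mx1.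
have PP0 : P *m conjM P = 0.
  rewrite conj_cfr mul1mx mulmxDr -scalemxAr cfr_eig scalerA i2N1 scaleN1r.
  by rewrite /toC map_mx1 mulmx1 subrr.
have rk : \rank (conjM P) = \rank P by rewrite /conjM mxrank_map.
have r1 : (m <= \rank P + \rank P)%N.
  rewrite -{2}rk -{1}(mxrank1 C m); apply: leq_trans (mxrank_add _ _).
  by rewrite PP mxrank_scale_nz// pnatr_eq0.
have r2 : (\rank P + \rank P <= m)%N by rewrite -{2}rk; exact: mulmx0_rank_max.
have rn : \rank P = n.
  have aux (r : nat) : (r + r = n + n)%N -> r = n.
    by move/eqP; rewrite !addnn -!mul2n eqn_pmul2l// => /eqP.
  by apply: aux; apply/eqP; rewrite eqn_leq r2 r1.
have castP (r : nat) (e : r = n) (A : 'M[C]_(r, m)) : row_free A -> A *m toC J = ii *: A ->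
    exists X : 'M[R]_(n, m), row_free (cfr X).
  by subst r => Af AJ; exists (reM A); rewrite -frame_cfr.
have /submxP[D DE] : (row_base P <= P)%MS by rewrite eq_row_base.
apply: (castP _ rn (row_base P)); first exact: row_base_free.
by rewrite DE -mulmxA cfr_eig -scalemxAr.
Qed.

End Frames.

Lemma hermP n (W : 'M[C]_n) : (W \is hermsymmx) = (W^H == W).
Proof.
apply/idP/idP.
  by move/is_hermitianmxP; rewrite expr0 scale1r => {2}->; rewrite /conjM map_trmx.
move/eqP => h; apply/is_hermitianmxP; rewrite expr0 scale1r -[LHS]h /conjM map_trmx.
done.
Qed.

Lemma trC_form n (E : 'M[C]_(n, n)) (W : 'M[C]_n) : W^H = W -> (E *m W *m E^H)^H = E *m W *m E^H.
Proof. by move=> h; rewrite !ctrM ctrK h mulmxA. Qed.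

Lemma herm_diag n (W : 'M[C]_n) : W^H = W -> exists U : 'M[C]_n, exists d : 'I_n -> R,
  [/\ U *m U^H = 1%:M & U *m W *m U^H = diag_mx (\row_i (d i)%:C)].
Proof.
move=> Wh; have Wh' : W \is hermsymmx by rewrite hermP; apply/eqP.
have /orthomx_spectralP := hermitian_normalmx Wh'.
have /mxOverP dr := hermitian_spectral_diag_real Wh'.
move: dr; set P := spectralmx W; set D := spectral_diag W => dr WE.
have Pu : P \is unitarymx := spectral_unitarymx W.
have PE : P *m P^H = 1%:M by move/unitarymxP: Pu; rewrite /conjM map_trmx.
exists P, (fun i => complex.Re (D 0 i)); split=> //.
have iP : invmx P = P^H by rewrite invmx_unitary// /conjM map_trmx.
rewrite iP in WE.
rewrite {1}WE -!mulmxA PE mulmx1 !mulmxA PE mul1mx; congr diag_mx.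
by apply/rowP => i; rewrite !mxE RRe_real.
Qed.

Lemma unitary_det n (U : 'M[C]_n) : U *m U^H = 1%:M -> \det U * \det U^H = 1.
Proof. by move=> h; rewrite -det_mulmx h det1. Qed.

Lemma posdef_diag n (W : 'M[C]_n) (U : 'M[C]_n) (d : 'I_n -> R) : herm_posdef W ->
  U *m U^H = 1%:M -> U *m W *m U^H = diag_mx (\row_i (d i)%:C) -> forall i, 0 < d i.
Proof.
move=> [_ Wp] UU UW i.
have r0 : row i U != 0.
  apply/eqP => r0; have : (row i U) *m U^H = 0 by rewrite r0 mul0mx.
  rewrite -row_mul UU => /rowP/(_ i); rewrite !mxE eqxx => /eqP.
  by rewrite oner_eq0.
have := Wp _ r0.
have -> : (row i U *m W *m (conjM (row i U))^T) 0 0 = (U *m W *m U^H) i i.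
  rewrite -row_mul [in RHS]mxE mxE; apply: eq_bigr => j _; rewrite !mxE.
  by congr (_ * _).
by rewrite UW !mxE eqxx mulr1n ltcR.
Qed.

Lemma AMGM n (W : 'M[C]_n) : (0 < n)%N -> herm_posdef W ->
  complex.Re (\det W) <= (n%:R^-1 * \sum_i complex.Re (W i i)) ^+ n.
Proof.
move=> n0 Wp; have [Wh _] := Wp; rewrite hermP in Wh; move/eqP: Wh => Wh.
have [U [d [UU UW]]] := herm_diag Wh.
have d0 := posdef_diag Wp UU UW.
have dE : \det W = (\prod_i d i)%:C.
  have : \det (U *m W *m U^H) = \det W.
    by rewrite !det_mulmx mulrAC unitary_det// mul1r.
  by rewrite UW det_diag => <-; rewrite rmorph_prod; apply: eq_bigr => i _; rewrite mxE.
have tE : \tr W = (\sum_i d i)%:C.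
  have <- : \tr (U *m W *m U^H) = \tr W.
    by rewrite mxtrace_mulC mulmxA (mulmx1C UU) mul1mx.
  by rewrite UW mxtrace_diag rmorph_sum; apply: eq_bigr => i _; rewrite mxE.
have -> : \sum_i complex.Re (W i i) = \sum_i d i.
  by have := congr1 (@complex.Re R) tE; rewrite /mxtrace raddf_sum.
rewrite dE /= mulrC; have := @leif_AGM R 'I_n predT d.
by rewrite card_ord => /(_ (fun i _ => ltW (d0 i)))/leifP; case: ifP => _ => [/eqP ->|/ltW].
Qed.

Lemma posdef_form n (W A : 'M[C]_n) : herm_posdef W -> A \in unitmx -> herm_posdef (A *m W *m A^H).
Proof.
move=> [Wh Wp] Au; split; first by move: Wh; rewrite !hermP => /eqP Wh; rewrite trC_form.
move=> v v0; have := Wp (v *m A); rewrite ctrM !mulmxA; apply.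
by apply: contraNneq v0 => h; rewrite -(mulmxK Au v) h mul0mx.
Qed.

(** [B] normalises W to the identity; a unitary change of frame preserves this and diagonalises the
    form induced by G. *)
Lemma simul_diag n (W G : 'M[C]_n) : herm_posdef W -> herm_posdef G ->
  exists A : 'M[C]_n, exists gam : 'I_n -> R,
  [/\ A *m W *m A^H = 1%:M, A *m G *m A^H = diag_mx (\row_i (gam i)%:C),
      A \in unitmx & forall i, 0 < gam i].
Proof.
move=> Wp Gp; have [Wh _] := Wp; rewrite hermP in Wh; move/eqP: Wh => Wh.
have [U [d [UU UW]]] := herm_diag Wh; have d0 := posdef_diag Wp UU UW.
pose S : 'M[C]_n := diag_mx (\row_i ((Num.sqrt (d i))^-1)%:C).
have SH : S^H = S.
  apply/matrixP => i j; rewrite !mxE; have [->|ij] := eqVneq i j.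
    by rewrite !mulr1n; exact: (conjc_real).
  by rewrite ?(negbTE ij) ?[j == i]eq_sym ?(negbTE ij) !mulr0n rmorph0.
have Uu : U \in unitmx by have [] := mulmx1_unit UU.
have Su : S \in unitmx.
  rewrite unitmxE det_diag unitfE; apply/prodf_neq0 => i _; rewrite mxE.
  by rewrite (fmorph_eq0 (real_complex R)) invr_eq0 gt_eqF// sqrtr_gt0.
pose B := S *m U; have Bu : B \in unitmx by rewrite unitmx_mul Su.
have BW : B *m W *m B^H = 1%:M.
  rewrite /B ctrM SH -!mulmxA (mulmxA W) (mulmxA U) [U *m (W *m _)]mulmxA UW.
  apply/matrixP => i j; rewrite mul_diag_mx mxE mul_mx_diag !mxE.
  have [->|ij] := eqVneq i j; last by rewrite !mulr0n mul0r mulr0.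
  rewrite !mulr1n -!rmorphM /= -[X in _ * (X * _)]sqr_sqrtr ?ltW// expr2.
  by rewrite mulfK ?mulVf// gt_eqF// sqrtr_gt0.
have [Gh _] := posdef_form Gp Bu; rewrite hermP in Gh; move/eqP: Gh => Gh.
have [U' [gam [UU' UG]]] := herm_diag Gh.
exists (U' *m B), gam; split.
- rewrite ctrM; have -> : U' *m B *m W *m (B^H *m U'^H) = U' *m (B *m W *m B^H) *m U'^H.
    by rewrite !mulmxA.
  by rewrite BW mulmx1.
- by rewrite ctrM -UG !mulmxA.
- by rewrite unitmx_mul Bu; have [-> _] := mulmx1_unit UU'.
- exact: posdef_diag (posdef_form Gp Bu) UU' UG.
Qed.

End ComplexFrames.

(** * The estimate at a maximum point *)

Section BilinearBounds.
Variables (R : realType) (m : nat).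
Implicit Types (A : 'M[R]_m) (u v w : 'rV[R]_m) (K a b x y z P : R).

Lemma n1M_le A u K : (forall i j, `|A i j| <= K) -> n1 (u *m A) <= m%:R * K * n1 u.
Proof.
move=> AK; apply: le_trans (_ : \sum_(j < m) (K * n1 u) <= _); last first.
  by rewrite sumr_const card_ord -[leLHS]mulr_natl mulrA.
apply: ler_sum => j _; rewrite mxE; apply: le_trans (ler_norm_sum _ _ _) _.
rewrite mulr_sumr; apply: ler_sum => i _.
by rewrite normrM mulrC; apply: ler_wpM2r.
Qed.

Lemma sum_le_n1 u (c : 'I_m -> R) K : (forall s, `|c s| <= K) ->
  `|\sum_s u 0 s * c s| <= n1 u * K.
Proof.
move=> cK; apply: le_trans (ler_norm_sum _ _ _) _; rewrite mulr_suml.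
by apply: ler_sum => i _; rewrite normrM; apply: ler_wpM2l.
Qed.

Lemma bil_row A u w : bil A u w = \sum_s (u *m A) 0 s * w 0 s.
Proof. by rewrite /bil mxE; apply: eq_bigr => s _; rewrite [w^T _ _]mxE. Qed.

Lemma bil_sumr A u (I : finType) (F : I -> 'rV[R]_m) :
  bil A u (\sum_k F k) = \sum_k bil A u (F k).
Proof. by rewrite /bil linear_sum mulmx_sumr summxE. Qed.

Lemma bil_le_n1 A u w : `|bil A u w| <= n1 (u *m A) * n1 w.
Proof. by rewrite bil_row; apply: sum_le_n1 => s; exact: n1_coord. Qed.

Lemma bil_le A u w K a b : 0 <= K -> (forall i j, `|A i j| <= K) -> n1 u <= a -> n1 w <= b ->
  `|bil A u w| <= K * a * b.
Proof.
move=> K0 AK ua wb.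
apply: le_trans (_ : K * n1 u * n1 w <= _); last first.
  by rewrite ler_pM ?mulr_ge0 ?n1_ge0// ler_wpM2l.
rewrite bil_row; under eq_bigr do rewrite mulrC.
rewrite mulrC; apply: sum_le_n1 => s; rewrite mxE.
by apply: le_trans (sum_le_n1 _ _) _; [move=> i; exact: AK|rewrite mulrC].
Qed.

(** One constant P serves for the form and for both vectors, while x, y and z carry their scales.
    Most error terms of the estimate are bounded in this shape. *)
Lemma bilP_le A u w P x y z : 0 <= P -> 0 <= x -> (forall i j, `|A i j| <= P * x) ->
  n1 u <= P * y -> n1 w <= P * z -> `|bil A u w| <= P ^+ 3 * (x * y * z).
Proof.
move=> P0 x0 AK uy wz.
have -> : P ^+ 3 * (x * y * z) = (P * x) * (P * y) * (P * z) by ring.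
by apply: bil_le => //; rewrite mulr_ge0.
Qed.

(* Coefficients of t and t^2 in the expansion of (A0 + t A1 + t^2 A2)(u, u)
   along u = u0 + t u1 + t^2 u2. *)
Definition b1c A0 A1 u0 u1 : R := bil A1 u0 u0 + bil A0 u0 u1 + bil A0 u1 u0.
Definition b2c A0 A1 A2 u0 u1 u2 : R :=
  bil A2 u0 u0 + bil A1 u0 u1 + bil A1 u1 u0 + bil A0 u1 u1 + bil A0 u0 u2 + bil A0 u2 u0.

Lemma b1c_le A0 A1 u0 u1 P x y z : 1 <= P -> 0 <= x -> 0 <= y -> 0 <= z ->
  (forall i j, `|A0 i j| <= P) -> (forall i j, `|A1 i j| <= P * x) ->
  n1 u0 <= P * y -> n1 u1 <= P * z -> `|b1c A0 A1 u0 u1| <= P ^+ 3 * (x * y ^+ 2 + 2 * y * z).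
Proof.
move=> P1 x0 y0 z0 h0 h1 hy hz; have P0 : 0 <= P by lra.
have h0' i j : `|A0 i j| <= P * 1 by rewrite mulr1.
have k1 := bilP_le P0 x0 h1 hy hy.
have k2 := bilP_le P0 ler01 h0' hy hz.
have k3 := bilP_le P0 ler01 h0' hz hy.
apply: le_trans (ler_normD _ _) _; apply: le_trans (lerD (ler_normD _ _) (lexx _)) _.
apply: le_trans (lerD (lerD k1 k2) k3) _.
by rewrite -subr_ge0 [leRHS](_ : _ = 0)//; ring.
Qed.

Lemma b2c_le A0 A1 A2 u0 u1 u2 P x y z a : 1 <= P -> 0 <= x -> 0 <= y -> 0 <= z -> 0 <= a ->
  (forall i j, `|A0 i j| <= P) -> (forall i j, `|A1 i j| <= P * x) ->
  (forall i j, `|A2 i j| <= P * x ^+ 2) ->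
  n1 u0 <= P * y -> n1 u1 <= P * z -> n1 u2 <= P * a ->
  `|b2c A0 A1 A2 u0 u1 u2| <= P ^+ 3 * ((x * y + z) ^+ 2 + 2 * y * a).
Proof.
move=> P1 x0 y0 z0 a0 h0 h1 h2 hy hz hw; have P0 : 0 <= P by lra.
have h0' i j : `|A0 i j| <= P * 1 by rewrite mulr1.
have k1 := bilP_le P0 (sqr_ge0 x) h2 hy hy.
have k2 := bilP_le P0 x0 h1 hy hz.
have k3 := bilP_le P0 x0 h1 hz hy.
have k4 := bilP_le P0 ler01 h0' hz hz.
have k5 := bilP_le P0 ler01 h0' hy hw.
have k6 := bilP_le P0 ler01 h0' hw hy.
rewrite /b2c.
do 5 (apply: le_trans (ler_normD _ _) _; rewrite -lerBrDr).
rewrite !lerBrDr -!addrA -!lerBrDr.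
have -> : P ^+ 3 * ((x * y + z) ^+ 2 + 2 * y * a) = P ^+ 3 * (x ^+ 2 * y * y) + P ^+ 3 * (x * y * z)
  + P ^+ 3 * (x * z * y) + P ^+ 3 * (1 * z * z) + P ^+ 3 * (1 * y * a) + P ^+ 3 * (1 * a * y) by ring.
lra.
Qed.

End BilinearBounds.

(* The jets, at an interior maximum point of the test quantity, of all the
   functions entering the second derivative estimate: X k v is the coefficient
   of t^k along x0 + t v; D2, D3, D4 are the derivatives of phi, Gm the
   Christoffel symbols, h the inverse metric, and b the drift coefficients of
   the linearised equation. *)
Record cdata (R : realType) (n : nat) := CData {
  cV : 'rV[R]_(n + n);
  cX : 'I_n -> 'rV[R]_(n + n);
  sg : 'I_n -> R;
  lam : R; F0 : R; eps : R; cA : R; yy : R;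
  dd : 'rV[R]_(n + n);
  D2 : 'M[R]_(n + n); D3 : 'rV[R]_(n + n) -> 'M[R]_(n + n); D4 : 'rV[R]_(n + n) -> 'M[R]_(n + n);
  J0 : 'M[R]_(n + n); J1 : 'rV[R]_(n + n) -> 'M[R]_(n + n); J2 : 'rV[R]_(n + n) -> 'M[R]_(n + n);
  g0 : 'M[R]_(n + n); g1 : 'rV[R]_(n + n) -> 'M[R]_(n + n); g2 : 'rV[R]_(n + n) -> 'M[R]_(n + n);
  h0 : 'M[R]_(n + n); h1 : 'rV[R]_(n + n) -> 'M[R]_(n + n); h2 : 'rV[R]_(n + n) -> 'M[R]_(n + n);
  G0 : 'I_(n + n) -> 'M[R]_(n + n);
  G1 : 'I_(n + n) -> 'rV[R]_(n + n) -> 'M[R]_(n + n);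
  G2 : 'I_(n + n) -> 'rV[R]_(n + n) -> 'M[R]_(n + n);
  b0 : 'I_(n + n) -> 'M[R]_(n + n);
  b1 : 'I_(n + n) -> 'rV[R]_(n + n) -> 'M[R]_(n + n);
  b2 : 'I_(n + n) -> 'rV[R]_(n + n) -> 'M[R]_(n + n) }.

Section Core.
Variables (R : realType) (n : nat).
Notation m := (n + n)%N.
Notation V := 'rV[R]_m.
Implicit Types (d : cdata R n) (u v w : V) (i j : 'I_n) (s t : 'I_m).

Definition dot u w : R := \sum_s u 0 s * w 0 s.

(** [N1], [N2] are the coefficients of t and t^2 of |dphi|^2 along x0 + t v, [y1], [y2] those of the
    exponential, and [eta1], [eta2] those of eta. *)
Definition N1 d v : R := bil (h1 d v) (dd d) (dd d) + 2 * bil (h0 d) (dd d) (v *m D2 d).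
Definition N2 d v : R := bil (h2 d v) (dd d) (dd d) + 2 * bil (h1 d v) (dd d) (v *m D2 d) +
  bil (h0 d) (v *m D2 d) (v *m D2 d) + bil (h0 d) (dd d) (v *m D3 d v).
Definition y1 d v : R := - (cA d * yy d * dot v (dd d)).
Definition y2 d v : R := yy d *
  (- (cA d * (2^-1 * bil (D2 d) v v)) + 2^-1 * (cA d * dot v (dd d)) ^+ 2).
Definition eta1 d v : R := eps d * N1 d v + y1 d v.
Definition eta2 d v : R := eps d * N2 d v + y2 d v.

(** [Pb] and [Pc] are the coefficients of t and t^2 of H(w_t, w_t) - lam exp(eta(x0) - eta(x_t))
    g(w_t, w_t) along x_t = x0 + t v and w_t = V + t w. At a maximum this function is nonpositive
    and vanishes at t = 0. *)
Definition Pb d v w : R :=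
  b1c (D2 d) (D3 d v) (cV d) w -
  \sum_s ((v *m D2 d) 0 s * bil (G0 d s) (cV d) (cV d) +
          dd d 0 s * b1c (G0 d s) (G1 d s v) (cV d) w) -
  lam d * (b1c (g0 d) (g1 d v) (cV d) w - eta1 d v).
Definition Pc d v w : R :=
  b2c (D2 d) (D3 d v) (2^-1 *: D4 d v) (cV d) w 0 -
  \sum_s (2^-1 * (v *m D3 d v) 0 s * bil (G0 d s) (cV d) (cV d) +
          (v *m D2 d) 0 s * b1c (G0 d s) (G1 d s v) (cV d) w +
          dd d 0 s * b2c (G0 d s) (G1 d s v) (G2 d s v) (cV d) w 0) -
  lam d * (b2c (g0 d) (g1 d v) (g2 d v) (cV d) w 0 - eta1 d v * b1c (g0 d) (g1 d v) (cV d) w +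
           (2^-1 * eta1 d v ^+ 2 - eta2 d v)).

(** For w = J u this is the diagonal entry of the matrix of the equation on the frame vector u - i
    w. [om1] and [om2] are the next coefficients along u + t u1 + t^2 u2, with w w1 w2 the expansion
    of its image under J. *)
Definition om0 d u w : R := bil (D2 d) u u + bil (D2 d) w w + 2 * bil (g0 d) u u +
  \sum_s dd d 0 s * bil (b0 d s) u u.
Definition om1 d v u u1 w w1 : R :=
  b1c (D2 d) (D3 d v) u u1 + b1c (D2 d) (D3 d v) w w1 + 2 * b1c (g0 d) (g1 d v) u u1 +
  \sum_s ((v *m D2 d) 0 s * bil (b0 d s) u u + dd d 0 s * b1c (b0 d s) (b1 d s v) u u1).
Definition om2 d v u u1 u2 w w1 w2 : R :=
  b2c (D2 d) (D3 d v) (2^-1 *: D4 d v) u u1 u2 + b2c (D2 d) (D3 d v) (2^-1 *: D4 d v) w w1 w2 +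
  2 * b2c (g0 d) (g1 d v) (g2 d v) u u1 u2 +
  \sum_s (2^-1 * (v *m D3 d v) 0 s * bil (b0 d s) u u +
          (v *m D2 d) 0 s * b1c (b0 d s) (b1 d s v) u u1 +
          dd d 0 s * b2c (b0 d s) (b1 d s v) (b2 d s v) u u1 u2).

Definition cY d i : V := cX d i *m J0 d.
(** As g(X_i, X_i) = sg_i^2 / 2, [pp] and [qq] are half the coefficients of V in the orthogonal
    basis X_i, J X_i. *)
Definition pp d i : R := bil (g0 d) (cV d) (cX d i) / sg d i ^+ 2.
Definition qq d i : R := bil (g0 d) (cV d) (cY d i) / sg d i ^+ 2.
Definition ra d i : R := y1 d (cX d i).
Definition rb d i : R := - y1 d (cY d i).
Definition Ui d : V := \sum_i qq d i *: cX d i.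
Definition Ur d : V := \sum_i pp d i *: cX d i.
(** [cZ] and [cK] are the coefficients of t and t^2 of the frame vector X_i + t (ra U_t + rb J_t
    U_t) along x0 + t V, where U_t = Ur + J_t Ui starts at V / 2. [cZ'] and [cK'] are those of its
    image under J_t, whence the terms in [J1] and [J2]. *)
Definition cZ d i : V := 2^-1 *: (ra d i *: cV d + rb d i *: (cV d *m J0 d)).
Definition cK d i : V := ra d i *: (Ui d *m J1 d (cV d)) +
  rb d i *: (Ui d *m J1 d (cV d) *m J0 d + 2^-1 *: cV d *m J1 d (cV d)).
Definition cZ' d i : V := cZ d i *m J0 d + cX d i *m J1 d (cV d).
Definition cK' d i : V := cK d i *m J0 d + cZ d i *m J1 d (cV d) + cX d i *m J2 d (cV d).
(** [kr] and [ki] are the real and imaginary parts of the number kappa for which this motion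
    multiplies the determinant of g on the frame by |1 + t kappa|^2. *)
Definition kr d : R := \sum_i (pp d i * ra d i - qq d i * rb d i).
Definition ki d : R := \sum_i (pp d i * rb d i + qq d i * ra d i).

Definition entries_le (A : 'M[R]_m) (K : R) := forall s t, `|A s t| <= K.

(** The facts about one maximum point from which the bound on [lam] follows by linear algebra and
    inequalities alone. No positive lower bound of f is available, so the derivatives of log f cost
    a factor F0^-1; [trG_ge] converts it into the sum of the sg_i^2. *)
Record core (B : R) d : Prop := Core {
  B1 : 1 <= B; mB : m%:R <= B; n_pos : (0 < n)%N;
  g0_le : entries_le (g0 d) B; g1_le : forall v, entries_le (g1 d v) (B * n1 v);
  g2_le : forall v, entries_le (g2 d v) (B * n1 v ^+ 2);
  h0_le : entries_le (h0 d) B; h1_le : forall v, entries_le (h1 d v) (B * n1 v);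
  h2_le : forall v, entries_le (h2 d v) (B * n1 v ^+ 2);
  J0_le : entries_le (J0 d) B; J1_le : forall v, entries_le (J1 d v) (B * n1 v);
  J2_le : forall v, entries_le (J2 d v) (B * n1 v ^+ 2);
  G0_le : forall s, entries_le (G0 d s) B; G1_le : forall s v, entries_le (G1 d s v) (B * n1 v);
  G2_le : forall s v, entries_le (G2 d s v) (B * n1 v ^+ 2);
  b0_le : forall s, entries_le (b0 d s) B; b1_le : forall s v, entries_le (b1 d s v) (B * n1 v);
  b2_le : forall s v, entries_le (b2 d s v) (B * n1 v ^+ 2);
  dd_le : n1 (dd d) <= B;
  g_coer : forall v, n1 v ^+ 2 <= B * bil (g0 d) v v;
  h_coer : forall v, n1 v ^+ 2 <= B * bil (h0 d) v v;
  g0T : (g0 d)^T = g0 d; h0T : (h0 d)^T = h0 d; D2T : (D2 d)^T = D2 d;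
  D3T : forall v, (D3 d v)^T = D3 d v;
  D3C : forall u v w, bil (D3 d u) v w = bil (D3 d v) u w;
  D4C : forall v w, bil (D4 d v) w w = bil (D4 d w) v v;
  J0J : forall u w, bil (g0 d) (u *m J0 d) (w *m J0 d) = bil (g0 d) u w;
  J0K : J0 d *m J0 d = - 1%:M;
  cV1 : bil (g0 d) (cV d) (cV d) = 1;
  Xnorm : forall i, bil (g0 d) (cX d i) (cX d i) = 2^-1 * sg d i ^+ 2;
  Xorth : forall i j, i != j -> bil (g0 d) (cX d i) (cX d j) = 0;
  XYorth : forall i j, bil (g0 d) (cX d i) (cY d j) = 0;
  sg_pos : forall i, 0 < sg d i;
  Vdec : cV d = 2 *: (Ur d + Ui d *m J0 d);
  om_eq1 : forall i, om0 d (cX d i) (cY d i) = 1;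
  F0_pos : 0 < F0 d; F0_le : F0 d <= B;
  trG_ge : n%:R / F0 d <= \sum_i sg d i ^+ 2;
  eigen : forall w, bil (D2 d) (cV d) w - \sum_s dd d 0 s * bil (G0 d s) (cV d) w
                    = lam d * bil (g0 d) (cV d) w;
  first_order : forall v, Pb d v 0 = 0;
  second_order : forall v w, Pc d v w <= 0;
  lin_eq : forall v, `|\sum_i om1 d v (cX d i) 0 (cY d i) (cX d i *m J1 d v)| <=
             B * n1 v * (1 + (F0 d)^-1);
  agm_second : - (B * (1 + kr d ^+ 2 + ki d ^+ 2) * (1 + (F0 d)^-1)) <=
     \sum_i om2 d (cV d) (cX d i) (cZ d i) (cK d i) (cY d i) (cZ' d i) (cK' d i) }.
End Core.

(** * Sizes of the frame and of the coefficients of its motion *)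

Section CoreEstimate.
Variables (R : realType) (n : nat) (d : cdata R n) (B P : R).
Notation m := (n + n)%N.
Notation V := 'rV[R]_m.
Hypothesis H : core B d.
Hypothesis hP : 3 * B ^+ 9 <= P.
Implicit Types (u v w : V) (i j : 'I_n) (s t : 'I_m).

Notation X := (cX d).
Notation Y := (cY d).
Notation cv := (cV d).
Notation Z := (cZ d).
Notation Z' := (cZ' d).
Notation K := (cK d).
Notation K' := (cK' d).
Notation D := (D2 d).

(** The scales attached to an index: [rabs] for Z_i, [hrow] for D^2 phi on X_i and J X_i, and [wrow]
    for the remaining coefficients of the moving frame. *)
Definition rabs i : R := `|ra d i| + `|rb d i|.
Definition hrow i : R := n1 (X i *m D) + n1 (Y i *m D).
Definition wrow i : R := sg d i + rabs i.

Lemma B_ge1 : 1 <= B. Proof. exact: B1 H. Qed.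
Lemma B_ge0 : 0 <= B. Proof. by have := B_ge1; lra. Qed.

Lemma Bexp_ge1 (k : nat) : 1 <= B ^+ k.
Proof. exact: exprn_ege1 B_ge1. Qed.

Lemma P_ge3 (k : nat) : (k <= 9)%N -> 3 * B ^+ k <= P.
Proof. by move=> k9; apply: le_trans hP; rewrite ler_wpM2l// ler_weXn2l// B_ge1. Qed.

Lemma P_ge (k : nat) : (k <= 9)%N -> B ^+ k <= P.
Proof. by move=> /P_ge3; have := Bexp_ge1 k; lra. Qed.

Lemma P_ge1 : 1 <= P.
Proof. by have := P_ge (leq0n 9). Qed.

Lemma BP : B <= P.
Proof. by have := @P_ge 1 isT. Qed.

Lemma P_ge0 : 0 <= P. Proof. by have := P_ge1; lra. Qed.

Lemma n1M u (A : 'M[R]_m) L a : 0 <= L -> entries_le A L -> n1 u <= a -> n1 (u *m A) <= B * L * a.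
Proof.
move=> L0 AL ua; apply: le_trans (n1M_le _ AL) _.
rewrite ler_pM ?n1_ge0 ?mulr_ge0 ?ler0n//; apply: ler_wpM2r => //; exact: mB H.
Qed.

Lemma n1_coer u x : 0 <= x -> bil (g0 d) u u <= x ^+ 2 -> n1 u <= B * x.
Proof.
move=> x0 gu; rewrite -(@ler_pXn2r _ 2) ?nnegrE ?n1_ge0 ?mulr_ge0 ?B_ge0//.
apply: le_trans (g_coer H u) _; rewrite exprMn expr2 -mulrA ler_wpM2l ?B_ge0//.
by apply: le_trans gu _; rewrite ler_peMl ?sqr_ge0 ?B_ge1.
Qed.

Lemma sg_gt0 i : 0 < sg d i. Proof. exact: sg_pos H i. Qed.
Lemma sg_ge0 i : 0 <= sg d i. Proof. exact/ltW/sg_gt0. Qed.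
Lemma rr_ge0 i : 0 <= rabs i. Proof. by rewrite addr_ge0. Qed.
Lemma HH_ge0 i : 0 <= hrow i. Proof. by rewrite addr_ge0// n1_ge0. Qed.
Lemma tau_ge0 i : 0 <= wrow i. Proof. by rewrite addr_ge0 ?sg_ge0 ?rr_ge0. Qed.
Lemma sg_tau i : sg d i <= wrow i. Proof. by rewrite lerDl rr_ge0. Qed.
Lemma rr_tau i : rabs i <= wrow i. Proof. by rewrite lerDr sg_ge0. Qed.

Lemma cv_le : n1 cv <= B.
Proof. by rewrite -[leRHS]mulr1 n1_coer// (cV1 H) expr1n. Qed.
Lemma cvJ_le : n1 (cv *m J0 d) <= B.
Proof. by rewrite -[leRHS]mulr1 n1_coer// (J0J H) (cV1 H) expr1n. Qed.
Lemma X_le i : n1 (X i) <= B * sg d i.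
Proof. by rewrite n1_coer ?sg_ge0// (Xnorm H); have := sqr_ge0 (sg d i); lra. Qed.
Lemma Y_le i : n1 (Y i) <= B * sg d i.
Proof. by rewrite n1_coer ?sg_ge0// (J0J H) (Xnorm H); have := sqr_ge0 (sg d i); lra. Qed.

Lemma J0r u w : bil (g0 d) u (w *m J0 d) = - bil (g0 d) (u *m J0 d) w.
Proof.
by rewrite -(J0J H) -mulmxA (J0K H) mulmxN mulmx1 bilNr.
Qed.

Lemma bil_cvJ u : bil (g0 d) u (u *m J0 d) = 0.
Proof.
have h := J0r u u; have e : bil (g0 d) (u *m J0 d) u = bil (g0 d) u (u *m J0 d).
  by apply: bil_sym; exact: g0T H.
by rewrite e in h; lra.
Qed.

(** This is g(V, V) = 1 read in the frame: each summand is half the share of V in the complex line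
    of X_i. *)
Lemma pq_sum : \sum_i sg d i ^+ 2 * (pp d i ^+ 2 + qq d i ^+ 2) = 2^-1.
Proof.
have := cV1 H; rewrite [X in bil _ _ X](Vdec H) bilZr bilDr /Ur /Ui mulmx_suml !bil_sumr -big_split.
set S := (X in 2 * X) => h; have -> : 2^-1 = S by lra.
apply: eq_bigr => i _; rewrite -scalemxAl !bilZr -/(cY d i) /pp /qq.
by rewrite /=; have := sg_gt0 i => s0; field; lra.
Qed.

Lemma pq_le i : sg d i ^+ 2 * (pp d i ^+ 2 + qq d i ^+ 2) <= 2^-1.
Proof.
rewrite -pq_sum (bigD1 i)//= lerDl; apply: sumr_ge0 => j _.
by rewrite mulr_ge0 ?addr_ge0 ?sqr_ge0.
Qed.

Lemma Ui_le : n1 (Ui d) <= B.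
Proof.
rewrite -[leRHS]mulr1 n1_coer// expr1n.
have -> : bil (g0 d) (Ui d) (Ui d) = \sum_i 2^-1 * (sg d i ^+ 2 * qq d i ^+ 2).
  rewrite {2}/Ui bil_sumr; apply: eq_bigr => i _; rewrite bilZr (bil_sym _ _ (g0T H)).
  rewrite /Ui bil_sumr (bigD1 i)//= bilZr (Xnorm H) big1 ?addr0; first by ring.
  by move=> j ji; rewrite bilZr (Xorth H) ?mulr0// eq_sym.
apply: le_trans (_ : \sum_i sg d i ^+ 2 * (pp d i ^+ 2 + qq d i ^+ 2) <= _).
  apply: ler_sum => i _; have := sqr_ge0 (pp d i); have := sqr_ge0 (qq d i); have := sqr_ge0 (sg d i).
  move: (sg d i ^+ 2) (pp d i ^+ 2) (qq d i ^+ 2) => a b c *; nra.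
by rewrite pq_sum; lra.
Qed.

Lemma ra_le i : `|ra d i| <= rabs i. Proof. by rewrite lerDl. Qed.
Lemma rb_le i : `|rb d i| <= rabs i. Proof. by rewrite lerDr. Qed.

Lemma tauE i : wrow i = sg d i + rabs i. Proof. by []. Qed.
Lemma rrE i : rabs i = `|ra d i| + `|rb d i|. Proof. by []. Qed.
Lemma HHE i : hrow i = n1 (X i *m D) + n1 (Y i *m D). Proof. by []. Qed.
Local Opaque rabs hrow wrow.

Lemma n1_comb (a b x : R) u w : n1 u <= x -> n1 w <= x ->
  n1 (a *: u + b *: w) <= (`|a| + `|b|) * x.
Proof.
move=> ux wx; apply: le_trans (n1D _ _) _; rewrite !n1Z mulrDl lerD//; exact: ler_wpM2l.
Qed.

Lemma Z_le i : n1 (Z i) <= B * rabs i.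
Proof.
rewrite n1Z ger0_norm//; have := n1_comb (ra d i) (rb d i) cv_le cvJ_le.
rewrite -rrE mulrC; have := n1_ge0 (ra d i *: cv + rb d i *: (cv *m J0 d)); lra.
Qed.

Lemma J0_le' : entries_le (J0 d) B. Proof. exact: J0_le H. Qed.
Lemma J1_le' : entries_le (J1 d cv) (B ^+ 2).
Proof. by move=> s t; apply: le_trans (J1_le H cv s t) _; rewrite expr2 ler_wpM2l ?B_ge0 ?cv_le. Qed.
Lemma J2_le' : entries_le (J2 d cv) (B ^+ 3).
Proof.
move=> s t; apply: le_trans (J2_le H cv s t) _; rewrite [leRHS]exprS ler_wpM2l ?B_ge0//.
by rewrite ler_pXn2r ?nnegrE ?n1_ge0 ?B_ge0// cv_le.
Qed.

Lemma XJ1_le i : n1 (X i *m J1 d cv) <= B ^+ 4 * sg d i.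
Proof.
by apply: le_trans (n1M (exprn_ge0 _ B_ge0) J1_le' (X_le i)) _; rewrite -subr_ge0 [leRHS](_ : _ = 0)//; ring.
Qed.

Lemma Z'_le i : n1 (Z' i) <= P * wrow i.
Proof.
apply: le_trans (n1D _ _) _.
have k1 := n1M B_ge0 J0_le' (Z_le i); have k2 := XJ1_le i.
have p3 := @P_ge 3 isT; have p4 := @P_ge 4 isT; have r0 := rr_ge0 i; have s0 := sg_ge0 i.
have e1 : B * B * (B * rabs i) <= P * rabs i.
  by rewrite (_ : _ * _ = B ^+ 3 * rabs i) ?ler_wpM2r//; ring.
have e2 : B ^+ 4 * sg d i <= P * sg d i by rewrite ler_wpM2r.
rewrite tauE (mulrDr P); lra.
Qed.

Lemma K_le i : n1 (K i) <= 2 * B ^+ 6 * rabs i.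
Proof.
have k1 : n1 (Ui d *m J1 d cv) <= B ^+ 4.
  by apply: le_trans (n1M (exprn_ge0 _ B_ge0) J1_le' Ui_le) _; rewrite -subr_ge0 [leRHS](_ : _ = 0)//; ring.
have k2 := n1M B_ge0 J0_le' k1.
have k3 : n1 (2^-1 *: cv *m J1 d cv) <= B ^+ 4.
  rewrite -scalemxAl n1Z ger0_norm//.
  have := n1M (exprn_ge0 _ B_ge0) J1_le' cv_le; have := n1_ge0 (cv *m J1 d cv).
  by rewrite (_ : B * B ^+ 2 * B = B ^+ 4); [lra|ring].
have k4 := le_trans (n1D _ _) (lerD k2 k3).
have b1 := Bexp_ge1 2; have b4 := Bexp_ge1 4.
have b6 : B ^+ 4 <= B ^+ 6 by rewrite ler_weXn2l// B_ge1.
rewrite mulrC rrE; apply: n1_comb; first by lra.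
by apply: le_trans k4 _; rewrite (_ : B * B * B ^+ 4 = B ^+ 6); [lra|ring].
Qed.

Lemma K_leP i : n1 (K i) <= P * wrow i.
Proof.
apply: le_trans (K_le i) _; have p6 := @P_ge3 6 isT; have b6 := Bexp_ge1 6.
by rewrite ler_pM ?rr_ge0 ?rr_tau//; lra.
Qed.

Lemma Z_leP i : n1 (Z i) <= P * wrow i.
Proof.
by apply: le_trans (Z_le i) _; rewrite ler_pM ?rr_ge0 ?rr_tau ?BP ?B_ge0.
Qed.

Lemma K'_le i : n1 (K' i) <= P * wrow i.
Proof.
have k1 := n1M B_ge0 J0_le' (K_le i).
have k2 := n1M (exprn_ge0 _ B_ge0) J1_le' (Z_le i).
have k3 := n1M (exprn_ge0 _ B_ge0) J2_le' (X_le i).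
apply: le_trans (n1D _ _) _; apply: le_trans (lerD (n1D _ _) (lexx _)) _.
apply: le_trans (lerD (lerD k1 k2) k3) _.
have p8 := @P_ge3 8 isT; have r0 := rr_ge0 i; have s0 := sg_ge0 i.
have b4 : B ^+ 4 <= B ^+ 8 by rewrite ler_weXn2l// B_ge1.
have b5 : B ^+ 5 <= B ^+ 8 by rewrite ler_weXn2l// B_ge1.
rewrite (_ : _ + _ = (2 * B ^+ 8 + B ^+ 4) * rabs i + B ^+ 5 * sg d i); last by ring.
have e1 : (2 * B ^+ 8 + B ^+ 4) * rabs i <= P * rabs i by rewrite ler_wpM2r//; lra.
have e2 : B ^+ 5 * sg d i <= P * sg d i by rewrite ler_wpM2r//; have := Bexp_ge1 8; lra.
by rewrite tauE (mulrDr P); lra.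
Qed.

End CoreEstimate.

(** * Second order conditions along the pairs of test curves *)

Section CoreEstimate2.
Variables (R : realType) (n : nat) (d : cdata R n) (B P : R).
Notation m := (n + n)%N.
Notation V := 'rV[R]_m.
Hypothesis H : core B d.
Hypothesis hP : 3 * B ^+ 9 <= P.
Hypothesis lam0 : 0 <= lam d.
Implicit Types (u v w : V) (i j : 'I_n) (s t : 'I_m).

Notation X := (cX d).
Notation Y := (cY d).
Notation cv := (cV d).
Notation Z := (cZ d).
Notation Z' := (cZ' d).
Notation K := (cK d).
Notation K' := (cK' d).
Notation D := (D2 d).
Notation rr := (rabs d).
Notation HH := (hrow d).
Notation tau := (wrow d).
Local Opaque rabs hrow wrow.

Lemma absb (x y : R) : `|x| <= y -> - y <= x <= y. Proof. by rewrite ler_norml. Qed.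

Lemma P3_4 (x : R) : 0 <= x -> P ^+ 3 * x <= P ^+ 4 * x.
Proof. by move=> x0; rewrite ler_wpM2r// ler_weXn2l// (P_ge1 H hP). Qed.

Lemma entries_scale (A : 'M[R]_m) v x : entries_le A (B * n1 v) -> n1 v <= B * x -> entries_le A (P * x).
Proof.
move=> h vx s t; apply: le_trans (h s t) _.
have x0 : 0 <= x by have := n1_ge0 v; have := B_ge1 H; move=> ? ?; nra.
apply: le_trans (ler_wpM2l (B_ge0 H) vx) _.
by rewrite mulrA -expr2 ler_wpM2r// (P_ge H hP).
Qed.

Lemma entries_scale2 (A : 'M[R]_m) v x : entries_le A (B * n1 v ^+ 2) -> n1 v <= B * x ->
  entries_le A (P * x ^+ 2).
Proof.
move=> h vx s t; apply: le_trans (h s t) _.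
have x0 : 0 <= x by have := n1_ge0 v; have := B_ge1 H; move=> ? ?; nra.
have vx2 : n1 v ^+ 2 <= (B * x) ^+ 2 by rewrite ler_pXn2r ?nnegrE ?n1_ge0 ?mulr_ge0 ?(B_ge0 H).
apply: le_trans (ler_wpM2l (B_ge0 H) vx2) _.
by rewrite exprMn mulrA -exprS ler_wpM2r ?sqr_ge0// (P_ge H hP).
Qed.

Lemma entriesP (A : 'M[R]_m) : entries_le A B -> entries_le A P.
Proof. by move=> h s t; apply: le_trans (h s t) (BP H hP). Qed.

Lemma cv_P : n1 cv <= P * 1.
Proof. by rewrite mulr1; apply: le_trans (cv_le H) (BP H hP). Qed.

Lemma dd_P (c : 'I_m -> R) x : 0 <= x -> (forall s, `|c s| <= P ^+ 3 * x) ->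
  `|\sum_s dd d 0 s * c s| <= P ^+ 4 * x.
Proof.
move=> x0 h; apply: le_trans (sum_le_n1 _ h) _; rewrite [P ^+ 4]exprS -mulrA ler_wpM2r//.
  by rewrite mulr_ge0 ?exprn_ge0 ?(P_ge0 H hP).
exact: le_trans (dd_le H) (BP H hP).
Qed.

Lemma g0C u w : bil (g0 d) u w = bil (g0 d) w u. Proof. exact: bil_sym (g0T H). Qed.
Lemma D2C u w : bil D u w = bil D w u. Proof. exact: bil_sym (D2T H). Qed.
Lemma D3C' v u w : bil (D3 d v) u w = bil (D3 d v) w u. Proof. exact: bil_sym (D3T H v). Qed.

Lemma b2c_0 (A0 A1 A2 : 'M[R]_m) u w : b2c A0 A1 A2 u w 0 =
  bil A2 u u + bil A1 u w + bil A1 w u + bil A0 w w.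
Proof. by rewrite /b2c bil0r bil0l !addr0. Qed.

Lemma b1cE (A0 A1 : 'M[R]_m) u w : b1c A0 A1 u w = bil A1 u u + bil A0 u w + bil A0 w u.
Proof. by []. Qed.

(** Twice [second_order]. The terms destined to cancel against the equation, those in eta and those
    pairing w with itself or with V are kept; the others become errors, where s0 is the scale of v
    and t0 that of w. *)
Lemma test_lower v w (s0 t0 hh : R) : 0 <= s0 -> s0 <= t0 -> n1 v <= B * s0 -> n1 w <= P * t0 ->
  n1 (v *m D) <= hh ->
  bil (D4 d v) cv cv + 4 * bil (D3 d v) cv w + 2 * bil D w w -
    \sum_s (v *m D3 d v) 0 s * bil (G0 d s) cv cv +
    lam d * (2 * eta2 d v - eta1 d v ^+ 2 - 2 * bil (g0 d) w w + 4 * (eta1 d v * bil (g0 d) cv w))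
  <= 8 * (P ^+ 4 * (hh * t0)) + 8 * (P ^+ 4 * t0 ^+ 2) +
     8 * (P ^+ 4 * (lam d * (s0 * (t0 + `|eta1 d v|)))).
Proof.
move=> s0p st vs wt vh; have t0p : 0 <= t0 by lra.
have P1 := P_ge1 H hP; have hh0 : 0 <= hh by apply: le_trans (n1_ge0 _) vh.
have z0 : n1 (0 : V) <= P * 0 by rewrite n1_0 mulr0.
have c1 s : `|b1c (G0 d s) (G1 d s v) cv w| <= P ^+ 3 * (s0 * 1 ^+ 2 + 2 * 1 * t0).
  by apply: b1c_le => //; [exact/entriesP/(G0_le H)|exact: entries_scale (G1_le H s v) vs|exact: cv_P].
have c2 s : `|b2c (G0 d s) (G1 d s v) (G2 d s v) cv w 0| <=
    P ^+ 3 * ((s0 * 1 + t0) ^+ 2 + 2 * 1 * 0).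
  apply: b2c_le => //; [exact/entriesP/(G0_le H)|exact: entries_scale (G1_le H s v) vs| |exact: cv_P].
  exact: entries_scale2 (G2_le H s v) vs.
have S1 : `|\sum_s (v *m D) 0 s * b1c (G0 d s) (G1 d s v) cv w| <= P ^+ 4 * (hh * t0) * 3.
  apply: le_trans (sum_le_n1 _ c1) _.
  apply: le_trans (ler_wpM2r _ vh) _; first by rewrite mulr_ge0 ?exprn_ge0//; lra.
  have -> : hh * (P ^+ 3 * (s0 * 1 ^+ 2 + 2 * 1 * t0)) = P ^+ 3 * (hh * (s0 + 2 * t0)) by ring.
  rewrite -mulrA; apply: le_trans (P3_4 _) _; first by rewrite mulr_ge0//; lra.
  by rewrite ler_wpM2l ?exprn_ge0//; [lra|nra].
have S2 : `|\sum_s dd d 0 s * b2c (G0 d s) (G1 d s v) (G2 d s v) cv w 0| <= P ^+ 4 * t0 ^+ 2 * 4.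
  apply: le_trans (dd_P _ c2) _; first by rewrite mulr0 addr0 sqr_ge0.
  by rewrite -[leRHS]mulrA ler_wpM2l ?exprn_ge0//; [lra|nra].
have g1e := entries_scale (g1_le H v) vs; have g2e := entries_scale2 (g2_le H v) vs.
have P0 : 0 <= P by lra.
have q2 := bilP_le P0 (sqr_ge0 s0) g2e cv_P cv_P.
have q1 := bilP_le P0 s0p g1e cv_P wt.
have q1' := bilP_le P0 s0p g1e wt cv_P.
have k1 := bilP_le P0 s0p g1e cv_P cv_P.
have P34 : P ^+ 3 <= P ^+ 4 by rewrite ler_weXn2l.
have P30 : 0 <= P ^+ 3 by rewrite exprn_ge0.
have l2 : `|lam d * bil (g2 d v) cv cv| <= P ^+ 4 * (lam d * (s0 * t0)).
  rewrite normrM ger0_norm// mulrCA ler_wpM2l//; apply: le_trans q2 _.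
  by rewrite ler_pM// ?mulr_ge0//; nra.
have l1 : `|lam d * bil (g1 d v) cv w| <= P ^+ 4 * (lam d * (s0 * t0)).
  rewrite normrM ger0_norm// mulrCA ler_wpM2l//; apply: le_trans q1 _.
  by rewrite ler_pM// ?mulr_ge0//; nra.
have l1' : `|lam d * bil (g1 d v) w cv| <= P ^+ 4 * (lam d * (s0 * t0)).
  rewrite normrM ger0_norm// mulrCA ler_wpM2l//; apply: le_trans q1' _.
  by rewrite ler_pM// ?mulr_ge0//; nra.
have l3 : `|lam d * (eta1 d v * bil (g1 d v) cv cv)| <= P ^+ 4 * (lam d * (s0 * `|eta1 d v|)).
  rewrite normrM ger0_norm// mulrCA ler_wpM2l// normrM (mulrCA _ s0) mulrC.
  rewrite mulrC [leRHS]mulrCA [s0 * _]mulrC [P ^+ 4 * _]mulrCA ler_wpM2l//; apply: le_trans k1 _.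
  by rewrite !mulr1 ler_wpM2r.
have := second_order H v w.
rewrite /Pc !big_split /= (b2c_0 (D2 d)) (b2c_0 (g0 d)) (b1cE (g0 d)) bilZ (D3C' _ w cv) (g0C w cv).
have -> : \sum_s 2^-1 * (v *m D3 d v) 0 s * bil (G0 d s) cv cv =
    2^-1 * \sum_s (v *m D3 d v) 0 s * bil (G0 d s) cv cv.
  by rewrite mulr_sumr; apply: eq_bigr => s _; rewrite mulrA.
move: S1 S2 l2 l1 l1' l3; set S1 := \sum_s _ * b1c _ _ _ _; set S2 := \sum_s _ * b2c _ _ _ _ _ _.
set S0 := \sum_s _; move=> /absb/andP[S1a S1b] /absb/andP[S2a S2b] /absb/andP[_ l2b]
  /absb/andP[_ l1b] /absb/andP[_ l1'b] /absb/andP[l3a _] hc.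
have p1 : 0 <= P ^+ 4 * (hh * t0) by rewrite !mulr_ge0 ?exprn_ge0.
have p2 : 0 <= P ^+ 4 * (lam d * (s0 * t0)) by rewrite !mulr_ge0 ?exprn_ge0.
have p3 : 0 <= P ^+ 4 * (lam d * (s0 * `|eta1 d v|)) by rewrite !mulr_ge0 ?exprn_ge0.
clear -S1a S1b S2a S2b l2b l1b l1'b l3a hc p1 p2 p3.
lra.
Qed.

(** The linearised operator L sends u to the sum over i of D^2 u(X_i, X_i) + D^2 u(J X_i, J X_i) +
    du(beta_i), with D^2 the coordinate second derivatives. [ellv] is the contribution of i to L
    applied to the partial derivatives of phi. *)
Definition betav i : V := \row_s bil (b0 d s) (X i) (X i).
Definition ellv i : V := X i *m D3 d (X i) + Y i *m D3 d (Y i) + betav i *m D.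

Lemma beta_le i : n1 (betav i) <= B ^+ 4 * sg d i ^+ 2.
Proof.
have h s : `|betav i 0 s| <= B ^+ 3 * sg d i ^+ 2.
  rewrite mxE (_ : B ^+ 3 * _ = B * (B * sg d i) * (B * sg d i)); last by ring.
  apply: bil_le; [exact: B_ge0 H|exact: (b0_le H)|exact: X_le H i|exact: X_le H i].
apply: le_trans (_ : \sum_(s < m) (B ^+ 3 * sg d i ^+ 2) <= _); first by apply: ler_sum => s _.
rewrite sumr_const card_ord -[leLHS]mulr_natl mulrA [B ^+ 4]exprS ler_wpM2r ?sqr_ge0//.
by rewrite ler_wpM2r ?exprn_ge0 ?(B_ge0 H)// (mB H).
Qed.

(** The first order condition in the direction beta_i supplies the first order part of L, which
    completes the second derivatives along X_i and J X_i. *)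
Lemma drift_lower i :
  bil (D3 d cv) cv (betav i) - \sum_s (betav i *m D) 0 s * bil (G0 d s) cv cv + lam d * eta1 d (betav i)
  <= P ^+ 4 * ((1 + lam d) * sg d i ^+ 2).
Proof.
have P1 := P_ge1 H hP; have P0 : 0 <= P by lra.
have P34 : P ^+ 3 <= P ^+ 4 by rewrite ler_weXn2l.
have s2 := sqr_ge0 (sg d i); have P30 : 0 <= P ^+ 3 by rewrite exprn_ge0.
have ent (A : 'M[R]_m) : entries_le A (B * n1 (betav i)) -> entries_le A (P * sg d i ^+ 2).
  move=> h s t; apply: le_trans (h s t) _; apply: le_trans (ler_wpM2l (B_ge0 H) (beta_le i)) _.
  by rewrite mulrA -exprS ler_wpM2r// (P_ge H hP).
have c1 s : `|bil (G1 d s (betav i)) cv cv| <= P ^+ 3 * (sg d i ^+ 2).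
  rewrite -[X in _ * X]mulr1 -[X in _ * X]mulr1.
  exact: bilP_le P0 s2 (ent _ (G1_le H s _)) cv_P cv_P.
have S1 := dd_P s2 c1.
have q1 : `|lam d * bil (g1 d (betav i)) cv cv| <= P ^+ 4 * (lam d * sg d i ^+ 2).
  rewrite normrM ger0_norm// mulrCA ler_wpM2l//.
  apply: le_trans (bilP_le P0 s2 (ent _ (g1_le H _)) cv_P cv_P) _.
  by rewrite !mulr1 ler_wpM2r.
have := first_order H (betav i); rewrite /Pb !b1cE !bil0r !bil0l !addr0 big_split /=.
have -> : \sum_s dd d 0 s * b1c (G0 d s) (G1 d s (betav i)) cv 0 =
    \sum_s dd d 0 s * bil (G1 d s (betav i)) cv cv.
  by apply: eq_bigr => s _; rewrite b1cE bil0r bil0l !addr0.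
rewrite (D3C H) D3C' => hc; move: S1 q1 => /absb/andP[_ S1] /absb/andP[_ q1].
clear -S1 q1 hc; lra.
Qed.

(** By the eigenvector equation, D^2 phi(V, .) is lam g(V, .) up to first derivatives of phi. *)
Lemma n1VD : n1 (cv *m D) <= P * (1 + lam d).
Proof.
have h s : `|(cv *m D) 0 s| <= B ^+ 3 * (1 + lam d).
  have -> : (cv *m D) 0 s = bil D cv (delta_mx 0 s).
    rewrite bil_row (bigD1 s)//= [delta_mx _ _ _ _]mxE !eqxx mulr1 big1 ?addr0// => t ts.
    by rewrite [delta_mx _ _ _ _]mxE (negbTE ts) andbF mulr0.
  have d1 : n1 (delta_mx 0 s : V) <= 1.
    rewrite /n1 (bigD1 s)//= mxE !eqxx normr1 big1 ?addr0// => t ts.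
    by rewrite mxE (negbTE ts) andbF normr0.
  have e := eigen H (delta_mx 0 s).
  have -> : bil D cv (delta_mx 0 s) = \sum_s0 dd d 0 s0 * bil (G0 d s0) cv (delta_mx 0 s) +
      lam d * bil (g0 d) cv (delta_mx 0 s) by lra.
  apply: le_trans (ler_normD _ _) _.
  have b0' := B_ge0 H; have b1' := B_ge1 H.
  have k1 : `|\sum_s0 dd d 0 s0 * bil (G0 d s0) cv (delta_mx 0 s)| <= B * (B * B * 1).
    apply: le_trans (sum_le_n1 _ (fun s0 => bil_le b0' (G0_le H s0) (cv_le H) d1)) _.
    by rewrite ler_wpM2r ?(dd_le H)// !mulr_ge0.
  have k2 : `|lam d * bil (g0 d) cv (delta_mx 0 s)| <= lam d * (B * B * 1).
    by rewrite normrM ger0_norm// ler_wpM2l// (bil_le b0' (g0_le H) (cv_le H) d1).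
  have b23 : B ^+ 2 <= B ^+ 3 by rewrite ler_weXn2l.
  have k3 : lam d * B ^+ 2 <= lam d * B ^+ 3 by rewrite ler_wpM2l.
  apply: le_trans (lerD k1 k2) _; rewrite !mulr1 -expr2 -exprS mulrDr mulr1 lerD2l.
  by rewrite [leRHS]mulrC.
apply: le_trans (_ : \sum_(s < m) (B ^+ 3 * (1 + lam d)) <= _); first by apply: ler_sum => s _.
have l1 : 0 <= 1 + lam d by rewrite addr_ge0.
rewrite sumr_const card_ord -[leLHS]mulr_natl mulrA ler_wpM2r//.
apply: le_trans (_ : B * B ^+ 3 <= _); first by rewrite ler_wpM2r ?exprn_ge0 ?(B_ge0 H)// (mB H).
by rewrite -exprS (P_ge H hP).
Qed.

Definition Om2 i : R := om2 d cv (X i) (Z i) (K i) (Y i) (Z' i) (K' i).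

(** The fourth and third derivatives of phi and the terms quadratic in Z_i, Z'_i are kept exactly,
    since the test inequalities contain the same ones; metric and drift terms become errors. *)
Lemma Om2_upper i : 2 * Om2 i <=
  bil (D4 d cv) (X i) (X i) + bil (D4 d cv) (Y i) (Y i) + 4 * bil (D3 d cv) (X i) (Z i) +
  4 * bil (D3 d cv) (Y i) (Z' i) + 2 * bil D (Z i) (Z i) + 2 * bil D (Z' i) (Z' i) +
  bil (D3 d cv) cv (betav i) +
  (4 * (P ^+ 4 * (HH i * tau i)) + 36 * (P ^+ 4 * tau i ^+ 2) +
   6 * (P ^+ 4 * ((1 + lam d) * (sg d i * tau i)))).
Proof.
have P1 := P_ge1 H hP; have P0 : 0 <= P by lra.
have P34 : P ^+ 3 <= P ^+ 4 by rewrite ler_weXn2l.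
have P14 : P <= P ^+ 4 by rewrite -[leLHS]expr1 ler_weXn2l.
have s0 := sg_ge0 H i; have st := sg_tau d i; have t0 := tau_ge0 H i.
have P30 : 0 <= P ^+ 3 by rewrite exprn_ge0.
have B1' : n1 cv <= B * 1 by rewrite mulr1; exact: cv_le H.
have XP : n1 (X i) <= P * sg d i.
  by apply: le_trans (X_le H i) _; rewrite ler_wpM2r// (BP H hP).
have bD u w : n1 w <= P * tau i -> `|bil D u w| <= P ^+ 4 * (n1 (u *m D) * tau i).
  move=> wt; apply: le_trans (bil_le_n1 _ _ _) _.
  apply: le_trans (ler_wpM2l (n1_ge0 _) wt) _.
  by rewrite mulrCA ler_wpM2r// mulr_ge0 ?n1_ge0.
have x1 := bD (X i) _ (K_leP H hP i).
have x2 := bD (Y i) _ (K'_le H hP i).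
have q : `|b2c (g0 d) (g1 d cv) (g2 d cv) (X i) (Z i) (K i)| <= P ^+ 4 * (6 * tau i ^+ 2).
  apply: le_trans (b2c_le (x := 1) P1 _ s0 t0 t0 (entriesP (g0_le H)) (entries_scale (g1_le H cv) B1')
    (entries_scale2 (g2_le H cv) B1') XP (Z_leP H hP i) (K_leP H hP i)) _ => //.
  by rewrite ler_pM//; nra.
have S1 : `|\sum_s (cv *m D) 0 s * b1c (b0 d s) (b1 d s cv) (X i) (Z i)| <=
    P ^+ 4 * ((1 + lam d) * (3 * (sg d i * tau i))).
  have c1 s : `|b1c (b0 d s) (b1 d s cv) (X i) (Z i)| <= P ^+ 3 * (1 * sg d i ^+ 2 + 2 * sg d i * tau i).
    apply: b1c_le => //; [exact: entriesP (b0_le H s)|exact: entries_scale (b1_le H s cv) B1'|].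
    exact: Z_leP H hP i.
  apply: le_trans (sum_le_n1 _ c1) _.
  have e0 : 0 <= 1 * sg d i ^+ 2 + 2 * sg d i * tau i by nra.
  apply: le_trans (ler_wpM2r _ n1VD) _; first by rewrite mulr_ge0.
  rewrite (_ : P * _ * _ = P ^+ 4 * ((1 + lam d) * (1 * sg d i ^+ 2 + 2 * sg d i * tau i))); last by ring.
  rewrite ler_wpM2l ?exprn_ge0// ler_wpM2l ?addr_ge0//.
  by move: (sg d i) (tau i) s0 st => a b s0 st; nra.
have S2 : `|\sum_s dd d 0 s * b2c (b0 d s) (b1 d s cv) (b2 d s cv) (X i) (Z i) (K i)| <=
    P ^+ 4 * (6 * tau i ^+ 2).
  apply: dd_P; first by rewrite mulr_ge0// sqr_ge0.
  move=> s; apply: le_trans (b2c_le (x := 1) P1 _ s0 t0 t0 (entriesP (b0_le H s)) (entries_scale (b1_le H s cv) B1')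
    (entries_scale2 (b2_le H s cv) B1') XP (Z_leP H hP i) (K_leP H hP i)) _ => //.
  by rewrite ler_wpM2l//; nra.
rewrite /Om2 /om2 !big_split /=.
have -> : \sum_s 2^-1 * (cv *m D3 d cv) 0 s * bil (b0 d s) (X i) (X i) = 2^-1 * bil (D3 d cv) cv (betav i).
  by rewrite bil_row mulr_sumr; apply: eq_bigr => s _; rewrite [betav i 0 s]mxE mulrA.
have bE u u1 u2 : b2c D (D3 d cv) (2^-1 *: D4 d cv) u u1 u2 =
    2^-1 * bil (D4 d cv) u u + 2 * bil (D3 d cv) u u1 + bil D u1 u1 + 2 * bil D u u2.
  by rewrite /b2c bilZ (D3C' _ u1 u) (D2C u2 u); lra.
rewrite !bE HHE; move: q S1 S2 x1 x2.
set q := b2c _ _ _ _ _ _; set S1 := \sum_s _; set S2 := \sum_s _.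
move=> /absb/andP[_ q'] /absb/andP[_ S1'] /absb/andP[_ S2'] /absb/andP[_ x1] /absb/andP[_ x2].
clear -q' S1' S2' x1 x2; lra.
Qed.

(** The bad term: up to sign, the part of the coefficient of [lam] in the two conditions that is
    quadratic in eta1, Z_i and Z'_i. *)
Definition br i : R := eta1 d (X i) ^+ 2 + eta1 d (Y i) ^+ 2 +
  2 * bil (g0 d) (Z i) (Z i) + 2 * bil (g0 d) (Z' i) (Z' i) -
  4 * (eta1 d (X i) * bil (g0 d) cv (Z i)) - 4 * (eta1 d (Y i) * bil (g0 d) cv (Z' i)).

(* The maximum is tested along the curves (t X_i, V + t Z_i) and (t J X_i, V + t Z'_i):
   in the sum of the two second-order conditions the third and fourth derivatives
   of phi are those in 2 Om2, the second-order term of the differentiated equation. *)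
Lemma pair_upper i : 2 * Om2 i - \sum_s ellv i 0 s * bil (G0 d s) cv cv +
   lam d * (2 * eta2 d (X i) + 2 * eta2 d (Y i) + eta1 d (betav i) - br i) <=
  60 * (P ^+ 4 * (HH i * tau i + tau i ^+ 2 + (1 + lam d) * (sg d i * tau i) +
        lam d * (sg d i * (`|eta1 d (X i)| + `|eta1 d (Y i)|)))).
Proof.
have t1 := test_lower (sg_ge0 H i) (sg_tau d i) (X_le H i) (Z_leP H hP i) (lexx _).
have t2 := test_lower (sg_ge0 H i) (sg_tau d i) (Y_le H i) (Z'_le H hP i) (lexx _).
have t3 := drift_lower i; have t4 := Om2_upper i.
rewrite /br /ellv.
have -> : \sum_s (X i *m D3 d (X i) + Y i *m D3 d (Y i) + betav i *m D) 0 s * bil (G0 d s) cv cv =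
  \sum_s (X i *m D3 d (X i)) 0 s * bil (G0 d s) cv cv +
  \sum_s (Y i *m D3 d (Y i)) 0 s * bil (G0 d s) cv cv +
  \sum_s (betav i *m D) 0 s * bil (G0 d s) cv cv.
  by rewrite -!big_split; apply: eq_bigr => s _; rewrite !mxE !mulrDl.
rewrite !(D4C H _ cv) (D3C H _ cv (Z i)) (D3C H _ cv (Z' i)) in t1 t2; rewrite HHE in t4 *.
have s0 := sg_ge0 H i; have st := sg_tau d i; have r0 := tau_ge0 H i.
have P0 := P_ge0 H hP; have P40 : 0 <= P ^+ 4 by rewrite exprn_ge0.
have a1 : 0 <= P ^+ 4 * (n1 (X i *m D) * tau i) by rewrite !mulr_ge0 ?n1_ge0.
have a2 : 0 <= P ^+ 4 * (n1 (Y i *m D) * tau i) by rewrite !mulr_ge0 ?n1_ge0.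
have a3 : 0 <= P ^+ 4 * (tau i ^+ 2) by rewrite !mulr_ge0.
have a4 : P ^+ 4 * ((1 + lam d) * sg d i ^+ 2) <= P ^+ 4 * ((1 + lam d) * (sg d i * tau i)).
  by rewrite ler_wpM2l// ler_wpM2l ?addr_ge0// expr2 ler_wpM2l.
have a5 : 0 <= P ^+ 4 * (lam d * (sg d i * tau i)) by rewrite !mulr_ge0.
have a5' : 0 <= P ^+ 4 * (sg d i * tau i) by rewrite !mulr_ge0.
have a6 : 0 <= P ^+ 4 * (lam d * (sg d i * `|eta1 d (X i)|)) by rewrite !mulr_ge0.
have a7 : 0 <= P ^+ 4 * (lam d * (sg d i * `|eta1 d (Y i)|)) by rewrite !mulr_ge0.
clear -t1 t2 t3 t4 a1 a2 a3 a4 a5 a5' a6 a7; lra.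
Qed.

End CoreEstimate2.

(** * The good terms of eta and the cancellation of the bad term *)

Section CoreEstimate3.
Variables (R : realType) (n : nat) (d : cdata R n) (B P : R).
Notation m := (n + n)%N.
Notation V := 'rV[R]_m.
Hypothesis H : core B d.
Hypothesis hP : 3 * B ^+ 9 <= P.
Hypothesis lam0 : 0 <= lam d.
Hypothesis eps0 : 0 <= eps d.
Hypothesis A0 : 0 <= cA d.
Hypothesis y0 : 0 <= yy d.
Implicit Types (u v w : V) (i j : 'I_n) (s t : 'I_m).

Notation X := (cX d).
Notation Y := (cY d).
Notation cv := (cV d).
Notation Z := (cZ d).
Notation Z' := (cZ' d).
Notation D := (D2 d).
Notation rr := (rabs d).
Notation HH := (hrow d).
Notation tau := (wrow d).
Notation beta := (betav d).
Notation ell := (ellv d).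
Local Opaque rabs hrow wrow.

Lemma dd_P1 : n1 (dd d) <= P * 1.
Proof. by rewrite mulr1; apply: le_trans (dd_le H) (BP H hP). Qed.

Lemma XD_P u : n1 (u *m D) <= P * n1 (u *m D).
Proof. by rewrite ler_peMl ?n1_ge0 ?(P_ge1 H hP). Qed.

Lemma beta_entries i (A : 'M[R]_m) : entries_le A (B * n1 (beta i)) -> entries_le A (P * sg d i ^+ 2).
Proof.
move=> h s t; apply: le_trans (h s t) _; apply: le_trans (ler_wpM2l (B_ge0 H) (beta_le H i)) _.
by rewrite mulrA -exprS ler_wpM2r ?sqr_ge0// (P_ge H hP).
Qed.

Lemma N2_lower v (s0 : R) : 0 <= s0 -> n1 v <= B * s0 ->
  B^-1 * n1 (v *m D) ^+ 2 + bil (h0 d) (dd d) (v *m D3 d v) - P ^+ 3 * (s0 ^+ 2 + 2 * s0 * n1 (v *m D))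
  <= N2 d v.
Proof.
move=> s0p vs; have P0 := P_ge0 H hP.
have q1 := bilP_le P0 (sqr_ge0 s0) (entries_scale2 H hP (h2_le H v) vs) dd_P1 dd_P1.
have q2 := bilP_le P0 s0p (entries_scale H hP (h1_le H v) vs) dd_P1 (XD_P v).
have q3 : B^-1 * n1 (v *m D) ^+ 2 <= bil (h0 d) (v *m D) (v *m D).
  by rewrite ler_pdivrMl ?(h_coer H)//; have := B_ge1 H; lra.
move: q1 q2 => /absb/andP[q1 _] /absb/andP[q2 _]; rewrite /N2.
by clear -q1 q2 q3; lra.
Qed.

(** L applied to |dphi|^2 gives the good term, by coercivity of the inverse metric, and the pairing
    of dphi with [ellv]. The latter stays unestimated, because the equation controls only its sum
    over i. *)
Lemma Nsum_lower i :
  B^-1 * HH i ^+ 2 + 2 * bil (h0 d) (dd d) (ell i) -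
    6 * (P ^+ 3 * (sg d i ^+ 2 + sg d i * HH i))
  <= 2 * N2 d (X i) + 2 * N2 d (Y i) + N1 d (beta i).
Proof.
have P0 := P_ge0 H hP; have P30 : 0 <= P ^+ 3 by rewrite exprn_ge0.
have s0 := sg_ge0 H i.
have k1 := N2_lower s0 (X_le H i); have k2 := N2_lower s0 (Y_le H i).
have q1 := bilP_le P0 (sqr_ge0 (sg d i)) (beta_entries (h1_le H (beta i))) dd_P1 dd_P1.
have -> : bil (h0 d) (dd d) (ell i) = bil (h0 d) (dd d) (X i *m D3 d (X i)) +
   bil (h0 d) (dd d) (Y i *m D3 d (Y i)) + bil (h0 d) (dd d) (beta i *m D).
  by rewrite /ellv !bilDr.
move: q1 => /absb/andP[q1 _]; rewrite /N1 HHE.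
have B1 : 0 <= B^-1 by rewrite invr_ge0 (B_ge0 H).
move: k1 k2 B1; move: (n1_ge0 (X i *m D)) (n1_ge0 (Y i *m D)).
move: (B^-1) (n1 (X i *m D)) (n1 (Y i *m D)) => b x y x0 y0' k1 k2 B1.
have e : b * (x + y) ^+ 2 <= 2 * (b * x ^+ 2 + b * y ^+ 2).
  by have := mulr_ge0 B1 (sqr_ge0 (x - y)); lra.
have p1 : 0 <= P ^+ 3 * (sg d i ^+ 2) by rewrite mulr_ge0 ?sqr_ge0.
have p2 : 0 <= P ^+ 3 * (sg d i * x) by rewrite !mulr_ge0.
have p3 : 0 <= P ^+ 3 * (sg d i * y) by rewrite !mulr_ge0.
clear -e q1 k1 k2 p1 p2 p3; lra.
Qed.

Definition Lell : V := \sum_i ell i.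

Lemma trG_inv : (F0 d)^-1 <= \sum_i sg d i ^+ 2.
Proof.
apply: le_trans (trG_ge H); rewrite ler_peMl ?invr_ge0 ?(ltW (F0_pos H))//.
by rewrite ler1n (n_pos H).
Qed.

(** F0 is bounded above, so the constant 1 is itself at most B F0^-1. *)
Lemma one_trG : 1 + (F0 d)^-1 <= (B + 1) * \sum_i sg d i ^+ 2.
Proof.
have k := trG_inv; have F0p := F0_pos H; have FB := F0_le H; have B0 := B_ge0 H.
have e : 1 <= B * (F0 d)^-1 by rewrite ler_pdivlMr// mul1r.
have e2 : B * (F0 d)^-1 <= B * \sum_i sg d i ^+ 2 by rewrite ler_wpM2l.
by rewrite mulrDl mul1r lerD// (le_trans e).
Qed.

(** Differentiating the equation along a coordinate direction e, with the real parts X_i held fixed,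
    expresses the component of L(dphi) along e through the logarithmic derivative of f. The
    discrepancy comes from derivatives of g, J and the drift, and is linear in D^2 phi. *)
Lemma Lell_le : n1 Lell <= 8 * P ^+ 6 * \sum_i (sg d i ^+ 2 + sg d i * HH i).
Proof.
have P0 := P_ge0 H hP; have P1 := P_ge1 H hP; have b0' := B_ge0 H; have b1' := B_ge1 H.
set S := \sum_i (_ + _); have S0 : 0 <= S.
  by apply: sumr_ge0 => i _; rewrite addr_ge0 ?sqr_ge0 ?mulr_ge0 ?(sg_ge0 H) ?HH_ge0.
have P45 : P ^+ 4 <= P ^+ 5 by rewrite ler_weXn2l.
have s2S : \sum_i sg d i ^+ 2 <= S.
  by apply: ler_sum => i _; rewrite lerDl ?mulr_ge0 ?(sg_ge0 H) ?HH_ge0.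
have h s : `|Lell 0 s| <= 8 * P ^+ 5 * S.
  pose e : V := delta_mx 0 s.
  have e1 : n1 e <= 1.
    rewrite /n1 (bigD1 s)//= mxE !eqxx normr1 big1 ?addr0// => t ts.
    by rewrite mxE (negbTE ts) andbF normr0.
  have eE (u : V) : u 0 s = bil 1%:M u e.
    rewrite bil_row mulmx1 (bigD1 s)//= [e _ _]mxE !eqxx mulr1 big1 ?addr0// => t ts.
    by rewrite [e _ _]mxE (negbTE ts) andbF mulr0.
  have MsE (A : 'M[R]_m) (u : V) : (u *m A) 0 s = bil A u e.
    by rewrite eE bil_mull mulmx1.
  have L1 := lin_eq H e.
  have part i : `|ell i 0 s - om1 d e (X i) 0 (Y i) (X i *m J1 d e)| <=
     6 * P ^+ 4 * (sg d i ^+ 2 + sg d i * HH i).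
    rewrite /om1 /b1c !bil0r !bil0l !addr0 (D2C H (X i *m _)).
    have -> : ell i 0 s = (X i *m D3 d (X i)) 0 s + (Y i *m D3 d (Y i)) 0 s + (beta i *m D) 0 s.
      by rewrite /ellv [LHS]mxE [X in X + _]mxE.
    have -> : (X i *m D3 d (X i)) 0 s = bil (D3 d e) (X i) (X i) by rewrite MsE (D3C' H) (D3C H).
    have -> : (Y i *m D3 d (Y i)) 0 s = bil (D3 d e) (Y i) (Y i) by rewrite MsE (D3C' H) (D3C H).
    have -> : (beta i *m D) 0 s = \sum_s0 (e *m D) 0 s0 * bil (b0 d s0) (X i) (X i).
      rewrite MsE (D2C H) bil_row; apply: eq_bigr => s0 _; by rewrite [beta i _ _]mxE.
    rewrite big_split /=.
    have -> : \sum_s0 dd d 0 s0 * (bil (b1 d s0 e) (X i) (X i) + bil (b0 d s0) (X i) 0 +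
          bil (b0 d s0) 0 (X i)) =
      \sum_s0 dd d 0 s0 * bil (b1 d s0 e) (X i) (X i) by apply: eq_bigr => s0 _; rewrite bil0r bil0l !addr0.
    have s0' := sg_ge0 H i.
    have e1' : n1 e <= B * 1 by rewrite mulr1 (le_trans e1).
    have XP : n1 (X i) <= P * sg d i.
      by apply: le_trans (X_le H i) _; rewrite ler_wpM2r// (BP H hP).
    have q1 := bilP_le P0 ler01 (entries_scale H hP (g1_le H e) e1') XP XP.
    have S1 : `|\sum_s0 dd d 0 s0 * bil (b1 d s0 e) (X i) (X i)| <= P ^+ 4 * (1 * sg d i * sg d i).
      apply: (dd_P H hP); first by rewrite !mulr_ge0.
      by move=> s0; exact: (bilP_le P0 ler01 (entries_scale H hP (b1_le H s0 e) e1') XP XP).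
    have q2 : `|bil D (Y i) (X i *m J1 d e)| <= P ^+ 4 * (sg d i * HH i).
      apply: le_trans (bil_le_n1 _ _ _) _.
      have w1 : n1 (X i *m J1 d e) <= P * sg d i.
        apply: le_trans (n1M H _ (J1_le H e) (X_le H i)) _; first by rewrite mulr_ge0 ?n1_ge0.
        apply: le_trans (_ : B * (B * 1) * (B * sg d i) <= _).
          by rewrite ler_wpM2r ?mulr_ge0// ler_wpM2l// ler_wpM2l.
        by rewrite (_ : _ * _ = B ^+ 3 * sg d i) ?ler_wpM2r ?(P_ge H hP)//; ring.
      rewrite mulrC; have HY : n1 (Y i *m D) <= HH i by rewrite HHE lerDr n1_ge0.
      rewrite mulrA ler_pM ?n1_ge0//; apply: le_trans w1 _; rewrite ler_wpM2r//.
      by rewrite -[leLHS]expr1 ler_weXn2l.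
    have q1' : P ^+ 3 * (1 * sg d i * sg d i) <= P ^+ 4 * (1 * sg d i * sg d i).
      by rewrite ler_wpM2r ?mulr_ge0// ler_weXn2l.
    have := q1'; move: q1 S1 q2 => /absb/andP[q1a q1b] /absb/andP[S1a S1b] /absb/andP[q2a q2b] q1''.
    have p1 : 0 <= P ^+ 4 * (sg d i * HH i) by rewrite !mulr_ge0 ?exprn_ge0 ?HH_ge0.
    have p2 : 0 <= P ^+ 4 * (sg d i * sg d i) by rewrite !mulr_ge0 ?exprn_ge0.
    rewrite ler_norml; clear -q1a q1b S1a S1b q2a q2b q1'' p1 p2; apply/andP; split; lra.
  have F1 := one_trG.
  have LE : Lell 0 s = \sum_i (ell i 0 s - om1 d e (X i) 0 (Y i) (X i *m J1 d e)) +
     \sum_i om1 d e (X i) 0 (Y i) (X i *m J1 d e).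
    by rewrite -big_split /Lell summxE; apply: eq_bigr => i _; rewrite /= subrK.
  rewrite LE; apply: le_trans (ler_normD _ _) _.
  have k1 : `|\sum_i (ell i 0 s - om1 d e (X i) 0 (Y i) (X i *m J1 d e))| <= 6 * P ^+ 4 * S.
    by apply: le_trans (ler_norm_sum _ _ _) _; rewrite mulr_sumr; apply: ler_sum.
  have Fp : 0 <= 1 + (F0 d)^-1 by rewrite addr_ge0// invr_ge0 ltW// (F0_pos H).
  have k2 : B * n1 e * (1 + (F0 d)^-1) <= 2 * P ^+ 4 * S.
    apply: le_trans (_ : B * 1 * ((B + 1) * \sum_i sg d i ^+ 2) <= _).
      by rewrite ler_pM// ?mulr_ge0 ?n1_ge0// ler_wpM2l.
    rewrite mulrA ler_pM ?sumr_ge0 ?mulr_ge0 ?addr_ge0// => [i _|]; first exact: sqr_ge0.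
    have := P_ge H hP (isT : (2 <= 9)%N); have : P <= P ^+ 4 by rewrite -[leLHS]expr1 ler_weXn2l.
    by have : B <= B ^+ 2 by [rewrite -[leLHS]expr1 ler_weXn2l]; lra.
  have k3 : 8 * P ^+ 4 * S <= 8 * P ^+ 5 * S by rewrite ler_wpM2r// ler_wpM2l.
  clear -k1 k2 k3 L1; lra.
rewrite /n1; apply: le_trans (_ : \sum_(s < m) (8 * P ^+ 5 * S) <= _); first exact: ler_sum.
rewrite sumr_const card_ord -[leLHS]mulr_natl.
have -> : 8 * P ^+ 6 * S = P * (8 * P ^+ 5 * S) by ring.
by rewrite ler_wpM2r ?mulr_ge0 ?exprn_ge0// (le_trans (mB H))// (BP H hP).
Qed.

Definition dabs i : R := `|dot (X i) (dd d)| + `|dot (Y i) (dd d)|.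
Definition etaabs i : R := `|eta1 d (X i)| + `|eta1 d (Y i)|.

Lemma ff_ge0 i : 0 <= dabs i. Proof. by rewrite addr_ge0. Qed.
Lemma ee_ge0 i : 0 <= etaabs i. Proof. by rewrite addr_ge0. Qed.

Lemma rr_ff i : rr i = cA d * yy d * dabs i.
Proof.
rewrite rrE /ra /rb /y1 opprK normrN !normrM (ger0_norm A0) (ger0_norm y0) -mulrDr //.
Qed.

Lemma ff_le i : dabs i <= P * sg d i.
Proof.
have h u : n1 u <= B * sg d i -> `|dot u (dd d)| <= B ^+ 2 * sg d i.
  move=> us; apply: le_trans (sum_le_n1 _ (n1_coord (dd d))) _.
  rewrite expr2 -mulrA mulrC ler_pM ?n1_ge0 ?(dd_le H)//.
have := h _ (X_le H i); have := h _ (Y_le H i).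
have p3 := @P_ge3 _ _ _ _ _ H hP 2 isT; have s0 := sg_ge0 H i.
have e : 3 * B ^+ 2 * sg d i <= P * sg d i by rewrite ler_wpM2r.
have e0 : 0 <= B ^+ 2 * sg d i by rewrite mulr_ge0 ?exprn_ge0 ?(B_ge0 H).
by rewrite /dabs; lra.
Qed.

Lemma N1_le i : `|N1 d (X i)| + `|N1 d (Y i)| <= 2 * P ^+ 3 * (sg d i + HH i).
Proof.
have P0 := P_ge0 H hP.
have h0P : forall s t, `|h0 d s t| <= P * 1 by move=> s t; rewrite mulr1; exact: (entriesP H hP (h0_le H)).
have h u : n1 u <= B * sg d i -> `|N1 d u| <= P ^+ 3 * (sg d i + 2 * n1 (u *m D)).
  move=> us.
  have q1 := bilP_le P0 (sg_ge0 H i) (entries_scale H hP (h1_le H u) us) dd_P1 dd_P1.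
  have q2 := bilP_le P0 ler01 h0P dd_P1 (XD_P u).
  move: q1 q2 => /absb/andP[q1 q1'] /absb/andP[q2 q2'].
  by rewrite ler_norml /N1; apply/andP; split; lra.
by have := h _ (X_le H i); have := h _ (Y_le H i); rewrite HHE; lra.
Qed.

Lemma ee_le i : etaabs i <= eps d * (2 * P ^+ 3 * (sg d i + HH i)) + rr i.
Proof.
rewrite /etaabs /eta1 rrE /ra /rb (normrN (y1 d (Y i))).
have h (u : V) : `|eps d * N1 d u + y1 d u| <= eps d * `|N1 d u| + `|y1 d u|.
  by apply: le_trans (ler_normD _ _) _; rewrite normrM ger0_norm.
have := h (X i); have := h (Y i); have := ler_wpM2l eps0 (N1_le i).
rewrite mulrDr => k1 k2 k3.
lra.
Qed.

(** The values of g on V, Z_i and J Z_i make ra^2, rb^2 and their products with eps N1 cancel in the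
    sum over X_i and J X_i. What is left is eps^2 N1^2 and the errors due to [w], the effect of the
    derivative of J on X_i. *)
Lemma br_upper i : br d i <= eps d ^+ 2 * (4 * P ^+ 6 * (sg d i + HH i) ^+ 2) +
  6 * (P ^+ 3 * (sg d i * tau i)) + 4 * (P ^+ 3 * (sg d i * etaabs i)).
Proof.
have P0 := P_ge0 H hP; have P1 := P_ge1 H hP.
pose w := X i *m J1 d cv; pose a := ra d i; pose b := rb d i.
have s0 := sg_ge0 H i; have st := sg_tau d i; have t0 := tau_ge0 H i.
have gZ : bil (g0 d) (Z i) (Z i) = 4^-1 * (a ^+ 2 + b ^+ 2).
  rewrite /cZ bilZl bilZr !bilDl !bilDr !bilZl !bilZr (J0J H) (cV1 H) (bil_cvJ H).
  by rewrite (g0C H (cv *m _)) (bil_cvJ H) -/a -/b; field.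
have gVZ : bil (g0 d) cv (Z i) = 2^-1 * a.
  by rewrite /cZ bilZr bilDr !bilZr (cV1 H) (bil_cvJ H) -/a; ring.
have gVZ' : bil (g0 d) cv (Z' i) = - (2^-1 * b) + bil (g0 d) cv w.
  rewrite /cZ' bilDr (J0r H) /cZ bilZr bilDr !bilZr (J0J H) (cV1 H).
  by rewrite (g0C H (cv *m _)) (bil_cvJ H) -/b -/w; ring.
have gZ' : bil (g0 d) (Z' i) (Z' i) = bil (g0 d) (Z i) (Z i) +
    2 * bil (g0 d) (Z i *m J0 d) w + bil (g0 d) w w.
  by rewrite /cZ' -/w bilDl !bilDr (J0J H) (g0C H w (_ *m _)); ring.
have g0P : forall s t, `|g0 d s t| <= P * 1 by move=> s t; rewrite mulr1; exact: (entriesP H hP (g0_le H)).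
have wP : n1 w <= P * sg d i.
  by apply: le_trans (XJ1_le H i) _; rewrite ler_wpM2r ?(P_ge H hP).
have ZJ : n1 (Z i *m J0 d) <= P * tau i.
  apply: le_trans (n1M H (B_ge0 H) (J0_le H) (Z_le H i)) _.
  rewrite (_ : _ * _ = B ^+ 3 * rr i); last by ring.
  by rewrite ler_pM ?exprn_ge0 ?(B_ge0 H) ?rr_ge0 ?(P_ge H hP) ?(rr_tau H).
have q1 := bilP_le P0 ler01 g0P ZJ wP.
have q2 := bilP_le P0 ler01 g0P wP wP.
have q3 := bilP_le P0 ler01 g0P (cv_P H hP) wP.
have q4 : `|eta1 d (Y i) * bil (g0 d) cv w| <= P ^+ 3 * (sg d i * etaabs i).
  rewrite normrM; apply: le_trans (ler_wpM2l (normr_ge0 _) q3) _.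
  rewrite mulrCA ler_wpM2l ?exprn_ge0// !mul1r mulrC ler_wpM2l//.
  by rewrite /etaabs lerDr.
have e1 : eta1 d (X i) = eps d * N1 d (X i) + a by [].
have e2 : eta1 d (Y i) = eps d * N1 d (Y i) - b by rewrite /b /rb opprK.
have n2 : N1 d (X i) ^+ 2 + N1 d (Y i) ^+ 2 <= 4 * P ^+ 6 * (sg d i + HH i) ^+ 2.
  have h := N1_le i; rewrite -[N1 d (X i) ^+ 2]real_normK ?num_real// -[N1 d (Y i) ^+ 2]real_normK ?num_real//.
  have -> : 4 * P ^+ 6 * (sg d i + HH i) ^+ 2 = (2 * P ^+ 3 * (sg d i + HH i)) ^+ 2 by ring.
  move: (normr_ge0 (N1 d (X i))) (normr_ge0 (N1 d (Y i))) h.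
  move: `|N1 d (X i)| `|N1 d (Y i)| (2 * P ^+ 3 * (sg d i + HH i)) => x y z x0 y0' xyz; nra.
have n3 := ler_wpM2l (sqr_ge0 (eps d)) n2.
have s2 : P ^+ 3 * (1 * sg d i * sg d i) <= P ^+ 3 * (sg d i * tau i).
  by rewrite ler_wpM2l ?exprn_ge0// mul1r ler_wpM2l.
rewrite /br gZ' gVZ gVZ' gZ e1.
move: q1 q2 q4 => /absb/andP[_ q1] /absb/andP[_ q2] /absb/andP[q4 _].
rewrite e2 in q4 *.
move: q1 q2 q4 n3 s2; move: (bil _ _ w) (bil _ w w) (bil _ cv w) => x1 x2 x3.
move=> q1 q2 q4 n3 s2; clear -q1 q2 q4 n3 s2; lra.
Qed.

(** The normalisation W(E_i, E_i) = 1 says that the share of i in L phi is 1 - sg_i^2. Multiplied by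
    - A y this yields the good term A y sg_i^2; the square of the derivative yields the second good
    term. *)
Lemma ysum_lower i : - (cA d * yy d) + cA d * yy d * sg d i ^+ 2 + 2^-1 * (cA d ^+ 2 * yy d * dabs i ^+ 2) <=
  2 * y2 d (X i) + 2 * y2 d (Y i) + y1 d (beta i).
Proof.
have := om_eq1 H i; rewrite /om0 (Xnorm H).
have -> : \sum_s dd d 0 s * bil (b0 d s) (X i) (X i) = dot (beta i) (dd d).
  by apply: eq_bigr => s _; rewrite mxE mulrC.
rewrite /y2 /y1 /dabs => h.
set x := dot (X i) _; set z := dot (Y i) _.
have k : 0 <= cA d ^+ 2 * yy d * (`|x| - `|z|) ^+ 2 by rewrite mulr_ge0 ?sqr_ge0// mulr_ge0 ?sqr_ge0.
have xx : x ^+ 2 = `|x| ^+ 2 by rewrite real_normK ?num_real.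
have zz : z ^+ 2 = `|z| ^+ 2 by rewrite real_normK ?num_real.
have b1 : dot (beta i) (dd d) = 1 - bil D (X i) (X i) - bil D (Y i) (Y i) - sg d i ^+ 2 by lra.
rewrite b1 !exprMn xx zz; lra.
Qed.

End CoreEstimate3.

Ltac nonneg := solve [repeat first [ done | exact: sqr_ge0 | exact: ltW | apply: exprn_ge0 |
  apply: addr_ge0 | apply: mulr_ge0 ]].

(** * The scalar inequality that determines eps and A *)

Section CoreNumeric.
Variable R : realType.
Implicit Types (C e A y h s f r E : R).

(** The letters h, s, r, f, E stand for [hrow], [sg], [rabs], [dabs], [etaabs] at one index. The
    value of e lets C e^2 (s + h)^2 cost at most an eighth of e C^-1 h^2, besides a multiple of s^2;
    A is chosen afterwards, large enough for all terms in s^2. *)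
Lemma weight_lower C e A y h s f r E : 1 <= C -> e = (16 * C ^+ 2)^-1 -> A = 10 * C ^+ 3 ->
  1 <= y -> 0 <= h -> 0 <= s -> r = A * y * f -> 0 <= E -> E <= C * (e * (s + h)) + r ->
  e * (2 * C)^-1 * h ^+ 2 + s ^+ 2 <=
  e * (C^-1 * h ^+ 2 - C * (s ^+ 2 + s * h)) + A * y * s ^+ 2 + 2^-1 * (A ^+ 2 * y * f ^+ 2) -
  C * (e ^+ 2 * (s + h) ^+ 2) - C * (s * (s + r + E)).
Proof.
move=> C1 eE AE y1 h0 s0 rE E0 Ele.
have C0 : 0 < C by lra.
have y0 : 0 <= y by lra.
have C2 : 0 < C ^+ 2 by rewrite exprn_gt0.
have e0 : 0 < e by rewrite eE invr_gt0 mulr_gt0.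
have eC : 16 * (e * C ^+ 2) = 1 by rewrite eE; field; lra.
pose ic := C^-1; have icC : ic * C = 1 by rewrite mulVf//; lra.
have ic0 : 0 < ic by rewrite invr_gt0.
have -> : e * (2 * C)^-1 * h ^+ 2 = 2^-1 * (e * (ic * h ^+ 2)) by rewrite /ic; field; lra.
rewrite -/ic.
have CC : C <= C ^+ 2 by rewrite -[leLHS]expr1 ler_weXn2l.
have CC3 : C ^+ 2 <= C ^+ 3 by rewrite ler_weXn2l.
have eC1 : 16 * (e * C) <= 1 by rewrite -[leRHS]eC ler_wpM2l// ler_wpM2l// ltW.
have e1 : 16 * e <= 1 by rewrite -[leRHS]eC ler_wpM2l// ler_peMr ?(ltW e0)//; lra.
(* the cross term s h is split by AM-GM, with weight e / C on h^2 *)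
have k1 : e * (2 * C ^+ 2 * (s * h)) <= e * (8^-1 * (ic * h ^+ 2)) + e * (8 * C ^+ 5 * s ^+ 2).
  rewrite -mulrDr ler_wpM2l ?(ltW e0)//.
  have : 0 <= 8^-1 * (ic * (h - 8 * C ^+ 3 * s) ^+ 2) by nonneg.
  have -> : 8^-1 * (ic * (h - 8 * C ^+ 3 * s) ^+ 2) =
    8^-1 * (ic * h ^+ 2) - 2 * (ic * C) * C ^+ 2 * (s * h) + 8 * (ic * C) * C ^+ 5 * s ^+ 2 by field.
  by rewrite icC; lra.
(* and s r against the quadratic gradient term *)
have k2 : 2 * C * (s * r) <= 2^-1 * (A ^+ 2 * y * f ^+ 2) + 2 * C ^+ 2 * y * s ^+ 2.
  have : 0 <= 2^-1 * y * (A * f - 2 * C * s) ^+ 2 by nonneg.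
  by rewrite rE; lra.
have k3 : C * (e ^+ 2 * (s + h) ^+ 2) <= e * (8^-1 * (ic * h ^+ 2)) + 2 * (C * e ^+ 2 * s ^+ 2).
  have -> : e * (8^-1 * (ic * h ^+ 2)) = 2 * C * e ^+ 2 * h ^+ 2.
    have -> : 8^-1 = 2 * (e * C ^+ 2) by lra.
    transitivity (2 * (ic * C) * C * e ^+ 2 * h ^+ 2); first by ring.
    by rewrite icC; ring.
  have : 0 <= C * e ^+ 2 * (s - h) ^+ 2 by nonneg.
  lra.
have k4 : C * (s * E) <= C * (s * r) + e * (C ^+ 2 * s ^+ 2) + e * (C ^+ 2 * (s * h)).
  have : C * (s * E) <= C * (s * (C * (e * (s + h)) + r)).
    by apply: (ler_wpM2l (ltW C0)); apply: ler_wpM2l.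
  lra.
have k5 : e * (C * (s * h)) <= e * (C ^+ 2 * (s * h)).
  by apply: (ler_wpM2l (ltW e0)); apply: ler_wpM2r => //; nonneg.
(* The coefficients of s^2 collected so far are at most of order C^3 y: the cross term gives 8 e C^5
   = C^3 / 2. This fixes the power of C in A. *)
have k6 : 0 <= (A * y - 1 - C * e - C - 2 * C * e ^+ 2 - e * C ^+ 2 - 8 * (e * C ^+ 2) * C ^+ 3 - 2 * C ^+ 2 * y) * s ^+ 2.
  rewrite mulr_ge0 ?sqr_ge0//.
  have c3 : 1 <= C ^+ 3 by rewrite exprn_ege1.
  have a1 : C ^+ 3 <= C ^+ 3 * y by rewrite ler_peMr//; lra.
  have a2 : C ^+ 2 * y <= C ^+ 3 * y by rewrite ler_wpM2r//; lra.
  have a3 : C * e ^+ 2 <= 1.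
    rewrite expr2 mulrA; apply: le_trans (_ : 1 * 1 <= _); last by rewrite mulr1.
    by rewrite ler_pM ?mulr_ge0//; lra.
  have a4 : 8 * (e * C ^+ 2) * C ^+ 3 <= C ^+ 3 by rewrite (_ : 8 * _ = 2^-1); lra.
  rewrite AE; have -> : 10 * C ^+ 3 * y = 10 * (C ^+ 3 * y) by ring.
  have -> : 2 * C ^+ 2 * y = 2 * (C ^+ 2 * y) by ring.
  by lra.
have p1 : 0 <= e * (ic * h ^+ 2) by nonneg.
clear -k1 k2 k3 k4 k5 k6 p1; lra.
Qed.

End CoreNumeric.

(** * Summation over the frame and the bound on the largest eigenvalue *)

Section CoreBound.
Variables (R : realType) (n : nat) (d : cdata R n) (B P Yb C : R).
Notation m := (n + n)%N.
Notation V := 'rV[R]_m.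
Hypothesis H : core B d.
Hypothesis PE : P = 3 * B ^+ 9.
Hypothesis CE : C = 200 * P ^+ 8.
Hypothesis epsE : eps d = (16 * C ^+ 2)^-1.
Hypothesis AE : cA d = 10 * C ^+ 3.
Hypothesis y1 : 1 <= yy d.
Hypothesis yY : yy d <= Yb.
Hypothesis lam1 : 1 <= lam d.
Implicit Types (u v w : V) (i j : 'I_n) (s t : 'I_m).

Notation X := (cX d).
Notation Y := (cY d).
Notation cv := (cV d).
Notation D := (D2 d).
Notation rr := (rabs d).
Notation HH := (hrow d).
Notation tau := (wrow d).
Notation beta := (betav d).
Notation ell := (ellv d).
Notation ff := (dabs d).
Notation ee := (etaabs d).
Local Opaque rabs hrow wrow dabs etaabs ellv.

Let hP : 3 * B ^+ 9 <= P. Proof. by rewrite PE. Qed.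
Let lam0 : 0 <= lam d. Proof. exact: le_trans lam1. Qed.
Let P1 : 1 <= P := P_ge1 H hP.
Let C1 : 1 <= C.
Proof. by rewrite CE; have := exprn_ege1 8 P1; lra. Qed.
Let C0 : 0 <= C. Proof. exact: le_trans C1. Qed.
Let eps0 : 0 <= eps d. Proof. by rewrite epsE invr_ge0 mulr_ge0// exprn_ge0. Qed.
Let A0 : 0 <= cA d. Proof. by rewrite AE mulr_ge0// exprn_ge0. Qed.
Let y0 : 0 <= yy d. Proof. exact: le_trans y1. Qed.

(** Good terms minus errors in the coefficient of [lam] at the index i, apart from - A y and from
    what is matched with [ellv]. *)
Definition ww i : R :=
  eps d * (C^-1 * HH i ^+ 2 - C * (sg d i ^+ 2 + sg d i * HH i)) + cA d * yy d * sg d i ^+ 2 +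
  2^-1 * (cA d ^+ 2 * yy d * ff i ^+ 2) -
  C * (eps d ^+ 2 * (sg d i + HH i) ^+ 2) - C * (sg d i * (sg d i + rr i + ee i)).

Lemma ww_lower i : eps d * (2 * C)^-1 * HH i ^+ 2 + sg d i ^+ 2 <= ww i.
Proof.
apply: weight_lower => //; [exact: HH_ge0|exact: sg_ge0 H i|exact: rr_ff|exact: ee_ge0|].
apply: le_trans (ee_le H hP eps0 i) _; rewrite lerD2r [leRHS]mulrCA ler_wpM2l//.
have S0 : 0 <= sg d i + HH i by rewrite addr_ge0 ?(sg_ge0 H) ?HH_ge0.
apply: ler_wpM2r => //; rewrite CE.
have : P ^+ 3 <= P ^+ 8 by rewrite ler_weXn2l.
by have := exprn_ege1 8 P1; lra.
Qed.

(** The last summand in the factor of [lam] is held in reserve: after summation it absorbs the part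
    of the bound on the sum of [ellv] that carries the factor lam eps. *)
Lemma index_upper i : 2 * Om2 d i +
    (2 * (lam d * eps d) * bil (h0 d) (dd d) (ell i) - \sum_s ell i 0 s * bil (G0 d s) cv cv) +
    lam d * (ww i - cA d * yy d + eps d * (2^-1 * C * (sg d i ^+ 2 + sg d i * HH i))) <=
  2^-1 * C * (HH i * tau i + tau i ^+ 2 + sg d i * tau i).
Proof.
have k1 := pair_upper H hP lam0 i.
have k2 := ler_wpM2l (mulr_ge0 lam0 eps0) (Nsum_lower H hP i).
have k3 := ler_wpM2l lam0 (br_upper H hP i).
have k4 := ler_wpM2l lam0 (ysum_lower H y0 i).
have B1 : C^-1 * HH i ^+ 2 <= B^-1 * HH i ^+ 2.
  rewrite ler_wpM2r ?sqr_ge0// lef_pV2 ?posrE; last 2 first.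
    by have := C1; lra.
    by have := B_ge1 H; lra.
  apply: le_trans (BP H hP) _; rewrite CE; have : P ^+ 1 <= P ^+ 8 by rewrite ler_weXn2l.
  by rewrite expr1; have := exprn_ege1 8 P1; lra.
have k5 := ler_wpM2l (mulr_ge0 lam0 eps0) B1.
have P38 : P ^+ 3 <= P ^+ 8 by rewrite ler_weXn2l.
have P48 : P ^+ 4 <= P ^+ 8 by rewrite ler_weXn2l.
have P68 : P ^+ 6 <= P ^+ 8 by rewrite ler_weXn2l.
have P0 : 0 <= P by apply: le_trans P1.
have p8 : 0 <= P ^+ 8 by rewrite exprn_ge0.
have s0 := sg_ge0 H i; have t0 := tau_ge0 H i; have h0 := HH_ge0 d i; have e0 := ee_ge0 d i.
have c1 : lam d * (P ^+ 3 * (sg d i * ee i)) <= P ^+ 8 * (lam d * (sg d i * ee i)).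
  by rewrite mulrCA ler_wpM2r// !mulr_ge0.
have c2 : lam d * (P ^+ 3 * (sg d i * tau i)) <= P ^+ 8 * (lam d * (sg d i * tau i)).
  by rewrite mulrCA ler_wpM2r// !mulr_ge0.
have c3 : lam d * (eps d ^+ 2 * (4 * P ^+ 6 * (sg d i + HH i) ^+ 2)) <=
    4 * (P ^+ 8 * (lam d * (eps d ^+ 2 * (sg d i + HH i) ^+ 2))).
  rewrite (_ : lam d * _ = 4 * (P ^+ 6 * (lam d * (eps d ^+ 2 * (sg d i + HH i) ^+ 2)))); last by ring.
  by rewrite ler_wpM2l// ler_wpM2r// mulr_ge0// mulr_ge0 ?sqr_ge0.
have c4 : lam d * eps d * (P ^+ 3 * (sg d i ^+ 2 + sg d i * HH i)) <=
    P ^+ 8 * (lam d * eps d * (sg d i ^+ 2 + sg d i * HH i)).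
  by rewrite mulrCA ler_wpM2r// mulr_ge0 ?addr_ge0 ?sqr_ge0 ?mulr_ge0.
have c5 : P ^+ 4 * (HH i * tau i + tau i ^+ 2 + (1 + lam d) * (sg d i * tau i) +
        lam d * (sg d i * ee i)) <= P ^+ 8 * (HH i * tau i + tau i ^+ 2 + (1 + lam d) * (sg d i * tau i) +
        lam d * (sg d i * ee i)).
  by apply: ler_wpM2r => //; nonneg.
have q1 : 0 <= P ^+ 8 * (lam d * (sg d i * ee i)) by rewrite !mulr_ge0.
have q2 : 0 <= P ^+ 8 * (lam d * (sg d i * tau i)) by rewrite !mulr_ge0.
have q3 : 0 <= P ^+ 8 * (lam d * (eps d ^+ 2 * (sg d i + HH i) ^+ 2)).
  by rewrite mulr_ge0// mulr_ge0// mulr_ge0 ?sqr_ge0.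
have q4 : 0 <= P ^+ 8 * (lam d * eps d * (sg d i ^+ 2 + sg d i * HH i)).
  by rewrite mulr_ge0// mulr_ge0 ?addr_ge0 ?sqr_ge0 ?mulr_ge0.
have q5 : 0 <= P ^+ 8 * (HH i * tau i) by rewrite !mulr_ge0.
have q6 : 0 <= P ^+ 8 * (tau i ^+ 2) by rewrite !mulr_ge0 ?sqr_ge0.
have q7 : 0 <= P ^+ 8 * (sg d i * tau i) by rewrite !mulr_ge0.
rewrite /ww -[_ + rr i](tauE d i).
have eeE : ee i = `|eta1 d (X i)| + `|eta1 d (Y i)| by [].
rewrite -eeE in k1; rewrite /eta2 /eta1 in k1.
move: k5; rewrite -/(C^-1 * _); move: (C^-1 * _) (B^-1 * _) k2 => iCH iBH k2 k5.
rewrite CE; clear -k1 k2 k3 k4 k5 c1 c2 c3 c4 c5 q1 q2 q3 q4 q5 q6 q7.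
lra.
Qed.

(** [T] bounds the ratio of [wrow] to [sg], and [Q] is the quantity on which the good terms are
    coercive. *)
Let T : R := 1 + cA d * Yb * P.
Let Q : R := \sum_i (HH i ^+ 2 + sg d i ^+ 2).

Lemma T_ge1 : 1 <= T.
Proof.
have Y0 : 0 <= Yb by apply: le_trans yY.
have P0 : 0 <= P by apply: le_trans P1.
by rewrite lerDl; nonneg.
Qed.

Lemma Q_ge0 : 0 <= Q.
Proof. by apply: sumr_ge0 => i _; rewrite addr_ge0 ?sqr_ge0. Qed.

Lemma rr_le i : rr i <= (T - 1) * sg d i.
Proof.
have P0 : 0 <= P by apply: le_trans P1.
rewrite (rr_ff A0 y0) /T [1 + _]addrC addrK -!mulrA ler_wpM2l// ler_pM ?ff_ge0//.
exact: ff_le H hP i.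
Qed.

Lemma tau_le i : tau i <= T * sg d i.
Proof. by rewrite tauE; have := rr_le i; rewrite mulrBl mul1r; lra. Qed.

(** kappa pairs [pp], [qq], of size at most 1 / sg_i, with [ra], [rb], of size at most (T - 1) sg_i:
    the unknown scales of the frame cancel. *)
Lemma kappa_le : kr d ^+ 2 + ki d ^+ 2 <= 8 * (B * T) ^+ 2.
Proof.
have B0 := B_ge0 H; have T1 := T_ge1.
have pq (a : R) i : sg d i * `|a| <= 1 -> forall b : R, `|b| <= rr i -> `|a * b| <= T.
  move=> h b br; rewrite normrM; apply: le_trans (ler_wpM2l (normr_ge0 a) (le_trans br (rr_le i))) _.
  rewrite mulrCA [`|a| * _]mulrC; apply: le_trans (ler_wpM2l _ h) _; [lra|lra].
have sq (x : R) : x ^+ 2 <= 1 -> x <= 1.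
  by move=> x1; have := sqr_ge0 (x - 1); lra.
have p1 i : sg d i * `|pp d i| <= 1.
  apply: sq; rewrite exprMn real_normK ?num_real//; have := pq_le H i.
  by rewrite mulrDr; have := mulr_ge0 (sqr_ge0 (sg d i)) (sqr_ge0 (qq d i)); lra.
have q1 i : sg d i * `|qq d i| <= 1.
  apply: sq; rewrite exprMn real_normK ?num_real//; have := pq_le H i.
  by rewrite mulrDr; have := mulr_ge0 (sqr_ge0 (sg d i)) (sqr_ge0 (pp d i)); lra.
have nB : n%:R <= B by apply: le_trans (mB H); rewrite ler_nat leq_addr.
have bnd (F : 'I_n -> R) : (forall i, `|F i| <= 2 * T) -> (\sum_i F i) ^+ 2 <= 4 * (B * T) ^+ 2.
  move=> h; have : `|\sum_i F i| <= 2 * (B * T).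
    apply: le_trans (ler_norm_sum _ _ _) _.
    apply: le_trans (_ : \sum_(i < n) (2 * T) <= _); first by apply: ler_sum.
    rewrite sumr_const card_ord -[leLHS]mulr_natl mulrCA ler_wpM2l// ler_wpM2r//; lra.
  move=> k; rewrite -[_ ^+ 2]real_normK ?num_real//.
  have -> : 4 * (B * T) ^+ 2 = (2 * (B * T)) ^+ 2 by ring.
  by rewrite ler_pXn2r ?nnegrE//; apply: le_trans k.
have kr' : kr d ^+ 2 <= 4 * (B * T) ^+ 2.
  apply: bnd => i; apply: le_trans (ler_normB _ _) _.
  by have := pq _ _ (p1 i) _ (ra_le d i); have := pq _ _ (q1 i) _ (rb_le d i); lra.
have ki' : ki d ^+ 2 <= 4 * (B * T) ^+ 2.
  apply: bnd => i; apply: le_trans (ler_normD _ _) _.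
  by have := pq _ _ (p1 i) _ (rb_le d i); have := pq _ _ (q1 i) _ (ra_le d i); lra.
lra.
Qed.

(* The eigenvector equation forces some X_i to see a large part of the Hessian. *)
Lemma lam_le_Q : lam d <= 24 * P ^+ 12 * Q.
Proof.
have P0 : 0 <= P by apply: le_trans P1.
have P14 : P <= P ^+ 4 by rewrite -[leLHS]expr1 ler_weXn2l.
have P34 : P ^+ 3 <= P ^+ 4 by rewrite ler_weXn2l.
have P4 : 1 <= P ^+ 4 by rewrite exprn_ege1.
have P40 : 0 <= P ^+ 4 by lra.
have uw (u : V) i : n1 u <= B * sg d i -> n1 (u *m D) <= HH i ->
   `|lam d * bil (g0 d) cv u| <= P ^+ 4 * (HH i + sg d i).
  move=> us uh; rewrite -(eigen H) (D2C H).
  have k1 : `|bil D u cv| <= P ^+ 4 * HH i.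
    apply: le_trans (bil_le_n1 _ _ _) _; rewrite mulrC ler_pM ?n1_ge0//.
    by apply: le_trans (cv_le H) _; apply: le_trans (BP H hP) _.
  have us' : n1 u <= P * sg d i.
    by apply: le_trans us _; rewrite ler_wpM2r ?(sg_ge0 H)// (BP H hP).
  have k2 : `|\sum_s dd d 0 s * bil (G0 d s) cv u| <= P ^+ 4 * (1 * 1 * sg d i).
    apply: (dd_P H hP) => [|s]; first by rewrite mulr_ge0 ?(sg_ge0 H)//.
    by apply: bilP_le => // [s' t|]; rewrite ?mulr1; [exact: (entriesP H hP (G0_le H s))|rewrite -[leRHS]mulr1; exact: (cv_P H hP)].
  apply: le_trans (ler_normB _ _) _; rewrite mulrDr; lra.
(* Because W(E_i, E_i) = 1, sg_i can be small only if D^2 phi is large on the complex line of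
   X_i. *)
have one i : 1 <= 2 * P ^+ 4 * (HH i * sg d i + sg d i ^+ 2).
  have s0 := sg_ge0 H i; have h0 := HH_ge0 d i.
  rewrite -{1}(om_eq1 H i) /om0 (Xnorm H).
  have k1 : `|bil D (X i) (X i)| <= n1 (X i *m D) * (P * sg d i).
    apply: le_trans (bil_le_n1 _ _ _) _; rewrite ler_wpM2l ?n1_ge0//.
    by apply: le_trans (X_le H i) _; rewrite ler_wpM2r ?(BP H hP).
  have k2 : `|bil D (Y i) (Y i)| <= n1 (Y i *m D) * (P * sg d i).
    apply: le_trans (bil_le_n1 _ _ _) _; rewrite ler_wpM2l ?n1_ge0//.
    by apply: le_trans (Y_le H i) _; rewrite ler_wpM2r ?(BP H hP).
  have XP : n1 (X i) <= P * sg d i.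
    by apply: le_trans (X_le H i) _; rewrite ler_wpM2r ?(BP H hP).
  have k3 : `|\sum_s dd d 0 s * bil (b0 d s) (X i) (X i)| <= P ^+ 4 * (1 * sg d i * sg d i).
    apply: (dd_P H hP) => [|s]; first by rewrite mulr_ge0 ?mulr_ge0.
    by apply: bilP_le => // s' t; rewrite mulr1; exact: (entriesP H hP (b0_le H s)).
  have k4 : P * (HH i * sg d i) <= P ^+ 4 * (HH i * sg d i) by rewrite ler_wpM2r ?mulr_ge0.
  have k5 : sg d i * sg d i <= P ^+ 4 * (sg d i * sg d i) by rewrite ler_peMl ?mulr_ge0.
  have k6 : 0 <= P ^+ 4 * (HH i * sg d i) by rewrite !mulr_ge0.
  move: k1 k2 k3 => /absb/andP[_ k1] /absb/andP[_ k2] /absb/andP[_ k3].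
  rewrite HHE in k4 k6 *; lra.
(* The eigenvector equation bounds lam g(V, X_i) and lam g(V, J X_i), hence the share S of V in this
   line only up to a factor sg_i. As sg_i has no lower bound, [one] is used to remove that
   factor. *)
have step i : lam d * (sg d i ^+ 2 * (pp d i ^+ 2 + qq d i ^+ 2)) <= 12 * P ^+ 12 * (HH i ^+ 2 + sg d i ^+ 2).
  have s0 := sg_gt0 H i; have h0 := HH_ge0 d i; set u := P ^+ 4 * (HH i + sg d i).
  have u0 : 0 <= u by nonneg.
  have k1 := uw (X i) i (X_le H i) (_ : n1 (X i *m D) <= HH i).
  have k2 := uw (Y i) i (Y_le H i) (_ : n1 (Y i *m D) <= HH i).
  have {}k1 : `|lam d * bil (g0 d) cv (X i)| <= u by apply: k1; rewrite HHE lerDl n1_ge0.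
  have {}k2 : `|lam d * bil (g0 d) cv (Y i)| <= u by apply: k2; rewrite HHE lerDr n1_ge0.
  have sqb (x : R) : `|x| <= u -> x ^+ 2 <= u ^+ 2.
    by move=> xu; rewrite -[x ^+ 2]real_normK ?num_real// ler_pXn2r ?nnegrE.
  set S := sg d i ^+ 2 * _.
  have S0 : 0 <= S by rewrite mulr_ge0 ?addr_ge0 ?sqr_ge0.
  have S12 : S <= 2^-1 := pq_le H i.
  have m1 : lam d ^+ 2 * sg d i ^+ 2 * S <= 2 * u ^+ 2.
    have -> : lam d ^+ 2 * sg d i ^+ 2 * S = (lam d * bil (g0 d) cv (X i)) ^+ 2 + (lam d * bil (g0 d) cv (Y i)) ^+ 2.
      by rewrite /S /pp /qq; field; lra.
    by have := sqb _ k1; have := sqb _ k2; lra.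
  have m2 : lam d * S * sg d i <= u.
    rewrite -(@ler_pXn2r _ 2) ?nnegrE//; last by nonneg.
    have -> : (lam d * S * sg d i) ^+ 2 = (lam d ^+ 2 * sg d i ^+ 2 * S) * S by ring.
    have : lam d ^+ 2 * sg d i ^+ 2 * S * S <= (2 * u ^+ 2) * 2^-1 by rewrite ler_pM//; nonneg.
    lra.
  have m3 : lam d * S * sg d i ^+ 2 <= 2 * u ^+ 2.
    apply: le_trans m1; rewrite [leLHS]mulrAC ler_wpM2r// ler_wpM2r ?sqr_ge0//.
    by rewrite expr2 ler_peMl.
  have m4 : lam d * S <= lam d * S * (2 * P ^+ 4 * (HH i * sg d i + sg d i ^+ 2)).
    by rewrite ler_peMr//; nonneg.
  have m5 : HH i * (lam d * S * sg d i) <= HH i * u by rewrite ler_wpM2l.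
  have m6 : lam d * S * (2 * P ^+ 4 * (HH i * sg d i + sg d i ^+ 2)) <= 2 * P ^+ 4 * (HH i * u + 2 * u ^+ 2).
    have -> : lam d * S * (2 * P ^+ 4 * (HH i * sg d i + sg d i ^+ 2)) =
      2 * P ^+ 4 * (HH i * (lam d * S * sg d i) + lam d * S * sg d i ^+ 2) by ring.
    by rewrite ler_wpM2l ?mulr_ge0// lerD.
  have m7 : HH i * u <= P ^+ 8 * (HH i + sg d i) ^+ 2.
    rewrite (_ : HH i * u = P ^+ 4 * (HH i * (HH i + sg d i))); last by rewrite /u; ring.
    rewrite ler_pM//; [nonneg|by rewrite ler_weXn2l|].
    by rewrite expr2; apply: ler_wpM2r; [nonneg|lra].
  have m8 : HH i * u + 2 * u ^+ 2 <= 3 * P ^+ 8 * (HH i + sg d i) ^+ 2.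
    have -> : u ^+ 2 = P ^+ 8 * (HH i + sg d i) ^+ 2 by rewrite /u; ring.
    lra.
  have m9 : (HH i + sg d i) ^+ 2 <= 2 * (HH i ^+ 2 + sg d i ^+ 2).
    by have := sqr_ge0 (HH i - sg d i); lra.
  apply: le_trans m4 _; apply: le_trans m6 _.
  apply: le_trans (ler_wpM2l _ m8) _; first by nonneg.
  have -> : 2 * P ^+ 4 * (3 * P ^+ 8 * (HH i + sg d i) ^+ 2) = 6 * P ^+ 12 * (HH i + sg d i) ^+ 2 by ring.
  have -> : 12 * P ^+ 12 * (HH i ^+ 2 + sg d i ^+ 2) = 6 * P ^+ 12 * (2 * (HH i ^+ 2 + sg d i ^+ 2)) by ring.
  by rewrite ler_wpM2l//; nonneg.
have tot : lam d * 2^-1 <= 12 * P ^+ 12 * Q.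
  by rewrite -(pq_sum H) mulr_sumr /Q mulr_sumr; apply: ler_sum.
lra.
Qed.

(** The factors are 1 + [W], 2 [E] and the inverse of [c1] in the proof of [lam_le], where c1 is the
    weight of [Q] among the good terms. *)
Definition core_bound : R :=
  1 + (1 + 48 * P ^+ 12 * (cA d * Yb * B)) * (2 * (2 * B * (1 + 8 * (B * T) ^+ 2) * (B + 1) + 4 * C * T ^+ 2)) *
      (2 * C / eps d).

(** The sum over i is [main]. Either lam is at most 2 E / c1, or E Q is absorbed by half of lam c1
    Q; in the second case a factor lam divides out, Q is bounded independently of lam, and
    [lam_le_Q] concludes. *)
Lemma lam_le : lam d <= core_bound.
Proof.
have P0 : 0 <= P by apply: le_trans P1.
have B0 := B_ge0 H; have T1 := T_ge1; have Q0 := Q_ge0.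
have Y0 : 0 <= Yb by apply: le_trans yY.
have eps_gt0 : 0 < eps d by rewrite epsE invr_gt0 mulr_gt0// exprn_gt0//; have := C1; lra.
pose c1 := eps d * (2 * C)^-1.
have c10 : 0 < c1 by rewrite mulr_gt0// invr_gt0; have := C1; lra.
have Cp : 0 < C by apply: lt_le_trans C1.
have c11 : c1 <= 1.
  rewrite /c1 ler_pdivrMr ?mul1r; last by have := C1; lra.
  rewrite epsE; apply: le_trans (_ : 1 <= _); last by have := C1; lra.
  rewrite invf_le1 ?mulr_gt0 ?exprn_gt0//.
  by have := exprn_ege1 2 C1; lra.
have s2Q : \sum_i sg d i ^+ 2 <= Q.
  by apply: ler_sum => i _; rewrite lerDr sqr_ge0.
have S1 : \sum_i (2 * Om2 d i +
    (2 * (lam d * eps d) * bil (h0 d) (dd d) (ell i) - \sum_s ell i 0 s * bil (G0 d s) cv cv) +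
    lam d * (ww i - cA d * yy d + eps d * (2^-1 * C * (sg d i ^+ 2 + sg d i * HH i)))) <=
  \sum_i 2^-1 * C * (HH i * tau i + tau i ^+ 2 + sg d i * tau i).
  by apply: ler_sum => i _; exact: index_upper.
have S2 : \sum_i 2^-1 * C * (HH i * tau i + tau i ^+ 2 + sg d i * tau i) <= 2 * C * T ^+ 2 * Q.
  rewrite /Q mulr_sumr; apply: ler_sum => i _.
  have t1 := tau_le i; have h0 := HH_ge0 d i; have s0 := sg_ge0 H i; have t0 := tau_ge0 H i.
  have a1 : HH i * tau i <= HH i * (T * sg d i) by rewrite ler_wpM2l.
  have a2 : tau i ^+ 2 <= (T * sg d i) ^+ 2 by rewrite ler_pXn2r ?nnegrE//; nonneg.
  have a3 : sg d i * tau i <= sg d i * (T * sg d i) by rewrite ler_wpM2l.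
  have TT : T <= T ^+ 2 by rewrite -[leLHS]expr1 ler_weXn2l.
  have a4 : T * (HH i * sg d i) <= T ^+ 2 * (HH i * sg d i) by rewrite ler_wpM2r ?mulr_ge0.
  have a5 : T * (sg d i ^+ 2) <= T ^+ 2 * (sg d i ^+ 2) by rewrite ler_wpM2r ?sqr_ge0.
  have a6 : T ^+ 2 * (HH i * sg d i) <= T ^+ 2 * (2^-1 * (HH i ^+ 2 + sg d i ^+ 2)).
    by rewrite ler_wpM2l ?sqr_ge0//; have := sqr_ge0 (HH i - sg d i); lra.
  have a7 : 0 <= T ^+ 2 * HH i ^+ 2 by nonneg.
  have -> : 2 * C * T ^+ 2 * (HH i ^+ 2 + sg d i ^+ 2) =
    2^-1 * C * (4 * (T ^+ 2 * (HH i ^+ 2 + sg d i ^+ 2))) by field.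
  rewrite ler_wpM2l//; first by have := C0; lra.
  have a8 : 0 <= T ^+ 2 * sg d i ^+ 2 by nonneg.
  lra.
have S3 : `|2 * (lam d * eps d) * bil (h0 d) (dd d) (Lell d) - \sum_s Lell d 0 s * bil (G0 d s) cv cv|
   <= (1 + lam d * eps d) * (2^-1 * C * \sum_i (sg d i ^+ 2 + sg d i * HH i)).
  have k := Lell_le H hP.
  set S := \sum_i _ in k *.
  have k1 : `|bil (h0 d) (dd d) (Lell d)| <= P * n1 (Lell d).
    apply: le_trans (bil_le B0 (h0_le H) (dd_le H) (lexx _)) _.
    by rewrite ler_wpM2r ?n1_ge0// -expr2 (P_ge H hP).
  have k2 : `|\sum_s Lell d 0 s * bil (G0 d s) cv cv| <= P * n1 (Lell d).
    rewrite mulrC; apply: sum_le_n1 => s.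
    apply: le_trans (bil_le B0 (G0_le H s) (cv_le H) (cv_le H)) _.
    by rewrite (_ : B * B * B = B ^+ 3) ?(P_ge H hP)//; ring.
  have k3 : P * n1 (Lell d) <= 2^-1 * (2^-1 * C * S).
    apply: le_trans (ler_wpM2l P0 k) _.
    have S0 : 0 <= S by apply: sumr_ge0 => i _; rewrite addr_ge0 ?sqr_ge0 ?mulr_ge0 ?(sg_ge0 H) ?HH_ge0.
    have -> : P * (8 * P ^+ 6 * S) = 8 * P ^+ 7 * S by ring.
    rewrite CE; have -> : 2^-1 * (2^-1 * (200 * P ^+ 8) * S) = 50 * P ^+ 8 * S by field.
    rewrite ler_wpM2r//; have : P ^+ 7 <= P ^+ 8 by rewrite ler_weXn2l.
    by have := exprn_ege1 8 P1; lra.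
  have le0 : 0 <= lam d * eps d by nonneg.
  apply: le_trans (ler_normB _ _) _; rewrite !normrM (ger0_norm lam0) (ger0_norm eps0) ger0_norm//.
  have k4 := ler_wpM2l le0 (le_trans k1 k3); have k5 := le_trans k2 k3.
  have n0 : 0 <= 2^-1 * (2^-1 * C * S) by apply: le_trans k3; rewrite mulr_ge0 ?n1_ge0.
  lra.
pose E := 2 * B * (1 + 8 * (B * T) ^+ 2) * (B + 1) + 4 * C * T ^+ 2.
have E1 : 1 <= E.
  rewrite /E; have : 0 <= 2 * B * (1 + 8 * (B * T) ^+ 2) * (B + 1) by nonneg.
  have : 1 <= C * T ^+ 2 by rewrite -[leLHS]mulr1 ler_pM ?exprn_ege1//.
  lra.
have S4 : - (B * (1 + 8 * (B * T) ^+ 2) * (B + 1) * Q) <= \sum_i Om2 d i.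
  apply: le_trans (agm_second H); rewrite lerN2.
  have k := kappa_le; have o := one_trG H.
  have Fi0 : 0 <= 1 + (F0 d)^-1 by rewrite addr_ge0// invr_ge0 ltW// (F0_pos H).
  have e1 : 1 + (F0 d)^-1 <= (B + 1) * Q by apply: le_trans o _; rewrite ler_wpM2l//; lra.
  rewrite -!mulrA; apply: ler_wpM2l => //; apply: ler_pM => //; last by lra.
  by rewrite -addrA addr_ge0// addr_ge0 ?sqr_ge0.
have S5 : c1 * Q <= \sum_i ww i.
  rewrite /Q mulr_sumr; apply: ler_sum => i _; apply: le_trans (ww_lower i).
  rewrite mulrDr lerD2l; have := sqr_ge0 (sg d i); move: (sg d i ^+ 2) => x x0.
  by have := ler_wpM2r x0 c11; rewrite mul1r.
have S6 : \sum_i (sg d i ^+ 2 + sg d i * HH i) <= 2 * Q.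
  rewrite /Q mulr_sumr; apply: ler_sum => i _.
  by have := sqr_ge0 (sg d i - HH i); have := sqr_ge0 (HH i); have := sqr_ge0 (sg d i); lra.
have main : lam d * (c1 * Q) <= n%:R * (lam d * (cA d * yy d)) + E * Q.
  have hG : \sum_s Lell d 0 s * bil (G0 d s) cv cv = \sum_i \sum_s ell i 0 s * bil (G0 d s) cv cv.
    by rewrite exchange_big; apply: eq_bigr => s _; rewrite /Lell summxE mulr_suml.
  have nE : n%:R * (lam d * (cA d * yy d)) = \sum_(i < n) lam d * (cA d * yy d).
    by rewrite sumr_const card_ord mulr_natl.
  have e : \sum_i (2 * Om2 d i +
    (2 * (lam d * eps d) * bil (h0 d) (dd d) (ell i) - \sum_s ell i 0 s * bil (G0 d s) cv cv) +
    lam d * (ww i - cA d * yy d + eps d * (2^-1 * C * (sg d i ^+ 2 + sg d i * HH i)))) =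
    2 * (\sum_i Om2 d i) + (2 * (lam d * eps d) * bil (h0 d) (dd d) (Lell d) -
      \sum_s Lell d 0 s * bil (G0 d s) cv cv) + (lam d * (\sum_i ww i) - n%:R * (lam d * (cA d * yy d)) +
     lam d * eps d * (2^-1 * C * \sum_i (sg d i ^+ 2 + sg d i * HH i))).
    rewrite hG nE bil_sumr !mulr_sumr -!sumrB -!big_split; apply: eq_bigr => i _ /=.
    by ring.
  have S7 := ler_wpM2l lam0 S5.
  have S8 : 2^-1 * C * \sum_i (sg d i ^+ 2 + sg d i * HH i) <= C * T ^+ 2 * Q.
    apply: le_trans (ler_wpM2l _ S6) _; first by have := C0; lra.
    rewrite mulrACA mulVf ?mul1r ?pnatr_eq0// -mulrA ler_wpM2l// ler_peMl// exprn_ege1//.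
  have CTQ : 0 <= C * T ^+ 2 * Q by nonneg.
  rewrite e in S1; move: S3 => /absb/andP[S3 _].
  move: S1 S2 S3 S4 S7 S8; rewrite /E; move: (2 * (lam d * eps d) * _ - _) => x.
  move: (\sum_i ww i) (\sum_i Om2 d i) (2^-1 * C * \sum_i (sg d i ^+ 2 + sg d i * HH i)) => x1 x2 x3.
  move: (\sum_i _) => x4 S1 S2 S3 S4 S7 S8; lra.
have icE : c1 * (2 * C / eps d) = 1.
  by rewrite /c1; field; have := C1; rewrite !gt_eqF//; lra.
have ic0 : 0 <= 2 * C / eps d by rewrite divr_ge0//; have := C0; lra.
set ic := 2 * C / eps d in icE ic0 *.
pose W := 48 * P ^+ 12 * (cA d * Yb * B).
have W0 : 0 <= W by rewrite /W; nonneg.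
have bE : core_bound = 1 + (1 + W) * (2 * E) * ic by [].
have E0 : 0 <= 2 * E by lra.
have p1 : 0 <= W * (2 * E) * ic by nonneg.
have p2 : W * ic <= W * (2 * E) * ic.
  by apply: ler_wpM2r => //; apply: ler_peMr => //; lra.
have p3 : 0 <= 2 * E * ic by nonneg.
have [l1|l1] := lerP (lam d) (2 * E * ic); first by rewrite bE; lra.
have l2 : 2 * E <= lam d * c1.
  apply: le_trans (_ : 2 * E * ic * c1 <= _); last by rewrite ler_wpM2r ?ltW.
  by rewrite -mulrA [ic * _]mulrC icE mulr1.
have l3 : 2 * E * Q <= lam d * c1 * Q by rewrite ler_wpM2r.
have nB : n%:R <= B by apply: le_trans (mB H); rewrite ler_nat leq_addr.
have l4 : lam d * (c1 * Q) <= lam d * (2 * (cA d * Yb * B)).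
  have : n%:R * (lam d * (cA d * yy d)) <= B * (lam d * (cA d * Yb)).
    apply: ler_pM => //; first by nonneg.
    by rewrite ler_wpM2l// ler_wpM2l.
  by lra.
have l5 : c1 * Q <= 2 * (cA d * Yb * B) by move: l4; rewrite ler_pM2l//; have := lam1; lra.
have l6 : lam d * c1 <= W.
  apply: le_trans (ler_wpM2r (ltW c10) lam_le_Q) _.
  have -> : 24 * P ^+ 12 * Q * c1 = 24 * P ^+ 12 * (c1 * Q) by ring.
  apply: le_trans (ler_wpM2l _ l5) _; first by nonneg.
  by rewrite /W; lra.
have l7 : lam d <= W * ic.
  have -> : lam d = lam d * c1 * ic by rewrite -mulrA icE mulr1.
  by rewrite ler_wpM2r.
rewrite bE; lra.
Qed.

End CoreBound.

Definition coreC (R : realType) (B : R) : R := 200 * (3 * B ^+ 9) ^+ 8.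
Definition core_eps (R : realType) (B : R) : R := (16 * coreC B ^+ 2)^-1.
Definition core_A (R : realType) (B : R) : R := 10 * coreC B ^+ 3.

Lemma core_estimate (R : realType) (n : nat) (B Yb : R) : exists L : R, forall d : cdata R n,
  core B d -> eps d = core_eps B -> cA d = core_A B -> 1 <= yy d -> yy d <= Yb -> lam d <= L.
Proof.
pose P : R := 3 * B ^+ 9; pose C := coreC B.
pose T := 1 + core_A B * Yb * P.
exists (Num.max 1 (1 + (1 + 48 * P ^+ 12 * (core_A B * Yb * B)) *
   (2 * (2 * B * (1 + 8 * (B * T) ^+ 2) * (B + 1) + 4 * C * T ^+ 2)) * (2 * C / core_eps B))).
move=> d H eE AE y1 yY; rewrite le_max; apply/orP.
have [l1|/ltW l1] := lerP (lam d) 1; [by left|right].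
have := @lam_le _ _ d B P Yb C H erefl erefl eE AE y1 yY l1.
by rewrite /core_bound eE AE.
Qed.

(** * Determinants of frames *)

Section RealForm.
Variables (R : realType) (n : nat).
Local Open Scope complex_scope.
Local Open Scope ring_scope.
Notation C := (R[i]).
Notation "A ^H" := ((conjM A)^T) (at level 8, format "A ^H").
Notation ii := ('i%C : C).
Notation m := (n + n)%N.
Variable J : 'M[R]_m.
Hypothesis JJ : J *m J = - 1%:M.
Notation cf := (cfr J).

(** Two block triangular factorisations of the same matrix have the same determinant. *)
Lemma det_1_rank1 k (r : 'cV[C]_k) (w : 'rV[C]_k) : \det (1%:M + r *m w) = 1 + (w *m r) 0 0.
Proof.
have e1 : block_mx 1%:M 0 w 1%:M *m block_mx 1%:M (- r) 0 (1%:M + w *m r) = block_mx 1%:M (- r) w (1%:M : 'M[C]_(1, 1)).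
  rewrite mulmx_block !mul1mx !mulmx1 !mulmx0 !mul0mx !addr0 !mulmxN.
  by congr block_mx; rewrite addrCA addNr addr0.
have e2 : block_mx 1%:M (- r) 0 1%:M *m block_mx (1%:M + r *m w) 0 w 1%:M = block_mx 1%:M (- r) w (1%:M : 'M[C]_(1, 1)).
  rewrite mulmx_block !mul1mx !mulmx1 !mulmx0 !mul0mx !add0r !mulNmx.
  by congr block_mx; rewrite -addrA subrr addr0.
have := congr1 determinant (etrans e1 (esym e2)).
rewrite !det_mulmx !det_lblock !det_ublock !det1 !mul1r !mulr1 => <-.
by rewrite det_mx11 mxE mxE eqxx.
Qed.

Lemma frame_form_cfr (X : 'M[R]_(n, m)) (h : 'M[R]_m) i j :
  frame_form (cf X) h i j =
  (bil h (row i X) (row j X) + bil h (row i (X *m J)) (row j (X *m J))) +i*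
  (bil h (row i X) (row j (X *m J)) - bil h (row i (X *m J)) (row j X)).
Proof.
have bE (U W : 'M[R]_(n, m)) : (U *m h *m W^T) i j = bil h (row i U) (row j W).
  rewrite bil_row -row_mul mxE; apply: eq_bigr => k _.
  by rewrite [W^T _ _]mxE [row i _ _ _]mxE [row j _ _ _]mxE.
rewrite /frame_form conj_cfr /cfr -!bE.
have -> : (toC X + ii *: toC (X *m J))^T = toC X^T + ii *: toC (X *m J)^T.
  by apply/matrixP => k l; rewrite !mxE.
rewrite mulmxDr.
rewrite !mulmxBl -!scalemxAr -!scalemxAl -!toCM.
rewrite !mxE; simpc.
by congr (_ +i* _); ring.
Qed.

Definition normsq (z : C) : R := complex.Re z ^+ 2 + complex.Im z ^+ 2.

Lemma mul_conjE (z : C) : z * Num.conj z = (normsq z)%:C.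
Proof. by case: z => x y; rewrite /Num.conj /= /normsq /=; simpc; congr (_ +i* _); ring. Qed.

Lemma det_ctr k (A : 'M[C]_k) : \det A^H = Num.conj (\det A).
Proof. by rewrite det_tr /conjM det_map_mx. Qed.

(** J acts on (1,0)-vectors as multiplication by i. Moving the rows of X along U and J U is
    therefore a complex rank one change of the frame as soon as U lies in the span of X and J X. *)
Lemma cfr_perturb (X : 'M[R]_(n, m)) (a b : 'cV[R]_n) (p q : 'rV[R]_n) (U := p *m X + q *m (X *m J)) :
  cf (X + a *m U + b *m (U *m J)) =
  (1%:M + (toC a + ii *: toC b) *m (toC p + ii *: toC q)) *m cf X.
Proof.
have cU : cf U = (toC p + ii *: toC q) *m cf X.
  by rewrite /U (cfrD J) (cfr_mul J p) (cfr_mul J q) (cfr_J JJ) mulmxDl -scalemxAr -scalemxAl.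
rewrite !(cfrD J) (cfr_mul J a) (cfr_mul J b) (cfr_J JJ) cU mulmxDl mul1mx -addrA; congr (_ + _).
by rewrite -mulmxA [in RHS]mulmxDl -scalemxAr -scalemxAl.
Qed.

Lemma frame_form_mul (K : 'M[C]_n) (E : 'M[C]_(n, m)) (h : 'M[R]_m) :
  frame_form (K *m E) h = K *m frame_form E h *m K^H.
Proof. by rewrite /frame_form ctrM !mulmxA. Qed.

Lemma sum_complex (I : Type) (r : seq I) (x y : I -> R) :
  \sum_(i <- r) (x i +i* y i) = (\sum_(i <- r) x i) +i* (\sum_(i <- r) y i).
Proof.
elim: r => [|i r IH]; first by rewrite !big_nil.
by rewrite !big_cons IH; simpc.
Qed.

Lemma det_perturb (X : 'M[R]_(n, m)) (h : 'M[R]_m) (a b : 'cV[R]_n) (p q : 'rV[R]_n)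
    (U := p *m X + q *m (X *m J)) :
  \det (frame_form (cf (X + a *m U + b *m (U *m J))) h) =
  ((1 + (\sum_i (p 0 i * a i 0 - q 0 i * b i 0))) ^+ 2 +
    (\sum_i (p 0 i * b i 0 + q 0 i * a i 0)) ^+ 2)%:C * \det (frame_form (cf X) h).
Proof.
rewrite cfr_perturb frame_form_mul !det_mulmx det_ctr mulrAC mul_conjE det_1_rank1.
congr (_%:C * _).
have -> : ((toC p + ii *: toC q) *m (toC a + ii *: toC b)) 0 0 =
    (\sum_i (p 0 i * a i 0 - q 0 i * b i 0)) +i* (\sum_i (p 0 i * b i 0 + q 0 i * a i 0)).
  rewrite mxE -sum_complex; apply: eq_bigr => i _; rewrite !mxE; simpc.
  by congr (_ +i* _); ring.
by rewrite /normsq; simpc.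
Qed.

(** The rows of E and its conjugate arise from X and J X by a constant matrix whose determinant is
    (2i)^n, and in that basis the Gram matrix of h is block diagonal with conjugate blocks. The
    complex determinant is thereby replaced by a real one, whose jets are available. *)
Lemma det_gram (X : 'M[R]_(n, m)) (h : 'M[R]_m) : h^T = h -> J *m h *m J^T = h ->
  normsq (\det (frame_form (cf X) h)) =
  4 ^+ n * \det (col_mx X (X *m J) *m h *m (col_mx X (X *m J))^T).
Proof.
move=> hT hJ; set E := cf X; set G := frame_form E h.
have EJ : E *m toC J = ii *: E := cfr_eig JJ X.
have hJr : h *m J^T = - (J *m h).
  have : J *m (J *m h *m J^T) = J *m h by rewrite hJ.
  by rewrite !mulmxA JJ mulNmx mul1mx mulNmx => <-; rewrite opprK.
have EE : E *m toC h *m E^T = 0.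
  (* the complex bilinear extension of a J-invariant form vanishes on (1,0)-vectors *)
  have e : ii *: (E *m toC h *m E^T) = - (ii *: (E *m toC h *m E^T)).
    have {1}-> : ii *: (E *m toC h *m E^T) = E *m toC h *m (E *m toC J)^T.
      by rewrite EJ scalemxAr; congr (_ *m _); apply/matrixP => k l; rewrite !mxE.
    rewrite trmx_mul -toCT mulmxA -[E *m toC h *m _]mulmxA -toCM hJr toCN toCM mulmxN mulmxA EJ.
    by rewrite mulNmx -!scalemxAl.
  have i0 : ii != 0 by rewrite eq_complex /= oner_eq0 andbF.
  move/eqP: e; rewrite -addr_eq0 -mulr2n -scaler_nat scalerA scaler_eq0 mulf_eq0 pnatr_eq0.
  by rewrite (negbTE i0) /= => /eqP.
have cjE : conjM E *m toC h *m (conjM E)^T = 0.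
  have -> : (conjM E)^T = conjM E^T by rewrite /conjM map_trmx.
  by rewrite -[toC h]conjM_toC -!conjMM EE /conjM map_mx0.
have cjG : conjM E *m toC h *m E^T = conjM G.
  rewrite /G /frame_form !conjMM conjM_toC; congr (_ *m _).
  by rewrite /conjM !map_trmx -map_mx_comp; apply/matrixP => k l; rewrite !mxE /= conjCK.
have blk : col_mx E (conjM E) *m toC h *m (col_mx E (conjM E))^H = block_mx G 0 0 (conjM G).
  have -> : (col_mx E (conjM E))^H = row_mx (E^H) (E^T).
    by rewrite /conjM map_col_mx -/(conjM _) -/(conjM _) conjMK tr_col_mx.
  by rewrite mul_col_mx mul_col_row EE cjE cjG.
pose Pm : 'M[C]_(n + n) := block_mx 1%:M (- ii)%:M 1%:M ii%:M.
have colE : col_mx E (conjM E) = Pm *m toC (col_mx X (X *m J)).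
  have -> : toC (col_mx X (X *m J)) = col_mx (toC X) (toC (X *m J)) by rewrite /toC map_col_mx.
  rewrite /Pm mul_block_col !mul1mx !mul_scalar_mx conj_cfr scaleNr.
  by [].
have detP : \det Pm * Num.conj (\det Pm) = (4 ^+ n)%:C.
  have -> : \det Pm = (2 * ii) ^+ n.
    have e : block_mx 1%:M 0 (- 1%:M) 1%:M *m Pm = block_mx 1%:M (- ii)%:M 0 ((2 * ii)%:M : 'M[C]_(n, n)).
      rewrite mulmx_block !mul1mx !mul0mx !addr0 !mulNmx !mul1mx addNr; congr block_mx.
      by rewrite -raddfN -raddfD opprK; congr (_%:M); ring.
    have := congr1 determinant e; rewrite det_mulmx det_lblock det_ublock !det1 !mul1r => ->.
    by rewrite det_scalar.
  rewrite rmorphXn -exprMn mul_conjE rmorphXn; congr (_ ^+ n).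
  by rewrite /normsq /=; simpc; congr (_ +i* _); ring.
have := congr1 determinant blk; rewrite det_ublock.
have -> : \det (conjM G) = Num.conj (\det G) by rewrite /conjM det_map_mx.
rewrite mul_conjE colE ctrM conjM_toC -toCT.
have -> : Pm *m toC (col_mx X (X *m J)) *m toC h *m (toC (col_mx X (X *m J))^T *m Pm^H) =
   Pm *m toC (col_mx X (X *m J) *m h *m (col_mx X (X *m J))^T) *m Pm^H.
  by rewrite !toCM !mulmxA.
move: (col_mx X (X *m J) *m h *m (col_mx X (X *m J))^T) => Gr.
rewrite !det_mulmx det_ctr mulrAC detP /toC det_map_mx -rmorphM /=.
by move=> /(congr1 (@complex.Re R)) /= <-.
Qed.

Lemma posdef_real_form (E : 'M[C]_(n, m)) (h : 'M[R]_m) : h^T = h ->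
  (forall v : 'rV[R]_m, v != 0 -> 0 < bil h v v) -> row_free E -> herm_posdef (frame_form E h).
Proof.
move=> hT hpos Ef; split.
  rewrite hermP /frame_form !ctrM ctrK conjM_toC -toCT hT mulmxA //.
move=> v v0.
have z0 : v *m E != 0.
  by apply: contraNneq v0 => h0; rewrite -(mulmxKp Ef v) h0 mul0mx.
have -> : v *m frame_form E h *m v^H = (v *m E) *m toC h *m (v *m E)^H.
  by rewrite /frame_form ctrM !mulmxA.
move: (v *m E) z0 => z z0; pose x := reM z; pose y := imM z.
have zE : z = toC x + ii *: toC y := cmxE z.
have -> : (z *m toC h *m z^H) 0 0 = (bil h x x + bil h y y)%:C.
  have -> : z^H = toC x^T - ii *: toC y^T.
    rewrite {1}zE; apply/matrixP => k l; rewrite !mxE rmorphD rmorphM.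
    by rewrite /Num.conj /=; simpc.
  rewrite zE mulmxDl mulmxBr !mulmxDl -!scalemxAr -!scalemxAl -!toCM.
  rewrite /bil; have hs : (x *m h *m y^T) 0 0 = (y *m h *m x^T) 0 0 by exact: bil_sym.
  move: hs; move: (x *m h *m y^T) (y *m h *m x^T) (x *m h *m x^T) (y *m h *m y^T) => t1 t2 t3 t4 hs.
  by rewrite !mxE hs; simpc; congr (_ +i* _); ring.
rewrite ltcR.
have hge u : 0 <= bil h u u.
  by have [->|/hpos/ltW//] := eqVneq u 0; rewrite bil0l.
have [x0|/hpos hx] := eqVneq x 0; last by rewrite ltr_wpDr.
rewrite ltr_wpDl//; apply: hpos; apply: contraNneq z0 => y0.
by rewrite zE x0 y0; apply/eqP/matrixP => k l; rewrite !mxE; simpc.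
Qed.

Lemma det_posdef (G : 'M[C]_n) : herm_posdef G -> exists2 r : R, 0 < r & \det G = r%:C.
Proof.
move=> Gp; have [Gh _] := Gp; rewrite hermP in Gh; move/eqP: Gh => Gh.
have [U [e [UU UG]]] := herm_diag Gh; have e0 := posdef_diag Gp UU UG.
exists (\prod_i e i); first by apply: prodr_gt0 => i _.
have := congr1 determinant UG; rewrite !det_mulmx mulrAC unitary_det// mul1r => ->.
by rewrite det_diag rmorph_prod; apply: eq_bigr => i _; rewrite mxE.
Qed.

Lemma row_free_det (E : 'M[C]_(n, m)) (h : 'M[R]_m) : \det (frame_form E h) != 0 -> row_free E.
Proof.
rewrite -unitfE -unitmxE => /mxrank_unit r.
rewrite /row_free eqn_leq rank_leq_row -{1}r /frame_form -mulmxA; exact: mxrankM_maxl.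
Qed.

End RealForm.

(** * The equation in real form *)

Section PointwiseEquation.
Variables (R : realType) (n : nat) (M : almost_hermitian R n) (T : mixed_field M).
Local Open Scope complex_scope.
Local Open Scope ring_scope.
Notation C := (R[i]).
Notation "A ^H" := ((conjM A)^T) (at level 8, format "A ^H").
Notation ii := ('i%C : C).
Notation m := (n + n)%N.
Implicit Types (a b : mindex M) (p q : M) (c u f : M -> R) (v w x : 'rV[R]_m) (X : 'M[R]_(n, m)).

Definition chris a p (s : 'I_m) : 'M[R]_m := \matrix_(i, j) christoffel a p s i j.
Definition TRe a p (s : 'I_m) : 'M[R]_m := \matrix_(k, l) complex.Re (T a p k l 0 s).
Definition TIm a p (s : 'I_m) : 'M[R]_m := \matrix_(k, l) complex.Im (T a p k l 0 s).

(* The first order part of the linearised operator, including the Christoffel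
   terms of the Hessian. *)
Definition bmat a p s : 'M[R]_m := let J := acs a p in
  - chris a p s - J *m chris a p s *m J^T + TRe a p s + J *m TRe a p s *m J^T +
  J *m TIm a p s - TIm a p s *m J^T.

(** The diagonal entry of the matrix of the equation on the frame vector x - i J x, as a real
    quadratic form in x. *)
Definition omf a p c x : R := bil (hmat a c p) x x + bil (hmat a c p) (x *m acs a p) (x *m acs a p) +
  2 * bil (metric a p) x x + \sum_s pderiv a s c p * bil (bmat a p s) x x.

Definition DG a p X : R := complex.Re (\det (frame_form (cfr (acs a p) X) (metric a p))).

Lemma hess_chris a c p : hess a c p = hmat a c p - \sum_s pderiv a s c p *: chris a p s.
Proof.
apply/matrixP => i j; rewrite !mxE summxE; congr (_ - _).
by apply: eq_bigr => s _; rewrite !mxE mulrC.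
Qed.

Lemma cfr_frame a p X : dom a p -> row_free (cfr (acs a p) X) -> is_frame a p (cfr (acs a p) X).
Proof. by move=> ap Xf; split=> //; apply: cfr_eig; exact: acs_sqr. Qed.

Lemma frame_form_sq a p X (h : 'M[R]_m) i :
  frame_form (cfr (acs a p) X) h i i =
  (bil h (row i X) (row i X) + bil h (row i X *m acs a p) (row i X *m acs a p)) +i*
  (bil h (row i X) (row i X *m acs a p) - bil h (row i X *m acs a p) (row i X)).
Proof. by rewrite frame_form_cfr row_mul. Qed.

Definition TA a p c : 'M[R]_m := \sum_s pderiv a s c p *: TRe a p s.
Definition TB a p c : 'M[R]_m := \sum_s pderiv a s c p *: TIm a p s.

(** Pairing the components of T(e_i, conj e_j) in the basis e_p, conj e_p with the derivatives along
    that basis is evaluating dc on this vector, which can be done in real coordinates. *)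
Lemma ma_matrixE a p c (E : 'M[C]_(n, m)) : dom a p -> is_frame a p E ->
  ma_matrix T a p E c = E *m (toC (metric a p + hess a c p + TA a p c) + ii *: toC (TB a p c)) *m E^H.
Proof.
move=> ap [Ef EJ]; have JJ := acs_sqr ap; have Cu := col_frame_unit Ef EJ.
have comp (w : 'rV[C]_m) (du : 'cV[C]_m) :
    \sum_q comp10 E w q * (E *m du) q 0 + \sum_q comp01 E w q * (conjM E *m du) q 0 = (w *m du) 0 0.
  pose l := lsubmx (w *m invmx (col_mx E (conjM E))).
  pose r := rsubmx (w *m invmx (col_mx E (conjM E))).
  have wE : w = l *m E + r *m conjM E by rewrite -mul_row_col hsubmxK mulmxKV.
  rewrite /comp10 /comp01 -/l -/r; move: l r wE => l r ->.
  by rewrite mulmxDl -!mulmxA [RHS]mxE; congr (_ + _); rewrite [RHS]mxE; apply: eq_bigr.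
pose du := toC (differential a c p).
have theta i j : (T_frame T a p E i j *m du) 0 0 = (E *m (toC (TA a p c) + ii *: toC (TB a p c)) *m E^H) i j.
  have thetakl k l : (T a p k l *m du) 0 0 = (toC (TA a p c) + ii *: toC (TB a p c)) k l.
    rewrite [LHS]mxE [RHS]mxE [X in _ = X + _]mxE [X in _ = _ + X]mxE [toC (TB _ _ _) _ _]mxE.
    rewrite /TA /TB !summxE !rmorph_sum /= mulr_sumr -big_split; apply: eq_bigr => s _.
    rewrite /= !mxE /=; case: (T a p k l 0 s) => t1 t2; simpc.
    by congr (_ +i* _); rewrite /= mulrC.
  rewrite /T_frame mulmx_suml summxE [RHS]mxE.
  under [RHS]eq_bigr do rewrite mxE mulr_suml.
  rewrite [RHS]exchange_big; apply: eq_bigr => k _.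
  rewrite mulmx_suml summxE; apply: eq_bigr => l _.
  by rewrite -scalemxAl mxE thetakl [E^H _ _]mxE [conjM E _ _]mxE; ring.
apply/matrixP => i j; rewrite /ma_matrix.
have -> : forall (P Q S : 'M[C]_n), (P + Q + S) i j = P i j + Q i j + S i j by move=> P Q S; rewrite !mxE.
rewrite [X in _ + X]mxE /T10 /T01 /e_der /ebar_der comp -/du theta /frame_form.
rewrite !toCD -[_ + _ + ii *: _]addrA !mulmxDr !mulmxDl.
have -> : forall (P Q S : 'M[C]_n), (P + Q + S) i j = P i j + Q i j + S i j by move=> P Q S; rewrite !mxE.
by rewrite -mulmxDl -mulmxDr.
Qed.

Lemma ma_matrix_re a p c X i : dom a p -> row_free (cfr (acs a p) X) ->
  complex.Re (ma_matrix T a p (cfr (acs a p) X) c i i) = omf a p c (row i X).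
Proof.
move=> ap Xf; set J := acs a p; set E := cfr J X.
rewrite ma_matrixE//; last exact: cfr_frame.
rewrite mulmxDr mulmxDl -scalemxAr -scalemxAl -!/(frame_form E _).
have -> : forall (P Q : 'M[C]_n), (P + ii *: Q) i i = P i i + ii * Q i i by move=> P Q; rewrite !mxE.
rewrite !frame_form_sq -/J.
set x := row i X; set y := x *m J.
have gy : bil (metric a p) y y = bil (metric a p) x x.
  by rewrite /y bil_mull bil_mulr metric_acs.
have zE (w z : 'rV[R]_m) : bil (\sum_s pderiv a s c p *: chris a p s) w z =
    \sum_s pderiv a s c p * bil (chris a p s) w z.
  by rewrite bil_sum; apply: eq_bigr => s _; rewrite bilZ.
rewrite /omf -/J -/y.
have -> : \sum_s pderiv a s c p * bil (bmat a p s) x x =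
   - (\sum_s pderiv a s c p * bil (chris a p s) x x) - (\sum_s pderiv a s c p * bil (chris a p s) y y)
   + bil (TA a p c) x x + bil (TA a p c) y y + bil (TB a p c) y x - bil (TB a p c) x y.
  rewrite /TA /TB !bil_sum -!sumrN -!big_split; apply: eq_bigr => s _ /=.
  rewrite /bmat -/J !bilD !bilN -!bil_mulr -!bil_mull -/y !bilZ.
  by ring.
by simpc; rewrite !bilD gy hess_chris !bilB !zE /=; ring.
Qed.

Lemma frame_posdef a p X : dom a p -> row_free (cfr (acs a p) X) ->
  herm_posdef (frame_form (cfr (acs a p) X) (metric a p)).
Proof.
move=> ap; apply: posdef_real_form; first exact: Defs.metric_sym.
by move=> v v0; exact: metric_pos.
Qed.

Lemma DG_gt0 a p X : dom a p -> row_free (cfr (acs a p) X) ->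
  0 < DG a p X /\ \det (frame_form (cfr (acs a p) X) (metric a p)) = (DG a p X)%:C.
Proof. by move=> ap /(frame_posdef ap)/det_posdef[r r0 rE]; rewrite /DG rE. Qed.

Definition gram a p X : 'M[R]_m :=
  col_mx X (X *m acs a p) *m metric a p *m (col_mx X (X *m acs a p))^T.

Lemma DG_gram a p X : dom a p -> row_free (cfr (acs a p) X) ->
  DG a p X ^+ 2 = 4 ^+ n * \det (gram a p X).
Proof.
move=> ap Xf; rewrite -(det_gram (acs_sqr ap) _ (Defs.metric_sym ap) (metric_acs ap)).
have [_ ->] := DG_gt0 ap Xf.
by rewrite /normsq /= expr0n addr0.
Qed.

Lemma gram_row_free a p X : dom a p -> \det (gram a p X) != 0 -> row_free (cfr (acs a p) X).
Proof.
move=> ap G0; apply: (@row_free_det _ _ _ (metric a p)).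
apply/eqP => d0; have := det_gram (acs_sqr ap) X (Defs.metric_sym ap) (metric_acs ap).
rewrite d0 /normsq /= expr0n addr0 => /esym/eqP.
by rewrite mulf_eq0 (negbTE G0) orbF expf_eq0 pnatr_eq0 andbF.
Qed.

Lemma posdef_entry (W : 'M[C]_n) i : herm_posdef W -> 0 < complex.Re (W i i).
Proof.
move=> [_ /(_ (delta_mx 0 i))].
have -> : (conjM (delta_mx 0 i : 'rV[C]_n))^T = delta_mx i 0.
  apply/matrixP => k l; rewrite !mxE andbC.
  by case: (_ && _); rewrite ?rmorph1 ?rmorph0.
rewrite -rowE -colE => h; have : 0 < W i i.
  have := h _; rewrite !mxE; apply.
  by apply/eqP => /rowP/(_ i); rewrite !mxE !eqxx => /eqP; rewrite oner_eq0.
by rewrite ltcE => /andP[].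
Qed.

Lemma agm_point f c a p X : ma_solution T f c -> (0 < n)%N -> dom a p ->
  row_free (cfr (acs a p) X) ->
  (forall i, 0 < omf a p c (row i X)) /\
  f p * DG a p X <= (n%:R^-1 * \sum_i omf a p c (row i X)) ^+ n.
Proof.
move=> sol n0 ap Xf; have Ef := cfr_frame ap Xf; have [dE Wp] := sol a p _ ap Ef.
split=> [i|].
  by rewrite -(ma_matrix_re _ _ ap Xf); exact: posdef_entry.
have := AMGM n0 Wp; rewrite dE; have [_ ->] := DG_gt0 ap Xf.
rewrite -rmorphM /=; under eq_bigr do rewrite (ma_matrix_re _ _ ap Xf).
by [].
Qed.

Lemma root_expn (r : R) : (0 < n)%N -> 0 < r -> (r `^ n%:R^-1) ^+ n = r.
Proof.
move=> n0 r0; rewrite -powR_mulrn ?powR_ge0// -powRrM mulVf ?powRr1 ?ltW//.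
by rewrite pnatr_eq0 -lt0n.
Qed.

(** The frame that turns W into the identity and g into a diagonal matrix; sg_i^2 are the
    eigenvalues of g relative to W. The arithmetic-geometric mean inequality for W is an equality on
    it, and the same inequality for g bounds the sum of the sg_i^2 from below. *)
Lemma normal_frame f c a p : ma_solution T f c -> (0 < n)%N -> 0 < f p -> dom a p ->
  exists X, exists sg : 'I_n -> R,
  [/\ row_free (cfr (acs a p) X), forall i, 0 < sg i, forall i, omf a p c (row i X) = 1,
      forall i j, bil (metric a p) (row i X) (row j X) = 2^-1 * sg i ^+ 2 *+ (i == j) &
      forall i j, bil (metric a p) (row i X) (row j X *m acs a p) = 0] /\
  [/\ DG a p X = \prod_i sg i ^+ 2, f p * \prod_i sg i ^+ 2 = 1 &
      n%:R / (f p `^ n%:R^-1) <= \sum_i sg i ^+ 2].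
Proof.
move=> sol n0 f0 ap; have JJ := acs_sqr ap.
have [X0 X0f] := frame_exists JJ.
have Ef0 := cfr_frame ap X0f; have [dE Wp] := sol a p _ ap Ef0.
have Gp := frame_posdef ap X0f.
have [A [gam [AW AG Au gam0]]] := simul_diag Wp Gp.
have EJ : A *m cfr (acs a p) X0 *m toC (acs a p) = ii *: (A *m cfr (acs a p) X0).
  by rewrite -mulmxA (cfr_eig JJ) scalemxAr.
have XE := frame_cfr EJ; set X := reM _ in XE.
have Xf : row_free (cfr (acs a p) X) by rewrite -XE /row_free mxrankMfree// mxrank_unit.
have Ef := cfr_frame ap Xf; have [dX _] := sol a p _ ap Ef.
have WX : ma_matrix T a p (cfr (acs a p) X) c = 1%:M.
  rewrite ma_matrixE// -XE ctrM !mulmxA.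
  have -> : forall (Z : 'M[C]_m) (E : 'M[C]_(n, m)), A *m E *m Z *m E^H *m A^H = A *m (E *m Z *m E^H) *m A^H.
    by move=> Z E; rewrite !mulmxA.
  by rewrite -ma_matrixE.
have GX : frame_form (cfr (acs a p) X) (metric a p) = diag_mx (\row_i (gam i)%:C).
  by rewrite -XE frame_form_mul.
have sE i : Num.sqrt (gam i) ^+ 2 = gam i by rewrite sqr_sqrtr// ltW.
have gJ (x y : 'rV[R]_m) : bil (metric a p) (x *m acs a p) (y *m acs a p) = bil (metric a p) x y.
  by rewrite bil_mull bil_mulr metric_acs.
have entry i j : bil (metric a p) (row i X) (row j X) = 2^-1 * gam i *+ (i == j) /\
    bil (metric a p) (row i X) (row j X *m acs a p) = 0.
  have := congr1 (fun W : 'M[C]_n => W i j) GX; rewrite frame_form_cfr !row_mul gJ !mxE.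
  set x := row i X; set y := row j X.
  have -> : bil (metric a p) (x *m acs a p) y = - bil (metric a p) x (y *m acs a p).
    by rewrite -(gJ x) -mulmxA JJ mulmxN mulmx1 bilNr opprK.
  have -> : (gam i)%:C *+ (i == j) = (gam i *+ (i == j))%:C by rewrite rmorphMn.
  case; rewrite opprK -!mulr2n => h1 h2; split; last first.
    by apply/eqP; move/eqP: h2; rewrite mulrn_eq0.
  by rewrite -mulrnAr -h1 mulr2n; lra.
have DE : DG a p X = \prod_i gam i.
  by rewrite /DG GX det_diag; under eq_bigr do rewrite mxE; rewrite -rmorph_prod.
have fg : f p * \prod_i gam i = 1.
  have := dX; rewrite WX det1; have [_ ->] := DG_gt0 ap Xf.
  by rewrite -rmorphM -DE => /(congr1 (@complex.Re R)) /= <-.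
exists X, (fun i => Num.sqrt (gam i)); split; split=> //.
- by move=> i; rewrite sqrtr_gt0.
- by move=> i; rewrite -(ma_matrix_re _ _ ap Xf) WX mxE eqxx.
- by move=> i j; rewrite sE; case: (entry i j).
- by move=> i j; case: (entry i j).
- by under eq_bigr do rewrite sE.
- by under eq_bigr do rewrite sE.
under eq_bigr do rewrite sE.
set F := f p `^ _; have F0 : 0 < F by rewrite powR_gt0.
have n0' : 0 < (n%:R : R) by rewrite ltr0n.
have k := AMGM n0 (frame_posdef ap Xf).
have {}k : \prod_i gam i <= (n%:R^-1 * \sum_i gam i) ^+ n.
  rewrite -DE /DG; apply: le_trans k _; rewrite GX.
  by under eq_bigr do rewrite !mxE eqxx mulr1n.
have S0 : 0 <= n%:R^-1 * \sum_i gam i.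
  by rewrite mulr_ge0 ?invr_ge0 ?ler0n// sumr_ge0// => i _; exact: ltW.
have : F^-1 <= n%:R^-1 * \sum_i gam i.
  rewrite -(@ler_pXn2r _ n)// ?nnegrE// ?invr_ge0 ?(ltW F0)//.
  apply: le_trans k; rewrite exprVn root_expn//.
  have -> : (f p)^-1 = \prod_i gam i by apply: (mulfI (lt0r_neq0 f0)); rewrite fg divff ?lt0r_neq0.
  exact: lexx.
by rewrite ler_pdivlMl// mulrC.
Qed.

End PointwiseEquation.

(** * Jets along coordinate rays *)

Section TwoSidedJets.
Variable R : realType.
Let FF : Filter (nbhs (0 : R)) := nbhs_filter 0.
Let Fid : forall P : R -> Prop, (\forall t \near (0 : R), P t) -> \forall t \near (0 : R), P t :=
  fun P h => h.
Notation j2 := (jet2 (nbhs (0 : R))).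
Notation mj := (mjet (nbhs (0 : R))).

Lemma bil_jet2 k l (A : R -> 'M[R]_(k, l)) (u : R -> 'rV[R]_k) (w : R -> 'rV[R]_l) A0 A1 A2 u0 u1 u2 w0 w1 w2 :
  mj A A0 A1 A2 -> mj u u0 u1 u2 -> mj w w0 w1 w2 ->
  j2 (fun t => bil (A t) (u t) (w t)) (bil A0 u0 w0)
    (bil A1 u0 w0 + bil A0 u1 w0 + bil A0 u0 w1)
    (bil A2 u0 w0 + bil A1 u1 w0 + bil A1 u0 w1 + bil A0 u2 w0 + bil A0 u1 w1 + bil A0 u0 w2).
Proof.
move=> jA ju jw.
have j := mjetM (FF := FF) Fid (mjetM (FF := FF) Fid ju jA) (mjetT (FF := FF) jw).
have mD (S S' : 'M[R]_(1, 1)) : (S + S') 0 0 = S 0 0 + S' 0 0 by rewrite mxE.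
apply: (jet2_eq (j 0 0)) => //.
- by rewrite !mulmxDl !mD /bil; ring.
- by rewrite !mulmxDl !mD /bil; ring.
Qed.

Lemma quad_jet2 k (A : R -> 'M[R]_k) (u : R -> 'rV[R]_k) A0 A1 A2 u0 u1 u2 :
  mj A A0 A1 A2 -> mj u u0 u1 u2 ->
  j2 (fun t => bil (A t) (u t) (u t)) (bil A0 u0 u0) (b1c A0 A1 u0 u1) (b2c A0 A1 A2 u0 u1 u2).
Proof.
move=> jA ju; apply: (jet2_eq (bil_jet2 jA ju ju)) => //.
- by rewrite /b1c; ring.
- by rewrite /b2c; ring.
Qed.

End TwoSidedJets.

Section InteriorJets.
Variables (R : realType) (n : nat) (M : almost_hermitian R n) (a : mindex M) (p : M).
Notation m := (n + n)%N.
Hypothesis ap : dom a p.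
Hypothesis inner : forall v : 'rV[R]_m, \forall t \near (0 : R), half_space (crd a p + t *: v).
Let FF : Filter (nbhs (0 : R)) := nbhs_filter 0.
Let Fid : forall P : R -> Prop, (\forall t \near (0 : R), P t) -> \forall t \near (0 : R), P t :=
  fun P h => h.
Notation j2 := (jet2 (nbhs (0 : R))).
Notation mj := (mjet (nbhs (0 : R))).
Implicit Types (c : M -> R) (v w : 'rV[R]_m).

(* The coefficients of t and t^2 of A along the coordinate ray p + t v. *)
Definition mx1 {k l} (A : M -> 'M[R]_(k, l)) v : 'M[R]_(k, l) :=
  \matrix_(i, j) (v *m differential a (fun q => A q i j) p) 0 0.
Definition mx2 {k l} (A : M -> 'M[R]_(k, l)) v : 'M[R]_(k, l) :=
  \matrix_(i, j) (2^-1 * bil (hmat a (fun q => A q i j) p) v v).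
Definition smooth_mx {k l} (A : M -> 'M[R]_(k, l)) : Prop :=
  forall i j, smooth_at a p (fun q => A q i j).

Lemma ray_mjet k l (A : M -> 'M[R]_(k, l)) v : smooth_mx A ->
  mj (fun t => A (ray a p v t)) (A p) (mx1 A v) (mx2 A v).
Proof.
move=> sA i j; rewrite [mx1 _ _ _ _]mxE [mx2 _ _ _ _]mxE.
exact: (ray_jet' (FF := FF) Fid ap (sA i j) (inner v)).
Qed.

Lemma smooth_hmat c : smooth_at a p c -> smooth_mx (hmat a c).
Proof.
move=> sc i j; apply: smooth_at_eq ap _ (pderiv_smooth i ap (pderiv_smooth j ap sc)) => q _.
by rewrite mxE.
Qed.

Lemma smooth_dif c : smooth_at a p c -> smooth_mx (fun q => (differential a c q)^T).
Proof.
move=> sc i j; apply: smooth_at_eq ap _ (pderiv_smooth j ap sc) => q _.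
by rewrite !mxE.
Qed.

Lemma mx1_hmatE c v i j : mx1 (hmat a c) v i j = \sum_s v 0 s * pderiv a s (pderiv a i (pderiv a j c)) p.
Proof.
rewrite /mx1 !mxE; apply: eq_bigr => s _; rewrite mxE; congr (_ * _).
by apply: pderiv_eq_dom => // q _; rewrite mxE.
Qed.

Lemma dif_jet c v : smooth_at a p c ->
  mj (fun t => (differential a c (ray a p v t))^T) (differential a c p)^T
    (v *m hmat a c p) (2^-1 *: (v *m mx1 (hmat a c) v)).
Proof.
move=> sc; apply: (mjet_eq (ray_mjet v (smooth_dif sc))) => //.
  apply/matrixP => i j; rewrite ord1 /mx1 !mxE; apply: eq_bigr => s _; rewrite !mxE; congr (_ * _).
  by apply: pderiv_eq_dom => // q _; rewrite !mxE.
apply/matrixP => i j; rewrite ord1 /mx2 !mxE; congr (_ * _); rewrite bilE exchange_big.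
apply: eq_bigr => s _; rewrite mx1_hmatE mulr_sumr; apply: eq_bigr => s' _.
rewrite mulrCA mulrA mxE; congr (_ * _).
apply: pderiv_eq_dom => // q; rewrite inE => aq.
by apply: pderiv_eq_dom => // r _; rewrite !mxE.
Qed.

Lemma mx1_hmatC c u v w : smooth_at a p c ->
  bil (mx1 (hmat a c) u) v w = bil (mx1 (hmat a c) v) u w.
Proof.
move=> sc; rewrite !bilE.
transitivity (\sum_i \sum_s \sum_j v 0 i * u 0 s * w 0 j * pderiv a s (pderiv a i (pderiv a j c)) p).
  apply: eq_bigr => i _; rewrite exchange_big; apply: eq_bigr => j _.
  by rewrite mx1_hmatE mulr_sumr; apply: eq_bigr => s _; ring.
rewrite exchange_big; apply: eq_bigr => s _.
rewrite exchange_big; apply: eq_bigr => j _.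
rewrite mx1_hmatE mulr_sumr; apply: eq_bigr => i _.
rewrite (pderivC i s ap (pderiv_smooth j ap sc)); ring.
Qed.

Lemma mx1_hmatT c v : (forall q, dom a q -> smooth_at a q c) -> (mx1 (hmat a c) v)^T = mx1 (hmat a c) v.
Proof.
move=> sc; apply/matrixP => i j; rewrite [_^T _ _]mxE mx1_hmatE mx1_hmatE.
apply: eq_bigr => s _; apply: congr1.
apply: (pderiv_eq_dom s ap) => q; rewrite inE => aq; exact: (pderivC j i aq (sc q aq)).
Qed.

Lemma mx2_hmatE c v i j : 2 * mx2 (hmat a c) v i j =
  \sum_s \sum_t v 0 s * v 0 t * pderiv a s (pderiv a t (pderiv a i (pderiv a j c))) p.
Proof.
rewrite [mx2 _ _ _ _]mxE mulrA divff ?mul1r ?pnatr_eq0// bilE.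
apply: eq_bigr => s _; apply: eq_bigr => t _; rewrite [hmat _ _ _ _ _]mxE; congr (_ * _).
apply: pderiv_eq_dom => // q; rewrite inE => aq.
by apply: pderiv_eq_dom => // r _; rewrite mxE.
Qed.

Lemma pderiv_congr i q (F G : M -> R) : dom a q -> (forall r, dom a r -> F r = G r) ->
  pderiv a i F q = pderiv a i G q.
Proof. by move=> aq FG; apply: (pderiv_eq_dom i aq) => r; rewrite inE => ar; exact: FG. Qed.

Lemma pderiv4C c s t i j : (forall q, dom a q -> smooth_at a q c) ->
  pderiv a s (pderiv a t (pderiv a i (pderiv a j c))) p =
  pderiv a i (pderiv a j (pderiv a s (pderiv a t c))) p.
Proof.
move=> sc; have s1 k q : dom a q -> smooth_at a q (pderiv a k c).
  by move=> aq; exact: (pderiv_smooth k aq (sc q aq)).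
have s2 k l q : dom a q -> smooth_at a q (pderiv a k (pderiv a l c)).
  by move=> aq; exact: (pderiv_smooth k aq (s1 l q aq)).
transitivity (pderiv a s (pderiv a i (pderiv a t (pderiv a j c))) p).
  by apply: (pderiv_congr s ap) => q aq; exact: (pderivC t i aq (s1 j q aq)).
transitivity (pderiv a i (pderiv a s (pderiv a t (pderiv a j c))) p).
  exact: (pderivC s i ap (s2 t j p ap)).
transitivity (pderiv a i (pderiv a s (pderiv a j (pderiv a t c))) p).
  apply: (pderiv_congr i ap) => q aq; apply: (pderiv_congr s aq) => r ar.
  exact: (pderivC t j ar (sc r ar)).
by apply: (pderiv_congr i ap) => q aq; exact: (pderivC s j aq (s1 t q aq)).
Qed.

Lemma sum4C (I : finType) (F : I -> I -> I -> I -> R) :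
  \sum_i \sum_j \sum_s \sum_t F i j s t = \sum_s \sum_t \sum_i \sum_j F i j s t.
Proof.
under eq_bigr do rewrite exchange_big /=.
rewrite exchange_big; apply: eq_bigr => s _.
by under eq_bigr do rewrite exchange_big /=; rewrite exchange_big.
Qed.

Lemma mx2_hmatC c v w : (forall q, dom a q -> smooth_at a q c) ->
  bil (mx2 (hmat a c) v) w w = bil (mx2 (hmat a c) w) v v.
Proof.
move=> sc.
pose d4 i j s t := pderiv a s (pderiv a t (pderiv a i (pderiv a j c))) p.
have E x y : 2 * bil (mx2 (hmat a c) x) y y = \sum_i \sum_j \sum_s \sum_t
    y 0 i * y 0 j * (x 0 s * x 0 t) * d4 i j s t.
  rewrite bilE mulr_sumr; apply: eq_bigr => i _; rewrite mulr_sumr; apply: eq_bigr => j _.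
  rewrite mulrCA mx2_hmatE mulr_sumr; apply: eq_bigr => s _; rewrite mulr_sumr.
  by apply: eq_bigr => t _; rewrite mulrA.
have dC i j s t : d4 i j s t = d4 s t i j by exact: pderiv4C.
suff : 2 * bil (mx2 (hmat a c) v) w w = 2 * bil (mx2 (hmat a c) w) v v by move=> h; lra.
rewrite !E; move: d4 dC {E} => d4 dC; rewrite sum4C; apply: eq_bigr => s _; apply: eq_bigr => t _.
by apply: eq_bigr => i _; apply: eq_bigr => j _; rewrite dC; ring.
Qed.

End InteriorJets.

Section SmoothMatrices.
Variables (R : realType) (n : nat) (M : almost_hermitian R n) (T : mixed_field M) (a : mindex M) (p : M).
Notation m := (n + n)%N.
Hypothesis ap : dom a p.
Hypothesis Ts : is_smooth_tensor T.

Lemma smooth_mxD k l (A B : M -> 'M[R]_(k, l)) : smooth_mx a p A -> smooth_mx a p B ->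
  smooth_mx a p (fun q => A q + B q).
Proof.
move=> sA sB i j; apply: smooth_at_eq ap _ (smooth_atD (sA i j) (sB i j)) => q _.
by rewrite mxE.
Qed.

Lemma smooth_mxN k l (A : M -> 'M[R]_(k, l)) : smooth_mx a p A -> smooth_mx a p (fun q => - A q).
Proof. by move=> sA i j; apply: smooth_at_eq ap _ (smooth_atN (sA i j)) => q _; rewrite mxE. Qed.

Lemma smooth_mxT k l (A : M -> 'M[R]_(k, l)) : smooth_mx a p A -> smooth_mx a p (fun q => (A q)^T).
Proof. by move=> sA i j; apply: smooth_at_eq ap _ (sA j i) => q _; rewrite mxE. Qed.

Lemma smooth_mxM k l r (A : M -> 'M[R]_(k, l)) (B : M -> 'M[R]_(l, r)) :
  smooth_mx a p A -> smooth_mx a p B -> smooth_mx a p (fun q => A q *m B q).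
Proof.
move=> sA sB i j.
apply: smooth_at_eq ap _ (smooth_at_sum (index_enum _) (fun s => smooth_atM (sA i s) (sB s j))) => q _.
by rewrite mxE.
Qed.

Lemma mx1_sym k (A : M -> 'M[R]_k) v : (forall q, dom a q -> (A q)^T = A q) ->
  (mx1 a p A v)^T = mx1 a p A v.
Proof.
move=> sA; apply/matrixP => i j; rewrite [_^T _ _]mxE [LHS]mxE [RHS]mxE -!sum_differential.
apply: eq_bigr => s _; apply: congr1.
by apply: (pderiv_eq_dom s ap) => q; rewrite inE => aq; rewrite -[in RHS](sA q aq) mxE.
Qed.

Lemma smooth_mx_metric : smooth_mx a p (metric a). Proof. by move=> i j; exact: smooth_at_metric. Qed.
Lemma smooth_mx_acs : smooth_mx a p (acs a). Proof. by move=> i j; exact: smooth_at_acs. Qed.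
Lemma smooth_mx_ginv : smooth_mx a p (fun q => invmx (metric a q)).
Proof. by move=> i j; exact: smooth_at_ginv. Qed.

Lemma smooth_mx_chris s : smooth_mx a p (chris a ^~ s).
Proof.
move=> i j.
have sm k i' j' := pderiv_smooth k ap (smooth_at_metric i' j' ap).
have st l : smooth_at a p (fun q => invmx (metric a q) s l *
    (pderiv a i (fun q => metric a q j l) q + pderiv a j (fun q => metric a q i l) q +
     - pderiv a l (fun q => metric a q i j) q)).
  apply: (smooth_atM (smooth_at_ginv s l ap)).
  by apply: smooth_atD; [exact: smooth_atD|exact: smooth_atN].
apply: smooth_at_eq ap _ (smooth_atM (smooth_at_cst a p 2^-1) (smooth_at_sum (index_enum _) st)) => q _.
by rewrite mxE.
Qed.

Lemma smooth_mx_T s : smooth_mx a p (TRe T a ^~ s) /\ smooth_mx a p (TIm T a ^~ s).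
Proof.
by split=> i j; have [Ts1 _] := Ts; have [sr si] := Ts1 a i j s;
  [apply: smooth_at_eq ap _ (smooth_in_at sr ap)|apply: smooth_at_eq ap _ (smooth_in_at si ap)] => q _; rewrite mxE.
Qed.

Lemma smooth_mx_bmat s : smooth_mx a p (bmat T a ^~ s).
Proof.
have sJ := smooth_mx_acs; have sG := smooth_mx_chris s; have [sR sI] := smooth_mx_T s.
have sJT := smooth_mxT sJ.
have JX (A : M -> 'M[R]_m) : smooth_mx a p A -> smooth_mx a p (fun q => acs a q *m A q *m (acs a q)^T).
  by move=> sA; apply: (smooth_mxM (smooth_mxM sJ sA) sJT).
apply: (smooth_mxD (A := fun q => _) (B := fun q => - _)).
  apply: (smooth_mxD (A := fun q => _) (B := fun q => _)).
    apply: (smooth_mxD (A := fun q => _) (B := fun q => _)).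
      apply: (smooth_mxD (A := fun q => _) (B := fun q => _)) => //.
      apply: (smooth_mxD (A := fun q => - _) (B := fun q => - _)); first exact: smooth_mxN.
      exact: (smooth_mxN (JX _ sG)).
    exact: JX.
  exact: smooth_mxM sJ sI.
exact: (smooth_mxN (smooth_mxM sI sJT)).
Qed.

End SmoothMatrices.

(** * Jets of the test quantity and of the equation along coordinate rays *)

Section CurveJets.
Variables (R : realType) (n : nat) (M : almost_hermitian R n) (T : mixed_field M) (a : mindex M) (p : M).
Notation m := (n + n)%N.
Hypothesis ap : dom a p.
Hypothesis Ts : is_smooth_tensor T.
Hypothesis inner : forall v : 'rV[R]_m, \forall t \near (0 : R), half_space (crd a p + t *: v).
Variable phi : M -> R.
Hypothesis sphi : forall q, dom a q -> smooth_at a q phi.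
Variables (Vv : 'rV[R]_m) (X : 'M[R]_(n, m)) (sgm : 'I_n -> R) (la Fv ep cAv K0 : R).
Implicit Types (v w : 'rV[R]_m).
Let FF : Filter (nbhs (0 : R)) := nbhs_filter 0.
Let Fid : forall P : R -> Prop, (\forall t \near (0 : R), P t) -> \forall t \near (0 : R), P t :=
  fun P h => h.
Notation j2 := (jet2 (nbhs (0 : R))).
Notation mj := (mjet (nbhs (0 : R))).

Definition yfun q : R := expR (- (cAv * (phi q - K0))).
Definition efun q : R := ep * gradsq a phi q + yfun q.

Definition mk_cdata : cdata R n := {|
  cV := Vv; cX := fun i => row i X; sg := sgm; lam := la; F0 := Fv; eps := ep; cA := cAv;
  yy := yfun p; dd := (differential a phi p)^T;
  D2 := hmat a phi p; D3 := mx1 a p (hmat a phi); D4 := fun v => 2 *: mx2 a p (hmat a phi) v;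
  J0 := acs a p; J1 := mx1 a p (acs a); J2 := mx2 a p (acs a);
  g0 := metric a p; g1 := mx1 a p (metric a); g2 := mx2 a p (metric a);
  h0 := invmx (metric a p); h1 := mx1 a p (fun q => invmx (metric a q));
  h2 := mx2 a p (fun q => invmx (metric a q));
  G0 := chris a p; G1 := fun s => mx1 a p (chris a ^~ s); G2 := fun s => mx2 a p (chris a ^~ s);
  b0 := bmat T a p; b1 := fun s => mx1 a p (bmat T a ^~ s); b2 := fun s => mx2 a p (bmat T a ^~ s) |}.
Notation d := mk_cdata.

Lemma phi_jet v : j2 (fun t => phi (ray a p v t)) (phi p) (dot v (dd d)) (2^-1 * bil (D2 d) v v).
Proof.
apply: (jet2_eq (ray_jet' (FF := FF) Fid ap (sphi ap) (inner v))) => //.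
by rewrite mxE; apply: eq_bigr => s _; rewrite /= [_^T _ _]mxE.
Qed.

Lemma dphi_jet v : mj (fun t => (differential a phi (ray a p v t))^T) (dd d) (v *m D2 d)
  (2^-1 *: (v *m D3 d v)).
Proof. exact: dif_jet (sphi ap). Qed.

Lemma gradsq_jet v : j2 (fun t => gradsq a phi (ray a p v t)) (gradsq a phi p) (N1 d v) (N2 d v).
Proof.
have sym : (h0 d)^T = h0 d by exact: ginv_sym.
apply: (jet2_eq (quad_jet2 (ray_mjet ap inner v (smooth_mx_ginv ap)) (dphi_jet v))) => //.
- by rewrite /b1c /N1 (bil_sym (v *m _) _ sym) /=; ring.
have symh1 : (h1 d v)^T = h1 d v.
  by apply: mx1_sym => // q aq; exact: ginv_sym.
rewrite /b2c /N2 !bilZr !bilZl (bil_sym (v *m D3 d v) _ sym) (bil_sym (v *m D2 d) _ symh1) /=.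
by field.
Qed.

Lemma y_jet v : j2 (fun t => yfun (ray a p v t)) (yfun p) (y1 d v) (y2 d v).
Proof.
have j0 : j2 (fun t => - (cAv * (phi (ray a p v t) - K0))) _ _ _ :=
  jet2N (FF := FF) (jet2Z (FF := FF) Fid cAv (jet2D (FF := FF) (phi_jet v) (jet2_cst (FF := FF) (- K0)))).
apply: (jet2_eq (jet2_expR FF Fid j0)) => //.
- by rewrite /y1 /= /yfun; ring.
- by rewrite /y2 /= /yfun; field.
Qed.

Lemma e_jet v : j2 (fun t => efun (ray a p v t)) (efun p) (eta1 d v) (eta2 d v).
Proof. exact: (jet2D (FF := FF) (jet2Z (FF := FF) Fid ep (gradsq_jet v)) (y_jet v)). Qed.

Lemma row_jet1 v w : mj (fun t => v + t *: w) v w 0.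
Proof. exact: mjet_lin. Qed.

Lemma first_jet (A : 'I_m -> M -> 'M[R]_m) v (u : R -> 'rV[R]_m) u0 u1 u2 :
  (forall s, smooth_mx a p (A s)) -> mj u u0 u1 u2 ->
  j2 (fun t => \sum_s pderiv a s phi (ray a p v t) * bil (A s (ray a p v t)) (u t) (u t))
    (\sum_s dd d 0 s * bil (A s p) u0 u0)
    (\sum_s ((v *m D2 d) 0 s * bil (A s p) u0 u0 + dd d 0 s * b1c (A s p) (mx1 a p (A s) v) u0 u1))
    (\sum_s (2^-1 * (v *m D3 d v) 0 s * bil (A s p) u0 u0 +
      (v *m D2 d) 0 s * b1c (A s p) (mx1 a p (A s) v) u0 u1 +
      dd d 0 s * b2c (A s p) (mx1 a p (A s) v) (mx2 a p (A s) v) u0 u1 u2)).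
Proof.
move=> sA ju.
have h := @jet2_sum _ _ FF _ (index_enum _) xpredT _ _ _ _ (fun s _ =>
  jet2M (FF := FF) Fid (dphi_jet v 0 s) (quad_jet2 (ray_mjet ap inner v (sA s)) ju)).
apply: (jet2_eq (jet2_ext _ h)) => //.
- by move=> t; apply: eq_bigr => s _; rewrite !mxE.
- by apply: eq_bigr => s _; rewrite [X in X * _ + _ + _]mxE.
Qed.

Lemma P_jet v w : dom a p ->
  la = bil (hess a phi p) Vv Vv -> bil (metric a p) Vv Vv = 1 ->
  j2 (fun t => bil (hess a phi (ray a p v t)) (Vv + t *: w) (Vv + t *: w) -
     la * (expR (efun p - efun (ray a p v t)) *
       bil (metric a (ray a p v t)) (Vv + t *: w) (Vv + t *: w)))
  0 (Pb d v w) (Pc d v w).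
Proof.
move=> _ laE g1E; have jw := row_jet1 Vv w.
have jH := quad_jet2 (ray_mjet ap inner v (smooth_hmat ap (sphi ap))) jw.
have jG := first_jet v (fun s => smooth_mx_chris ap s) jw.
have jg := quad_jet2 (ray_mjet ap inner v (smooth_mx_metric ap)) jw.
have je := jet2_expR FF Fid (jet2D (FF := FF) (jet2_cst (FF := FF) (efun p)) (jet2N (FF := FF) (e_jet v))).
have h := jet2B (FF := FF) (jet2B (FF := FF) jH jG) (jet2Z (FF := FF) Fid la (jet2M (FF := FF) Fid je jg)).
apply: (jet2_eq (jet2_ext _ h)).
- move=> t; congr (_ - _); rewrite hess_chris bilB bil_sum; congr (_ - _).
  by apply: eq_bigr => s _; rewrite bilZ.
- rewrite subrr expR0 mul1r g1E mulr1 laE hess_chris bilB bil_sum.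
  apply/eqP; rewrite subr_eq0; apply/eqP; congr (_ - _).
  by apply: eq_bigr => s _; rewrite bilZ [dd d 0 s]mxE [differential _ _ _ _ _]mxE.
- rewrite subrr expR0 /Pb /= g1E sub0r.
  by move: (\sum_s _) (b1c _ _ _ _) (b1c _ _ _ _) (eta1 _ _) => x1 x2 x3 x4; ring.
- rewrite subrr expR0 /Pc /= g1E scalerA mulVf ?pnatr_eq0// scale1r.
  move: (\sum_s _) (b2c _ _ _ _ _ _) (b2c _ _ _ _ _ _) (b1c _ _ _ _) (eta1 _ _) (eta2 _ _).
  by move=> x1 x2 x3 x4 x5 x6; field.
Qed.

Lemma om_jet v (u : R -> 'rV[R]_m) u0 u1 u2 : mj u u0 u1 u2 ->
  j2 (fun t => omf T a (ray a p v t) phi (u t)) (om0 d u0 (u0 *m J0 d))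
    (om1 d v u0 u1 (u0 *m J0 d) (u1 *m J0 d + u0 *m J1 d v))
    (om2 d v u0 u1 u2 (u0 *m J0 d) (u1 *m J0 d + u0 *m J1 d v)
       (u2 *m J0 d + u1 *m J1 d v + u0 *m J2 d v)).
Proof.
move=> ju; have jH := ray_mjet ap inner v (smooth_hmat ap (sphi ap)).
have jJ := ray_mjet ap inner v (smooth_mx_acs ap).
have jw := mjetM (FF := FF) Fid ju jJ.
have jg := quad_jet2 (ray_mjet ap inner v (smooth_mx_metric ap)) ju.
have jb := first_jet v (fun s => smooth_mx_bmat ap Ts s) ju.
have h := jet2D (FF := FF) (jet2D (FF := FF) (jet2D (FF := FF) (quad_jet2 jH ju) (quad_jet2 jH jw))
  (jet2Z (FF := FF) Fid 2 jg)) jb.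
apply: (jet2_eq h) => //.
by rewrite /om2 /= !scalerA mulVf ?scale1r ?pnatr_eq0.
Qed.

End CurveJets.

(** * Differentiating the arithmetic-geometric mean inequality *)

Section BoundedJets.
Variable R : realType.
Let FF : Filter (nbhs (0 : R)) := nbhs_filter 0.
Let Fid : forall P : R -> Prop, (\forall t \near (0 : R), P t) -> \forall t \near (0 : R), P t :=
  fun P h => h.
Notation j2 := (jet2 (nbhs (0 : R))).
Implicit Types (K S : R) (F G : R -> R).

(** Jets along a ray of length scale S, with coefficients of orders 1, S and S^2. Sums, products and
    determinants keep this homogeneity, with constants that do not depend on S. *)
Definition bjet K S F : Prop := exists a b c, [/\ j2 F a b c, `|a| <= K, `|b| <= K * S & `|c| <= K * S ^+ 2].

Definition bmx K S {k l} (A : R -> 'M[R]_(k, l)) : Prop := forall i j, bjet K S (fun t => A t i j).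

Lemma bjet_ext K S F G : F =1 G -> bjet K S F -> bjet K S G.
Proof. by move=> FG [a [b [c [j ? ? ?]]]]; exists a, b, c; split=> //; exact: jet2_ext j. Qed.

Lemma bjet_cst K S c : 0 <= S -> `|c| <= K -> bjet K S (fun=> c).
Proof.
move=> S0 cK; have K0 : 0 <= K by apply: le_trans cK.
exists c, 0, 0; split=> //; first exact: (jet2_cst (FF := FF) c).
- by rewrite normr0 mulr_ge0.
- by rewrite normr0 mulr_ge0 ?sqr_ge0.
Qed.

Lemma bjet_le K K' S F : 0 <= S -> K <= K' -> bjet K S F -> bjet K' S F.
Proof.
move=> S0 KK [a [b [c [j ha hb hc]]]]; exists a, b, c; split=> //; first exact: le_trans KK.
- by apply: le_trans hb _; rewrite ler_wpM2r.
- by apply: le_trans hc _; rewrite ler_wpM2r ?sqr_ge0.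
Qed.

Lemma bjetD K K' S F G : bjet K S F -> bjet K' S G -> bjet (K + K') S (fun t => F t + G t).
Proof.
move=> [a [b [c [j ha hb hc]]]] [a' [b' [c' [j' ha' hb' hc']]]].
exists (a + a'), (b + b'), (c + c'); split; first exact: (jet2D (FF := FF) j j').
- by apply: le_trans (ler_normD _ _) _; exact: lerD.
- by apply: le_trans (ler_normD _ _) _; rewrite mulrDl lerD.
- by apply: le_trans (ler_normD _ _) _; rewrite mulrDl lerD.
Qed.

Lemma bjetM K K' S F G : 0 <= S -> bjet K S F -> bjet K' S G -> bjet (3 * (K * K')) S (fun t => F t * G t).
Proof.
move=> S0 [a [b [c [j ha hb hc]]]] [a' [b' [c' [j' ha' hb' hc']]]].
have K0 : 0 <= K by apply: le_trans ha.
have K'0 : 0 <= K' by apply: le_trans ha'.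
have KK : 0 <= K * K' by rewrite mulr_ge0.
have m1 (x y X Y : R) : `|x| <= X -> `|y| <= Y -> `|x * y| <= X * Y.
  by move=> hx hy; rewrite normrM ler_pM.
exists (a * a'), (b * a' + a * b'), (c * a' + b * b' + a * c'); split.
- exact: (jet2M (FF := FF) Fid j j').
- by apply: le_trans (m1 _ _ _ _ ha ha') _; lra.
- have := m1 _ _ _ _ hb ha'; have := m1 _ _ _ _ ha hb'.
  have := ler_normD (b * a') (a * b'); have : 0 <= K * K' * S by rewrite mulr_ge0.
  lra.
- have := m1 _ _ _ _ hc ha'; have := m1 _ _ _ _ hb hb'; have := m1 _ _ _ _ ha hc'.
  have := ler_normD (c * a' + b * b') (a * c'); have := ler_normD (c * a') (b * b').
  lra.
Qed.

Lemma bjet_sum K S (I : Type) (r : seq I) (F : I -> R -> R) : 0 <= S -> (forall i, bjet K S (F i)) ->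
  bjet ((size r)%:R * K) S (fun t => \sum_(i <- r) F i t).
Proof.
move=> S0 h; elim: r => [|i r IH].
  apply: (@bjet_ext _ _ (fun=> 0)) => [t|]; first by rewrite big_nil.
  by apply: bjet_cst => //; rewrite normr0 mul0r.
apply: (@bjet_ext _ _ (fun t => F i t + \sum_(j <- r) F j t)) => [t|]; first by rewrite big_cons.
by rewrite /= -addn1 natrD mulrDl mul1r addrC; apply: bjetD.
Qed.

Lemma bjet_prod K S (I : Type) (r : seq I) (F : I -> R -> R) : 0 <= S -> (forall i, bjet K S (F i)) ->
  bjet ((3 * K) ^+ size r) S (fun t => \prod_(i <- r) F i t).
Proof.
move=> S0 h; elim: r => [|i r IH].
  apply: (@bjet_ext _ _ (fun=> 1)) => [t|]; first by rewrite big_nil.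
  by apply: bjet_cst => //; rewrite normr1 expr0.
apply: (@bjet_ext _ _ (fun t => F i t * \prod_(j <- r) F j t)) => [t|]; first by rewrite big_cons.
by rewrite /= exprS -mulrA; apply: bjetM.
Qed.

Lemma bmxM K K' S k l r (A : R -> 'M[R]_(k, l)) (B : R -> 'M[R]_(l, r)) : 0 <= S ->
  bmx K S A -> bmx K' S B -> bmx ((size (index_enum 'I_l))%:R * (3 * (K * K'))) S (fun t => A t *m B t).
Proof.
move=> S0 hA hB i j.
have := bjet_sum (index_enum 'I_l) S0 (fun s => bjetM S0 (hA i s) (hB s j)).
apply: bjet_ext => t.
by rewrite mxE.
Qed.

Lemma bmxT K S k l (A : R -> 'M[R]_(k, l)) : bmx K S A -> bmx K S (fun t => (A t)^T).
Proof. by move=> h i j; apply: bjet_ext (h j i) => t; rewrite mxE. Qed.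

Lemma bjet_det (K : R) k : exists C : R, forall S (A : R -> 'M[R]_k), 0 <= S -> bmx K S A ->
  bjet C S (fun t => \det (A t)).
Proof.
(* The constant is left open and is produced by the Leibniz expansion, from K and the size of the
   matrix alone. *)
eexists => S A S0 hA.
apply: bjet_sum => // s; apply: bjetM => //.
  by apply: (bjet_cst (K := 1)) => //; rewrite normrX normrN1 expr1n.
by apply: bjet_prod => // i.
Qed.

Lemma bmx_mjet K S k l (A : R -> 'M[R]_(k, l)) A0 A1 A2 : mjet (nbhs (0 : R)) A A0 A1 A2 ->
  (forall i j, `|A0 i j| <= K) -> (forall i j, `|A1 i j| <= K * S) ->
  (forall i j, `|A2 i j| <= K * S ^+ 2) -> bmx K S A.
Proof. by move=> jA h0 h1 h2 i j; exists (A0 i j), (A1 i j), (A2 i j). Qed.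

Lemma jet2_near_pos (F : R -> R) b c : j2 F 1 b c -> \forall t \near (0 : R), 0 < F t.
Proof.
move=> jF; have h := jet2_lip (FF := FF) Fid jF.
have Kp : 0 < `|b| + `|c| + 1 by rewrite ltr_wpDl ?addr_ge0.
have sm : \forall t \near (0 : R), `|t| < (2 * (`|b| + `|c| + 1))^-1 by apply: nbhs0_lt; rewrite invr_gt0 mulr_gt0.
apply: filterS2 h sm => t h1 h2.
have : (`|b| + `|c| + 1) * `|t| <= 2^-1.
  by rewrite -ler_pdivlMl// -invfM mulrC ltW// mulrC.
by move: h1; rewrite ler_norml => /andP[]; lra.
Qed.

(* The scalar consequences of the two-jet of
   n ln F + ln |1 + t k|^2 + (1/2) ln R - n ln S being nonpositive. *)
Lemma agm_algebra (N ni w1 w2 k l r1 r2 x z : R) : 0 < N -> N * ni = 1 ->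
  N * w1 + 2 * k + 2^-1 * r1 - N * (ni * x) = 0 ->
  N * (w2 - w1 ^+ 2 / 2) + (k ^+ 2 + l ^+ 2 - (2 * k) ^+ 2 / 2) + 2^-1 * (r2 - r1 ^+ 2 / 2) -
    N * (ni * z - (ni * x) ^+ 2 / 2) <= 0 ->
  x = N * w1 + 2 * k + 2^-1 * r1 /\
  N * w2 + w1 * (2 * k + 2^-1 * r1) + l ^+ 2 - k ^+ 2 + 2^-1 * r2 - 4^-1 * r1 ^+ 2 <= z.
Proof.
move=> N0 Nni hb hc.
have ni0 : 0 <= ni by have -> : ni = N^-1; [apply: (mulfI (lt0r_neq0 N0)); rewrite Nni divff ?gt_eqF|rewrite invr_ge0 ltW].
have n1E : N * (ni * x) = x by rewrite mulrA Nni mul1r.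
have n2E : N * (ni * z) = z by rewrite mulrA Nni mul1r.
have xE : x = N * w1 + 2 * k + 2^-1 * r1 by lra.
split=> //.
have sq : 0 <= ni * (2 * k + 2^-1 * r1) ^+ 2 by rewrite mulr_ge0 ?sqr_ge0.
have xx : N * (ni * x) ^+ 2 = N * w1 ^+ 2 + 2 * w1 * (2 * k + 2^-1 * r1) + ni * (2 * k + 2^-1 * r1) ^+ 2.
  have -> : N * (ni * x) ^+ 2 = (N * ni) * (ni * x ^+ 2) by ring.
  rewrite Nni mul1r xE.
  have -> : ni * (N * w1 + 2 * k + 2^-1 * r1) ^+ 2 =
     (N * ni) * (N * w1 ^+ 2 + 2 * w1 * (2 * k + 2^-1 * r1)) + ni * (2 * k + 2^-1 * r1) ^+ 2 by ring.
  by rewrite Nni mul1r.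
lra.
Qed.

End BoundedJets.

Lemma mjet_ext (R : realType) (Fl : set_system R) {FF : Filter Fl} k l (A B : R -> 'M[R]_(k, l)) A0 A1 A2 :
  A =1 B -> mjet Fl A A0 A1 A2 -> mjet Fl B A0 A1 A2.
Proof. by move=> AB jA i j; apply: (jet2_ext _ (jA i j)) => t; rewrite AB. Qed.

Lemma ln_half (R : realType) (D r s : R) : 0 < D -> 0 < r -> 0 < s -> D ^+ 2 = r * s ^+ 2 ->
  ln D = 2^-1 * ln r + ln s.
Proof.
move=> D0 r0 s0 /(congr1 (@ln R)); rewrite lnM ?posrE ?exprn_gt0// !lnXn//; lra.
Qed.

Lemma agm_log (R : realType) (n : nat) (f k D S r s A B : R) :
  0 < f -> 0 < k -> 0 < D -> 0 < S -> 0 < r -> 0 < s ->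
  ln f = A -> ln s = - B -> D ^+ 2 = r * s ^+ 2 -> f * (k * D) <= S ^+ n ->
  A + ln k + 2^-1 * ln r - n%:R * ln S + - B <= 0.
Proof.
move=> f0 k0 D0 S0 r0 s0 fA sB DE h.
have : ln (f * (k * D)) <= ln (S ^+ n) by rewrite ler_ln ?posrE ?mulr_gt0 ?exprn_gt0.
by rewrite lnM ?posrE ?mulr_gt0// lnM ?posrE// lnXn// -mulr_natl fA (ln_half D0 r0 s0 DE) sB; lra.
Qed.

(** * The arithmetic-geometric mean inequality along curves of frames *)

Section AgmAlongCurves.
Variables (R : realType) (n : nat) (M : almost_hermitian R n) (T : mixed_field M).
Notation m := (n + n)%N.
Let FF : Filter (nbhs (0 : R)) := nbhs_filter 0.
Let Fid : forall P : R -> Prop, (\forall t \near (0 : R), P t) -> \forall t \near (0 : R), P t :=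
  fun P h => h.
Notation j2 := (jet2 (nbhs (0 : R))).

Lemma gram_scale (a : mindex M) p (X : 'M[R]_(n, m)) (sgm : 'I_n -> R) :
  (forall i, 0 < sgm i) ->
  \det (gram a p X) = (\prod_i sgm i ^+ 2) ^+ 2 *
    \det (gram a p (\matrix_i ((sgm i)^-1 *: row i X))).
Proof.
move=> s0; set X' := \matrix_i _.
pose D : 'M[R]_n := diag_mx (\row_i sgm i).
have XE : X = D *m X'.
  apply/row_matrixP => i; rewrite row_mul row_diag_mx -scalemxAl -rowE rowK mxE scalerA.
  by rewrite divff ?scale1r// gt_eqF.
have cE : col_mx X (X *m acs a p) = block_mx D 0 0 D *m col_mx X' (X' *m acs a p).
  by rewrite mul_block_col !mul0mx addr0 add0r [in LHS]XE mulmxA.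
have dD : \det (block_mx D 0 0 D) = \prod_i sgm i ^+ 2.
  rewrite det_ublock det_diag -expr2 -prodrXl; apply: eq_bigr => i _; by rewrite mxE.
rewrite /gram cE trmx_mul !mulmxA -[block_mx D 0 0 D *m _ *m _]mulmxA.
rewrite -[block_mx D 0 0 D *m _ *m _]mulmxA !det_mulmx !det_tr dD; ring.
Qed.

(** The rows X_i / sg_i have bounded entries whatever the values of sg_i, and the homogeneity of the
    Gram determinant restores the scales. The constant is therefore independent of the frame. *)
Lemma gram_jet (B : R) : exists C : R, 0 <= C /\ forall (a : mindex M) p (X : 'M[R]_(n, m)) (sgm : 'I_n -> R) v,
  dom a p -> (forall v : 'rV[R]_m, \forall t \near (0 : R), half_space (crd a p + t *: v)) ->
  (forall i, 0 < sgm i) -> (forall i, n1 (row i X) <= B * sgm i) ->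
  entries_le (metric a p) B -> entries_le (mx1 a p (metric a) v) (B * n1 v) ->
  entries_le (mx2 a p (metric a) v) (B * n1 v ^+ 2) ->
  entries_le (acs a p) B -> entries_le (mx1 a p (acs a) v) (B * n1 v) ->
  entries_le (mx2 a p (acs a) v) (B * n1 v ^+ 2) ->
  4 ^+ n * \det (gram a p X) = (\prod_i sgm i ^+ 2) ^+ 2 ->
  exists r1 r2, [/\ j2 (fun t => 4 ^+ n * \det (gram a (ray a p v t) X) / (\prod_i sgm i ^+ 2) ^+ 2) 1 r1 r2,
    `|r1| <= C * n1 v & `|r2| <= C * n1 v ^+ 2].
Proof.
pose l := (size (index_enum 'I_m))%:R : R.
pose B' := Num.max B 1.
pose K1 := l * (3 * (B * B)); pose K2 := l * (3 * (Num.max B K1 * B)).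
pose K3 := l * (3 * (K2 * Num.max B K1)).
have [C0 hC0] := bjet_det K3 m.
exists (Num.max 0 (4 ^+ n * C0)); split; first by rewrite le_max lexx.
move=> a p X sgm v ap inner s0 XB g0e g1e g2e J0e J1e J2e gE.
have v0 : 0 <= n1 v := n1_ge0 v.
pose X' : 'M[R]_(n, m) := \matrix_i ((sgm i)^-1 *: row i X).
have jg := ray_mjet ap inner v (smooth_mx_metric ap).
have jJ := ray_mjet ap inner v (smooth_mx_acs ap).
have bg : bmx B (n1 v) (fun t => metric a (ray a p v t)) := bmx_mjet jg g0e g1e g2e.
have bJ : bmx B (n1 v) (fun t => acs a (ray a p v t)) := bmx_mjet jJ J0e J1e J2e.
have bX : bmx B (n1 v) (fun _ : R => X').
  move=> i j; apply: bjet_cst => //.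
  have -> : X' i j = (sgm i)^-1 * row i X 0 j by rewrite !mxE.
  rewrite normrM ger0_norm ?invr_ge0 ?(ltW (s0 i))// mulrC ler_pdivrMr//.
  by apply: le_trans (XB i); exact: n1_coord.
have bXJ : bmx K1 (n1 v) (fun t => X' *m acs a (ray a p v t)) := bmxM v0 bX bJ.
have bC : bmx (Num.max B K1) (n1 v) (fun t => col_mx X' (X' *m acs a (ray a p v t))).
  move=> i j; case: (splitP i) => k ik.
    apply: (@bjet_ext _ _ _ (fun t => X' k j)).
      by move=> t; rewrite (_ : i = lshift n k) ?col_mxEu//; apply: val_inj.
    by apply: bjet_le (bX k j); rewrite // le_max lexx.
  apply: (@bjet_ext _ _ _ (fun t => (X' *m acs a (ray a p v t)) k j)).
    by move=> t; rewrite (_ : i = rshift n k) ?col_mxEd//; apply: val_inj.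
  by apply: bjet_le (bXJ k j); rewrite // le_max lexx orbT.
have bG := bmxM v0 (bmxM v0 bC bg) (bmxT bC).
have [q0 [q1 [q2 [jq h0 h1 h2]]]] := hC0 _ _ v0 bG.
have s4 : 0 < (\prod_i sgm i ^+ 2) ^+ 2.
  by rewrite exprn_gt0// prodr_gt0// => i _; rewrite exprn_gt0.
have q0E : 4 ^+ n * q0 = 1.
  rewrite -(jet2_0 jq); have -> : ray a p v 0 = p by rewrite /ray scale0r addr0 parK.
  by apply: (mulfI (lt0r_neq0 s4)); rewrite mulrCA mulr1 -[in RHS]gE (gram_scale a p X s0).
exists (4 ^+ n * q1), (4 ^+ n * q2); split.
- apply: (jet2_eq (jet2_ext _ (jet2Z (FF := FF) Fid (4 ^+ n) jq))) => // t.
  by rewrite (gram_scale a _ X s0) mulrCA [_ ^+ 2 * _]mulrC mulfK ?gt_eqF.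
- rewrite normrM ger0_norm ?exprn_ge0//; apply: le_trans (_ : 4 ^+ n * (C0 * n1 v) <= _).
    by rewrite ler_wpM2l ?exprn_ge0.
  by rewrite mulrA ler_wpM2r// le_max lexx orbT.
- rewrite normrM ger0_norm ?exprn_ge0//; apply: le_trans (_ : 4 ^+ n * (C0 * n1 v ^+ 2) <= _).
    by rewrite ler_wpM2l ?exprn_ge0.
  by rewrite mulrA ler_wpM2r ?sqr_ge0// le_max lexx orbT.
Qed.

Variables (a : mindex M) (p : M).
Hypothesis ap : dom a p.
Hypothesis Ts : is_smooth_tensor T.
Hypothesis inner : forall v : 'rV[R]_m, \forall t \near (0 : R), half_space (crd a p + t *: v).
Variables (phi f : M -> R).
Hypothesis sphi : forall q, dom a q -> smooth_at a q phi.
Hypothesis sf : smooth_at a p f.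
Hypothesis f_gt0 : forall q, 0 < f q.
Hypothesis sol : ma_solution T f phi.
Hypothesis n_gt0 : (0 < n)%N.
Variables (Vv : 'rV[R]_m) (X : 'M[R]_(n, m)) (sgm : 'I_n -> R) (la ep cAv K0 : R).
Hypothesis s_gt0 : forall i, 0 < sgm i.
Hypothesis fs1 : f p * \prod_i sgm i ^+ 2 = 1.

Notation root := (fun q => f q `^ n%:R^-1).
Notation d := (mk_cdata T a p phi Vv X sgm la (root p) ep cAv K0).
Notation F1 v := ((v *m differential a root p) 0 0).
Notation F2 v := (2^-1 * bil (hmat a root p) v v).

Hypothesis om1X : forall i, omf T a p phi (row i X) = 1.

Section OneCurve.
Variables (v : 'rV[R]_m) (ca cb : 'cV[R]_n) (cp cq : 'rV[R]_n) (r1 r2 : R).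
Hypothesis jR : j2 (fun t => 4 ^+ n * \det (gram a (ray a p v t) X) / (\prod_i sgm i ^+ 2) ^+ 2) 1 r1 r2.
Let U0 := cp *m X + cq *m X *m acs a p.
Let U1 := cq *m X *m mx1 a p (acs a) v.
Let u1 i := ca i 0 *: U0 + cb i 0 *: (U0 *m acs a p).
Let u2 i := ca i 0 *: U1 + cb i 0 *: (U1 *m acs a p + U0 *m mx1 a p (acs a) v).
Let kre := \sum_i (cp 0 i * ca i 0 - cq 0 i * cb i 0).
Let kim := \sum_i (cp 0 i * cb i 0 + cq 0 i * ca i 0).
Let J0 := acs a p.
Let J1 := mx1 a p (acs a) v.
Let J2 := mx2 a p (acs a) v.
Let s1 i := om1 d v (row i X) (u1 i) (row i X *m J0) (u1 i *m J0 + row i X *m J1).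
Let s2 i := om2 d v (row i X) (u1 i) (u2 i) (row i X *m J0) (u1 i *m J0 + row i X *m J1)
  (u2 i *m J0 + u1 i *m J1 + row i X *m J2).

(** U_t is formed with the structure J at the moving point. Only then is the motion of rank one over
    C for every t, with determinant exactly |1 + t kappa|^2 times that of the unmoved frame. *)
Let Ut t : 'rV[R]_m := cp *m X + cq *m (X *m acs a (ray a p v t)).
Let Xt t : 'M[R]_(n, m) := X + (t *: ca) *m Ut t + (t *: cb) *m (Ut t *m acs a (ray a p v t)).

Lemma Xt_jet i : mjet (nbhs (0 : R)) (fun t => row i (Xt t)) (row i X) (u1 i) (u2 i).
Proof.
have jJ := ray_mjet ap inner v (smooth_mx_acs ap).
have jU : mjet (nbhs (0 : R)) Ut U0 U1 (cq *m X *m J2).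
  have j0 := mjetD (FF := FF) (mjet_cst (FF := FF) (cp *m X)) (mjetM (FF := FF) Fid (mjet_cst (FF := FF) (cq *m X)) jJ).
  have j1 : (fun t => cp *m X + cq *m X *m acs a (ray a p v t)) =1 Ut by move=> t; rewrite /Ut mulmxA.
  by apply: (mjet_eq (mjet_ext (FF := FF) j1 j0)); rewrite // ?mul0mx ?add0r.
have jW := mjetD (FF := FF) (mjetZ (FF := FF) Fid (jet2_cst (FF := FF) (ca i 0)) jU)
  (mjetZ (FF := FF) Fid (jet2_cst (FF := FF) (cb i 0)) (mjetM (FF := FF) Fid jU jJ)).
have jt : j2 (fun t => t) 0 1 0.
  by apply: (jet2_ext _ (jet2_poly (FF := FF) 0 1 0)) => t; rewrite add0r mul1r mul0r addr0.
have jX := mjetD (FF := FF) (mjet_cst (FF := FF) (row i X)) (mjetZ (FF := FF) Fid jt jW).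
apply: (mjet_eq (mjet_ext (FF := FF) _ jX)).
- by move=> t; apply/rowP => k; rewrite /Xt !mxE !big_ord1 !mxE; ring.
- by rewrite scale0r addr0.
- by rewrite add0r scale0r addr0 scale1r.
- by rewrite !scale0r !addr0 !add0r scale1r.
Qed.

Lemma root_gt0 q : 0 < root q. Proof. by rewrite powR_gt0. Qed.

Let St t := n%:R^-1 * \sum_i omf T a (ray a p v t) phi (row i (Xt t)).
Let Rt t := 4 ^+ n * \det (gram a (ray a p v t) X) / (\prod_i sgm i ^+ 2) ^+ 2.
Let kt t : R := (1 + t * kre) ^+ 2 + (t * kim) ^+ 2.

(** The determinant of g enters through its square, the Gram determinant, whence the factor 2^-1
    before ln R. The normalisation of f at p turns the remaining constant into - n ln f^(1/n). *)
Lemma agm_log_le0 : (\forall t \near (0 : R), 0 < Rt t) -> (\forall t \near (0 : R), 0 < kt t) ->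
  \forall t \near (0 : R), n%:R * ln (root (ray a p v t)) + ln (kt t) + 2^-1 * ln (Rt t) -
    n%:R * ln (St t) + - (n%:R * ln (root p)) <= 0.
Proof.
have nn : 0 < (n%:R : R) by rewrite ltr0n.
have s2p : 0 < \prod_i sgm i ^+ 2 by apply: prodr_gt0 => i _; rewrite exprn_gt0.
have lnf q : ln (f q) = n%:R * ln (root q).
  by rewrite ln_powR mulrA divff ?mul1r// gt_eqF.
have near1 := ray_near (FF := FF) Fid ap ap (inner v) ltr01.
move=> R1 k1; apply: filterS3 near1 R1 k1 => t [aq _ _ _] R0 k0.
set q := ray a p v t in aq *.
have gX0 : \det (gram a q X) != 0.
  apply: contraTneq R0 => g0; by rewrite /Rt -/q g0 mulr0 mul0r ltxx.
have Xf := gram_row_free aq gX0.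
have [DX0 DXE] := DG_gt0 aq Xf.
have det2 : \det (frame_form (cfr (acs a q) (Xt t)) (metric a q)) = (kt t * DG a q X)%:C%C.
  rewrite /Xt /Ut (det_perturb (acs_sqr aq)) DXE -rmorphM; congr (_ %:C)%C; congr (_ * _).
  by rewrite /kt /kre /kim !mulr_sumr; congr ((1 + _) ^+ 2 + _ ^+ 2);
    apply: eq_bigr => i _; rewrite !mxE; ring.
have Xtf : row_free (cfr (acs a q) (Xt t)).
  apply: (@row_free_det _ _ _ (metric a q)); rewrite det2.
  by rewrite (fmorph_eq0 (real_complex R)) mulf_neq0 ?gt_eqF.
have [om0' agm] := agm_point sol n_gt0 aq Xtf.
have DXt : DG a q (Xt t) = kt t * DG a q X by rewrite [LHS]/DG det2.
have S0 : 0 < St t.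
  rewrite mulr_gt0 ?invr_gt0//; rewrite (bigD1 (Ordinal n_gt0))//= ltr_wpDr//.
  by apply: sumr_ge0 => i _; exact: ltW.
have e2 : DG a q X ^+ 2 = Rt t * (\prod_i sgm i ^+ 2) ^+ 2.
  by rewrite DG_gram// /Rt divfK// expf_neq0// gt_eqF.
have lnp : ln (\prod_i sgm i ^+ 2) = - (n%:R * ln (root p)).
  rewrite -lnf; have := congr1 (@ln R) fs1; rewrite lnM ?posrE// ln1 => /eqP.
  by rewrite addr_eq0 => /eqP ->; rewrite opprK.
apply: (agm_log (f_gt0 q) k0 DX0 S0 R0 s2p (lnf q) lnp e2).
by rewrite -DXt.
Qed.

(** The logarithm of the inequality is nonpositive along the curve and vanishes at t = 0, where the
    frame is normal. Hence it yields an equality of first order and an inequality of second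
    order. *)
Lemma agm_curve : \sum_i s1 i = n%:R * (F1 v / root p) + 2 * kre + 2^-1 * r1 /\
  n%:R * (F2 v / root p) + (F1 v / root p) * (2 * kre + 2^-1 * r1) + kim ^+ 2 - kre ^+ 2 +
    2^-1 * r2 - 4^-1 * r1 ^+ 2 <= \sum_i s2 i.
Proof.
have nn : 0 < (n%:R : R) by rewrite ltr0n.
have omE i : om0 d (row i X) (row i X *m J0) = 1.
  rewrite -(om1X i) /omf /om0 /=; congr (_ + _).
  by apply: eq_bigr => s _; rewrite !mxE.
have jS : j2 St 1 (n%:R^-1 * \sum_i s1 i) (n%:R^-1 * \sum_i s2 i).
  have h := @jet2_sum _ _ FF _ (index_enum _) xpredT _ _ _ _ (fun i _ =>
    @om_jet _ _ _ T _ _ ap Ts inner _ sphi Vv X sgm la (root p) ep cAv K0 v _ _ _ _ (Xt_jet i)).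
  apply: (jet2_eq (jet2Z (FF := FF) Fid n%:R^-1 h)) => //.
  rewrite (eq_bigr (fun=> 1)); last by move=> i _; exact: omE.
  by rewrite sumr_const card_ord mulVf// gt_eqF.
have sroot : smooth_at a p root := smooth_at_powR _ ap (f_gt0 p) sf.
have jr := ray_jet' (FF := FF) Fid ap sroot (inner v).
have jk : j2 kt 1 (2 * kre) (kre ^+ 2 + kim ^+ 2).
  by apply: (jet2_ext _ (jet2_poly (FF := FF) _ _ _)) => t; rewrite /kt; ring.
have l1 := jet2_ln FF Fid (root_gt0 p) jr.
have l2 := jet2_ln FF Fid (ltr01 : 0 < (1 : R)) jk.
have l3 := jet2_ln FF Fid (ltr01 : 0 < (1 : R)) jR.
have l4 := jet2_ln FF Fid (ltr01 : 0 < (1 : R)) jS.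
have jF := jet2D (FF := FF) (jet2B (FF := FF) (jet2D (FF := FF) (jet2D (FF := FF)
   (jet2Z (FF := FF) Fid n%:R l1) l2) (jet2Z (FF := FF) Fid 2^-1 l3))
   (jet2Z (FF := FF) Fid n%:R l4)) (jet2_cst (FF := FF) (- (n%:R * ln (root p)))).
have le0 := agm_log_le0 (jet2_near_pos jR) (jet2_near_pos jk).
move: jF; rewrite ln1 !mulr0 !addr0 subr0 subrr => jF.
have [hb hc] := jet2_le0 jF le0.
move: hb hc; rewrite !divr1; apply: agm_algebra => //; by rewrite divff// gt_eqF.
Qed.

End OneCurve.

End AgmAlongCurves.

(** * Interior maximum points *)

Section BoundedGeometry.
Variables (R : realType) (n : nat) (M : almost_hermitian R n) (T : mixed_field M).
Notation m := (n + n)%N.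

Implicit Types (a : mindex M) (p : M) (u v w : 'rV[R]_m).

Definition jets_le (B : R) a p (A : M -> 'M[R]_m) : Prop :=
  [/\ entries_le (A p) B, forall v, entries_le (mx1 a p A v) (B * n1 v) &
      forall v, entries_le (mx2 a p A v) (B * n1 v ^+ 2)].

Record bgeom (B : R) (a : mindex M) (p : M) : Prop := BGeom {
  bg_dom : dom a p;
  bg_g : jets_le B a p (metric a);
  bg_h : jets_le B a p (fun q => invmx (metric a q));
  bg_J : jets_le B a p (acs a);
  bg_G : forall s, jets_le B a p (chris a ^~ s);
  bg_b : forall s, jets_le B a p (bmat T a ^~ s);
  bg_gc : forall v, n1 v ^+ 2 <= B * bil (metric a p) v v;
  bg_hc : forall v, n1 v ^+ 2 <= B * bil (invmx (metric a p)) v v }.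

Lemma entries_le_mono (A : 'M[R]_m) K K' : K <= K' -> entries_le A K -> entries_le A K'.
Proof. by move=> KK h s t; exact: le_trans (h s t) KK. Qed.

Lemma jets_le_mono B B' a p A : B <= B' -> jets_le B a p A -> jets_le B' a p A.
Proof.
move=> BB [h0 h1 h2]; split=> [|v|v]; first exact: entries_le_mono h0.
- by apply: entries_le_mono (h1 v); rewrite ler_wpM2r ?n1_ge0.
- by apply: entries_le_mono (h2 v); rewrite ler_wpM2r ?sqr_ge0.
Qed.

Lemma mx1_0 k l a p (A : M -> 'M[R]_(k, l)) : mx1 a p A 0 = 0.
Proof. by apply/matrixP => i j; rewrite [mx1 _ _ _ _ _ _]mxE mul0mx !mxE. Qed.

Lemma metric_bil_ge0 a p v : dom a p -> 0 <= bil (metric a p) v v.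
Proof.
move=> ap; have [->|v0] := eqVneq v 0; first by rewrite bil0l.
exact/ltW/metric_pos.
Qed.

Lemma chris_sym a p s : dom a p -> (chris a p s)^T = chris a p s.
Proof.
move=> ap; have [h _] := (christoffelP (christoffel a p) ap).2 (fun _ _ _ => erefl).
by apply/matrixP => i j; rewrite !mxE.
Qed.

Lemma metric_JJ a p u w : dom a p ->
  bil (metric a p) (u *m acs a p) (w *m acs a p) = bil (metric a p) u w.
Proof. by move=> ap; rewrite bil_mull bil_mulr metric_acs. Qed.

Lemma metric_Jskew a p u w : dom a p ->
  bil (metric a p) (u *m acs a p) w = - bil (metric a p) u (w *m acs a p).
Proof.
move=> ap; rewrite -[in LHS](metric_JJ _ _ ap) -mulmxA (acs_sqr ap) mulmxN mulmx1 bilNl.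
by [].
Qed.

End BoundedGeometry.

Section Frame.
Variables (R : realType) (n : nat) (M : almost_hermitian R n).
Notation m := (n + n)%N.

(** The difference of the two sides is orthogonal to all X_i and J X_i, which form a basis because
    their Gram determinant does not vanish. *)
Lemma frame_expand (a : mindex M) p (X : 'M[R]_(n, m)) (sgm : 'I_n -> R) (W : 'rV[R]_m) :
  dom a p -> row_free (cfr (acs a p) X) -> (forall i, 0 < sgm i) ->
  (forall i j, bil (metric a p) (row i X) (row j X) = 2^-1 * sgm i ^+ 2 *+ (i == j)) ->
  (forall i j, bil (metric a p) (row i X) (row j X *m acs a p) = 0) ->
  W = 2 *: (\sum_i (bil (metric a p) W (row i X) / sgm i ^+ 2) *: row i X +
      (\sum_i (bil (metric a p) W (row i X *m acs a p) / sgm i ^+ 2) *: row i X) *m acs a p).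
Proof.
move=> ap Xf s0 Xn XY; set g := metric a p; set J := acs a p.
set Ur := \sum_i _ *: row i X; set Ui := \sum_i _ *: row i X.
have gT : g^T = g := Defs.metric_sym ap.
have YX i j : bil g (row i X *m J) (row j X) = 0 by rewrite metric_Jskew// XY oppr0.
have Usum (c : 'I_n -> R) j : bil g (\sum_i c i *: row i X) (row j X) = c j * (2^-1 * sgm j ^+ 2).
  rewrite bil_sym// bil_sumr (bigD1 j)//= big1 ?addr0 => [|i ij]; rewrite bilZr Xn ?eqxx//.
  by rewrite eq_sym (negbTE ij) mulr0.
have UsumJ (c : 'I_n -> R) j : bil g (\sum_i c i *: row i X) (row j X *m J) = 0.
  by rewrite bil_sym// bil_sumr big1// => i _; rewrite bilZr YX mulr0.
pose Z := W - 2 *: (Ur + Ui *m J).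
have ZX j : bil g Z (row j X) = 0.
  rewrite bilDl bilNl bilZl bilDl Usum [bil g (Ui *m J) _]metric_Jskew// UsumJ oppr0 addr0.
  by field; rewrite gt_eqF.
have ZY j : bil g Z (row j X *m J) = 0.
  rewrite bilDl bilNl bilZl bilDl UsumJ metric_JJ// Usum add0r.
  by field; rewrite gt_eqF.
suff Z0 : Z = 0 by apply/eqP; rewrite -subr_eq0 -/Z Z0.
have Cu : col_mx X (X *m J) \in unitmx.
  have [DG0 _] := DG_gt0 ap Xf; rewrite unitmxE unitfE; apply: contraTneq DG0 => d0.
  have := DG_gram ap Xf; rewrite /gram !det_mulmx -/J d0 !mul0r mulr0 => /eqP.
  by rewrite sqrf_eq0 => /eqP ->; rewrite ltxx.
have ZC : Z *m g *m (col_mx X (X *m J))^T = 0.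
  apply/rowP => k; rewrite [RHS]mxE.
  have E (j : 'I_m) (Y : 'M[R]_m) : (Z *m g *m Y^T) 0 j = bil g Z (row j Y).
    by rewrite /bil !mxE; apply: eq_bigr => s _; rewrite !mxE.
  rewrite E; case: (splitP k) => j kj.
    by rewrite (_ : k = lshift n j) ?rowKu ?ZX//; apply: val_inj.
  by rewrite (_ : k = rshift n j) ?rowKd ?row_mul ?ZY//; apply: val_inj.
have Zg : Z *m g = 0.
  by rewrite -[Z *m g]mulmx1 -(mulmxV (x := (col_mx X (X *m J))^T)) ?unitmx_tr// mulmxA ZC mul0mx.
by rewrite -[Z]mulmx1 -(mulmxV (metric_unitmx ap)) mulmxA -/g Zg mul0mx.
Qed.

End Frame.

Lemma lin_real (R : realType) (N C B F s w1 r1 B' : R) : 0 <= N -> 0 <= s -> 0 < F ->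
  `|w1| <= B * s -> `|r1| <= C * s -> 0 <= C -> 0 <= B -> N * B + C <= B' ->
  `|N * (w1 / F) + 2^-1 * r1| <= B' * s * (1 + F^-1).
Proof.
move=> N0 s0 F0 hw hr C0 B0 hB; have x0 : 0 <= F^-1 by rewrite invr_ge0 ltW.
apply: le_trans (ler_normD _ _) _.
rewrite !normrM (ger0_norm N0) (ger0_norm x0) (ger0_norm (x := 2^-1)) ?invr_ge0//.
have k1 : N * (`|w1| / F) <= N * (B * s / F) by rewrite ler_wpM2l// ler_wpM2r.
have k2 : (N * B + C) * (s * (1 + F^-1)) <= B' * (s * (1 + F^-1)) by rewrite ler_wpM2r// mulr_ge0// addr_ge0.
have k3 : 0 <= C * (s * F^-1) by rewrite !mulr_ge0.
have k4 : 0 <= N * (B * s) by rewrite !mulr_ge0.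
have k5 : 0 <= C * s by rewrite mulr_ge0.
move: F^-1 x0 k1 k2 k3 => x x0 k1 k2 k3; lra.
Qed.

(** Brings the second part of [agm_curve] into the form [agm_second]: the only powers of F^-1 come
    from the first and second derivatives of F, and products with kappa are split by 2 |k| <= 1 +
    k^2. *)
Lemma agm_real (R : realType) (N C B F s w1 w2 r1 r2 k l B' : R) : 0 <= N -> 0 <= s -> 0 < F ->
  `|w1| <= B * s -> - (B * s ^+ 2) <= w2 -> `|r1| <= C * s -> `|r2| <= C * s ^+ 2 ->
  s ^+ 2 <= B -> s <= B -> 0 <= C -> 0 <= B ->
  N * B * B + B * B * (1 + C) + 1 + C * B + C ^+ 2 * B <= B' ->
  - (B' * (1 + k ^+ 2 + l ^+ 2) * (1 + F^-1)) <=
  N * (w2 / F) + w1 / F * (2 * k + 2^-1 * r1) + l ^+ 2 - k ^+ 2 + 2^-1 * r2 - 4^-1 * r1 ^+ 2.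
Proof.
move=> N0 s0 F0 hw hw2 hr hr2 s2 s1 C0 B0 hB.
have : 0 <= F^-1 by rewrite invr_ge0 ltW.
move: F^-1 => x x0.
have k20 := sqr_ge0 k; have l20 := sqr_ge0 l.
set Q := (1 + k ^+ 2 + l ^+ 2) * (1 + x).
have QE : Q = 1 + k ^+ 2 + l ^+ 2 + x + x * k ^+ 2 + x * l ^+ 2 by rewrite /Q; ring.
have xk : 0 <= x * k ^+ 2 by rewrite mulr_ge0.
have xl : 0 <= x * l ^+ 2 by rewrite mulr_ge0.
have BBs : B * s ^+ 2 <= B * B by rewrite ler_wpM2l.
have h1 : - (N * B * B * Q) <= N * (w2 * x).
  have : - (N * (B * B * x)) <= N * (w2 * x).
    rewrite -mulrN ler_wpM2l// -mulNr ler_wpM2r//; lra.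
  have : N * B * B * x <= N * B * B * Q by rewrite ler_wpM2l ?mulr_ge0//; lra.
  move: Q QE => Q _; lra.
have w1B : `|w1| <= B * B by apply: le_trans hw _; rewrite ler_wpM2l.
have h2 : - (B * B * Q) <= w1 * x * (2 * k).
  have e : `|w1 * x * (2 * k)| <= B * B * ((1 + k ^+ 2) * x).
    have -> : w1 * x * (2 * k) = w1 * (2 * k * x) by ring.
    rewrite normrM; apply: ler_pM => //; rewrite normrM (ger0_norm x0) ler_wpM2r//.
    by rewrite ler_norml; apply/andP; split; have := sqr_ge0 (k + 1); have := sqr_ge0 (k - 1); lra.
  have : B * B * ((1 + k ^+ 2) * x) <= B * B * Q by rewrite ler_wpM2l ?mulr_ge0//; lra.
  by move: e; rewrite ler_norml => /andP[]; lra.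
have h3 : - (B * B * C * Q) <= w1 * x * (2^-1 * r1).
  have e : `|w1 * r1| <= B * B * C.
    apply: le_trans (_ : (B * s) * (C * s) <= _); first by rewrite normrM ler_pM.
    have -> : B * s * (C * s) = C * (B * s ^+ 2) by ring.
    by rewrite [leRHS]mulrC ler_wpM2l.
  have e2 : - (B * B * C) * x <= w1 * r1 * x by rewrite ler_wpM2r//; move: e; rewrite ler_norml => /andP[].
  have e3 : 0 <= B * B * C * x by rewrite !mulr_ge0.
  have : B * B * C * x <= B * B * C * Q by rewrite ler_wpM2l ?mulr_ge0//; lra.
  lra.
have h4 : - Q <= l ^+ 2 - k ^+ 2 by lra.
have h5 : - (C * B * Q) <= 2^-1 * r2.
  have e0 : C * s ^+ 2 <= C * B by rewrite ler_wpM2l.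
  have : C * B * 1 <= C * B * Q by rewrite ler_wpM2l ?mulr_ge0//; lra.
  have : 0 <= C * B by rewrite mulr_ge0.
  by move: hr2; rewrite ler_norml => /andP[]; lra.
have h6 : 4^-1 * r1 ^+ 2 <= C ^+ 2 * B * Q.
  have e : r1 ^+ 2 <= C ^+ 2 * B.
    apply: le_trans (_ : (C * s) ^+ 2 <= _); last by rewrite exprMn ler_wpM2l ?sqr_ge0.
    by rewrite -(real_normK (num_real r1)) lerXn2r ?nnegrE ?mulr_ge0.
  have : C ^+ 2 * B * 1 <= C ^+ 2 * B * Q by rewrite ler_wpM2l ?mulr_ge0 ?sqr_ge0//; lra.
  have := sqr_ge0 r1; lra.
have : (N * B * B + B * B * (1 + C) + 1 + C * B + C ^+ 2 * B) * Q <= B' * Q.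
  by rewrite ler_wpM2r//; lra.
have -> : B' * (1 + k ^+ 2 + l ^+ 2) * (1 + x) = B' * Q by rewrite /Q mulrA.
by move: Q QE h1 h2 h3 h4 h5 h6 => Q _ h1 h2 h3 h4 h5 h6 h7; lra.
Qed.

(** * From an interior maximum to the hypotheses of the pointwise estimate *)

Section Producer.
Variables (R : realType) (n : nat) (M : almost_hermitian R n) (T : mixed_field M).
Notation m := (n + n)%N.
Hypothesis Ts : is_smooth_tensor T.
Notation root f := (fun q => f q `^ n%:R^-1).

Record maxdata (B : R) (f phi : M -> R) (a : mindex M) (p : M) (Vv : 'rV[R]_m) (la ep cAv K0 : R) : Prop := MaxData {
  md_n : (0 < n)%N;
  md_geom : bgeom T B a p;
  md_inner : forall v : 'rV[R]_m, \forall t \near (0 : R), half_space (crd a p + t *: v);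
  md_phi : forall q, dom a q -> smooth_at a q phi;
  md_f : smooth_at a p f;
  md_fpos : forall q, 0 < f q;
  md_sol : ma_solution T f phi;
  md_root : root f p <= B;
  md_F1 : forall v, `|(v *m differential a (root f) p) 0 0| <= B * n1 v;
  md_F2 : forall v, - (B * n1 v ^+ 2) <= 2^-1 * bil (hmat a (root f) p) v v;
  md_dd : n1 (differential a phi p)^T <= B;
  md_V : bil (metric a p) Vv Vv = 1;
  md_la : la = bil (hess a phi p) Vv Vv;
  md_max : forall v w, \forall t \near (0 : R),
    bil (hess a phi (ray a p v t)) (Vv + t *: w) (Vv + t *: w) -
      la * (expR (efun a phi ep cAv K0 p - efun a phi ep cAv K0 (ray a p v t)) *
        bil (metric a (ray a p v t)) (Vv + t *: w) (Vv + t *: w)) <= 0 }.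

Section AtMaximum.
Variables (B : R) (f phi : M -> R) (a : mindex M) (p : M) (Vv : 'rV[R]_m) (la ep cAv K0 : R).
Hypothesis B1 : 1 <= B.
Hypothesis H : maxdata B f phi a p Vv la ep cAv K0.
Variables (X : 'M[R]_(n, m)) (sgm : 'I_n -> R).
Hypothesis Xf : row_free (cfr (acs a p) X).
Hypothesis s0 : forall i, 0 < sgm i.
Hypothesis om1X : forall i, omf T a p phi (row i X) = 1.
Hypothesis Xn : forall i j, bil (metric a p) (row i X) (row j X) = 2^-1 * sgm i ^+ 2 *+ (i == j).
Hypothesis XY : forall i j, bil (metric a p) (row i X) (row j X *m acs a p) = 0.
Hypothesis DGX : DG a p X = \prod_i sgm i ^+ 2.
Hypothesis fs1 : f p * \prod_i sgm i ^+ 2 = 1.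
Notation d := (mk_cdata T a p phi Vv X sgm la (root f p) ep cAv K0).

Let ap : dom a p := bg_dom (md_geom H).

Lemma max_P v w : Pb d v w = 0 /\ Pc d v w <= 0.
Proof.
have [h1 h2 h3] := And3 (md_la H) (md_V H) (md_max H v w).
exact: jet2_le0 (@P_jet R n M T a p ap (md_inner H) phi (md_phi H) Vv X sgm la (root f p) ep cAv K0 v w ap h1 h2) h3.
Qed.

(** The first order condition with the base point at rest: V is a critical point of H on the unit
    sphere of g. *)
Lemma max_eigen w : bil (hmat a phi p) Vv w - \sum_s dd d 0 s * bil (chris a p s) Vv w
  = la * bil (metric a p) Vv w.
Proof.
have [+ _] := max_P 0 w.
have b1cE (A : 'M[R]_m) : A^T = A -> b1c A 0 Vv w = 2 * bil A Vv w.
  by move=> AT; rewrite /b1c bil_0 (bil_sym w Vv AT); ring.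
have gT := Defs.metric_sym ap; have hT := hmat_sym ap (md_phi H ap).
rewrite /Pb /eta1 /N1 /y1 /= !mx1_0 !mul0mx !bil_0 bil0r /dot !b1cE//.
rewrite [X in _ - _ - _ * (_ - (_ + - (_ * X)))]big1 => [|s _]; last by rewrite mxE mul0r.
rewrite (_ : \sum_s _ = 2 * \sum_s (differential a phi p)^T 0 s * bil (chris a p s) Vv w); last first.
  rewrite mulr_sumr; apply: eq_bigr => s _; rewrite mx1_0 (b1cE _ (chris_sym s ap)) mxE mul0r add0r.
  by ring.
move: (\sum_s _) (bil _ _ _) (bil _ _ _) => x y z h; lra.
Qed.

End AtMaximum.

Lemma core_producer (B : R) : 1 <= B -> exists B', B <= B' /\
  forall f phi a p Vv la ep cAv K0, maxdata B f phi a p Vv la ep cAv K0 ->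
  exists X sgm, core B' (mk_cdata T a p phi Vv X sgm la (root f p) ep cAv K0).
Proof.
move=> B1; have [C [C0 hC]] := gram_jet M B.
pose N : R := n%:R.
have N0 : 0 <= N by rewrite ler0n.
have B0 : 0 <= B by lra.
(* [D1] and [D2] are the constants that [lin_real] and [agm_real] ask for. *)
pose D1 : R := N * B + C.
pose D2 : R := N * B * B + B * B * (1 + C) + 1 + C * B + C ^+ 2 * B.
have D10 : 0 <= D1 by rewrite addr_ge0// mulr_ge0.
have D20 : 0 <= D2 by rewrite !addr_ge0 ?mulr_ge0 ?sqr_ge0// addr_ge0.
have m0 : 0 <= m%:R :> R by rewrite ler0n.
pose B' := m%:R + B + D1 + D2.
have BB : B <= B' by rewrite /B'; lra.
have D1B : D1 <= B' by rewrite /B'; lra.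
have D2B : D2 <= B' by rewrite /B'; lra.
have mB : m%:R <= B' by rewrite /B'; lra.
exists B'; split=> // f phi a p Vv la ep cAv K0 H.
have ap : dom a p := bg_dom (md_geom H).
have [X [sgm [[Xf s0 om1X Xn XY] [DGX fs1 trG]]]] := normal_frame (md_sol H) (md_n H) (md_fpos H p) ap.
exists X, sgm.
have [g0l g1l g2l] := bg_g (md_geom H).
have [J0l J1l J2l] := bg_J (md_geom H).
have [g0l' g1l' g2l'] := jets_le_mono BB (bg_g (md_geom H)).
have [J0l' J1l' J2l'] := jets_le_mono BB (bg_J (md_geom H)).
have [h0l' h1l' h2l'] := jets_le_mono BB (bg_h (md_geom H)).
have Gl s := jets_le_mono BB (bg_G (md_geom H) s).
have bl s := jets_le_mono BB (bg_b (md_geom H) s).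
have f0 : 0 < root f p by rewrite powR_gt0// (md_fpos H).
have XB i : n1 (row i X) <= B * sgm i.
  rewrite -(ler_pXn2r (n := 2)) ?nnegrE ?n1_ge0 ?mulr_ge0 ?(ltW (s0 i))//.
  apply: le_trans (bg_gc (md_geom H) _) _; rewrite Xn eqxx mulr1n exprMn.
  have := mulr_ge0 B0 (sqr_ge0 (sgm i)).
  have : B * sgm i ^+ 2 <= B ^+ 2 * sgm i ^+ 2 by rewrite ler_wpM2r ?sqr_ge0// expr2 ler_peMr.
  by rewrite mulrCA; move: (B * sgm i ^+ 2) (B ^+ 2 * sgm i ^+ 2) => x y; lra.
have gr : 4 ^+ n * \det (gram a p X) = (\prod_i sgm i ^+ 2) ^+ 2 by rewrite -(DG_gram ap Xf) DGX.
have jR v := hC a p X sgm v ap (md_inner H) s0 XB g0l (g1l v) (g2l v) J0l (J1l v) (J2l v) gr.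
have agm v ca cb cp cq r1 r2 j := @agm_curve R n M T a p ap Ts (md_inner H) phi f (md_phi H) (md_f H)
  (md_fpos H) (md_sol H) (md_n H) Vv X sgm la ep cAv K0 s0 fs1 om1X v ca cb cp cq r1 r2 j.
have coer (A : 'rV[R]_m -> R) (x : R) v : x <= B * A v -> 0 <= A v -> x <= B' * A v.
  by move=> h A0; apply: le_trans h _; rewrite ler_wpM2r.
have V2 : n1 Vv ^+ 2 <= B by apply: le_trans (bg_gc (md_geom H) Vv) _; rewrite (md_V H) mulr1.
have V1 : n1 Vv <= B.
  rewrite -(ler_pXn2r (n := 2)) ?nnegrE ?n1_ge0//; apply: le_trans V2 _.
  by rewrite expr2 ler_peMr.
pose d := mk_cdata T a p phi Vv X sgm la (root f p) ep cAv K0.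
have Vd : Vv = 2 *: (Ur d + Ui d *m acs a p) := frame_expand Vv ap Xf s0 Xn XY.
have [ginv0 gT hT] := And3 (bg_hc (md_geom H)) (Defs.metric_sym ap) (ginv_sym ap).
constructor.
- by lra.
- exact: mB.
- exact: md_n H.
- exact: g0l'.
- exact: g1l'.
- exact: g2l'.
- exact: h0l'.
- exact: h1l'.
- exact: h2l'.
- exact: J0l'.
- exact: J1l'.
- exact: J2l'.
- by move=> s; have [h _ _] := Gl s; exact: h.
- by move=> s v; have [_ h _] := Gl s; exact: h.
- by move=> s v; have [_ _ h] := Gl s; exact: h.
- by move=> s; have [h _ _] := bl s; exact: h.
- by move=> s v; have [_ h _] := bl s; exact: h.
- by move=> s v; have [_ _ h] := bl s; exact: h.
- exact: le_trans (md_dd H) BB.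
- by move=> v; apply: coer (bg_gc (md_geom H) v) (metric_bil_ge0 v ap).
- move=> v; apply: coer (ginv0 v) _.
  by rewrite -(pmulr_rge0 _ (lt_le_trans ltr01 B1)); apply: le_trans (sqr_ge0 _) (ginv0 v).
- exact: gT.
- exact: hT.
- exact: hmat_sym (md_phi H ap).
- by move=> v; exact: mx1_hmatT (md_phi H).
- by move=> u v w; exact: mx1_hmatC (md_phi H ap).
- by move=> v w; rewrite /= !bilZ (mx2_hmatC ap _ _ (md_phi H)).
- by move=> u w; exact: metric_JJ.
- exact: acs_sqr.
- exact: md_V H.
- by move=> i; rewrite /= Xn eqxx.
- by move=> i j ij; rewrite /= Xn (negbTE ij).
- exact: XY.
- exact: s0.
- exact: Vd.
- move=> i; rewrite -(om1X i) /omf /om0 /=; congr (_ + _).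
  by apply: eq_bigr => s _; rewrite !mxE.
- exact: f0.
- exact: le_trans (md_root H) BB.
- exact: trG.
- exact: max_eigen H X sgm.
- by move=> v; have [] := max_P H X sgm v 0.
- by move=> v w; have [] := max_P H X sgm v w.
- move=> v; have [r1 [r2 [j b1 _]]] := jR v.
  (* With all four coefficient vectors zero the real frame X is constant along the ray, and the
     first order equality is the differentiated equation. *)
  have [e _] := agm v 0 0 0 0 r1 r2 j.
  rewrite (eq_bigr (fun i => om1 d v (row i X) ((0 : 'cV[R]_n) i 0 *: (0 *m X + 0 *m X *m acs a p) +
     (0 : 'cV[R]_n) i 0 *: ((0 *m X + 0 *m X *m acs a p) *m acs a p)) (row i X *m acs a p)
     (((0 : 'cV[R]_n) i 0 *: (0 *m X + 0 *m X *m acs a p) +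
       (0 : 'cV[R]_n) i 0 *: ((0 *m X + 0 *m X *m acs a p) *m acs a p)) *m acs a p + row i X *m mx1 a p (acs a) v))); last first.
    by move=> i _; rewrite !mul0mx !add0r !mul0mx !scaler0 !addr0 !mul0mx add0r.
  rewrite e big1 => [|i _]; last by rewrite !mxE !mul0r subrr.
  rewrite mulr0 addr0; apply: (lin_real N0 (n1_ge0 v) f0 (md_F1 H v) b1 C0 B0 D1B).
- have [r1 [r2 [j b1 b2]]] := jR Vv.
  (* The coefficients of V in the frame make U_0 = V / 2, so that the moving frame starts with X_i +
     t Z_i + t^2 K_i. *)
  have [_ e] := agm Vv (\col_i ra d i) (\col_i rb d i) (\row_i pp d i) (\row_i qq d i) r1 r2 j.
  have UrE : (\row_i pp d i) *m X = Ur d.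
    by rewrite mulmx_sum_row; apply: eq_bigr => i _; rewrite mxE.
  have UiE : (\row_i qq d i) *m X = Ui d.
    by rewrite mulmx_sum_row; apply: eq_bigr => i _; rewrite mxE.
  have VE : Ur d + Ui d *m acs a p = 2^-1 *: Vv by rewrite [in RHS]Vd scalerA mulVf ?scale1r ?pnatr_eq0.
  have kE : \sum_i ((\row_i pp d i) 0 i * (\col_i ra d i) i 0 - (\row_i qq d i) 0 i * (\col_i rb d i) i 0) = kr d.
    by apply: eq_bigr => i _; rewrite !mxE.
  have lE : \sum_i ((\row_i pp d i) 0 i * (\col_i rb d i) i 0 + (\row_i qq d i) 0 i * (\col_i ra d i) i 0) = ki d.
    by apply: eq_bigr => i _; rewrite !mxE.
  move: e; rewrite kE lE UrE UiE VE => e.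
  apply: le_trans (agm_real _ _ N0 (n1_ge0 Vv) f0 (md_F1 H Vv) (md_F2 H Vv) b1 b2 V2 V1 C0 B0 D2B) _.
  apply: le_trans e _; rewrite le_eqVlt; apply/orP; left; apply/eqP.
  apply: eq_bigr => i _; rewrite !mxE.
  have -> : ra d i *: (2^-1 *: Vv) + rb d i *: ((2^-1 *: Vv) *m acs a p) = cZ d i.
    rewrite /cZ -scalemxAl /=; move: (Vv *m _) (ra _ _) (rb _ _) => W x y.
    by apply/rowP => k; rewrite !mxE; ring.
  reflexivity.
Qed.

End Producer.

(** * Bounded geometry and compactness *)

Section PositiveForms.
Variables (R : realType) (m : nat).
Implicit Types (A : 'M[R]_m) (u v w : 'rV[R]_m).

Lemma bil_CS A u w : A^T = A -> (forall v, v != 0 -> 0 < bil A v v) ->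
  bil A u w ^+ 2 <= bil A u u * bil A w w.
Proof.
move=> AT Ap; have [->|w0] := eqVneq w 0; first by rewrite !bil0r expr0n mulr0.
have W := Ap _ w0; have A0 v : 0 <= bil A v v.
  by have [->|v0] := eqVneq v 0; [rewrite bil0l|exact/ltW/Ap].
have := A0 (bil A w w *: u - bil A u w *: w).
rewrite !(bilDl, bilDr, bilNl, bilNr, bilZl, bilZr) (bil_sym w u AT) => h.
rewrite -subr_ge0 -(pmulr_rge0 _ W); move: h; move: (bil A w w) (bil A u w) (bil A u u) => x y z.
by rewrite (_ : x * (z * x - y ^+ 2) = x * (x * z) - x * (y * y) - (y * (x * y) - y * (y * x)))
  ?(_ : x * (z * x - y ^+ 2) = _)//; [move=> h; apply: le_trans h _; rewrite le_eqVlt; apply/orP; left; apply/eqP; ring|ring].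
Qed.

Lemma posdef_unitmx A : (forall v, v != 0 -> 0 < bil A v v) -> A \in unitmx.
Proof.
move=> Ap; rewrite -row_free_unit -kermx_eq0; apply/eqP/row_matrixP => i.
rewrite row0; apply/eqP/negP => /negP v0.
by have := Ap _ v0; rewrite /bil -row_mul mulmx_ker row0 mul0mx mxE ltxx.
Qed.

(** The Cauchy-Schwarz inequality for A, applied to v and the i-th row of the inverse, isolates the
    coordinate v_i. Coercivity is thus controlled by the diagonal of the inverse. *)
Lemma posdef_coer A Ai K : A^T = A -> (forall v, v != 0 -> 0 < bil A v v) -> Ai *m A = 1%:M ->
  Ai^T = Ai -> (forall i, Ai i i <= K) -> forall v, n1 v ^+ 2 <= m%:R ^+ 2 * K * bil A v v.
Proof.
move=> AT Ap AiA AiT AiK v.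
have A0 u : 0 <= bil A u u by have [->|u0] := eqVneq u 0; [rewrite bil0l|exact/ltW/Ap].
have AAi : A *m Ai = 1%:M by rewrite -AT -AiT -trmx_mul AiA trmx1.
have vi i : v 0 i ^+ 2 <= K * bil A v v.
  pose w := (delta_mx 0 i : 'rV[R]_m) *m Ai.
  have e1 : bil A v w = v 0 i.
    by rewrite /w bil_mulr AiT AAi /bil mulmx1 mxE (bigD1 i)//= !mxE !eqxx mulr1 big1 ?addr0// => j ji;
      rewrite !mxE eqxx (negbTE ji) mulr0.
  have e2 : bil A w w = Ai i i by rewrite /w bil_mull AiA bil_mulr AiT mul1mx bil_delta.
  have := bil_CS v w AT Ap; rewrite e1 e2 mulrC => h; apply: le_trans h _.
  by rewrite ler_wpM2r.
have [m0|m0] := posnP m.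
  have -> : m%:R = 0 :> R by rewrite m0.
  by rewrite expr0n !mul0r /n1 big1 ?expr0n// => i; have := ltn_ord i; rewrite [X in (_ < X)%N]m0.
have K0 : 0 <= K * bil A v v := le_trans (sqr_ge0 _) (vi (Ordinal m0)).
have : n1 v <= m%:R * Num.sqrt (K * bil A v v).
  have -> : m%:R * Num.sqrt (K * bil A v v) = \sum_(i < m) Num.sqrt (K * bil A v v).
    by rewrite sumr_const card_ord mulr_natl.
  apply: ler_sum => i _.
  by rewrite -sqrtr_sqr ler_wsqrtr.
move=> h; rewrite -mulrA -(sqr_sqrtr K0) -exprMn.
by rewrite lerXn2r ?nnegrE ?n1_ge0 ?mulr_ge0 ?sqrtr_ge0.
Qed.

Lemma posdef_coercive A : A^T = A -> (forall v, v != 0 -> 0 < bil A v v) ->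
  exists2 c, 0 < c & forall v, c * n1 v ^+ 2 <= bil A v v.
Proof.
move=> AT Ap; have Au := posdef_unitmx Ap.
pose K := 1 + \sum_i `|invmx A i i|.
have K0 : 0 < K by rewrite ltr_pwDl// sumr_ge0.
have AiT : (invmx A)^T = invmx A by rewrite trmx_inv AT.
have AiK i : invmx A i i <= K.
  rewrite /K (bigD1 i)//=; have := ler_norm (invmx A i i).
  have : 0 <= \sum_(j | j != i) `|invmx A j j| by exact: sumr_ge0.
  move: (\sum_(_ | _) _) => x; lra.
have h := posdef_coer AT Ap (mulVmx Au) AiT AiK.
have c0 : 0 < m%:R ^+ 2 * K + 1 by rewrite ltr_wpDl// mulr_ge0 ?sqr_ge0// ltW.
exists (m%:R ^+ 2 * K + 1)^-1; first by rewrite invr_gt0.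
move=> v; rewrite ler_pdivrMl//; apply: le_trans (h v) _.
have A0 : 0 <= bil A v v by have [->|u0] := eqVneq v 0; [rewrite bil0l|exact/ltW/Ap].
by rewrite ler_wpM2r//; lra.
Qed.

End PositiveForms.

Section LocalBounds.
Variables (R : realType) (n : nat) (M : almost_hermitian R n) (T : mixed_field M).
Notation m := (n + n)%N.
Hypothesis Ts : is_smooth_tensor T.
Implicit Types (a : mindex M) (p q : M) (u v w : 'rV[R]_m).

(* Sums of squares are smooth, unlike maxima: one smooth function then bounds all
   coefficients near a point. *)
Definition jetsum a (A : M -> 'M[R]_m) q : R := \sum_i \sum_j (A q i j * A q i j +
  (\sum_s pderiv a s (fun q => A q i j) q * pderiv a s (fun q => A q i j) q +
   \sum_s \sum_t pderiv a s (pderiv a t (fun q => A q i j)) q *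
     pderiv a s (pderiv a t (fun q => A q i j)) q)).

Lemma jetsum_ge0 a A q : 0 <= jetsum a A q.
Proof.
do 2 (apply: sumr_ge0 => ? _); rewrite -expr2 addr_ge0 ?sqr_ge0// addr_ge0//.
  by apply: sumr_ge0 => ? _; rewrite -expr2 sqr_ge0.
by do 2 (apply: sumr_ge0 => ? _); rewrite -expr2 sqr_ge0.
Qed.

Lemma jetsum_smooth a p A : dom a p -> smooth_mx a p A -> smooth_at a p (jetsum a A).
Proof.
move=> ap sA; do 2 (apply: smooth_at_sum => ?).
have p1 s i j := pderiv_smooth s ap (sA i j).
apply: (smooth_atD (smooth_atM (sA _ _) (sA _ _))).
apply: (smooth_atD (d := fun q => \sum_s \sum_t _)).
  by apply: smooth_at_sum => s; exact: smooth_atM.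
do 2 (apply: smooth_at_sum => ?).
by apply: smooth_atM; exact: (pderiv_smooth _ ap (p1 _ _ _)).
Qed.

Lemma sqr_le_norm (x S : R) : x * x <= S -> `|x| <= 1 + S.
Proof.
move=> h; rewrite ler_norml; have := sqr_ge0 (x - 1); have := sqr_ge0 (x + 1).
by move=> h1 h2; apply/andP; split; lra.
Qed.

Lemma term_le_sum (I : finType) (F : I -> R) i : (forall j, 0 <= F j) -> F i <= \sum_j F j.
Proof. by move=> F0; rewrite (bigD1 i)//= ler_wpDr// sumr_ge0. Qed.

Lemma jetsum_le a q A : jets_le (1 + jetsum a A q) a q A.
Proof.
have Z i j : A q i j * A q i j + (\sum_s pderiv a s (fun q => A q i j) q * pderiv a s (fun q => A q i j) q +
   \sum_s \sum_t pderiv a s (pderiv a t (fun q => A q i j)) q *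
     pderiv a s (pderiv a t (fun q => A q i j)) q) <= jetsum a A q.
  have F0 i' j' : 0 <= A q i' j' * A q i' j' + (\sum_s pderiv a s (fun q => A q i' j') q * pderiv a s (fun q => A q i' j') q +
     \sum_s \sum_t pderiv a s (pderiv a t (fun q => A q i' j')) q *
     pderiv a s (pderiv a t (fun q => A q i' j')) q).
    rewrite -expr2 addr_ge0 ?sqr_ge0// addr_ge0//.
      by apply: sumr_ge0 => ? _; rewrite -expr2 sqr_ge0.
    by do 2 (apply: sumr_ge0 => ? _); rewrite -expr2 sqr_ge0.
  apply: le_trans (term_le_sum j (F0 i)) _.
  apply: (term_le_sum (F := fun i => \sum_j _)) => k; exact: sumr_ge0.
have S1 i j : 0 <= \sum_s pderiv a s (fun q => A q i j) q * pderiv a s (fun q => A q i j) q.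
  by apply: sumr_ge0 => ? _; rewrite -expr2 sqr_ge0.
have S2 i j : 0 <= \sum_s \sum_t pderiv a s (pderiv a t (fun q => A q i j)) q *
     pderiv a s (pderiv a t (fun q => A q i j)) q.
  by do 2 (apply: sumr_ge0 => ? _); rewrite -expr2 sqr_ge0.
have J0 := jetsum_ge0 a A q.
split=> [i j|v i j|v i j].
- by apply: sqr_le_norm; have := Z i j; have := S1 i j; have := S2 i j; lra.
- rewrite [mx1 _ _ _ _ _ _]mxE -sum_differential mulrC; apply: sum_le_n1 => s.
  apply: sqr_le_norm; have := Z i j; have := S2 i j; have := sqr_ge0 (A q i j).
  have := term_le_sum (F := fun s => pderiv a s (fun q => A q i j) q * pderiv a s (fun q => A q i j) q) s
    (fun s => sqr_ge0 _).
  by move: (\sum_s _) (\sum_s _) => x y /=; lra.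
- rewrite [mx2 _ _ _ _ _ _]mxE normrM ger0_norm ?invr_ge0//.
  have K0 : 0 <= 1 + jetsum a A q by lra.
  have : `|bil (hmat a (fun q => A q i j) q) v v| <= (1 + jetsum a A q) * n1 v * n1 v.
    apply: bil_le => // s t; rewrite mxE; apply: sqr_le_norm.
    apply: le_trans (Z i j); apply: le_trans (_ : \sum_s \sum_t pderiv a s (pderiv a t (fun q => A q i j)) q *
     pderiv a s (pderiv a t (fun q => A q i j)) q <= _); last first.
      by have := sqr_ge0 (A q i j); have := S1 i j; lra.
    apply: le_trans (_ : \sum_t pderiv a s (pderiv a t (fun q => A q i j)) q *
     pderiv a s (pderiv a t (fun q => A q i j)) q <= _).
      by apply: (term_le_sum (F := fun t => _)) => t'; rewrite -expr2 sqr_ge0.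
    apply: (term_le_sum (F := fun s => \sum_t _)) => s'; by apply: sumr_ge0 => ? _; rewrite -expr2 sqr_ge0.
  have : 0 <= (1 + jetsum a A q) * n1 v * n1 v by rewrite !mulr_ge0 ?n1_ge0.
  by rewrite expr2 mulrA; lra.
Qed.

Local Opaque jetsum.

Lemma smooth_at_bounded a p c : dom a p -> smooth_at a p c -> exists K, \forall q \near p, `|c q| <= K.
Proof.
move=> ap sc; exists (`|c p| + 1).
apply: filterS (smooth_at_cont ap sc ltr01) => q h.
by have := ler_normD (c q - c p) (c p); rewrite subrK; lra.
Qed.

Definition geomsum a q : R := jetsum a (metric a) q + jetsum a (fun q => invmx (metric a q)) q +
  jetsum a (acs a) q + \sum_s jetsum a (chris a ^~ s) q + \sum_s jetsum a (bmat T a ^~ s) q.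

Lemma sum5_le (x1 x2 x3 x4 x5 K : R) : 0 <= x1 -> 0 <= x2 -> 0 <= x3 -> 0 <= x4 -> 0 <= x5 ->
  x1 + x2 + x3 + x4 + x5 <= K -> [/\ 0 <= K, x1 <= K, x2 <= K, x3 <= K & x4 <= K /\ x5 <= K].
Proof. by move=> *; split; [lra|lra|lra|lra|split; lra]. Qed.

Lemma geomsum_bgeom a q K : dom a q -> geomsum a q <= K -> bgeom T ((m%:R ^+ 2 + 1) * (1 + K)) a q.
Proof.
move=> aq hK.
have [j1 j2 j3] := And3 (jetsum_ge0 a (metric a) q) (jetsum_ge0 a (fun q => invmx (metric a q)) q) (jetsum_ge0 a (acs a) q).
have j4 s := jetsum_ge0 a (chris a ^~ s) q; have j5 s := jetsum_ge0 a (bmat T a ^~ s) q.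
have J4 : 0 <= \sum_s jetsum a (chris a ^~ s) q by apply: sumr_ge0 => s _; exact: j4.
have J5 : 0 <= \sum_s jetsum a (bmat T a ^~ s) q by apply: sumr_ge0 => s _; exact: j5.
have [K0 k1 k2 k3 [k4 k5]] := sum5_le j1 j2 j3 J4 J5 hK.
have m0 : 0 <= m%:R ^+ 2 :> R by exact: sqr_ge0.
have KB : 1 + K <= (m%:R ^+ 2 + 1) * (1 + K).
  by rewrite ler_peMl ?addr_ge0// lerDr.
have up x : x <= K -> 1 + x <= (m%:R ^+ 2 + 1) * (1 + K).
  by move=> xK; apply: le_trans KB; rewrite lerD2l.
have gU := metric_unitmx aq; have gT := Defs.metric_sym aq; have hT := ginv_sym aq.
have gpos v : v != 0 -> 0 < bil (metric a q) v v by exact: metric_pos.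
have hpos v : v != 0 -> 0 < bil (invmx (metric a q)) v v.
  move=> v0; have v'0 : v *m invmx (metric a q) != 0.
    by apply: contra_neq v0 => h; rewrite -[v](mulmxKV gU) h mul0mx.
  by have := gpos _ v'0; rewrite bil_mull mulVmx// bil_mulr mul1mx hT.
have c1 x : 0 <= x -> m%:R ^+ 2 * (1 + K) * x <= (m%:R ^+ 2 + 1) * (1 + K) * x.
  by move=> x0; rewrite ler_wpM2r// ler_wpM2r ?lerDl// addr_ge0.
have nn A v : (forall v : 'rV[R]_m, v != 0 -> 0 < bil A v v) -> 0 <= bil A v v.
  by move=> Ap; have [->|v0] := eqVneq v 0; [rewrite bil0l|exact/ltW/Ap].
constructor.
- exact: aq.
- exact: jets_le_mono (up _ k1) (jetsum_le _ _ _).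
- exact: jets_le_mono (up _ k2) (jetsum_le _ _ _).
- exact: jets_le_mono (up _ k3) (jetsum_le _ _ _).
- by move=> s; apply: jets_le_mono (jetsum_le _ _ _); apply: up; exact: le_trans (term_le_sum s j4) k4.
- by move=> s; apply: jets_le_mono (jetsum_le _ _ _); apply: up; exact: le_trans (term_le_sum s j5) k5.
- move=> v; apply: le_trans (c1 _ (nn _ v gpos)).
  apply: (posdef_coer gT gpos (mulVmx gU) hT) => i.
  have [h _ _] := jetsum_le a q (fun q => invmx (metric a q)).
  apply: le_trans (ler_norm _) _; apply: le_trans (h i i) _; rewrite lerD2l; exact: k2.
- move=> v; apply: le_trans (c1 _ (nn _ v hpos)).
  apply: (posdef_coer hT hpos (mulmxV gU) gT) => i.
  have [h _ _] := jetsum_le a q (metric a).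
  apply: le_trans (ler_norm _) _; apply: le_trans (h i i) _; rewrite lerD2l; exact: k1.
Qed.

Lemma bgeom_mono B B' a q : B <= B' -> bgeom T B a q -> bgeom T B' a q.
Proof.
move=> BB [aq h1 h2 h3 h4 h5 h6 h7]; constructor.
- exact: aq.
- exact: jets_le_mono BB h1.
- exact: jets_le_mono BB h2.
- exact: jets_le_mono BB h3.
- by move=> s; exact: jets_le_mono BB (h4 s).
- by move=> s; exact: jets_le_mono BB (h5 s).
- by move=> v; apply: le_trans (h6 v) _; rewrite ler_wpM2r// metric_bil_ge0.
- move=> v; apply: le_trans (h7 v) _; rewrite ler_wpM2r//.
  have -> : bil (invmx (metric a q)) v v = bil (metric a q) (v *m invmx (metric a q)) (v *m invmx (metric a q)).
    by rewrite bil_mull mulVmx ?metric_unitmx// bil_mulr mul1mx ginv_sym.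
  exact: metric_bil_ge0.
Qed.

Lemma bgeom_near p : exists B, \forall q \near p, bgeom T B (chart_at p) q.
Proof.
have ap := chart_atP p; set a := chart_at p in ap *.
have sS : smooth_at a p (geomsum a).
  apply: smooth_atD (smooth_at_sum _ (fun s => jetsum_smooth ap (smooth_mx_bmat ap Ts s))).
  apply: smooth_atD (smooth_at_sum _ (fun s => jetsum_smooth ap (smooth_mx_chris ap s))).
  apply: smooth_atD (jetsum_smooth ap (smooth_mx_acs ap)).
  exact: smooth_atD (jetsum_smooth ap (smooth_mx_metric ap)) (jetsum_smooth ap (smooth_mx_ginv ap)).
have [K hK] := smooth_at_bounded ap sS.
exists ((m%:R ^+ 2 + 1) * (1 + K)).
apply: filterS2 hK (crd_cont ap ltr01) => q hq [aq _].
by apply: geomsum_bgeom => //; apply: le_trans hq; exact: ler_norm.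
Qed.

End LocalBounds.

Section Compactness.
Variables (R : realType) (X : topologicalType).
Hypothesis cX : compact [set: X].

(** The near-covering form of compactness, with the parameter tending to infinity. Monotonicity
    makes a local bound B valid for all larger parameters. *)
Lemma compact_uniform (P : R -> X -> Prop) : (forall B B' x, B <= B' -> P B x -> P B' x) ->
  (forall x : X, exists B, \forall y \near x, P B y) -> exists B, forall x, P B x.
Proof.
move=> mono loc; have nc : near_covering [set: X] by apply/compact_near_coveringP.
have [] := nc R (pinfty_nbhs R) P _.
  move=> x _; have [B hB] := loc x.
  exists ([set y | P B y], [set B' | B <= B']); first by split=> //; exact: nbhs_pinfty_ge (num_real B).
  by move=> [y B'] [/= h1 h2]; exact: mono h1.
by move=> B [_ h]; exists (B + 1) => x; apply: (h (B + 1)) => //; rewrite ltrDl.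
Qed.

End Compactness.

Lemma bil_congr (R : realType) m (P B : 'M[R]_m) v : bil (P *m B *m P^T) v v = bil B (v *m P) (v *m P).
Proof. by rewrite /bil trmx_mul !mulmxA. Qed.

(** * A symmetric tensor attains its maximum relative to the metric *)

Section TensorMaximum.
Variables (R : realType) (n : nat) (M : almost_hermitian R n) (T : mixed_field M).
Notation m := (n + n)%N.
Hypothesis Ts : is_smooth_tensor T.
Hypothesis cM : compact [set: mspace M].
Implicit Types (a b : mindex M) (p q : M) (u v w : 'rV[R]_m).

Lemma bgeom_uniform : exists B, 1 <= B /\ forall p, exists a, bgeom T B a p.
Proof.
have [B hB] : exists B, forall p, exists a, bgeom T B a p.
  apply: (compact_uniform cM (P := fun B p => exists a, bgeom T B a p)).
    by move=> B B' p BB [a h]; exists a; exact: bgeom_mono BB h.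
  move=> p; have [B h] := bgeom_near Ts p; exists B.
  by apply: filterS h => q h; exists (chart_at p).
exists (Num.max 1 B); rewrite le_max lexx; split=> // p.
by have [a h] := hB p; exists a; apply: bgeom_mono h; rewrite le_max lexx orbT.
Qed.

Variable A : mindex M -> M -> 'M[R]_m.
Hypothesis As : forall a p, dom a p -> smooth_mx a p (A a).
Hypothesis AT : forall a p, dom a p -> (A a p)^T = A a p.
Hypothesis Aj : forall a b p, dom a p -> dom b p -> A a p = jac a b p *m A b p *m (jac a b p)^T.

Definition tle (s : R) p : Prop :=
  forall a, dom a p -> forall v, bil (A a p) v v <= s * bil (metric a p) v v.

Lemma tle_chart s a p : dom a p -> (forall v, bil (A a p) v v <= s * bil (metric a p) v v) -> tle s p.
Proof.
move=> ap h b bp v; rewrite (Aj bp ap) (metric_tensor bp ap).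
rewrite !bil_congr; exact: h.
Qed.

Lemma tle_mono s s' p : s <= s' -> tle s p -> tle s' p.
Proof.
move=> ss h a ap v; apply: le_trans (h a ap v) _.
by rewrite ler_wpM2r// metric_bil_ge0.
Qed.

Lemma tle_near p : exists s, \forall q \near p, tle s q.
Proof.
have ap := chart_atP p; set a := chart_at p in ap.
have [K hK] := smooth_at_bounded ap (jetsum_smooth ap (As ap)).
have [B hB] := bgeom_near Ts p.
exists ((1 + K) * B); apply: filterS2 hK hB => q hq gq.
have aq := bg_dom gq; apply: (tle_chart aq) => v.
have K0 : 0 <= 1 + K by rewrite addr_ge0//; apply: le_trans hq.
have [h _ _] := jetsum_le a q (A a).
have h2 : entries_le (A a q) (1 + K).
  by apply: entries_le_mono h; rewrite lerD2l; apply: le_trans hq; exact: ler_norm.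
apply: le_trans (ler_norm _) _; apply: le_trans (bil_le K0 h2 (lexx _) (lexx _)) _.
rewrite -!mulrA -expr2 ler_wpM2l//; exact: bg_gc gq v.
Qed.

(** At p the form S g - A is positive definite, hence coercive, and half of the coercivity survives
    nearby since the entries are continuous. The margin is written exp(- B) so that the conclusion
    weakens as B grows, as [compact_uniform] requires. *)
Lemma tlt_near S a p : dom a p -> (forall v, v != 0 -> bil (A a p) v v < S * bil (metric a p) v v) ->
  exists B, \forall q \near p, tle (S - expR (- B)) q.
Proof.
move=> ap h; pose Q q := S *: metric a q - A a q.
have QT : (Q p)^T = Q p by rewrite linearB linearZ /= (Defs.metric_sym ap) AT.
have Qp v : v != 0 -> 0 < bil (Q p) v v by move=> v0; rewrite bilB bilZ subr_gt0 h.
have [c c0 hc] := posdef_coercive QT Qp.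
pose F q := \sum_i \sum_j (Q q i j - Q p i j) * (Q q i j - Q p i j).
have F_ge0 q i j : 0 <= (Q q i j - Q p i j) * (Q q i j - Q p i j) by rewrite -expr2 sqr_ge0.
have sQ i j : smooth_at a p (fun q => Q q i j - Q p i j).
  have sg := smooth_atM (smooth_at_cst a p S) (smooth_mx_metric ap i j).
  apply: smooth_at_eq ap _ (smooth_atD (smooth_atD sg (smooth_atN (As ap i j))) (smooth_at_cst a p (- Q p i j))) => q _.
  by rewrite /Q !mxE.
have sF : smooth_at a p F by do 2 (apply: smooth_at_sum => ?); exact: smooth_atM.
have Fp : F p = 0 by rewrite /F; do 2 (apply: big1 => ? _); rewrite subrr mulr0.
have [K hK] := smooth_at_bounded ap (jetsum_smooth ap (smooth_mx_metric ap)).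
have c2 : 0 < (c / 2) ^+ 2 by rewrite exprn_gt0// divr_gt0.
pose K' := 1 + `|K|; have K'0 : 0 < K' by rewrite /K' ltr_pwDl.
have e0 : 0 < c / 2 / K' by rewrite !divr_gt0.
exists (- ln (c / 2 / K')); rewrite opprK lnK ?posrE//.
apply: filterS3 hK (smooth_at_cont ap sF c2) (crd_cont ap ltr01) => q hq hF [aq _].
apply: (tle_chart aq) => v.
have d1 : entries_le (Q q - Q p) (c / 2).
  move=> i j; have -> : (Q q - Q p) i j = Q q i j - Q p i j by rewrite !mxE.
  have : (Q q i j - Q p i j) ^+ 2 <= (c / 2) ^+ 2.
    move: hF; rewrite Fp subr0; apply: le_trans; apply: le_trans (ler_norm _).
    apply: le_trans (term_le_sum j (F_ge0 q i)) _.
    apply: (term_le_sum (F := fun i => \sum_j _)) => k; exact: sumr_ge0.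
  by rewrite -(real_normK (num_real (_ - _))) ler_pXn2r// ?nnegrE// ltW// divr_gt0.
have cc0 : 0 <= c / 2 by rewrite ltW// divr_gt0.
have := bil_le cc0 d1 (lexx (n1 v)) (lexx (n1 v)).
rewrite bilB ler_norml => /andP[h1 _].
have h2 := hc v.
have [g1 _ _] := jetsum_le a q (metric a).
have g2 : entries_le (metric a q) K'.
  apply: entries_le_mono g1; rewrite lerD2l; apply: le_trans (ler_norm _) _; apply: le_trans hq _; exact: ler_norm.
have := bil_le (ltW K'0) g2 (lexx (n1 v)) (lexx (n1 v)).
rewrite ler_norml => /andP[_ h3].
have h4 : c / 2 / K' * bil (metric a q) v v <= c / 2 * n1 v ^+ 2.
  rewrite -mulrA ler_wpM2l// ler_pdivrMl// expr2 mulrA; exact: h3.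
have e1 : bil (Q q) v v = S * bil (metric a q) v v - bil (A a q) v v by rewrite bilB bilZ.
move: h1 h2 h4; rewrite e1 expr2.
have -> : c * (n1 v * n1 v) = c / 2 * n1 v * n1 v + c / 2 * n1 v * n1 v by field.
rewrite mulrA mulrBl; move: (c / 2 * n1 v * n1 v) (c / 2 / K' * _) (S * _) (bil (A a q) v v) (bil (Q p) v v) => x1 x2 x3 x4 x5; lra.
Qed.

(** S is the least number with A <= S g on M. If equality occurred at no point, the strict local
    margins would be uniform by compactness and S could be lowered. No unit sphere bundle has to be
    constructed. *)
Lemma tensor_max (p0 : M) : (0 < n)%N -> exists S, (forall p, tle S p) /\
  exists p, forall a, dom a p -> exists2 v, v != 0 & bil (A a p) v v = S * bil (metric a p) v v.
Proof.
move=> n0; pose Z := [set s | forall p, tle s p].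
have [S0 hS0] : exists s, forall p, tle s p := compact_uniform cM (P := tle) tle_mono tle_near.
have Z0 : Z !=set0 by exists S0.
have lbZ p a v : dom a p -> v != 0 -> lbound Z (bil (A a p) v v / bil (metric a p) v v).
  move=> ap v0 s sZ; rewrite ler_pdivrMr; last exact: metric_pos.
  exact: sZ.
have ap0 := chart_atP p0.
pose i0 : 'I_m := Ordinal (ltn_addr n n0).
have d0 : (delta_mx 0 i0 : 'rV[R]_m) != 0.
  by apply/eqP => /rowP/(_ i0); rewrite !mxE !eqxx => /eqP; rewrite oner_eq0.
have hlb : has_lbound Z by exists (bil (A (chart_at p0) p0) (delta_mx 0 i0) (delta_mx 0 i0) / bil (metric (chart_at p0) p0) (delta_mx 0 i0) (delta_mx 0 i0)); exact: lbZ.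
pose S := inf Z; have SZ p : tle S p.
  move=> a ap v; have [->|v0] := eqVneq v 0; first by rewrite !bil0l mulr0.
  rewrite -ler_pdivrMr; last exact: metric_pos.
  by apply: lb_le_inf => //; exact: lbZ.
exists S; split=> //; apply: contrapT => noatt.
have strict p : exists B, \forall q \near p, tle (S - expR (- B)) q.
  have /existsNP[a /not_implyP[ap hv]] : ~ forall a, dom a p ->
      exists2 v, v != 0 & bil (A a p) v v = S * bil (metric a p) v v.
    by move=> h; apply: noatt; exists p.
  apply: (tlt_near ap) => v v0; rewrite lt_neqAle SZ// andbT; apply/eqP => h.
  by apply: hv; exists v.
have [B hB] : exists B, forall p, tle (S - expR (- B)) p.
  apply: (compact_uniform cM (P := fun B p => tle (S - expR (- B)) p)) => // B B' q BB.
  by apply: tle_mono; rewrite lerD2l lerN2 ler_expR lerN2.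
have : S <= S - expR (- B) by apply: ge_inf.
by rewrite lerBrDr gerDl leNgt expR_gt0.
Qed.

End TensorMaximum.

(** * Norms and the conclusion *)

Section SupOn.
Variables (R : realType) (n : nat) (X : almost_hermitian R n).

Lemma sup_on_le (A : set X) (u : X -> R) (K : R) : (sup_on A u <= K%:E)%E -> forall p, A p -> u p <= K.
Proof.
move=> h p Ap; rewrite -lee_fin; apply: le_trans h.
by apply: ereal_sup_ubound; exists p.
Qed.

Lemma le_sup_on (u : X -> R) (K : R) : (forall p, u p <= K) -> (sup_on setT u <= K%:E)%E.
Proof. by move=> h; apply: ub_ereal_sup => _ [p _ <-]; rewrite lee_fin. Qed.

End SupOn.

Section Traces.
Variables (R : realType) (m : nat).
Implicit Types (A B P H g : 'M[R]_m) (c v : 'rV[R]_m).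

Lemma entries_leM A B x y : 0 <= x -> (forall i j, `|A i j| <= x) -> (forall i j, `|B i j| <= y) ->
  forall i j, `|(A *m B) i j| <= m%:R * (x * y).
Proof.
move=> x0 hA hB i j; rewrite mxE; apply: le_trans (ler_norm_sum _ _ _) _.
have -> : m%:R * (x * y) = \sum_(k < m) (x * y) by rewrite sumr_const card_ord mulr_natl.
by apply: ler_sum => k _; rewrite normrM ler_pM.
Qed.

Lemma trace_le A x : (forall i j, `|A i j| <= x) -> \tr A <= m%:R * x.
Proof.
move=> h; have -> : m%:R * x = \sum_(k < m) x by rewrite sumr_const card_ord mulr_natl.
by apply: ler_sum => i _; apply: le_trans (ler_norm _) (h i i).
Qed.

Lemma quad_entries A K : A^T = A -> 0 <= K -> (forall v, `|bil A v v| <= K * n1 v ^+ 2) ->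
  forall i j, `|A i j| <= 3 * K.
Proof.
move=> AT K0 h i j.
have nd k : n1 (delta_mx 0 k : 'rV[R]_m) = 1.
  rewrite /n1 (bigD1 k)//= big1 ?addr0 => [|l lk]; rewrite !mxE !eqxx ?normr1//.
  by rewrite (negbTE lk) normr0.
have h1 := h (delta_mx 0 i); have h2 := h (delta_mx 0 j).
have h3 := h (delta_mx 0 i + delta_mx 0 j).
have h4 : K * n1 (delta_mx 0 i + delta_mx 0 j : 'rV[R]_m) ^+ 2 <= K * 2 ^+ 2.
  rewrite ler_wpM2l// lerXn2r ?nnegrE ?n1_ge0//.
  by apply: le_trans (n1D _ _) _; rewrite !nd; lra.
move: h1 h2 h3; rewrite !nd !expr1n !mulr1 !(bilDl, bilDr) !bil_delta.
have -> : A j i = A i j by rewrite -[in LHS]AT mxE.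
rewrite !ler_norml => /andP[? ?] /andP[? ?] /andP[? ?]; apply/andP; split; lra.
Qed.

Lemma trace_orthonormal g P H K c : P *m g *m P^T = 1%:M -> 0 <= K ->
  \tr (invmx g *m H *m invmx g *m H^T) <= K ^+ 2 ->
  bil H (c *m P) (c *m P) <= m%:R * K * bil g (c *m P) (c *m P).
Proof.
move=> PgP K0; pose W := P *m H *m P^T.
have gi : invmx g = P^T *m P.
  by apply: invmx_uniq; rewrite mulmxA; apply: mulmx1C; rewrite mulmxA.
have -> : \tr (invmx g *m H *m invmx g *m H^T) = \sum_k \sum_l W k l ^+ 2.
  have -> : invmx g *m H *m invmx g *m H^T = P^T *m (W *m (P *m H^T)) by rewrite gi /W !mulmxA.
  rewrite mxtrace_mulC.
  have -> : W *m (P *m H^T) *m P^T = W *m W^T.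
    by rewrite -[LHS]mulmxA; congr (_ *m _); rewrite /W !trmx_mul trmxK mulmxA.
  by apply: eq_bigr => k _; rewrite mxE; apply: eq_bigr => l _; rewrite [W^T _ _]mxE expr2.
move=> hW; have Wkl k l : `|W k l| <= K.
  rewrite -(ler_pXn2r (n := 2)) ?nnegrE// real_normK ?num_real//; apply: le_trans hW.
  have F0 k' l' : 0 <= W k' l' ^+ 2 by exact: sqr_ge0.
  apply: le_trans (term_le_sum l (F0 k)) _.
  by apply: (term_le_sum (F := fun k => \sum_l _)) => k'; exact: sumr_ge0.
have -> : bil g (c *m P) (c *m P) = \sum_k c 0 k ^+ 2.
  rewrite -bil_congr PgP /bil mulmx1 mxE; apply: eq_bigr => k _; by rewrite [_^T _ _]mxE expr2.
rewrite -bil_congr -/W bilE.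
apply: le_trans (_ : \sum_k \sum_l (K * (2^-1 * (c 0 k ^+ 2 + c 0 l ^+ 2))) <= _).
  apply: ler_sum => k _; apply: ler_sum => l _; apply: le_trans (ler_norm _) _; rewrite normrM mulrC.
  apply: ler_pM => //; rewrite ler_norml; have := sqr_ge0 (c 0 k - c 0 l).
  by have := sqr_ge0 (c 0 k + c 0 l) => *; apply/andP; split; lra.
set S := \sum_k c 0 k ^+ 2.
have E k : \sum_l (K * (2^-1 * (c 0 k ^+ 2 + c 0 l ^+ 2))) = K * 2^-1 * m%:R * c 0 k ^+ 2 + K * 2^-1 * S.
  have -> : K * 2^-1 * m%:R * c 0 k ^+ 2 = \sum_(l < m) (K * 2^-1 * c 0 k ^+ 2).
    by rewrite sumr_const card_ord -mulr_natl; ring.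
  rewrite /S mulr_sumr.
  by rewrite -big_split; apply: eq_bigr => l _; rewrite /= mulrA -mulrDr.
under eq_bigr do rewrite E.
rewrite big_split /= -mulr_sumr -/S sumr_const card_ord -mulr_natl le_eqVlt; apply/orP; left; apply/eqP.
by field.
Qed.

End Traces.

(** * The norms of the statement compared with forms in a chart; positivity of the operator *)

Section Norms.
Variables (R : realType) (n : nat) (M : almost_hermitian R n) (T : mixed_field M).
Notation m := (n + n)%N.
Implicit Types (a b : mindex M) (p q : M) (u v w x : 'rV[R]_m).

Lemma ginv_acs a p : dom a p ->
  (acs a p)^T *m invmx (metric a p) *m acs a p = invmx (metric a p).
Proof.
move=> ap; set J := acs a p; set g := metric a p.
have gU : g \in unitmx := metric_unitmx ap.
have JgJ : J *m g *m J^T = g := metric_acs ap.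
have JJ : J *m J = - 1%:M := acs_sqr ap.
have JTJT : J^T *m J^T = - 1%:M by rewrite -trmx_mul JJ linearN /= trmx1.
have Jg : J *m g = - (g *m J^T).
  by rewrite -[in RHS]JgJ -mulmxA JTJT mulmxN mulmx1 opprK.
have gJ : invmx g *m J = - (J^T *m invmx g).
  rewrite -[LHS]mulmx1 -(mulmxV gU) mulmxA -[_ *m J *m g]mulmxA Jg mulmxN mulmxA mulVmx// mul1mx.
  by rewrite mulNmx.
by rewrite -mulmxA gJ mulmxN mulmxA JTJT mulNmx mul1mx opprK.
Qed.

Local Open Scope complex_scope.

Lemma Re_hermitian (x y : 'rV[R]_m) (G : 'M[R]_m) :
  complex.Re (((toC x + 'i%C *: toC y) *m toC G *m (toC x^T - 'i%C *: toC y^T)) 0 0) =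
  bil G x x + bil G y y.
Proof.
have -> : (toC x + 'i%C *: toC y) *m toC G *m (toC x^T - 'i%C *: toC y^T) =
    toC (x *m G *m x^T + y *m G *m y^T) + 'i%C *: toC (y *m G *m x^T - x *m G *m y^T).
  rewrite !toCD toCN !toCM !mulmxDl !mulmxDr !mulmxN -!scalemxAl -!scalemxAr !scalerA i2N1.
  rewrite scaleNr opprK scale1r scalerDr scalerN.
  by rewrite [_ *: _ + _]addrC addrACA [- _ + _]addrC.
have h := congr1 (fun A : 'M[R]_1 => A 0 0) (reM_E (x *m G *m x^T + y *m G *m y^T) (y *m G *m x^T - x *m G *m y^T)).
by move: h; rewrite [LHS]mxE => ->; rewrite mxE.
Qed.

(** The (1,0)-part of du is half of du - i du J, and J is an isometry of the inverse metric: 1/4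
    times two equal contributions. *)
Lemma del_norm_sq (u : M -> R) p (a := chart_at p) :
  complex.Re (((conjM (del a u p))^T *m toC (invmx (metric a p)) *m del a u p) 0 0) =
  2^-1 * gradsq a u p.
Proof.
have ap : dom a p := chart_atP p.
set D := differential a u p; set J := acs a p; set G := invmx (metric a p).
have dE : del a u p = (2^-1 *: cfr J^T D^T)^T.
  by rewrite linearZ /= /cfr linearB linearZ /= -!toCT trmx_mul !trmxK.
have e1 : (conjM (del a u p))^T = 2^-1 *: (toC D^T + 'i%C *: toC (D^T *m J^T)).
  rewrite dE -conj_cfr /conjM -map_trmx trmxK map_mxZ; congr (_ *: _).
  by rewrite fmorphV rmorph_nat.
have e2 : del a u p = 2^-1 *: (toC D^T^T - 'i%C *: toC (D^T *m J^T)^T).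
  by rewrite -trmx_mul !trmxK.
rewrite e1 e2 -!scalemxAl -!scalemxAr scalerA.
have -> : 2^-1 * 2^-1 = (4^-1)%:C :> R[i] by rewrite -invfM -natrM fmorphV rmorph_nat.
have sc (c : R) (A : 'M[R[i]]_1) : complex.Re ((c%:C *: A) 0 0) = c * complex.Re (A 0 0).
  by rewrite mxE; case: (A 0 0) => r s; simpc.
rewrite sc Re_hermitian /gradsq -/D -/G bil_mull bil_mulr trmxK ginv_acs// -/G.
by move: (bil _ _ _) => x; field.
Qed.

Lemma del_norm_le (u : M -> R) p K : 0 <= gradsq (chart_at p) u p -> del_norm u p <= K ->
  gradsq (chart_at p) u p <= 2 * K ^+ 2.
Proof.
move=> g0; rewrite /del_norm del_norm_sq => h.
have h0 : 0 <= 2^-1 * gradsq (chart_at p) u p by rewrite mulr_ge0.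
have K0 : 0 <= K := le_trans (sqrtr_ge0 _) h.
have : Num.sqrt (2^-1 * gradsq (chart_at p) u p) ^+ 2 <= K ^+ 2 by rewrite lerXn2r ?nnegrE ?sqrtr_ge0.
by rewrite sqr_sqrtr//; lra.
Qed.

Lemma gradsq_ge0 a (u : M -> R) p : dom a p -> 0 <= gradsq a u p.
Proof. by move=> ap; rewrite gradsqE// metric_bil_ge0. Qed.

Lemma differential_le B a (u : M -> R) p K : 1 <= B -> bgeom T B a p ->
  (forall b, dom b p -> smooth_at b p u) -> del_norm u p <= K ->
  n1 (differential a u p)^T <= 1 + B * (2 * K ^+ 2).
Proof.
move=> B1 gp su h; have ap := bg_dom gp; have bp := chart_atP p.
have := del_norm_le (gradsq_ge0 u bp) h.
rewrite -(gradsq_jac ap bp (su _ ap) (su _ bp)) => h2.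
have h3 : n1 (differential a u p)^T ^+ 2 <= B * gradsq a u p := bg_hc gp _.
have h4 : B * gradsq a u p <= B * (2 * K ^+ 2) by rewrite ler_wpM2l//; lra.
move: h3 h4; move: (n1 _) (B * gradsq _ _ _) (B * (2 * _)) => x y z h3 h4.
by have := sqr_ge0 (x - 1); have := sqr_ge0 x; lra.
Qed.

Lemma hess_norm_sq (u : M -> R) p K (a := chart_at p) : hess_norm u p <= K ->
  \tr (invmx (metric a p) *m hess a u p *m invmx (metric a p) *m (hess a u p)^T) <= K ^+ 2 /\ 0 <= K.
Proof.
rewrite /hess_norm; set t := \tr _ => h; have K0 : 0 <= K := le_trans (sqrtr_ge0 _) h.
split=> //; have [t0|t0] := leP t 0; first exact: le_trans t0 (sqr_ge0 K).
by rewrite -(sqr_sqrtr (ltW t0)) lerXn2r ?nnegrE ?sqrtr_ge0.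
Qed.

Lemma hess_norm_le (u : M -> R) p K (a := chart_at p) : 0 <= K ->
  \tr (invmx (metric a p) *m hess a u p *m invmx (metric a p) *m (hess a u p)^T) <= K ^+ 2 ->
  hess_norm u p <= K.
Proof. by move=> K0 h; rewrite /hess_norm -(ger0_norm K0) -sqrtr_sqr ler_wsqrtr. Qed.

Variables (f phi : M -> R).
Hypothesis sol : ma_solution T f phi.
Hypothesis n_gt0 : (0 < n)%N.
Hypothesis f_gt0 : forall q, 0 < f q.

Lemma hess_le_norm p K (a := chart_at p) v : hess_norm phi p <= K ->
  bil (hess a phi p) v v <= m%:R * K * bil (metric a p) v v.
Proof.
move=> /hess_norm_sq[hK K0]; have ap : dom a p := chart_atP p.
have [X [sgm [[Xf s0 _ Xn XY] _]]] := normal_frame sol n_gt0 (f_gt0 p) ap.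
(* As g(X_i, X_i) = sg_i^2 / 2, the factor sqrt 2 / sg_i makes X_i and J X_i orthonormal. *)
pose c i := Num.sqrt 2 / sgm i; pose J := acs a p; pose g := metric a p.
pose X' : 'M[R]_(n, m) := \matrix_i (c i *: row i X).
pose P := col_mx X' (X' *m J).
have gT : g^T = g := Defs.metric_sym ap.
have rX i : row i X' = c i *: row i X by rewrite rowK.
have cc i : c i * (c i * (2^-1 * sgm i ^+ 2)) = 1.
  have s2 : Num.sqrt 2 * Num.sqrt 2 = 2 :> R by rewrite -expr2 sqr_sqrtr.
  have := s0 i; rewrite /c; move: (Num.sqrt 2) s2 => r r2 si.
  have -> : r / sgm i * (r / sgm i * (2^-1 * sgm i ^+ 2)) = r * r * 2^-1 by field; rewrite gt_eqF.
  by rewrite r2 divff.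
have gX i j : bil g (row i X') (row j X') = (i == j)%:R.
  rewrite !rX bilZl bilZr Xn; have [->|ij] := eqVneq i j; first by rewrite mulr1n cc.
  by rewrite mulr0n !mulr0.
have gXY i j : bil g (row i X') (row j X' *m J) = 0.
  by rewrite !rX bilZl -scalemxAl bilZr XY !mulr0.
have PgP : P *m g *m P^T = 1%:M.
  apply/matrixP => k l; have -> : (P *m g *m P^T) k l = bil g (row k P) (row l P).
    by rewrite /bil -row_mul !mxE; apply: eq_bigr => s _; rewrite !mxE.
  rewrite [RHS]mxE.
  case: (splitP k) => i ki; case: (splitP l) => j lj.
  - have -> : k = lshift n i by exact: val_inj.
    have -> : l = lshift n j by exact: val_inj.
    by rewrite !rowKu gX (inj_eq (@lshift_inj _ _)).
  - have -> : k = lshift n i by exact: val_inj.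
    have -> : l = rshift n j by exact: val_inj.
    by rewrite rowKu rowKd row_mul gXY eq_lrshift.
  - have -> : k = rshift n i by exact: val_inj.
    have -> : l = lshift n j by exact: val_inj.
    by rewrite rowKu rowKd row_mul bil_sym// gXY eq_rlshift.
  - have -> : k = rshift n i by exact: val_inj.
    have -> : l = rshift n j by exact: val_inj.
    by rewrite !rowKd !row_mul metric_JJ// gX (inj_eq (@rshift_inj _ _)).
have [Pu _] : P \in unitmx /\ g *m P^T \in unitmx.
  by apply: mulmx1_unit; rewrite mulmxA.
have := trace_orthonormal (v *m invmx P) PgP K0 hK.
by rewrite mulmxKV.
Qed.

(** Every nonzero x belongs to some frame: an X_i on whose complex line x has a nonzero component is
    exchanged for x. Positivity then holds for the diagonal entry of the equation in the new
    frame. *)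
Lemma omf_gt0 a p x : dom a p -> x != 0 -> 0 < omf T a p phi x.
Proof.
move=> ap x0; set J := acs a p.
have [X [sgm [[Xf s0 _ Xn XY] _]]] := normal_frame sol n_gt0 (f_gt0 p) ap.
have xE := frame_expand x ap Xf s0 Xn XY.
pose A : 'rV[R]_n := \row_i (2 * (bil (metric a p) x (row i X) / sgm i ^+ 2)).
pose Bc : 'rV[R]_n := \row_i (2 * (bil (metric a p) x (row i X *m J) / sgm i ^+ 2)).
have xAB : x = A *m X + Bc *m (X *m J).
  have a1 : A *m X = 2 *: \sum_i (bil (metric a p) x (row i X) / sgm i ^+ 2) *: row i X.
    by rewrite mulmx_sum_row scaler_sumr; apply: eq_bigr => i _; rewrite mxE scalerA.
  have a2 : Bc *m X = 2 *: \sum_i (bil (metric a p) x (row i X *m acs a p) / sgm i ^+ 2) *: row i X.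
    by rewrite mulmx_sum_row scaler_sumr; apply: eq_bigr => i _; rewrite mxE scalerA.
  by rewrite mulmxA a1 a2 -scalemxAl -scalerDr.
have [i hi] : exists i, (A 0 i != 0) || (Bc 0 i != 0).
  apply/existsP; apply: contraNT x0; rewrite negb_exists => /forallP h.
  have A0 : A = 0 by apply/rowP => i; rewrite [RHS]mxE; have := h i; rewrite negb_or !negbK => /andP[/eqP].
  have B0 : Bc = 0 by apply/rowP => i; rewrite [RHS]mxE; have := h i; rewrite negb_or !negbK => /andP[_ /eqP].
  by rewrite xAB A0 B0 !mul0mx addr0.
(* The subtraction of the i-th basis vector makes the perturbed i-th row equal to x, and the
   determinant is multiplied by the squared modulus of the component of x along X_i, J X_i. *)
pose ca : 'cV[R]_n := delta_mx i 0; pose cp := A - delta_mx 0 i.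
pose X' := X + ca *m (cp *m X + Bc *m (X *m J)) + 0 *m ((cp *m X + Bc *m (X *m J)) *m J).
have rX' : row i X' = x.
  rewrite /X' mul0mx addr0 linearD /= row_mul.
  have -> : row i ca = 1%:M by apply/rowP => k; rewrite !mxE !eqxx ord1 eqxx.
  by rewrite mul1mx /cp mulmxBl -rowE addrA (addrC (row i X)) subrK.
have det := det_perturb (acs_sqr ap) X (metric a p) ca 0 cp Bc.
have [D0 DE] := DG_gt0 ap Xf.
have Xf' : row_free (cfr J X').
  apply: (@row_free_det _ _ _ (metric a p)); rewrite det DE mulf_neq0//; last first.
    by rewrite (fmorph_eq0 (real_complex R)) gt_eqF.
  rewrite (fmorph_eq0 (real_complex R)).
  rewrite (bigD1 i)//= big1 => [|j ji]; last by rewrite !mxE (negbTE ji) !mulr0 subrr.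
  rewrite (bigD1 i)//= [X in _ + (_ + X) ^+ 2]big1 => [|j ji]; last by rewrite !mxE (negbTE ji) !mulr0 addr0.
  rewrite !addr0 /ca /cp [(A - _) 0 i]mxE [(- _ : 'rV_n) 0 i]mxE.
  move: (A 0 i) (Bc 0 i) hi => x1 x2 hi; rewrite !mxE !eqxx /= !mulr1 !mulr0 subr0 add0r.
  rewrite (_ : 1 + (x1 - 1) = x1); last by ring.
  by rewrite paddr_eq0 ?sqr_ge0// !sqrf_eq0 negb_and.
by have [/(_ i)] := agm_point sol n_gt0 ap Xf'; rewrite rX'.
Qed.

End Norms.

Lemma is_Ck_expR (R : realType) (m k : nat) (U : set 'rV[R]_m) (G : 'rV[R]_m -> R) : open U ->
  is_Ck k U G -> is_Ck k U (fun x => expR (G x)).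
Proof.
move=> oU; elim: k => [|k IH] cG.
  split=> // x Ux; apply: (@continuous_comp _ _ _ G (@expR R)); last exact: continuous_expR.
  exact: is_Ck_cont cG x Ux.
have dP i x : U x -> is_derive x (basis_vec R i) (fun x => expR (G x)) (expR (G x) * 'D_(basis_vec R i) G x).
  move=> Ux; apply: (is_derive_comp_scalar (is_derive_expR (G x))).
  by have [/(_ x Ux)/derivableP] := (cG.2 i).
split=> [x Ux|i]; first exact: (is_Ck_cont (IH (is_CkS cG))) x Ux.
split=> [x Ux|]; first by case: (dP i x Ux).
apply: is_Ck_eq oU _ (is_CkM oU (IH (is_CkS cG)) (cG.2 i).2) => x Ux.
by have := dP i x Ux => /@derive_val ->.
Qed.

Lemma smooth_at_expR (R : realType) (m : nat) (M : manifold R m) (a : mindex M) (p : M) (c : M -> R) :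
  smooth_at a p c -> smooth_at a p (fun q => expR (c q)).
Proof.
move=> [U [G [oU Ux cG GE]]]; exists U, (fun y => expR (G y)); split=> //.
  by move=> k; exact: is_Ck_expR.
by move=> y yA Uy; rewrite GE.
Qed.

(** * From one-sided bounds to the norm of the Hessian; the weighted Hessian as a smooth tensor *)

Section Conclusion.
Variables (R : realType) (n : nat) (M : almost_hermitian R n) (T : mixed_field M).
Notation m := (n + n)%N.
Hypothesis Ts : is_smooth_tensor T.
Implicit Types (a b : mindex M) (p q : M) (u v w x : 'rV[R]_m).

(* The quadratic form of the Hessian is bounded above by assumption, and below
   because the linearised matrix is positive: H(v, v) + H(Jv, Jv) >= - C |v|^2. *)
Lemma hess_norm_bound (B D L : R) : 1 <= B -> 0 <= D -> 0 <= L -> exists K, forall (phi : M -> R) a q,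
  bgeom T B a q -> (forall b, dom b q -> smooth_at b q phi) -> n1 (differential a phi q)^T <= D ->
  (forall v, bil (hess a phi q) v v <= L * bil (metric a q) v v) ->
  (forall v, v != 0 -> 0 < omf T a q phi v) -> hess_norm phi q <= K.
Proof.
move=> B1 D0 L0; have B0 : 0 <= B by lra.
have m0 : 0 <= m%:R :> R by rewrite ler0n.
pose K1 : R := (L * B + D * B) * (m%:R * B) ^+ 2 + (L * B + 2 * (D * B) + 2 * B).
have DB : 0 <= D * B by rewrite mulr_ge0.
have LB : 0 <= L * B by rewrite mulr_ge0.
have P0 : 0 <= (L * B + D * B) * (m%:R * B) ^+ 2 by rewrite mulr_ge0 ?sqr_ge0// addr_ge0.
have K10 : 0 <= K1 by rewrite /K1; lra.
pose x : R := 3 * K1; have x0 : 0 <= x by rewrite mulr_ge0.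
pose Q : R := m%:R * (m%:R * (m%:R * (m%:R * (B * x) * B) * x)).
have Q0 : 0 <= Q by rewrite !mulr_ge0.
exists (1 + Q) => phi a q gq sphi dphi hup om.
have aq := bg_dom gq; have bq := chart_atP q.
pose S (A : 'I_m -> 'M[R]_m) v := \sum_s pderiv a s phi q * bil (A s) v v.
have SB A v : (forall s, entries_le (A s) B) -> `|S A v| <= D * B * n1 v ^+ 2.
  move=> hA; have -> : S A v = \sum_s (differential a phi q)^T 0 s * bil (A s) v v.
    by apply: eq_bigr => s _; rewrite !mxE.
  have hs s : `|bil (A s) v v| <= B * n1 v ^+ 2.
    by rewrite expr2 mulrA; exact: (bil_le B0 (hA s) (lexx _) (lexx _)).
  apply: le_trans (sum_le_n1 _ hs) _; rewrite -mulrA ler_wpM2r// mulr_ge0 ?sqr_ge0//.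
have hG s : entries_le (chris a q s) B by have [h _ _] := bg_G gq s; exact: h.
have hb s : entries_le (bmat T a q s) B by have [h _ _] := bg_b gq s; exact: h.
have [hg _ _] := bg_g gq; have [hJ _ _] := bg_J gq; have [hh _ _] := bg_h gq.
have hE v : bil (hmat a phi q) v v = bil (hess a phi q) v v + S (chris a q) v.
  rewrite hess_chris bilB bil_sum -addrA; under [X in _ + (- X + _)]eq_bigr do rewrite bilZ.
  by rewrite addNr addr0.
have gB v : bil (metric a q) v v <= B * n1 v ^+ 2.
  by apply: le_trans (ler_norm _) _; rewrite expr2 mulrA; exact: (bil_le B0 hg (lexx _) (lexx _)).
have up v : bil (hess a phi q) v v <= L * B * n1 v ^+ 2.
  by apply: le_trans (hup v) _; rewrite -mulrA ler_wpM2l.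
have vJ v : n1 (v *m acs a q) ^+ 2 <= (m%:R * B) ^+ 2 * n1 v ^+ 2.
  rewrite -exprMn lerXn2r ?nnegrE ?n1_ge0 ?mulr_ge0 ?n1_ge0//.
  exact: n1M_le.
have lo v : - (K1 * n1 v ^+ 2) <= bil (hess a phi q) v v.
  have [->|v0] := eqVneq v 0; first by rewrite bil0l n1_0 expr0n mulr0 oppr0.
  have := om v v0; rewrite /omf !hE.
  have := SB _ v hG; have := SB _ (v *m acs a q) hG; have := SB _ v hb; have := gB v.
  have := up (v *m acs a q).
  have w1 : D * B * n1 (v *m acs a q) ^+ 2 <= D * B * ((m%:R * B) ^+ 2 * n1 v ^+ 2) by rewrite ler_wpM2l.
  have w2 : L * B * n1 (v *m acs a q) ^+ 2 <= L * B * ((m%:R * B) ^+ 2 * n1 v ^+ 2) by rewrite ler_wpM2l.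
  have w3 : 0 <= L * B * n1 v ^+ 2 by rewrite mulr_ge0 ?sqr_ge0.
  rewrite -/(S (bmat T a q) v) /K1; move: w1 w2 w3; rewrite !ler_norml.
  move: (n1 (v *m acs a q) ^+ 2) ((m%:R * B) ^+ 2) (n1 v ^+ 2) => y1 y2 y3.
  move: (S _ _) (S _ _) (S _ _) (bil (metric a q) v v) (bil _ _ _) (bil _ v v) => z1 z2 z3 z4 z5 z6.
  by move=> ? ? ? ? ? /andP[? ?] /andP[? ?] /andP[? ?] ?; lra.
have HK v : `|bil (hess a phi q) v v| <= K1 * n1 v ^+ 2.
  rewrite ler_norml lo/=; apply: le_trans (up v) _; rewrite ler_wpM2r ?sqr_ge0// /K1; lra.
have HT := hess_sym aq (sphi a aq).
have Hx := quad_entries HT K10 HK.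
apply: hess_norm_le; first by rewrite addr_ge0.
rewrite -(hess_trace_jac aq bq (sphi a aq) (sphi _ bq)).
apply: le_trans (_ : Q <= _); last by have := sqr_ge0 Q; lra.
apply: trace_le; apply: entries_leM; first by rewrite !mulr_ge0.
  apply: entries_leM; [by rewrite !mulr_ge0| |exact: hh].
  by apply: entries_leM.
by move=> i j; rewrite mxE; exact: Hx.
Qed.

Lemma smooth_gradsq a p (phi : M -> R) : dom a p -> smooth_at a p phi -> smooth_at a p (gradsq a phi).
Proof.
move=> ap sp; have sd := smooth_dif ap sp.
have := smooth_mxM ap (smooth_mxM ap sd (smooth_mx_ginv ap)) (smooth_mxT ap sd).
by move=> /(_ 0 0); apply: smooth_at_eq ap _.
Qed.

Lemma smooth_efun a p (phi : M -> R) ep cAv K0 : dom a p -> smooth_at a p phi ->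
  smooth_at a p (efun a phi ep cAv K0).
Proof.
move=> ap sp; apply: smooth_atD (smooth_atM (smooth_at_cst a p ep) (smooth_gradsq ap sp)) _.
apply: smooth_at_expR; apply: smooth_atN; apply: smooth_atM (smooth_at_cst a p cAv) _.
exact: smooth_atD sp (smooth_at_cst a p (- K0)).
Qed.

Definition wtensor (phi : M -> R) (ep cAv K0 : R) a p : 'M[R]_m :=
  expR (efun a phi ep cAv K0 p) *: hess a phi p.

Section Weighted.
Variables (phi : M -> R) (ep cAv K0 : R).
Hypothesis sphi : forall a p, dom a p -> smooth_at a p phi.
Notation A := (wtensor phi ep cAv K0).

Lemma wtensor_smooth a p : dom a p -> smooth_mx a p (A a).
Proof.
move=> ap i j; have se := smooth_at_expR (smooth_efun ep cAv K0 ap (sphi ap)).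
have sH : smooth_at a p (fun q => hess a phi q i j).
  have sc := smooth_at_sum (index_enum _) (fun s => smooth_atM (pderiv_smooth s ap (sphi ap)) (smooth_mx_chris ap s i j)).
  apply: smooth_at_eq ap _ (smooth_atD (smooth_hmat ap (sphi ap) i j) (smooth_atN sc)) => q _.
  rewrite hess_chris !mxE summxE; congr (_ - _); by apply: eq_bigr => s _; rewrite !mxE.
by apply: smooth_at_eq ap _ (smooth_atM se sH) => q _; rewrite [RHS]mxE.
Qed.

Lemma wtensor_sym a p : dom a p -> (A a p)^T = A a p.
Proof. by move=> ap; rewrite /wtensor linearZ /= hess_sym//; exact: sphi. Qed.

Lemma efun_chart a b p : dom a p -> dom b p -> efun a phi ep cAv K0 p = efun b phi ep cAv K0 p.
Proof. by move=> ap bp; rewrite /efun (gradsq_jac ap bp (sphi ap) (sphi bp)). Qed.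

Lemma wtensor_jac a b p : dom a p -> dom b p -> A a p = jac a b p *m A b p *m (jac a b p)^T.
Proof.
move=> ap bp; rewrite /wtensor (efun_chart ap bp) (hess_jac ap bp (sphi ap) (sphi bp)).
by rewrite -scalemxAr -scalemxAl.
Qed.

End Weighted.

Lemma inner_point p a : ~ mboundary M p -> dom a p ->
  forall v, \forall t \near (0 : R), half_space (crd a p + t *: v).
Proof.
move=> pb ap v; have h0 := half_space_crd ap.
have [i0|n0] := pselect (exists i : 'I_m, val i = 0%N); last first.
  by apply/nbhs0P; exists 1; [exact: ltr01|move=> t _ i iv; exfalso; apply: n0; exists i].
have [i iv] := i0.
have c0 : 0 < crd a p 0 i.
  rewrite lt_neqAle h0// andbT eq_sym; apply/eqP => c0; apply: pb.
  by exists a => //; exists i.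
have d0 : 0 < crd a p 0 i / (`|v 0 i| + 1) by rewrite divr_gt0// ltr_wpDl.
apply: filterS (nbhs0_lt d0) => t ht j jv; have -> : j = i by apply: val_inj; rewrite /= jv iv.
rewrite !mxE; move: ht; rewrite ltr_pdivlMr ?ltr_wpDl// mulrDr mulr1 -normrM => ht.
have := ler_norm (- (t * v 0 i)); rewrite normrN; have := normr_ge0 t; lra.
Qed.

End Conclusion.

Lemma core_eps_ge0 (R : realType) (B : R) : 0 <= core_eps B.
Proof. by rewrite invr_ge0 mulr_ge0 ?sqr_ge0. Qed.

Lemma core_A_ge0 (R : realType) (B : R) : 0 <= B -> 0 <= core_A B.
Proof. by move=> B0; rewrite mulr_ge0// exprn_ge0// mulr_ge0// exprn_ge0// mulr_ge0// exprn_ge0. Qed.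

(** * The upper bound of the Hessian *)

Section Estimate.
Variables (R : realType) (n : nat) (M : almost_hermitian R n) (T : mixed_field M).
Notation m := (n + n)%N.
Hypothesis Ts : is_smooth_tensor T.
Hypothesis cM : compact [set: mspace M].
Hypothesis n_gt0 : (0 < n)%N.
Implicit Types (a b : mindex M) (p q : M) (u v w x : 'rV[R]_m).
Notation root f := (fun q => f q `^ n%:R^-1).

Lemma root_le (y K : R) : 0 < y -> y <= K -> y `^ n%:R^-1 <= 1 + `|K|.
Proof.
move=> y0 yK; have yK' : y <= 1 + `|K| by have := ler_norm K; lra.
have K1 : 1 <= 1 + `|K| by rewrite lerDl.
have r0 : 0 <= n%:R^-1 :> R by rewrite invr_ge0.
apply: le_trans (_ : (1 + `|K|) `^ n%:R^-1 <= _).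
  by apply: ge0_ler_powR => //; rewrite nnegrE; [exact: ltW|exact: le_trans ler01 K1].
apply: le_trans (_ : (1 + `|K|) `^ 1 <= _); last by rewrite powRr1//; lra.
by apply: ler_powR => //; rewrite invf_le1 ?ler1n// ltr0n.
Qed.

Lemma hmat_lower (B D k : R) a p (r : M -> R) v : 1 <= B -> 0 <= D -> bgeom T B a p -> hess_ge k r ->
  n1 (differential a r p)^T <= D ->
  - ((`|k| * B + D * B) * n1 v ^+ 2) <= 2^-1 * bil (hmat a r p) v v.
Proof.
move=> B1 D0 gp hk hd; have B0 : 0 <= B by lra.
have ap := bg_dom gp; have [hg _ _] := bg_g gp.
have hs s : `|bil (chris a p s) v v| <= B * n1 v ^+ 2.
  by have [h _ _] := bg_G gp s; rewrite expr2 mulrA; exact: (bil_le B0 h (lexx _) (lexx _)).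
have hE : bil (hmat a r p) v v = bil (hess a r p) v v + \sum_s (differential a r p)^T 0 s * bil (chris a p s) v v.
  rewrite hess_chris bilB bil_sum.
  rewrite (eq_bigr (fun s => (differential a r p)^T 0 s * bil (chris a p s) v v)); last first.
    by move=> s _; rewrite bilZ !mxE.
  by rewrite subrK.
have e1 : `|\sum_s (differential a r p)^T 0 s * bil (chris a p s) v v| <= D * (B * n1 v ^+ 2).
  apply: le_trans (sum_le_n1 _ hs) _; rewrite ler_wpM2r// mulr_ge0 ?sqr_ge0//.
have e2 : `|k * bil (metric a p) v v| <= `|k| * (B * n1 v ^+ 2).
  by rewrite normrM ler_wpM2l// expr2 mulrA; exact: (bil_le B0 hg (lexx _) (lexx _)).
have e3 : k * bil (metric a p) v v <= bil (hess a r p) v v := hk a p ap v.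
have e4 : 0 <= `|k| * (B * n1 v ^+ 2) by apply: le_trans e2.
have e5 : 0 <= D * (B * n1 v ^+ 2) by apply: le_trans e1.
rewrite hE; move: e1 e2 e3; rewrite !ler_norml => /andP[+ _] /andP[+ _].
rewrite mulrDl -!mulrA; move: (\sum_s _) (k * bil (metric a p) v v) (bil (hess a r p) v v) (`|k| * _) (D * _) e4 e5.
by move=> x1 x2 x3 x4 x5; lra.
Qed.

(** The maximum of exp(eta) H relative to g lies on the boundary, where the assumed bound on the
    norm applies, or in the interior, where the pointwise estimate does. All constants precede f and
    phi: B comes from the geometry and the given bounds, B' from B, eps and A from B', and L from
    these and the bound Yb on the exponential. *)
Lemma hess_upper (p0 : M) (K0 K1 K2 K3 K4 k : R) : exists L, 0 <= L /\ forall f phi : M -> R,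
  smooth f -> (forall p, 0 < f p) -> smooth phi -> ma_solution T f phi ->
  (forall p, `|phi p| <= K0) -> (forall p, del_norm phi p <= K1) ->
  (forall p, mboundary M p -> hess_norm phi p <= K2) -> (forall p, f p <= K3) ->
  (forall p, del_norm (root f) p <= K4) -> hess_ge k (root f) ->
  forall a p, dom a p -> forall v, bil (hess a phi p) v v <= L * bil (metric a p) v v.
Proof.
have [B0 [B01 geom]] := bgeom_uniform Ts cM.
pose d1 := 1 + B0 * (2 * K1 ^+ 2); pose d4 := 1 + B0 * (2 * K4 ^+ 2).
pose d5 := `|k| * B0 + d4 * B0; pose r3 := 1 + `|K3|.
have B00 : 0 <= B0 := le_trans ler01 B01.
have sq0 (x : R) : 0 <= 1 + B0 * (2 * x ^+ 2).
  by apply: addr_ge0 => //; apply: mulr_ge0 => //; apply: mulr_ge0 => //; exact: sqr_ge0.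
have d10 : 0 <= d1 by exact: sq0.
have d40 : 0 <= d4 by exact: sq0.
have d50 : 0 <= d5 by apply: addr_ge0; apply: mulr_ge0.
have r30 : 0 <= r3 by rewrite addr_ge0.
pose B := B0 + d1 + d4 + d5 + r3.
have [BB0 BB1 BB4 BB5 BB3] : [/\ B0 <= B, d1 <= B, d4 <= B, d5 <= B & r3 <= B].
  rewrite /B; clearbody d1 d4 d5 r3; by split; lra.
have B1 : 1 <= B := le_trans B01 BB0.
have [B' [BB' prod]] := core_producer Ts B1.
pose ep := core_eps B'; pose cAv := core_A B'.
have ep0 : 0 <= ep := core_eps_ge0 B'.
have cA0 : 0 <= cAv by apply: core_A_ge0; lra.
pose Yb := expR (cAv * (2 * K0)).
have [L hL] := core_estimate n B' Yb.
pose Em := ep * (2 * K1 ^+ 2) + Yb.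
pose L0 := Num.max 0 (Num.max L (m%:R * K2)).
have L00 : 0 <= L0 by rewrite le_max lexx.
have L0L : L <= L0 by rewrite !le_max lexx orbT.
have L0K : m%:R * K2 <= L0 by rewrite !le_max lexx !orbT.
exists (expR Em * L0); split; first by rewrite mulr_ge0 ?expR_ge0.
move=> f phi sf f0 sphi sol hK0 hK1 hK2 hK3 hK4 hk.
have sp a p : dom a p -> smooth_at a p phi by move=> ap; exact: smooth_in_at (sphi a) ap.
have sfa a p : dom a p -> smooth_at a p f by move=> ap; exact: smooth_in_at (sf a) ap.
have sr a p : dom a p -> smooth_at a p (root f).
  by move=> ap; apply: smooth_at_powR => //; exact: sfa.
have g2 a p : dom a p -> gradsq a phi p <= 2 * K1 ^+ 2.
  move=> ap; have bp := chart_atP p.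
  by rewrite (gradsq_jac ap bp (sp _ _ ap) (sp _ _ bp)); apply: del_norm_le (gradsq_ge0 phi bp) (hK1 p).
have y1 p : 1 <= yfun phi cAv K0 p.
  rewrite /yfun -expR0 ler_expR -mulrN mulr_ge0// opprB subr_ge0.
  exact: le_trans (ler_norm _) (hK0 p).
have yY p : yfun phi cAv K0 p <= Yb.
  rewrite /yfun ler_expR -mulrN ler_wpM2l//.
  by have := hK0 p; rewrite ler_norml => /andP[]; lra.
have e0 a p : dom a p -> 0 <= efun a phi ep cAv K0 p.
  move=> ap; rewrite addr_ge0 ?mulr_ge0 ?gradsq_ge0//; exact: le_trans ler01 (y1 p).
have eE a p : dom a p -> efun a phi ep cAv K0 p <= Em.
  by move=> ap; apply: lerD (yY p); rewrite ler_wpM2l// g2.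
have [S [hS [p hp]]] := tensor_max Ts cM (wtensor_smooth (phi := phi) ep cAv K0 sp)
  (wtensor_sym ep cAv K0 sp) (wtensor_jac ep cAv K0 sp) p0 n_gt0.
suff SL : S <= expR Em * L0.
  (* Removing the weight uses eta >= 0 where H(v, v) is positive; elsewhere the claim is immediate
     since the bound is nonnegative. *)
  move=> a q aq v; have G0 := metric_bil_ge0 v aq.
  have LG : 0 <= expR Em * L0 * bil (metric a q) v v by rewrite !mulr_ge0 ?expR_ge0.
  have [h|h] := leP (bil (hess a phi q) v v) 0; first exact: le_trans h LG.
  have := hS q a aq v; rewrite bilZ => h2.
  apply: le_trans (_ : expR (efun a phi ep cAv K0 q) * bil (hess a phi q) v v <= _).
    by apply: ler_peMl; [exact: ltW|rewrite -[leLHS]expR0 ler_expR e0].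
  by apply: le_trans h2 _; rewrite ler_wpM2r.
have fin a (l : R) : dom a p -> l <= L0 -> expR (efun a phi ep cAv K0 p) * l <= expR Em * L0.
  move=> ap lL; apply: le_trans (_ : expR (efun a phi ep cAv K0 p) * L0 <= _).
    by rewrite ler_wpM2l ?expR_ge0.
  by rewrite ler_wpM2r// ler_expR eE.
have [pb|pi] := pselect (mboundary M p).
  have bp := chart_atP p; have [v v0 hv] := hp _ bp.
  have G0 : 0 < bil (metric (chart_at p) p) v v := metric_pos bp v0.
  apply: le_trans (fin _ _ bp L0K).
  rewrite -(ler_pM2r G0) -hv bilZ -mulrA ler_wpM2l ?expR_ge0//.
  exact: (hess_le_norm sol n_gt0 f0 v (hK2 p pb)).
have [a ga0] := geom p; have ap := bg_dom ga0; have ga := bgeom_mono BB0 ga0.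
have [v v0 hv] := hp _ ap.
have G0 : 0 < bil (metric a p) v v := metric_pos ap v0.
pose t := (Num.sqrt (bil (metric a p) v v))^-1; pose Vv := t *: v.
have V1 : bil (metric a p) Vv Vv = 1.
  by rewrite bilZl bilZr mulrA -expr2 exprVn sqr_sqrtr ?ltW// mulVf// gt_eqF.
have SE : S = expR (efun a phi ep cAv K0 p) * bil (hess a phi p) Vv Vv.
  have : bil (wtensor phi ep cAv K0 a p) Vv Vv = S * bil (metric a p) Vv Vv.
    by rewrite !(bilZl, bilZr) hv; ring.
  by rewrite V1 mulr1 bilZ => <-.
have inner := inner_point pi ap.
have dphi : n1 (differential a phi p)^T <= d1 := differential_le B01 ga0 (sp ^~ p) (hK1 p).
have dr : n1 (differential a (root f) p)^T <= d4 := differential_le B01 ga0 (sr ^~ p) (hK4 p).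
have MD : maxdata T B f phi a p Vv (bil (hess a phi p) Vv Vv) ep cAv K0.
  constructor.
  - exact: n_gt0.
  - exact: ga.
  - exact: inner.
  - by move=> q aq; exact: sp.
  - exact: sfa.
  - exact: f0.
  - exact: sol.
  - exact: le_trans (root_le (f0 p) (hK3 p)) BB3.
  - move=> w; rewrite -sum_differential mulrC.
    apply: le_trans (sum_le_n1 (K := d4) _ _) _; last by rewrite ler_wpM2l ?n1_ge0.
    by move=> s; apply: le_trans dr; have := n1_coord (differential a (root f) p)^T s; rewrite !mxE.
  - move=> w; apply: le_trans (hmat_lower w B01 d40 ga0 hk dr).
    by rewrite lerN2 ler_wpM2r ?sqr_ge0.
  - exact: le_trans dphi BB1.
  - exact: V1.
  - by [].
  - move=> w z; have := ray_near (FF := nbhs_filter (0 : R)) (fun P h => h) ap ap (inner w) ltr01.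
    apply: filterS => s [aq _ _ _]; rewrite subr_le0; set q := ray a p w s in aq *.
    set x := Vv + s *: z; have := hS q a aq x; rewrite bilZ SE => h.
    rewrite -(ler_pM2l (expR_gt0 (efun a phi ep cAv K0 q))); apply: le_trans h _.
    rewrite expRD expRN; move: (bil _ _ _) (bil _ _ _) => y z'.
    by rewrite le_eqVlt; apply/orP; left; apply/eqP; field; rewrite gt_eqF// expR_gt0.
have [X [sgm hc]] := prod _ _ _ _ _ _ _ _ _ MD.
rewrite SE; apply: fin => //; apply: le_trans L0L.
exact: (hL _ hc erefl erefl (y1 p) (yY p)).
Qed.

End Estimate.

Theorem proposition6p1 (R : realType) (n : nat) (M : almost_hermitian R n)
    (T : mixed_field M) :
  compact [set: mspace M] ->
  mboundary M !=set0 ->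
  is_smooth_tensor T ->
  T_conj T ->
  forall K0 K1 K2 K3 K4 k : R,
  exists C : R, forall f phi : M -> R,
    smooth f -> (forall p, 0 < f p) ->
    smooth phi ->
    ma_solution T f phi ->
    (sup_on setT (fun p => `|phi p|%R) <= K0%:E)%E ->
    (sup_on setT (del_norm phi) <= K1%:E)%E ->
    (sup_on (mboundary M) (hess_norm phi) <= K2%:E)%E ->
    (sup_on setT f <= K3%:E)%E ->
    (sup_on setT (del_norm (fun p => (f p `^ n%:R^-1)%R)) <= K4%:E)%E ->
    hess_ge k (fun p => (f p `^ n%:R^-1)%R) ->
    (sup_on setT (hess_norm phi) <= C%:E)%E.
Proof.
move=> cM [pb [a apb [i i0 ci]]] Ts Tc K0 K1 K2 K3 K4 k.
(* A boundary point exhibits a coordinate of index 0, so the dimension is positive. *)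
have n0 : (0 < n)%N by have := leq_ltn_trans (leq0n _) (ltn_ord i); rewrite addnn double_gt0.
have [L [L0 hup]] := hess_upper Ts cM n0 pb K0 K1 K2 K3 K4 k.
have [B [B1 geom]] := bgeom_uniform Ts cM.
have D0 : 0 <= 1 + B * (2 * K1 ^+ 2).
  apply: addr_ge0 => //; apply: mulr_ge0; first exact: le_trans ler01 B1.
  by apply: mulr_ge0 => //; exact: sqr_ge0.
have [C hC] := hess_norm_bound T B1 D0 L0.
exists C => f phi sf f0 sphi sol hK0 hK1 hK2 hK3 hK4 hk.
have k0 p := sup_on_le hK0 (I : setT p); have k1 p := sup_on_le hK1 (I : setT p).
have k3 p := sup_on_le hK3 (I : setT p); have k4 p := sup_on_le hK4 (I : setT p).
have up := hup f phi sf f0 sphi sol k0 k1 (fun p => sup_on_le hK2 (p := p)) k3 k4 hk.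
apply: le_sup_on => p; have [b gb] := geom p; have bp := bg_dom gb.
have sp c : dom c p -> smooth_at c p phi by move=> cp; exact: smooth_in_at (sphi c) cp.
apply: (hC phi b p gb sp); first exact: differential_le B1 gb sp (k1 p).
- by move=> v; exact: up.
- by move=> v v0; exact: (omf_gt0 sol n0 f0 bp v0).
Qed.
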